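(* Let $F$ be a field with $\operatorname{char}(F)\neq 2$ such that there are two non-isomorphic quaternion division $F$-algebras $\mathcal A$ and $\mathcal B$. Then there exists a regular field extension $L/F$ with the following properties: (1) $\mathcal A_L$ and $\mathcal B_L$ are division algebras and $\mathbf{gen}(\mathcal A_L)=\mathbf{gen}(\mathcal B_L)$; (2) if $K/F$ is a finite separable field extension of degree $n$ satisfying conditions (A)–(C) below with respect to $\mathcal A$ and $\mathcal B$, then the matrix algebras $M_n(\mathcal A_L)$ and $M_n(\mathcal B_L)$ do not have the same maximal subfields; (3) if $K$ is as in (2) and $\mathcal C$ is a central division $F$-algebra of exponent $n$ which is split by $K$, then $\mathcal C_L$ is a division algebra of exponent $n$, and the algebras $\mathcal A_L\otimes_L\mathcal C_L$ and $\mathcal B_L\otimes_L\mathcal C_L$ do not have the same maximal subfields.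
   Context: For a field extension $K/F$ and a central simple $F$-algebra $\mathcal A$, $\mathcal A_K$ denotes $\mathcal A\otimes_F K$. The genus $\mathbf{gen}(\mathcal D)$ of a finite-dimensional central division algebra $\mathcal D$ over a field $F$ is the set of classes $[\mathcal D']\in\operatorname{Br}(F)$ of central division $F$-algebras $\mathcal D'$ having the same maximal subfields as $\mathcal D$, i.e. $\mathcal D'$ has the same degree $n$ as $\mathcal D$ and a field extension of $F$ of degree $n$ admits an $F$-embedding into $\mathcal D$ iff it admits one into $\mathcal D'$. Two central simple algebras of the same degree ''have the same maximal subfields'' in this same sense. For fixed non-isomorphic quaternion division $F$-algebras $\mathcal A,\mathcal B$, a finite separable field extension $K/F$ is said to satisfy conditions (A)–(C) if there is an element $d$ such that: (A) $d\in K^*\setminus K^{*2}$ and there is no $a\in F^*$ with $da\in K^{*2}$; (B) $K$ does not split $\mathcal B$; (C) $K(\sqrt d)$ splits $\mathcal B$ but does not split $\mathcal A$. *)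

(* Defs.v *)
From HB Require Import structures.
From mathcomp Require Import all_boot all_order all_algebra all_field.
Set Implicit Arguments. Unset Strict Implicit. Unset Printing Implicit Defensive.
Import Order.TTheory GRing.Theory.
Local Open Scope ring_scope.

(* A (not necessarily associative/unital a priori) finite-dimensional
   F-algebra with basis indexed by I: e_i * e_j = \sum_k sc i j k e_k. *)
Record salg (F : fieldType) (I : finType) := SAlg { sc : I -> I -> I -> F }.

Section Salg.
Variable F : fieldType.

Definition vec (I : finType) := {ffun I -> F}.
Definition vzero (I : finType) : vec I := [ffun=> 0].
Definition vadd (I : finType) (u v : vec I) : vec I := [ffun i => u i + v i].
Definition vscale (I : finType) (a : F) (u : vec I) : vec I := [ffun i => a * u i].

Definition amul (I : finType) (A : salg F I) (u v : vec I) : vec I :=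
  [ffun k => \sum_i \sum_j u i * v j * sc A i j k].

Definition is_unit_of (I : finType) (A : salg F I) (e : vec I) :=
  forall x, amul A e x = x /\ amul A x e = x.

Definition is_algebra (I : finType) (A : salg F I) :=
  (forall x y z, amul A x (amul A y z) = amul A (amul A x y) z) /\
  exists e, is_unit_of A e.

Definition is_central (I : finType) (A : salg F I) :=
  forall e, is_unit_of A e ->
  forall z, (forall x, amul A z x = amul A x z) -> exists a : F, z = vscale a e.

Definition is_ideal (I : finType) (A : salg F I) (P : vec I -> Prop) :=
  P (vzero I) /\ (forall u v, P u -> P v -> P (vadd u v)) /\
  (forall a u, P u -> P (vscale a u)) /\
  (forall x u, P u -> P (amul A x u) /\ P (amul A u x)).

Definition is_simple (I : finType) (A : salg F I) :=
  (exists x, x <> vzero I) /\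
  forall P, is_ideal A P -> (forall x, P x -> x = vzero I) \/ (forall x, P x).

Definition is_csa (I : finType) (A : salg F I) :=
  is_algebra A /\ is_central A /\ is_simple A.

Definition is_division (I : finType) (A : salg F I) :=
  is_algebra A /\ exists e, is_unit_of A e /\ e <> vzero I /\
  forall x, x <> vzero I -> exists y, amul A x y = e /\ amul A y x = e.

Definition is_field_alg (I : finType) (A : salg F I) :=
  is_division A /\ forall x y, amul A x y = amul A y x.

Definition lin (I J : finType) (M : I -> J -> F) (u : vec I) : vec J :=
  [ffun j => \sum_i u i * M i j].

Definition is_hom (I J : finType) (A : salg F I) (B : salg F J) (M : I -> J -> F) :=
  (forall x y, lin M (amul A x y) = amul B (lin M x) (lin M y)) /\
  exists e, is_unit_of A e /\ is_unit_of B (lin M e).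

Definition iso (I J : finType) (A : salg F I) (B : salg F J) :=
  exists (M : I -> J -> F) (N : J -> I -> F),
    is_hom A B M /\ (forall u, lin N (lin M u) = u) /\ (forall v, lin M (lin N v) = v).

Definition embeds (I J : finType) (E : salg F I) (A : salg F J) :=
  exists M : I -> J -> F, is_hom E A M /\ (forall u, lin M u = vzero J -> u = vzero I).

Definition tensor (I J : finType) (A : salg F I) (B : salg F J) : salg F (I * J)%type :=
  SAlg (fun x y z => sc A x.1 y.1 z.1 * sc B x.2 y.2 z.2).

(* the matrix algebra M_d(F), basis of matrix units E_(i,j) *)
Definition matalg (d : nat) : salg F ('I_d * 'I_d)%type :=
  SAlg (fun x y z => if [&& x.2 == y.1, z.1 == x.1 & z.2 == y.2] then 1 else 0).

Definition tpow (I : finType) (A : salg F I) (e : nat) : salg F {ffun 'I_e -> I} :=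
  SAlg (fun x y z : {ffun 'I_e -> I} => \prod_(t < e) sc A (x t) (y t) (z t)).

Definition brauer_equiv (I J : finType) (A : salg F I) (B : salg F J) :=
  exists m n : nat, (0 < m)%N /\ (0 < n)%N /\
    iso (tensor (matalg m) A) (tensor (matalg n) B).

Definition brauer_trivial (I : finType) (A : salg F I) := exists d, iso A (matalg d).

Definition exponent_is (I : finType) (A : salg F I) (e : nat) :=
  (0 < e)%N /\ brauer_trivial (tpow A e) /\
  forall k, (0 < k < e)%N -> ~ brauer_trivial (tpow A k).

Definition same_max_subfields (I J : finType) (A : salg F I) (B : salg F J) :=
  #|I| = #|J| /\
  forall (T : finType) (E : salg F T), is_field_alg E -> (#|T| * #|T| = #|I|)%N ->
    (embeds E A <-> embeds E B).

Definition in_genus (I J : finType) (D : salg F I) (X : salg F J) :=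
  exists (T : finType) (D' : salg F T),
    is_csa D' /\ is_division D' /\ same_max_subfields D' D /\ brauer_equiv D' X.

Definition same_genus (I J : finType) (A : salg F I) (B : salg F J) :=
  forall (T : finType) (X : salg F T), is_csa X -> (in_genus A X <-> in_genus B X).

Definition quaternion_division (I : finType) (A : salg F I) :=
  is_csa A /\ is_division A /\ #|I| = 4%N.

End Salg.

Definition base (F L : fieldType) (sigma : F -> L) (I : finType) (A : salg F I)
  : salg L I := SAlg (fun i j k => sigma (sc A i j k)).

Definition splits (F M : fieldType) (sigma : F -> M) (I : finType) (A : salg F I) :=
  brauer_trivial (base sigma A).

(* regular extension: L is linearly disjoint from the algebraic closure of F,
   i.e. L (x)_F E is a field for every finite field extension E of F *)
Definition regular_ext (F L : fieldType) (sigma : {rmorphism F -> L}) :=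
  forall (T : finType) (E : salg F T), is_field_alg E -> is_field_alg (base sigma E).

Definition conditions_ABC (F : fieldType) (K : fieldExtType F)
  (I J : finType) (A : salg F I) (B : salg F J) :=
  exists d : K,
    (d != 0 /\ ~ (exists y : K, y ^+ 2 = d) /\
     ~ (exists a : F, a != 0 /\ exists y : K, y ^+ 2 = d * a%:A)) /\
    ~ splits (in_alg K) B /\
    (exists (M : fieldType) (tau : {rmorphism K -> M}) (r : M),
       r ^+ 2 = tau d /\ (forall m : M, exists a b : K, m = tau a + tau b * r) /\
       splits (fun x => tau (in_alg K x)) B /\
       ~ splits (fun x => tau (in_alg K x)) A).

(* Main.v *)
(* L is a union of fields over which A and B gradually acquire the same square classes.
   Let P be a field over which everything is still intact and let a in P be a square
   in A over P, but not in B. Pass to the function field P(y)(z)(sqrt g),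
   g = al + be y^2 + ga z^2, of a quadric chosen so that a becomes a square in B.
   Ultraproducts make it possible to treat all a at once, and over the union of a
   countable tower of such steps A and B contain the same square roots of scalars,
   hence the same quadratic extensions.

   What the construction must preserve says that certain finite systems of polynomial
   equations over F have no solution, so it passes to ultraproducts and to subfields.
   A division algebra of dimension at most 4 that acquires zero divisors over the
   function field contains three anticommuting elements with squares al, be, ga,
   which forces - al be ga to be a square; the quadrics used exclude this.

   For (3), the exponent of C is preserved because small representations of the
   tensor powers of C are excluded, and C_L remains a division algebra because a
   representation of C of dimension n m gives, by antisymmetrizing with the Goldman
   element, a small one of the m-th tensor power. Finally M = K(sqrt d) embeds into
   Z (x) B, where Z is M_n or C and contains K, since M splits B; it does not embed
   into Z (x) A, because then A (x) M, a division algebra of dimension 8 n, would act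
   on a space of dimension 4 n. *)
Require Import Defs.
From HB Require Import structures.
From mathcomp Require Import all_boot all_order all_algebra all_field.
From mathcomp Require Import perm boolp zify ring.
From mathcomp Require classical_sets filter.
Set Implicit Arguments. Unset Strict Implicit. Unset Printing Implicit Defensive.
Import Order.TTheory GRing.Theory.
Local Open Scope ring_scope.

(** * Structure constants and base change *)

(** The quadric comes from the shape of a pure quaternion: for anticommuting i, j with i^2 = a1, j^2
    = a2, the square of r i + Y j + Z ij is a1 r^2 + a2 Y^2 - a1 a2 Z^2. Equating it to a and
    solving for r^2 gives al = a/a1, be = - a2/a1, ga = a2, so - al be ga is a times a square. Hence
    a division quaternion algebra over an extension E of P survives the step as soon as a is not a
    square in E. The obstacle is to know this for E = K and E = M = K(sqrt d). If a has a root in A,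
    both follow from A (x) M being division. If a has a root in B, then B (x) K gives it for K, but
    M splits B; a square root of a in M outside K would make d a a square in K. This is why
    condition (A), that no d a with a in P is a square in K, must itself survive each step; its
    survival is a separate square-class theorem, proved with norms. Zero divisors are controlled
    without index reduction formulas: square roots are pulled back from rational functions to
    polynomials over a division ring, where left ideals are principal. *)

Section AmulBilinear.
Variables (k : fieldType) (I : finType) (A : salg k I).
Implicit Types x y z : vec k I.

Lemma amulDl x y z : amul A (x + y) z = amul A x z + amul A y z.
Proof.
apply/ffunP=> l; rewrite !ffunE -big_split; apply: eq_bigr => i _.
by rewrite -big_split; apply: eq_bigr => j _ /=; rewrite ffunE !mulrDl.
Qed.

Lemma amulDr x y z : amul A x (y + z) = amul A x y + amul A x z.
Proof.
apply/ffunP=> l; rewrite !ffunE -big_split; apply: eq_bigr => i _.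
by rewrite -big_split; apply: eq_bigr => j _ /=; rewrite ffunE mulrDr !mulrDl.
Qed.

Lemma amulZl a x y : amul A (vscale a x) y = vscale a (amul A x y).
Proof.
apply/ffunP=> l; rewrite !ffunE big_distrr; apply: eq_bigr => i _.
by rewrite big_distrr; apply: eq_bigr => j _ /=; rewrite ffunE !mulrA.
Qed.

Lemma amulZr a x y : amul A x (vscale a y) = vscale a (amul A x y).
Proof.
apply/ffunP=> l; rewrite !ffunE big_distrr; apply: eq_bigr => i _.
by rewrite big_distrr; apply: eq_bigr => j _ /=; rewrite ffunE mulrCA !mulrA.
Qed.

Lemma amul0l y : amul A 0 y = 0.
Proof. by apply: (addrI (amul A 0 y)); rewrite -amulDl !addr0. Qed.
Lemma amul0r x : amul A x 0 = 0.
Proof. by apply: (addrI (amul A x 0)); rewrite -amulDr !addr0. Qed.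
Lemma amul_suml (T : Type) (r : seq T) (u : T -> vec k I) y :
  amul A (\sum_(t <- r) u t) y = \sum_(t <- r) amul A (u t) y.
Proof. by elim: r => [|t r IH]; rewrite ?big_nil ?amul0l // !big_cons amulDl IH. Qed.
Lemma amul_sumr (T : Type) (r : seq T) x (u : T -> vec k I) :
  amul A x (\sum_(t <- r) u t) = \sum_(t <- r) amul A x (u t).
Proof. by elim: r => [|t r IH]; rewrite ?big_nil ?amul0r // !big_cons amulDr IH. Qed.

Definition bvec (i : I) : vec k I := [ffun j => (i == j)%:R].

Lemma sum_bvec x : x = \sum_i vscale (x i) (bvec i).
Proof.
apply/ffunP=> l; rewrite sum_ffunE (bigD1 l) //= !ffunE eqxx mulr1.
by rewrite big1 ?addr0 // => i il; rewrite !ffunE (negPf il) mulr0.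
Qed.

Lemma amul_bvec i j l : amul A (bvec i) (bvec j) l = sc A i j l.
Proof.
rewrite ffunE (bigD1 i) //= [X in _ + X]big1 ?addr0 => [|p pi]; last first.
  by rewrite big1 // => q _; rewrite ffunE eq_sym (negPf pi) !mul0r.
rewrite (bigD1 j) //= [X in _ + X]big1 ?addr0 => [|p pj].
  by rewrite !ffunE !eqxx !mul1r.
by rewrite !ffunE [j == p]eq_sym (negPf pj) mulr0 mul0r.
Qed.

Lemma amul_sum x y :
  amul A x y = \sum_i \sum_j vscale (x i * y j) (amul A (bvec i) (bvec j)).
Proof.
apply/ffunP=> l; rewrite ffunE sum_ffunE; apply: eq_bigr => i _.
by rewrite sum_ffunE; apply: eq_bigr => j _; rewrite ffunE amul_bvec.
Qed.

End AmulBilinear.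
Arguments bvec k {I} i.

(* Structure constants satisfy the axioms of a unital algebra; unlike
   is_algebra this form is visibly stable under base change. *)
Definition tbl_assoc (k : fieldType) (I : finType) (A : salg k I) :=
  forall i j l m, \sum_p sc A j l p * sc A i p m = \sum_p sc A i j p * sc A p l m.
Definition tbl_unit (k : fieldType) (I : finType) (A : salg k I) (e : vec k I) :=
  forall j l, \sum_i e i * sc A i j l = (j == l)%:R /\
              \sum_i e i * sc A j i l = (j == l)%:R.

Section Table.
Variables (k : fieldType) (I : finType) (A : salg k I).

Lemma assoc_tbl : (forall x y z, amul A x (amul A y z) = amul A (amul A x y) z) ->
  tbl_assoc A.
Proof.
move=> h i j l m; have := congr1 (fun f : vec k I => f m) (h (bvec k i) (bvec k j) (bvec k l)).
rewrite !ffunE (bigD1 i) //= [X in _ + X]big1 ?addr0 => [|p pi]; last first.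
  by rewrite big1 // => q _; rewrite ffunE eq_sym (negPf pi) !mul0r.
under eq_bigr => p _ do rewrite amul_bvec ffunE eqxx mul1r.
move=> ->; apply: eq_bigr => p _; rewrite (bigD1 l) //= big1 ?addr0 => [|q ql].
  by rewrite amul_bvec ffunE eqxx mulr1.
by rewrite !ffunE eq_sym (negPf ql) mulr0 mul0r.
Qed.

Lemma tbl_amulA : tbl_assoc A ->
  forall x y z, amul A x (amul A y z) = amul A (amul A x y) z.
Proof.
move=> h x y z; apply/ffunP=> m; rewrite !ffunE.
transitivity (\sum_i \sum_j \sum_l x i * y j * z l * \sum_p sc A j l p * sc A i p m).
  apply: eq_bigr => i _.
  transitivity (\sum_p \sum_j \sum_l x i * y j * z l * (sc A j l p * sc A i p m)).
    apply: eq_bigr => p _; rewrite ffunE mulrAC big_distrr /=; apply: eq_bigr => j _.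
    rewrite big_distrr /=; apply: eq_bigr => l _.
    by rewrite -!mulrA; congr (_ * _); rewrite mulrC -!mulrA.
  rewrite exchange_big; apply: eq_bigr => j _; rewrite exchange_big.
  by apply: eq_bigr => l _; rewrite big_distrr.
transitivity (\sum_p \sum_l \sum_i \sum_j x i * y j * z l * (sc A i j p * sc A p l m)).
  transitivity (\sum_l \sum_i \sum_j x i * y j * z l * \sum_p sc A i j p * sc A p l m).
    rewrite [RHS]exchange_big; apply: eq_bigr => i _; rewrite exchange_big.
    by apply: eq_bigr => l _; apply: eq_bigr => j _; rewrite h.
  rewrite [RHS]exchange_big; apply: eq_bigr => l _; rewrite [RHS]exchange_big.
  apply: eq_bigr => i _; rewrite [RHS]exchange_big; apply: eq_bigr => j _.
  by rewrite big_distrr.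
apply: eq_bigr => p _; apply: eq_bigr => l _; rewrite ffunE -mulrA big_distrl /=.
apply: eq_bigr => i _; rewrite big_distrl /=; apply: eq_bigr => j _.
by rewrite -!mulrA; do 2 congr (_ * _); rewrite mulrCA.
Qed.

Lemma unit_tbl e : is_unit_of A e -> tbl_unit A e.
Proof.
move=> h j l; split.
  have := congr1 (fun f : vec k I => f l) (h (bvec k j)).1; rewrite !ffunE => <-.
  apply: eq_bigr => i _; rewrite (bigD1 j) //= big1 ?addr0 => [|q ql].
    by rewrite !ffunE eqxx mulr1.
  by rewrite !ffunE eq_sym (negPf ql) mulr0 mul0r.
have := congr1 (fun f : vec k I => f l) (h (bvec k j)).2; rewrite !ffunE => <-.
rewrite [RHS](bigD1 j) //= [X in _ + X]big1 ?addr0 => [|q ql].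
  by apply: eq_bigr => i _; rewrite !ffunE eqxx mul1r.
by rewrite big1 // => i _; rewrite !ffunE eq_sym (negPf ql) !mul0r.
Qed.

Lemma tbl_amul1 e : tbl_unit A e -> is_unit_of A e.
Proof.
move=> h x; split; apply/ffunP=> l; rewrite ffunE.
  rewrite exchange_big /=.
  transitivity (\sum_j x j * (j == l)%:R).
    apply: eq_bigr => j _; rewrite -(h j l).1 big_distrr /=; apply: eq_bigr => i _.
    by rewrite mulrCA !mulrA.
  rewrite (bigD1 l) //= eqxx mulr1 big1 ?addr0 // => j jl.
  by rewrite (negPf jl) mulr0.
transitivity (\sum_j x j * (j == l)%:R).
  apply: eq_bigr => j _; rewrite -(h j l).2 big_distrr /=; apply: eq_bigr => i _.
  by rewrite !mulrA.
rewrite (bigD1 l) //= eqxx mulr1 big1 ?addr0 // => j jl.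
by rewrite (negPf jl) mulr0.
Qed.

End Table.

Section Base.
Variables (k L : fieldType) (s : {rmorphism k -> L}) (I : finType) (A : salg k I).

Definition bmap (x : vec k I) : vec L I := [ffun i => s (x i)].

Lemma bmap_amul x y : bmap (amul A x y) = amul (base s A) (bmap x) (bmap y).
Proof.
apply/ffunP=> l; rewrite !ffunE rmorph_sum; apply: eq_bigr => i _.
by rewrite rmorph_sum; apply: eq_bigr => j _; rewrite !rmorphM !ffunE.
Qed.

Lemma base_unit e : is_unit_of A e -> is_unit_of (base s A) (bmap e).
Proof.
move=> /unit_tbl h; apply: tbl_amul1 => j l; have [h1 h2] := h j l.
split.
  rewrite -(rmorph_nat s) -h1 rmorph_sum.
  by apply: eq_bigr => i _; rewrite ffunE rmorphM.
rewrite -(rmorph_nat s) -h2 rmorph_sum.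
by apply: eq_bigr => i _; rewrite ffunE rmorphM.
Qed.

Lemma base_algebra : is_algebra A -> is_algebra (base s A).
Proof.
case=> /assoc_tbl h [e /base_unit he]; split; last by exists (bmap e).
apply: tbl_amulA => i j l m; have := congr1 s (h i j l m); rewrite !rmorph_sum /=.
move=> e0; rewrite (eq_bigr _ (fun p _ => rmorphM s (sc A j l p) _)) in e0.
by rewrite (eq_bigr _ (fun p _ => rmorphM s (sc A i j p) _)) in e0.
Qed.

Lemma bmap_inj : injective bmap.
Proof.
move=> x y /ffunP h; apply/ffunP => i; have := h i; rewrite !ffunE.
exact: fmorph_inj.
Qed.

End Base.

Arguments bmap {k L} s {I} x.

Lemma unit_uniq (k : fieldType) (I : finType) (A : salg k I) e e' :
  is_unit_of A e -> is_unit_of A e' -> e = e'.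
Proof. by move=> h h'; rewrite -(h e').1 (h' e).2. Qed.

(** * Polynomials over a division ring *)

Lemma centralCA (R : nzRingType) (f : R) : (forall p, f * p = p * f) ->
  forall p q, p * (f * q) = f * (p * q).
Proof. by move=> fC p q; rewrite mulrA -fC -mulrA. Qed.

Section PolyDivisionRing.
Variables (R : nzRingType) (S : R -> Prop).
Hypothesis S0 : S 0.
Hypothesis SD : forall x y, S x -> S y -> S (x + y).
Hypothesis SN : forall x, S x -> S (- x).
Hypothesis SM : forall x y, S x -> S y -> S (x * y).
Hypothesis SV : forall x, S x -> x != 0 -> exists2 y, S y & y * x = 1 /\ x * y = 1.

(** The division ring is a subset [S] of an ambient ring and not a type of its own: it will be the
    centralizer of a family of matrices, and the ambient matrix ring has zero divisors. *)
Definition polyIn (p : {poly R}) := forall i, S p`_i.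

Lemma polyIn_sum (I : Type) (r : seq I) (F : I -> R) :
  (forall i, S (F i)) -> S (\sum_(i <- r) F i).
Proof. by move=> h; elim/big_ind: _. Qed.

Lemma polyInD p q : polyIn p -> polyIn q -> polyIn (p + q).
Proof. by move=> hp hq i; rewrite coefD; apply: SD. Qed.
Lemma polyInN p : polyIn p -> polyIn (- p).
Proof. by move=> hp i; rewrite coefN; apply: SN. Qed.
Lemma polyInM p q : polyIn p -> polyIn q -> polyIn (p * q).
Proof. by move=> hp hq i; rewrite coefM; apply: polyIn_sum => j; apply: SM. Qed.
Lemma polyInC c : S c -> polyIn c%:P.
Proof. by move=> hc i; rewrite coefC; case: eqP. Qed.
Lemma polyInXn p n : polyIn p -> polyIn (p * 'X^n).
Proof. by move=> hp i; rewrite coefMXn; case: ifP. Qed.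

Lemma mulS_neq0 x y : S x -> S y -> x != 0 -> y != 0 -> x * y != 0.
Proof.
move=> hx hy x0 y0; have [z _ [_ yz]] := SV hy y0.
apply: contra_neq x0 => xy0; by rewrite -[x]mulr1 -yz mulrA xy0 mul0r.
Qed.

Lemma polyIn_mul_neq0 p q : polyIn p -> polyIn q -> p != 0 -> q != 0 -> p * q != 0.
Proof.
move=> hp hq p0 q0; apply/negP => /eqP pq.
have := mul_lead_coef p q; rewrite pq coef0 => /eqP.
apply/negP; apply: mulS_neq0; rewrite ?lead_coef_eq0 //; [exact: hp|exact: hq].
Qed.

Lemma polyIn_mulIr p q w : polyIn p -> polyIn q -> polyIn w -> w != 0 ->
  p * w = q * w -> p = q.
Proof.
move=> hp hq hw w0 e; apply/eqP; rewrite -subr_eq0; apply/negPn/negP => pq.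
have := polyIn_mul_neq0 (polyInD hp (polyInN hq)) hw pq w0.
by rewrite mulrBl e subrr eqxx.
Qed.

Lemma size_sqr p : polyIn p -> p != 0 -> size (p * p) = (size p + size p).-1.
Proof.
move=> hp p0; apply: size_proper_mul; apply: mulS_neq0; rewrite ?lead_coef_eq0 //; exact: hp.
Qed.

(** An element [w] of least degree generates: its leading coefficient is invertible in [S], so
    division by [w] on the right has a remainder of smaller degree. *)
Lemma left_ideal_principal (Lam : {poly R} -> Prop) x0 :
  (forall p, Lam p -> polyIn p) -> (forall p q, Lam p -> Lam q -> Lam (p + q)) ->
  (forall p q, polyIn p -> Lam q -> Lam (p * q)) -> Lam x0 -> x0 != 0 ->
  exists w, [/\ Lam w, w != 0 & forall x, Lam x -> exists2 q, polyIn q & x = q * w].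
Proof.
move=> LS LD LM Lx0 x00.
pose P n := `[< exists w, [/\ Lam w, w != 0 & size w = n] >].
have exP : exists n, P n by exists (size x0); apply/asboolP; exists x0.
have [n /asboolP [w [Lw w0 sw]] minw] := ex_minnP exP.
exists w; split=> // x; have [m] := ubnP (size x); elim: m x => // m IH x sx Lx.
have [->|xn0] := eqVneq x 0.
  by exists 0; rewrite ?mul0r // => i; rewrite coef0.
have sxw : (size w <= size x)%N.
  by rewrite sw; apply: minw; apply/asboolP; exists x.
have [y Sy [yl _]] := SV (LS _ Lw (size w).-1) (ltac:(by rewrite -lead_coefE lead_coef_eq0)).
set c := lead_coef x * y; set j := (size x - size w)%N.
have Sc : polyIn (c%:P * 'X^j).
  by apply: polyInXn; apply: polyInC; apply: SM => //; exact: (LS _ Lx).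
pose x' := x - c%:P * 'X^j * w.
have Lx' : Lam x'.
  by apply: LD => //; rewrite -mulNr; apply: LM => //; exact: polyInN.
have sx' : (size x' < m)%N.
  have szx : (0 < size x)%N by rewrite size_poly_gt0.
  have szw : (0 < size w)%N by rewrite size_poly_gt0.
  suff : (size x' <= (size x).-1)%N.
    by move=> h; apply: leq_ltn_trans h _; rewrite -ltnS prednK.
  apply/leq_sizeP => i; rewrite leq_eqVlt => /orP [/eqP <-|ilt]; last first.
    rewrite coefB -mulrA coefCM coefXnM nth_default ?sub0r; last first.
      by move: ilt; rewrite -ltnS prednK.
    case: ifP => _; rewrite ?mulr0 ?oppr0 // nth_default ?mulr0 ?oppr0 //.
    by move: (size x) (size w) sxw szx ilt @j {Sc x' Lx'} => a b; lia.
  rewrite coefB -mulrA coefCM coefXnM -lead_coefE ifF; last first.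
    by rewrite /j; lia.
  have -> : ((size x).-1 - j = (size w).-1)%N.
    by rewrite /j; lia.
  by rewrite /c -mulrA yl mulr1 subrr.
have [q Sq eq] := IH x' sx' Lx'.
exists (q + c%:P * 'X^j); first exact: polyInD.
by rewrite mulrDl -eq /x' subrK.
Qed.

Section Descent.
Variables (f : {poly R}) (Lam : {poly R} -> Prop) (w : {poly R}).
Hypotheses (fS : polyIn f) (f0 : f != 0) (fC : forall p, f * p = p * f).
Hypotheses (wS : polyIn w) (w0 : w != 0).

(** For central [f] the equation reads u = w (c/f) w^-1 in fractions: [u] is a polynomial conjugate
    of c/f, and so inherits its relations with central coefficients. *)
Definition descends (c u : {poly R}) := polyIn u /\ f * u * w = w * c.

Lemma descends_mul c u c' u' : descends c u -> descends c' u' ->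
  f * f * (u * u') * w = w * (c * c').
Proof.
by move=> [_ e] [_ e']; rewrite [RHS]mulrA -e -!mulrA -e' -!mulrA (centralCA fC u).
Qed.

Lemma descends_sqr c u g : descends c u -> (forall p, g * p = p * g) -> polyIn g ->
  c * c = f * f * g -> u * u = g.
Proof.
move=> h gC gS e; have hu := h.1.
have := descends_mul h h; rewrite e.
have -> : w * (f * f * g) = f * f * g * w.
  by rewrite -!mulrA !(centralCA fC w) -gC.
move/polyIn_mulIr => e1.
have {e1} : (u * u) * (f * f) = g * (f * f).
  have -> : u * u * (f * f) = f * f * (u * u).
    by rewrite -!mulrA !(centralCA fC u) -(fC u) !(centralCA fC u).
  have -> : g * (f * f) = f * f * g by rewrite gC.
  by apply: e1; do ?apply: polyInM.
by apply: polyIn_mulIr => //; [exact: polyInM|exact: polyInM|exact: polyIn_mul_neq0].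
Qed.

Lemma descends_anti c u c' u' : descends c u -> descends c' u' ->
  c * c' + c' * c = 0 -> u * u' + u' * u = 0.
Proof.
move=> h h' e; have hu := h.1; have hu' := h'.1.
have e1 : f * f * (u * u' + u' * u) * w = 0 * w.
  by rewrite mulrDr mulrDl (descends_mul h h') (descends_mul h' h) -mulrDr e mulr0 mul0r.
have S0' : polyIn 0 by move=> i; rewrite coef0.
set z := u * u' + u' * u in e1 *.
have zS : polyIn z by apply: polyInD; apply: polyInM.
have ffS : polyIn (f * f) by apply: polyInM.
have {}e1 := polyIn_mulIr (polyInM ffS zS) S0' wS w0 e1.
have {}e1 : z * (f * f) = 0 * (f * f).
  by rewrite mul0r -{}e1 -[RHS]mulrA (fC z) (centralCA fC z) -fC.
exact: polyIn_mulIr zS S0' ffS (polyIn_mul_neq0 fS fS f0 f0) e1.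
Qed.

End Descent.

(* If g becomes a square c^2/f^2 over the rational functions, it is a square:
   the left ideal generated by f and c is principal and stable under right
   multiplication by c/f. *)
Lemma poly_sqrt (f c g : {poly R}) : polyIn f -> polyIn c -> polyIn g -> f != 0 ->
  (forall p, f * p = p * f) -> (forall p, g * p = p * g) -> c * c = f * f * g ->
  exists2 u, polyIn u & u * u = g.
Proof.
move=> fS cS gS f0 fC gC e.
pose Lam x := exists p q, [/\ polyIn p, polyIn q & x = p * f + q * c].
have S0' : polyIn 0 by move=> i; rewrite coef0.
have S1 : polyIn 1.
  move=> i; rewrite coef1; case: eqP => // _.
  by have [y hy [<- _]] := SV (fS (size f).-1) (ltac:(by rewrite -lead_coefE lead_coef_eq0)); apply: SM.
have [|||||w [[p [q [pS qS wE]]] w0 hw]] := @left_ideal_principal Lam f.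
- by move=> _ [p [q [pS qS ->]]]; apply: polyInD; apply: polyInM.
- move=> _ _ [p [q [pS qS ->]]] [p' [q' [pS' qS' ->]]]; exists (p + p'), (q + q').
  by split; [exact: polyInD|exact: polyInD|by rewrite !mulrDl addrACA].
- move=> r _ rS [p [q [pS qS ->]]]; exists (r * p), (r * q).
  by split; [exact: polyInM|exact: polyInM|rewrite mulrDr !mulrA].
- by exists 1, 0; split; rewrite ?mul1r ?mul0r ?addr0.
- exact: f0.
have [u uS uE] : exists2 u, polyIn u & p * c + q * f * g = u * w.
  apply: hw; exists (q * g), p; split=> //; first exact: polyInM.
  by rewrite addrC -!mulrA gC.
exists u => //; apply: (@descends_sqr f w fS f0 fC _ w0 c) => //.
  by rewrite wE; apply: polyInD; apply: polyInM.
by split=> //; rewrite -mulrA -uE wE mulrDr mulrDl -!mulrA e -!mulrA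
  !(centralCA fC p) !(centralCA fC q).
Qed.

(** A single conjugating element must serve both roots. The left ideal generated by f^2, f c, f c'
    and c c' is stable under right multiplication by c/f and by c'/f, because c and c' anticommute
    and have the central squares f^2 g and f^2 g'; its generator [w] turns both fractions into
    polynomials. *)
Lemma poly_sqrt_anti (f c c' g g' : {poly R}) : polyIn f -> polyIn c -> polyIn c' ->
  polyIn g -> polyIn g' -> f != 0 ->
  (forall p, f * p = p * f) -> (forall p, g * p = p * g) -> (forall p, g' * p = p * g') ->
  c * c = f * f * g -> c' * c' = f * f * g' -> c * c' + c' * c = 0 ->
  exists u u', [/\ polyIn u, polyIn u', u * u = g, u' * u' = g' & u * u' + u' * u = 0].
Proof.
move=> fS cS cS' gS gS' f0 fC gC gC' e e' ecc.
have anti : c' * c = - (c * c') by apply/eqP; rewrite -addr_eq0 addrC ecc.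
pose Lam x := exists p q r t, [/\ [/\ polyIn p, polyIn q, polyIn r & polyIn t] &
  x = p * (f * f) + q * (f * c) + r * (f * c') + t * (c * c')].
have S0' : polyIn 0 by move=> i; rewrite coef0.
have S1 : polyIn 1.
  move=> i; rewrite coef1; case: eqP => // _.
  by have [y hy [<- _]] := SV (fS (size f).-1) (ltac:(by rewrite -lead_coefE lead_coef_eq0)); apply: SM.
have LS x : Lam x -> polyIn x.
  move=> [p [q [r [t [[pS qS rS tS] ->]]]]].
  by apply: polyInD; [apply: polyInD; [apply: polyInD|]|]; apply: polyInM => //; apply: polyInM.
have [|||||w [Lw w0 hw]] := @left_ideal_principal Lam (f * f).
- exact: LS.
- move=> _ _ [p [q [r [t [[pS qS rS tS] ->]]]]] [p' [q' [r' [t' [[pS' qS' rS' tS'] ->]]]]].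
  exists (p + p'), (q + q'), (r + r'), (t + t'); split; first by split; apply: polyInD.
  by rewrite !mulrDl addrACA; congr (_ + _); rewrite addrACA; congr (_ + _); rewrite addrACA.
- move=> x _ xS [p [q [r [t [[pS qS rS tS] ->]]]]].
  exists (x * p), (x * q), (x * r), (x * t); split; first by split; apply: polyInM.
  by rewrite !mulrDr !mulrA.
- by exists 1, 0, 0, 0; split; rewrite ?mul1r ?mul0r ?addr0.
- exact: polyIn_mul_neq0.
have wS := LS _ Lw; case: Lw => p [q [r [t [[pS qS rS tS] wE]]]].
(* The left-hand side is w c / f expanded on the four generators, and w c' / f in the next claim. *)
have [u uS uE] : exists2 u, polyIn u &
    q * g * (f * f) + p * (f * c) - t * g * (f * c') - r * (c * c') = u * w.
  apply: hw; exists (q * g), p, (- (t * g)), (- r); split; last by rewrite !mulNr.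
  by split=> //; do ?apply: polyInN; try apply: polyInM.
have [u' uS' uE'] : exists2 u', polyIn u' &
    r * g' * (f * f) + t * g' * (f * c) + p * (f * c') + q * (c * c') = u' * w.
  apply: hw; exists (r * g'), (t * g'), p, q; split=> //.
  by split=> //; apply: polyInM.
have D : descends f w c u.
  split=> //; rewrite -mulrA -uE wE !mulrDr !mulrDl !mulrN.
  have -> : t * (c * c') * c = - (f * (t * g * (f * c'))).
    by rewrite -!mulrA anti !mulrN (mulrA c c) e -!mulrA (centralCA fC g)
       !(centralCA fC t).
  have -> : r * (f * c') * c = - (f * (r * (c * c'))).
    by rewrite -!mulrA anti !mulrN (centralCA fC).
  have -> : q * (f * c) * c = f * (q * g * (f * f)).
    by rewrite -!mulrA e gC -!mulrA !(centralCA fC q).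
  have -> : p * (f * f) * c = f * (p * (f * c)).
    by rewrite -!mulrA (centralCA fC p).
  by rewrite addrAC; congr (_ - _ - _); rewrite addrC.
have D' : descends f w c' u'.
  split=> //; rewrite -mulrA -uE' wE !mulrDr !mulrDl.
  have -> : t * (c * c') * c' = f * (t * g' * (f * c)).
    by rewrite -!mulrA e' -!mulrA !(centralCA fC c) -(gC' c) (centralCA fC g')
       !(centralCA fC t).
  have -> : r * (f * c') * c' = f * (r * g' * (f * f)).
    by rewrite -!mulrA e' gC' -!mulrA !(centralCA fC r).
  have -> : q * (f * c) * c' = f * (q * (c * c')).
    by rewrite -!mulrA (centralCA fC q).
  have -> : p * (f * f) * c' = f * (p * (f * c')).
    by rewrite -!mulrA (centralCA fC p).
  by rewrite -[LHS]addrA [LHS]addrC !addrA.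
exists u, u'; split=> //.
- exact: (descends_sqr fS f0 fC wS w0 D).
- exact: (descends_sqr fS f0 fC wS w0 D').
- exact: (descends_anti fS f0 fC wS w0 D D').
Qed.

End PolyDivisionRing.

(** * Centralizers over function fields of quadrics *)

Section Fraction.
Variable R : idomainType.
Local Notation "x %:F" := (@FracField.tofrac R x).

Lemma fracP (x : {fraction R}) : exists p q : R, q != 0 /\ x * q%:F = p%:F.
Proof.
elim/quotW: x => r; exists r.1, r.2; split; first exact: denom_ratioP.
have r2 := denom_ratioP r; have o0 : (1 : R) != 0 by exact: oner_neq0.
unlock FracField.tofrac; rewrite -[LHS]FracField.pi_mul; apply/eqmodP => /=.
by rewrite FracField.equivfE /FracField.mulf !numden_Ratio ?mulf_neq0 // !mulr1 mulrC.
Qed.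

Lemma tofrac_inj : injective (@FracField.tofrac R).
Proof. by move=> p q /eqP; rewrite tofrac_eq => /eqP. Qed.
End Fraction.

(* Sealed: unfolding nested fraction fields makes conversion explode. *)
Lemma rat_pack (k : fieldType) : {K : fieldType & {ev : {rmorphism {poly k} -> K} |
  injective ev /\ forall x, exists p q, q != 0 /\ x * ev q = ev p}}.
Proof.
exists {fraction {poly k}}, (@FracField.tofrac {poly k}).
by split; [exact: tofrac_inj | exact: fracP].
Qed.

Definition ratf (k : fieldType) : fieldType := projT1 (rat_pack k).
Definition ratp (k : fieldType) : {rmorphism {poly k} -> ratf k} := sval (projT2 (rat_pack k)).
Definition ratc (k : fieldType) : {rmorphism k -> ratf k} := (ratp k \o polyC)%FUN.
Definition ratX (k : fieldType) : ratf k := ratp k 'X.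

Section Rat.
Variable k : fieldType.
Local Notation "x %:F" := (ratp k x).

Lemma ratp_inj : injective (ratp k).
Proof. by have [] := svalP (projT2 (rat_pack k)). Qed.

Lemma ratP (x : ratf k) : exists p q : {poly k}, q != 0 /\ x * q%:F = p%:F.
Proof. by have [_] := svalP (projT2 (rat_pack k)); apply. Qed.

Lemma ratp_eq0 (p : {poly k}) : (p%:F == 0) = (p == 0).
Proof. by rewrite -(rmorph0 (ratp k)) (inj_eq ratp_inj). Qed.

Lemma rat_common (T : finType) (x : T -> ratf k) :
  exists f : {poly k}, f != 0 /\ exists p : T -> {poly k}, forall t, f%:F * x t = (p t)%:F.
Proof.
have /fin_all_exists [q hq] t : exists q, q != 0 /\ exists p, x t * q%:F = p%:F.
  by have [p [q [q0 e]]] := ratP (x t); exists q; split=> //; exists p.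
exists (\prod_t q t); split; first by apply/prodf_neq0 => t _; case: (hq t).
have /fin_all_exists [p hp] t : exists p, (\prod_t q t)%:F * x t = p%:F.
  have [_ [p e]] := hq t; exists (p * \prod_(u | u != t) q u).
  by rewrite (bigD1 t) //= !rmorphM mulrAC [_%:F * x t]mulrC e.
by exists p.
Qed.

Variables (L : fieldType) (h : {rmorphism {poly k} -> L}).
Hypothesis h_inj : injective h.

Lemma rat_lift : exists h' : {rmorphism ratf k -> L}, forall x, h' x%:F = h x.
Proof.
have h0 q : q != 0 -> h q != 0.
  by move=> q0; rewrite -(rmorph0 h) (inj_eq h_inj).
have /choice [g hg] (x : ratf k) : exists y : L,
    forall p q : {poly k}, q != 0 -> x * q%:F = p%:F -> y * h q = h p.
  have [p [q [q0 e]]] := ratP x; exists (h p / h q) => p' q' q'0 e'.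
  apply: (mulIf (h0 _ q0)); rewrite mulrAC divfK ?h0 // -!rmorphM; congr (h _).
  by apply: ratp_inj; rewrite !rmorphM -e -e' mulrAC.
have hgE x p q : q != 0 -> x * q%:F = p%:F -> g x = h p / h q.
  by move=> q0 /(hg x _ _ q0) <-; rewrite mulfK ?h0.
have gF x : g x%:F = h x.
  by rewrite (@hgE _ x 1) ?rmorph1 ?divr1 ?mulr1 ?oner_neq0.
have gB : zmod_morphism g.
  move=> x y; have [p [q [q0 e]]] := ratP x; have [p' [q' [q'0 e']]] := ratP y.
  rewrite (hgE _ _ _ q0 e) (hgE _ _ _ q'0 e') (@hgE _ (p * q' - p' * q) (q * q')) ?mulf_neq0 //.
    by rewrite rmorphB !rmorphM; field; rewrite !h0.
  by rewrite rmorphB !rmorphM -e -e' mulrBl; ring.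
have gM : monoid_morphism g.
  split=> [|x y]; first by rewrite -(rmorph1 (ratp k)) gF rmorph1.
  have [p [q [q0 e]]] := ratP x; have [p' [q' [q'0 e']]] := ratP y.
  rewrite (hgE _ _ _ q0 e) (hgE _ _ _ q'0 e') (@hgE _ (p * p') (q * q')) ?mulf_neq0 //.
    by rewrite !rmorphM; field; rewrite !h0.
  by rewrite !rmorphM -e -e'; ring.
pose gA := GRing.isZmodMorphism.Build _ _ g gB.
pose gMM := GRing.isMonoidMorphism.Build _ _ g gM.
pose G : {rmorphism ratf k -> L} := HB.pack g gA gMM.
by exists G.
Qed.

End Rat.

Section MatrixCentralizer.
Variables (k : fieldType) (n : nat) (I : Type) (rho : I -> 'M[k]_n).

Definition mcent (M : 'M_n) := forall i, M *m rho i = rho i *m M.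
Definition mdiv := forall M, mcent M -> M != 0 -> M \in unitmx.

Lemma mcent0 : mcent 0. Proof. by move=> i; rewrite mul0mx mulmx0. Qed.
Lemma mcentD M N : mcent M -> mcent N -> mcent (M + N).
Proof. by move=> h h' i; rewrite mulmxDl mulmxDr h h'. Qed.
Lemma mcentN M : mcent M -> mcent (- M).
Proof. by move=> h i; rewrite mulNmx mulmxN h. Qed.
Lemma mcentM M N : mcent M -> mcent N -> mcent (M *m N).
Proof. by move=> h h' i; rewrite -mulmxA h' !mulmxA h. Qed.
Lemma mcent1 a : mcent a%:M. Proof. by move=> i; rewrite scalar_mxC. Qed.
Lemma mcentV M : mcent M -> M \in unitmx -> mcent (invmx M).
Proof.
by move=> h u i; rewrite -{1}[rho i](mulmxK u) -h !mulmxA mulVmx // mul1mx.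
Qed.
End MatrixCentralizer.

Section SingularMatrix.
Variables (k : fieldType) (n : nat) (I : Type) (rho : I -> 'M[k]_n.+1).

(** The minimal polynomial of a singular matrix is q X; q(M) is nonzero by minimality, is killed by
    M, and commutes with whatever M commutes with. *)
Lemma mcent_zero_divisor M : mcent rho M -> M != 0 -> M \notin unitmx ->
  exists2 N, mcent rho N & N != 0 /\ M *m N = 0.
Proof.
move=> cM M0 Mu; have r0 : root (mxminpoly M) 0.
  rewrite -eigenvalue_root_min; apply/eigenvalueP.
  move: Mu; rewrite unitmxE unitfE negbK => /det0P [v v0 e].
  by exists v => //; rewrite e scale0r.
have [q qE] := factor_theorem _ _ r0; rewrite subr0 in qE.
exists (horner_mx M q); last split.
- by move=> i; symmetry; apply: comm_mx_horner; rewrite /comm_mx cM.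
- apply/negP => /eqP /mxminpoly_min; rewrite qE.
  have q0 : q != 0.
    by apply: contra_neq (monic_neq0 (mxminpoly_monic M)) => q0; rewrite qE q0 mul0r.
  move/(dvdp_leq q0); rewrite size_mulX // ltnn //.
have := mx_root_minpoly M; rewrite qE rmorphM /= horner_mx_X => e.
by rewrite -[RHS]e; symmetry; apply: comm_horner_mx.
Qed.
End SingularMatrix.

(** Polynomials with matrix coefficients are matrices with polynomial entries, hence sit inside
    matrices over k(X). The last clause is a common denominator for a finite family. *)
Lemma poly_mx_embed (k : fieldType) (n : nat) :
  exists Psi : {rmorphism {poly 'M[k]_n.+1} -> 'M[ratf k]_n.+1},
  [/\ injective Psi, forall A, Psi A%:P = map_mx (ratc k) A,
      forall f : {poly k}, Psi (map_poly scalar_mx f) = (ratp k f)%:M &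
      forall (T : finType) (M : T -> 'M[ratf k]_n.+1),
        exists f : {poly k}, f != 0 /\ exists p, forall t,
          ratp k f *: M t = Psi (p t)].
Proof.
have [phi [[psi psiK phiK] phiS phiC _]] := mx_poly_ring_isom k n.
pose pA := GRing.isZmodMorphism.Build _ _ psi (can2_zmod_morphism psiK phiK).
pose pM := GRing.isMonoidMorphism.Build _ _ psi (can2_monoid_morphism psiK phiK).
pose P : {rmorphism {poly 'M[k]_n.+1} -> 'M[{poly k}]_n.+1} := HB.pack psi pA pM.
exists (map_mx (ratp k) \o P)%FUN; split.
- move=> p q /= /matrixP e; apply: (can_inj phiK); apply/matrixP => i j.
  by have := e i j; rewrite !mxE => /ratp_inj.
- by move=> A /=; rewrite -phiC psiK -map_mx_comp.
- by move=> f /=; rewrite -phiS psiK map_scalar_mx.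
move=> T M.
have [f [f0 [p hp]]] := rat_common (fun x : T * ('I_n.+1 * 'I_n.+1) => M x.1 x.2.1 x.2.2).
exists f; split=> //; exists (fun t => phi (\matrix_(i, j) p (t, (i, j)))) => t /=.
by rewrite psiK; apply/matrixP => i j; rewrite !mxE -hp.
Qed.

Lemma scalar_mx2E (k : nzRingType) n (a : k) (X : 'M[k]_n.+1) :
  a%:M * a%:M * X = (a * a) *: X.
Proof. by rewrite -mulrA -!mulmxE !mul_scalar_mx scalerA. Qed.

Section MatrixDivision.
Variables (k : fieldType) (n : nat) (I : Type) (rho : I -> 'M[k]_n.+1).
Hypothesis rho_div : mdiv rho.
Local Notation R := 'M[k]_n.+1.
Local Notation rhot := (fun i => map_mx (ratc k) (rho i)).

Let S0 : mcent rho 0 := @mcent0 _ _ _ rho.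
Let SD := @mcentD _ _ _ rho.
Let SN := @mcentN _ _ _ rho.
Let SM : forall x y : R, mcent rho x -> mcent rho y -> mcent rho (x * y) := @mcentM _ _ _ rho.
Lemma mdivV (x : R) : mcent rho x -> x != 0 ->
  exists2 y, mcent rho y & y * x = 1 /\ x * y = 1.
Proof.
move=> cx x0; have ux := rho_div cx x0; exists (invmx x); first exact: mcentV.
by split; [exact: mulVmx | exact: mulmxV].
Qed.

Lemma polyIn_scalar (f : {poly k}) : polyIn (mcent rho) (map_poly scalar_mx f).
Proof. by move=> i; rewrite coef_map; apply: mcent1. Qed.

Lemma scalar_poly_central (f : {poly k}) (p : {poly R}) :
  map_poly scalar_mx f * p = p * map_poly scalar_mx f.
Proof.
apply/polyP => i; rewrite coefM coefMr; apply: eq_bigr => j _; rewrite !coef_map.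
exact: comm_scalar_mx.
Qed.

Lemma scalar_poly_neq0 (f : {poly k}) : f != 0 -> map_poly (@scalar_mx k n.+1) f != 0.
Proof.
apply: contra_neq => /polyP e; apply/polyP => i; move: (e i).
rewrite coef_map !coef0 => /matrixP /(_ 0 0); rewrite !mxE eqxx mulr1n //.
Qed.

Section Embed.
Variable Psi : {rmorphism {poly R} -> 'M[ratf k]_n.+1}.
Hypotheses (Psi_inj : injective Psi) (PsiC : forall A, Psi A%:P = map_mx (ratc k) A).

Lemma polyIn_embed f M p : f != 0 -> ratp k f *: M = Psi p ->
  mcent rhot M -> polyIn (mcent rho) p.
Proof.
move=> f0 e cM i j; have : p * (rho j)%:P = (rho j)%:P * p.
  apply: Psi_inj; rewrite !rmorphM /= PsiC -e.
  by rewrite -scalerAl -scalerAr; congr (_ *: _); exact: cM.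
by move=> /(congr1 (fun q : {poly R} => q`_i)); rewrite coefMC coefCM.
Qed.
End Embed.

(** After clearing denominators, a zero divisor over k(X) would give two nonzero polynomials over
    the division ring with product zero. *)
Lemma mdiv_rat : mdiv rhot.
Proof.
move=> M cM M0; case: (boolP (M \in unitmx)) => // Mu; exfalso.
have [N cN [N0 MN]] := mcent_zero_divisor cM M0 Mu.
have [Psi [inj PsiC PsiS den]] := poly_mx_embed k n.
have [f [f0 [p hp]]] := den bool (fun b => if b then M else N).
have pS := polyIn_embed inj PsiC f0 (hp true) cM.
have qS := polyIn_embed inj PsiC f0 (hp false) cN.
have F0 : ratp k f != 0 by rewrite ratp_eq0.
have p0 b : p b != 0.
  apply/negP => /eqP pb; have /eqP := hp b; rewrite pb rmorph0 scaler_eq0 (negPf F0) /=.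
  by case: b {pb}; apply/negP.
have /negP[] := polyIn_mul_neq0 mdivV pS qS (p0 true) (p0 false).
apply/eqP; apply: inj; rewrite rmorph0 rmorphM -!hp.
by rewrite -scalerAl -scalerAr (MN : M * N = 0) !scaler0.
Qed.

Definition mquad (a b : k) : {poly R} := map_poly scalar_mx (a%:P + b%:P * 'X^2).

Lemma mquad_coef a b : ((mquad a b)`_0 = a%:M) * ((mquad a b)`_1 = 0) * ((mquad a b)`_2 = b%:M).
Proof.
rewrite /mquad !coef_map !coefD !coefCM !coefC !coefXn /= mulr0 mulr1 !addr0 add0r.
by rewrite raddf0.
Qed.

Lemma size_mquad a b : (size (mquad a b) <= 3)%N.
Proof.
apply: leq_trans (size_poly _ _) _; apply: leq_trans (size_polyD _ _) _.
rewrite geq_max (leq_trans (size_polyC_leq1 _)) //.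
by rewrite mul_polyC (leq_trans (size_scale_leq _ _)) // size_polyXn.
Qed.

(** Over a division ring squaring doubles the degree, so a root of a + b X^2 is linear; then the
    coefficients of (v0 + v1 X)^2 are compared. *)
Lemma sqr_linear (v : {poly R}) a b : polyIn (mcent rho) v -> v * v = mquad a b ->
  [/\ (size v <= 2)%N, v`_0 * v`_0 = a%:M, v`_0 * v`_1 + v`_1 * v`_0 = 0 & v`_1 * v`_1 = b%:M].
Proof.
move=> vS e; have sv : (size v <= 2)%N.
  have [->|v0] := eqVneq v 0; first by rewrite size_poly0.
  have := size_sqr mdivV vS v0; rewrite e => e1.
  by have := size_mquad a b; rewrite e1; move: (size v) => s; lia.
split=> //.
- by have := congr1 (fun q : {poly R} => q`_0) e; rewrite mquad_coef coefM big_ord1.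
- have := congr1 (fun q : {poly R} => q`_1) e; rewrite mquad_coef coefM.
  by rewrite big_ord_recr big_ord1 /= => ->.
have := congr1 (fun q : {poly R} => q`_2) e; rewrite mquad_coef coefM.
rewrite !big_ord_recr big_ord0 /= add0r => <-.
by rewrite [v`_2]nth_default // mulr0 mul0r add0r addr0.
Qed.

Lemma ratp_quad a b :
  ratp k (a%:P + b%:P * 'X^2) = ratc k a + ratc k b * ratX k ^+ 2.
Proof. by rewrite rmorphD rmorphM rmorphXn. Qed.

(** The polynomial root given by [poly_sqrt] is u0 + u1 X; the missing X-term of the form is the
    anticommutation of u0 and u1. *)
Lemma conic_descent u al ga : mcent rhot u ->
  u * u = (ratc k al + ratc k ga * ratX k ^+ 2)%:M ->
  exists u0 u1 : R, [/\ mcent rho u0, mcent rho u1, u0 * u0 = al%:M, u1 * u1 = ga%:M &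
     u0 * u1 + u1 * u0 = 0].
Proof.
move=> cu e; have [Psi [inj PsiC PsiS den]] := poly_mx_embed k n.
have [f [f0 [p hp]]] := den unit (fun => u).
have pS := polyIn_embed inj PsiC f0 (hp tt) cu.
have [|||||||v vS ve] := @poly_sqrt R (mcent rho) S0 SD SN SM mdivV (map_poly scalar_mx f) (p tt) (mquad al ga).
- exact: polyIn_scalar.
- exact: pS.
- exact: polyIn_scalar.
- exact: scalar_poly_neq0.
- exact: scalar_poly_central.
- exact: scalar_poly_central.
- apply: inj; rewrite !rmorphM /= -!hp !PsiS ratp_quad -e.
  by rewrite -!scalerAl -!scalerAr scalerA scalar_mx2E.
have [_ e0 e01 e1] := sqr_linear vS ve.
by exists v`_0, v`_1; split=> //; apply: vS.
Qed.

(** Second stage of the descent: the pair left by [conic_descent] has to be made polynomial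
    simultaneously, which is the purpose of [poly_sqrt_anti]. *)
Lemma quadric_descent u0 u1 al be ga : mcent rhot u0 -> mcent rhot u1 ->
  u0 * u0 = (ratc k al + ratc k be * ratX k ^+ 2)%:M -> u1 * u1 = (ratc k ga)%:M ->
  u0 * u1 + u1 * u0 = 0 ->
  exists v0 v1 v2 : R, [/\ mcent rho v0, mcent rho v1 & mcent rho v2] /\
    [/\ v0 * v0 = al%:M, v1 * v1 = be%:M & v2 * v2 = ga%:M] /\
    [/\ v0 * v1 + v1 * v0 = 0, v0 * v2 + v2 * v0 = 0 & v1 * v2 + v2 * v1 = 0].
Proof.
move=> cu0 cu1 e0 e1 e01; have [Psi [inj PsiC PsiS den]] := poly_mx_embed k n.
have [f [f0 [p hp]]] := den bool (fun b => if b then u0 else u1).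
have pS := polyIn_embed inj PsiC f0 (hp true) cu0.
have qS := polyIn_embed inj PsiC f0 (hp false) cu1.
have scal x y : (ratp k f *: x) * (ratp k f *: y) =
   (ratp k f * ratp k f) *: (x * y) :> 'M[ratf k]_n.+1.
  by rewrite -!scalerAl -!scalerAr scalerA.
have [||||||||||||v [v' [vS vS' ve ve' vv]]] := @poly_sqrt_anti R (mcent rho) S0 SD SN SM mdivV
   (map_poly scalar_mx f) (p true) (p false) (mquad al be) (mquad ga 0).
- exact: polyIn_scalar.
- exact: pS.
- exact: qS.
- exact: polyIn_scalar.
- exact: polyIn_scalar.
- exact: scalar_poly_neq0.
- exact: scalar_poly_central.
- exact: scalar_poly_central.
- exact: scalar_poly_central.
- apply: inj; rewrite !rmorphM /= -!hp !PsiS ratp_quad -e0 scal.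
  by rewrite scalar_mx2E.
- apply: inj; rewrite !rmorphM /= -!hp !PsiS ratp_quad rmorph0 mul0r addr0 -e1 scal.
  by rewrite scalar_mx2E.
- by apply: inj; rewrite rmorphD rmorph0 !rmorphM -!hp !scal -scalerDr e01 scaler0.
have [sv f1 f2 f3] := sqr_linear vS ve; have [sv' g1 _ g3] := sqr_linear vS' ve'.
(* The square is the constant [ga], so the linear coefficient squares to zero in a division ring. *)
have v'1 : v'`_1 = 0.
  apply/eqP/negPn/negP => v1; have := mulS_neq0 mdivV (vS' 1) (vS' 1) v1 v1.
  by rewrite g3 raddf0 eqxx.
exists v`_0, v`_1, v'`_0; split; first by split; [exact: vS|exact: vS|exact: vS'].
split; first by split.
split=> //.
  by have := congr1 (fun q : {poly R} => q`_0) vv; rewrite coefD coef0 !coefM !big_ord1.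
have := congr1 (fun q : {poly R} => q`_1) vv; rewrite coefD coef0 !coefM.
by rewrite !big_ord_recr !big_ord0 /= !add0r v'1 mulr0 mul0r add0r addr0.
Qed.

End MatrixDivision.

(** * Quadratic extensions of fields *)

Section QuadraticExtension.
Variables (k : fieldType) (g : k).
Hypothesis g_nsq : forall x, x * x != g.

(** The proof that [g] is not a square is a phantom argument, so that the type itself can carry the
    field structure. *)
Definition quad_ext of (forall x, x * x != g) : Type := (k * k)%type.
Local Notation Q := (quad_ext g_nsq).
HB.instance Definition _ := GRing.Zmodule.on Q.

Definition quad_mul (x y : Q) : Q := (x.1 * y.1 + g * (x.2 * y.2), x.1 * y.2 + x.2 * y.1).
Definition quad_one : Q := (1, 0).
Definition quad_inv (x : Q) : Q :=
  let N := x.1 * x.1 - g * (x.2 * x.2) in (x.1 / N, - x.2 / N).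

Lemma quad_mulA : associative quad_mul.
Proof. by move=> [a b] [c d] [e f]; rewrite /quad_mul /=; congr (_, _); ring. Qed.
Lemma quad_mulC : commutative quad_mul.
Proof. by move=> [a b] [c d]; rewrite /quad_mul /=; congr (_, _); ring. Qed.
Lemma quad_mul1 : left_id quad_one quad_mul.
Proof. by move=> [a b]; rewrite /quad_mul /=; congr (_, _); ring. Qed.
Lemma quad_mulD : left_distributive quad_mul +%R.
Proof. by move=> [a b] [c d] [e f]; rewrite /quad_mul /=; congr (_, _) => /=; ring. Qed.
Lemma quad_1neq0 : quad_one != 0.
Proof. by apply/negP => /eqP [] /eqP; rewrite oner_eq0. Qed.
HB.instance Definition _ := GRing.Zmodule_isComNzRing.Build Q
  quad_mulA quad_mulC quad_mul1 quad_mulD quad_1neq0.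

Lemma quad_mulV (x : Q) : x != 0 -> quad_inv x * x = 1.
Proof.
case: x => a b x0; have N0 : a * a - g * (b * b) != 0.
  have [b0|b0] := eqVneq b 0.
    rewrite b0 !mulr0 subr0 mulf_neq0 //;
      by apply: contra_neq x0 => a0; rewrite a0 b0.
  apply/negP => /eqP N; case/negP: (g_nsq (a / b)); apply/eqP.
  apply: (mulIf (mulf_neq0 b0 b0)); move: N => /eqP; rewrite subr_eq0 => /eqP <-.
  by field.
by rewrite /GRing.mul /= /quad_mul /quad_inv /=; congr (_, _); field.
Qed.
Lemma quad_inv0 : quad_inv 0 = 0.
Proof. by rewrite /quad_inv /= !mul0r !oppr0 mul0r. Qed.
HB.instance Definition _ := GRing.ComNzRing_isField.Build Q quad_mulV quad_inv0.

End QuadraticExtension.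

(** A form of k(sqrt g) free of any particular presentation; it also applies to a field given from
    outside, such as the one in the splitting condition (C). *)
Definition quad_over (k K : fieldType) (j : {rmorphism k -> K}) (r : K) (g : k) :=
  [/\ forall x, x * x != g, r * r = j g & forall x, exists a b, x = j a + j b * r].

Lemma quad_ext_exists (k : fieldType) (g : k) : (forall x, x * x != g) ->
  exists (K : fieldType) (j : {rmorphism k -> K}) (r : K), quad_over j r g.
Proof.
move=> hg; pose K : fieldType := quad_ext hg; pose f (a : k) : K := (a, 0).
have fB : zmod_morphism f by move=> a b; rewrite /f; congr (_, _) => /=; rewrite subr0.
have fM : monoid_morphism f.
  split=> [//|a b]; rewrite -[RHS]/(quad_mul (f a : quad_ext hg) (f b)) /quad_mul /f /=.
  by congr (_, _); ring.
pose fA := GRing.isZmodMorphism.Build _ _ f fB.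
pose fMM := GRing.isMonoidMorphism.Build _ _ f fM.
pose j : {rmorphism k -> K} := HB.pack f fA fMM.
exists K, j, (0, 1); split=> //.
  rewrite -[LHS]/(@quad_mul k g hg (0, 1) (0, 1)) /quad_mul /= /f.
  by congr (_, _); ring.
move=> [a b]; exists a, b.
rewrite -[RHS]/((a, 0) + @quad_mul k g hg (b, 0) (0, 1)) /quad_mul /=.
by congr (_, _) => /=; ring.
Qed.

Section QuadOver.
Variables (k K : fieldType) (j : {rmorphism k -> K}) (r : K) (g : k).
Hypothesis jr : quad_over j r g.

Lemma quad_over_eq0 a b : j a + j b * r = 0 -> a = 0 /\ b = 0.
Proof.
case: jr => hg rr _ e; have [b0|b0] := eqVneq b 0.
  split=> //; apply: (fmorph_inj j); rewrite rmorph0.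
  by move: e; rewrite b0 rmorph0 mul0r addr0.
case/negP: (hg (- a / b)); apply/eqP; apply: (fmorph_inj j).
have jb0 : j b != 0 by rewrite fmorph_eq0.
have rE : r = j (- a / b).
  rewrite rmorphM fmorphV rmorphN; apply: (mulIf jb0); rewrite divfK //.
  by rewrite mulrC -[RHS]add0r -e; ring.
by rewrite rmorphM -rE rr.
Qed.

Lemma quad_over_uniq a b a' b' : j a + j b * r = j a' + j b' * r -> a = a' /\ b = b'.
Proof.
move/eqP; rewrite -subr_eq0 => /eqP e.
have e' : j (a - a') + j (b - b') * r = 0.
  by rewrite -[RHS]e !rmorphB; ring.
have [/eqP + /eqP] := quad_over_eq0 e'.
by rewrite !subr_eq0 => /eqP -> /eqP ->.
Qed.

Lemma quad_lift (E : fieldType) (h : {rmorphism k -> E}) (s : E) : s * s = h g ->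
  exists h' : {rmorphism K -> E}, (forall a, h' (j a) = h a) /\ h' r = s.
Proof.
move=> ss; case: (jr) => _ rr sp.
have /choice [f hf] x : exists y, forall a b, x = j a + j b * r -> y = h a + h b * s.
  have [a [b xE]] := sp x; exists (h a + h b * s) => a' b'.
  by rewrite xE => /quad_over_uniq [-> ->].
have fE a b : f (j a + j b * r) = h a + h b * s by apply: hf.
have fB : zmod_morphism f.
  move=> x y; have [a [b ->]] := sp x; have [c [d ->]] := sp y; rewrite !fE.
  have -> : j a + j b * r - (j c + j d * r) = j (a - c) + j (b - d) * r by rewrite !rmorphB; ring.
  by rewrite fE !rmorphB; ring.
have fj a : f (j a) = h a by rewrite -[j a]addr0 -(mul0r r) -(rmorph0 j) fE rmorph0 mul0r addr0.
have fM : monoid_morphism f.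
  split=> [|x y]; first by rewrite -(rmorph1 j) fj rmorph1.
  have [a [b ->]] := sp x; have [c [d ->]] := sp y; rewrite !fE.
  have -> : (j a + j b * r) * (j c + j d * r) = j (a * c + b * d * g) + j (a * d + b * c) * r.
    by rewrite !rmorphD !rmorphM -rr; ring.
  by rewrite fE !rmorphD !rmorphM -ss; ring.
pose fA := GRing.isZmodMorphism.Build _ _ f fB.
pose fMM := GRing.isMonoidMorphism.Build _ _ f fM.
exists (HB.pack f fA fMM : {rmorphism K -> E}); split=> //=.
by rewrite -[r]mul1r -(rmorph1 j) -[j 1 * r]add0r -(rmorph0 j) fE rmorph0 rmorph1 add0r mul1r.
Qed.

(* If the centralizer of rho acquires a zero divisor A + B sqrt(g), then g has
   the square root A B^-1 in the centralizer. *)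
Lemma mdiv_quad (n : nat) (I : Type) (rho : I -> 'M[k]_n.+1) : mdiv rho ->
  (forall u, mcent rho u -> u * u != g%:M) -> mdiv (fun i => map_mx j (rho i)).
Proof.
move=> rd hu M cM M0; case: (boolP (M \in unitmx)) => // Mu; exfalso.
case: (jr) => _ rr sp.
have /fin_all_exists [F hF] (x : 'I_n.+1 * 'I_n.+1) :
  exists ab : k * k, M x.1 x.2 = j ab.1 + j ab.2 * r.
  by have [a [b e]] := sp (M x.1 x.2); exists (a, b).
pose A := \matrix_(p, q) (F (p, q)).1; pose B := \matrix_(p, q) (F (p, q)).2.
have ME : M = map_mx j A + r *: map_mx j B.
  by apply/matrixP => p q; rewrite !mxE (hF (p, q)) /= [r * _]mulrC.
have uniq (A1 B1 A2 B2 : 'M[k]_n.+1) :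
  map_mx j A1 + r *: map_mx j B1 = map_mx j A2 + r *: map_mx j B2 -> A1 = A2 /\ B1 = B2.
  move=> /matrixP e; split; apply/matrixP => p q; have := e p q; rewrite !mxE ![r * _]mulrC;
    by move=> /quad_over_uniq [].
have [cA cB] : mcent rho A /\ mcent rho B.
  split=> i; have := cM i; rewrite ME mulmxDl mulmxDr -scalemxAl -scalemxAr -!map_mxM;
    by move=> /uniq [].
have [B0|B0] := eqVneq B 0.
  have A0 : A != 0.
    by apply: contra_neq M0 => A0; rewrite ME A0 B0 !map_mx0 scaler0 addr0.
  by move: Mu; rewrite ME B0 map_mx0 scaler0 addr0 map_unitmx rd.
have uB := rd _ cB B0; pose u := invmx B *m A.
have cu : mcent rho u by apply: mcentM => //; apply: mcentV.
have cN : mcent rho (u * u - g%:M).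
  by apply: mcentD; [apply: mcentM | apply: mcentN; apply: mcent1].
have N0 : u * u - g%:M != 0 by rewrite subr_eq0 hu.
have uN := rd _ cN N0; move/negP: Mu; apply.
have AE : A = B *m u by rewrite /u mulmxA mulmxV // mul1mx.
clearbody u.
have : M *m (map_mx j u - r%:M) \in unitmx.
  suff -> : M *m (map_mx j u - r%:M) = map_mx j (B *m (u * u - g%:M)).
    by rewrite map_unitmx unitmx_mul uB.
  rewrite ME AE !map_mxM map_mxB map_mxM map_scalar_mx -rr scalar_mxM.
  rewrite -mul_mx_scalar -mulmxDr -mulmxA; congr (_ *m _).
  by rewrite mulmxDl !mulmxBr scalar_mxC addrA subrK.
by rewrite unitmx_mul => /andP[].
Qed.

End QuadOver.

Definition rquad (k : fieldType) (a b : k) : ratf k := ratc k a + ratc k b * ratX k ^+ 2.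
(** The form al + be Y^2 + ga Z^2 with Y the inner and Z the outer variable. Adjoining its square
    root to k(Y,Z) gives the function field of the quadric X^2 = al + be Y^2 + ga Z^2. *)
Definition quadric (k : fieldType) (al be ga : k) : ratf (ratf k) :=
  rquad (rquad al be) (ratc k ga).

Lemma ratc_quad_neq0 (k : fieldType) (a b : k) : a != 0 -> rquad a b != 0.
Proof.
rewrite /rquad.
apply: contra_neq; rewrite -ratp_quad -(rmorph0 (ratp k)) => /ratp_inj /(congr1 (fun p : {poly k} => p`_0)).
by rewrite coefD coefC coefCM coefXn /= mulr0 addr0 coef0.
Qed.

(** This is [conic_descent] for 1 by 1 matrices: a root would give two anticommuting scalars, whose
    product is then zero, with nonzero squares. *)
Lemma ratX_quad_nsq (k : fieldType) (a b : k) (x : ratf k) : 2%:R != 0 :> k -> a != 0 -> b != 0 ->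
  x * x != rquad a b.
Proof.
move=> two a0 b0; apply/negP => /eqP e.
have tdiv : mdiv (fun _ : unit => 0 : 'M[k]_1).
  move=> M _ M0; rewrite unitmxE unitfE det_mx11; apply: contra_neq M0 => e0.
  by apply/matrixP => i j; rewrite !ord1 e0 mxE.
have cx : mcent (fun _ : unit => map_mx (ratc k) (0 : 'M[k]_1)) x%:M.
  by move=> i; rewrite scalar_mxC.
have ex : x%:M * x%:M = (ratc k a + ratc k b * ratX k ^+ 2)%:M :> 'M_1.
  by rewrite -/(rquad a b) -e scalar_mxM.
have [u0 [u1 [_ _ /matrixP e0 /matrixP e1 /matrixP e01]]] := conic_descent tdiv cx ex.
have := e01 0 0; have := e0 0 0; have := e1 0 0; rewrite !mxE !big_ord1 !eqxx !mulr1n.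
move: (u0 0 0) (u1 0 0) => p q qq pp pq.
have /eqP : 2%:R * (p * q) = 0 by rewrite -pq; ring.
rewrite !mulf_eq0 (negPf two) /= => /orP [] /eqP z; move: pp qq; rewrite z mulr0 => /eqP.
  by rewrite eq_sym (negPf a0).
by move=> _ /esym /eqP; rewrite (negPf b0).
Qed.

Section Char2.
Variable k : fieldType.
Hypothesis two : 2%:R != 0 :> k.
Lemma char2_rat : 2%:R != 0 :> ratf k.
Proof. by rewrite -(rmorph_nat (ratc k)) fmorph_eq0. Qed.
End Char2.

(** The constant [N] serves the norm argument of [conjugate_contradiction], where the form would
    become a constant times a square. Dividing by [N] leaves a form of the same kind. *)
Lemma quadric_nsq (k : fieldType) (al be ga N : k) (x : ratf (ratf k)) : 2%:R != 0 :> k ->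
  al != 0 -> be != 0 -> ga != 0 -> N != 0 ->
  x * x * ratc _ (ratc _ N) != quadric al be ga.
Proof.
move=> two a0 b0 c0 N0; apply/negP => /eqP e.
have rN : ratc k N != 0 by rewrite fmorph_eq0.
move: e; rewrite /quadric; have := ratc_quad_neq0 be a0; move: (rquad al be) => A A0 e.
have rN2 : ratc (ratf k) (ratc k N) != 0 by rewrite (fmorph_eq0 (ratc (ratf k))); exact: rN.
have A0' : A / ratc k N != 0 by rewrite mulf_neq0 ?invr_eq0.
have C0 : ratc k ga / ratc k N != 0 by rewrite mulf_neq0 ?invr_eq0 // fmorph_eq0.
case/negP: (ratX_quad_nsq x (char2_rat two) A0' C0); apply/eqP.
apply: (mulIf rN2); rewrite e /rquad mulrDl -rmorphM divfK //; congr (_ + _).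
by rewrite mulrAC -rmorphM divfK.
Qed.

(** Dimension at most 4 of the centralizer, as dependence of any five elements: this needs no basis
    and descends along field extensions. *)
Definition mdim4 (k : fieldType) n (I : Type) (rho : I -> 'M[k]_n) :=
  forall M : 'I_5 -> 'M[k]_n, (forall i, mcent rho (M i)) ->
  exists c : 'I_5 -> k, (exists i, c i != 0) /\ \sum_i c i *: M i = 0.

Section FourDim.
Variables (k : fieldType) (n : nat) (I : Type) (rho : I -> 'M[k]_n.+1).
Hypotheses (two : 2%:R != 0 :> k) (rd : mdiv rho) (r4 : mdim4 rho).
Variables (al be ga : k).
Hypotheses (al0 : al != 0) (be0 : be != 0) (ga0 : ga != 0).
Local Notation R := 'M[k]_n.+1.

Lemma scalar_mx_neq0 (a : k) : a != 0 -> (a%:M : R) != 0.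
Proof.
by apply: contra_neq => /matrixP /(_ 0 0); rewrite !mxE eqxx mulr1n.
Qed.

(* 1, v0, v1, v0 v1 are independent, so v2 is a combination of them;
   anticommutation leaves only a multiple of v0 v1. *)
Lemma anticommuting_triple v0 v1 v2 : mcent rho v0 -> mcent rho v1 -> mcent rho v2 ->
  v0 * v0 = al%:M :> R -> v1 * v1 = be%:M :> R -> v2 * v2 = ga%:M :> R ->
  v0 * v1 + v1 * v0 = 0 :> R -> v0 * v2 + v2 * v0 = 0 :> R -> v1 * v2 + v2 * v1 = 0 :> R ->
  exists e : k, e * e = - (al * be * ga).
Proof.
move=> c0 c1 c2 q0 q1 q2 a01 a02 a12.
have s2 : 2%:R *: (1 : R) != 0 by rewrite scalemx1 scalar_mx_neq0.
have cancel2 (x : R) : x + x = 0 -> x = 0.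
  by move/eqP; rewrite -mulr2n -scaler_nat scaler_eq0 (negPf two) => /eqP.
have nz (v : R) (a : k) : a != 0 -> v * v = a%:M -> forall x : R, v * x = 0 -> x = 0.
  move=> a0 e x vx; have : v * (v * x) = 0 by rewrite vx mulr0.
  rewrite mulrA e -mulmxE mul_scalar_mx => /eqP; rewrite scaler_eq0 (negPf a0) => /eqP //.
have nz0 := nz _ _ al0 q0; have nz1 := nz _ _ be0 q1.
have w10 : v1 * v0 = - (v0 * v1) by apply/eqP; rewrite -addr_eq0 addrC a01.
have scal (a : k) (x : R) : a%:M * x = a *: x by rewrite -mulmxE mul_scalar_mx.
have scalr (a : k) (x : R) : x * a%:M = a *: x by rewrite -mulmxE mul_mx_scalar.
pose ac (v x : R) := v * x + x * v.
have acD v x y : ac v (x + y) = ac v x + ac v y by rewrite /ac mulrDr mulrDl addrACA.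
have acZ v a x : ac v (a *: x) = a *: ac v x by rewrite /ac -scalerAl -scalerAr -scalerDr.
have ac1 v : ac v 1 = v + v by rewrite /ac mulr1 mul1r.
have ac0 v : ac v 0 = 0 by rewrite /ac mulr0 mul0r addr0.
have ac01 : ac v0 (v0 * v1) = 0 by rewrite /ac mulrA q0 scal -mulrA w10 mulrN mulrA q0 scal subrr.
have ac11 : ac v1 (v0 * v1) = 0 by rewrite /ac mulrA w10 mulNr -!mulrA q1 scalr addrC subrr.
have ac10 : ac v1 v0 = 0 by rewrite /ac addrC.
have z0 : v0 != 0.
  by apply/negP => /eqP z; move: q0 => /eqP; rewrite z mulr0 eq_sym (negPf (scalar_mx_neq0 al0)).
have z1 : v1 != 0.
  by apply/negP => /eqP z; move: q1 => /eqP; rewrite z mulr0 eq_sym (negPf (scalar_mx_neq0 be0)).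
have lin0 v w (a b : k) : w != 0 -> v != 0 -> ac w v = 0 -> a *: v + b *: 1 = 0 -> a = 0 /\ b = 0.
  move=> w0 v_n0 awv E; have : b *: (w + w) = 0.
    by rewrite -ac1 -acZ -[RHS](ac0 w) -E acD !acZ awv scaler0 add0r.
  rewrite scalerDr => /cancel2 /eqP; rewrite scaler_eq0 (negPf w0) orbF => /eqP b0.
  by move: E; rewrite b0 scale0r addr0 => /eqP; rewrite scaler_eq0 (negPf v_n0) orbF => /eqP.
have key (a b c d e : k) : a *: 1 + b *: v0 + c *: v1 + d *: (v0 * v1) + e *: v2 = 0 ->
  [/\ a = 0, b = 0, c = 0 & d *: (v0 * v1) + e *: v2 = 0].
  move=> E; have [a0 b0] : a = 0 /\ b * al = 0.
    apply: (lin0 v0 v1) => //; apply: cancel2.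
    rewrite -[RHS](ac0 v0) -E !acD !acZ ac1 ac01 [ac v0 v1]a01 [ac v0 v2]a02 !scaler0 !addr0.
    by rewrite /ac q0 !scalerDr -scalerA scalemx1 addrACA.
  have [_ c0'] : a = 0 /\ c * be = 0.
    apply: (lin0 v1 v0) => //; apply: cancel2.
    rewrite -[RHS](ac0 v1) -E !acD !acZ ac1 ac11 ac10 [ac v1 v2]a12 !scaler0 !addr0.
    by rewrite /ac q1 !scalerDr -scalerA scalemx1 addrACA.
  have {}b0 : b = 0 by move/eqP: b0; rewrite mulf_eq0 (negPf al0) orbF => /eqP.
  have {}c0' : c = 0 by move/eqP: c0'; rewrite mulf_eq0 (negPf be0) orbF => /eqP.
  by split=> //; move: E; rewrite a0 b0 c0' !scale0r !add0r.
pose M (i : 'I_5) : R := nth 0 [:: 1; v0; v1; v0 * v1; v2] i.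
have [|c [[i ci] cE]] := @r4 M.
  have c01 : mcent rho (v0 * v1) by apply: mcentM.
  have c11 : mcent rho (1 : R) by apply: mcent1.
  by case=> [[|[|[|[|[|i]]]]] hi].
move: cE; rewrite !big_ord_recl big_ord0 /= addr0 !addrA.
set x0 := c _; set x1 := c _; set x2 := c _; set x3 := c _; set x4 := c _ => /key [y0 y1 y2 E].
have x4n : x4 != 0.
  apply/negP => /eqP y4; move: E; rewrite y4 scale0r addr0 => /eqP; rewrite scaler_eq0 => /orP [/eqP y3|/eqP].
    case/negP: ci; apply/eqP; case: i => [[|[|[|[|[|i]]]]] hi] //.
    - by rewrite -y0; congr c; apply: val_inj.
    - by rewrite -y1; congr c; apply: val_inj.
    - by rewrite -y2; congr c; apply: val_inj.
    - by rewrite -y3; congr c; apply: val_inj.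
    - by rewrite -y4; congr c; apply: val_inj.
  by move/nz0/eqP; rewrite (negPf z1).
have v2E : v2 = (- (x3 / x4)) *: (v0 * v1).
  apply: (scalerI x4n); rewrite scalerA mulrN mulrC divfK //.
  by apply/eqP; rewrite scaleNr -addr_eq0 addrC E.
exists (x3 / x4 * al * be).
have : v2 * v2 = (- (x3 / x4) * (x3 / x4) * al * be)%:M.
  have W : v0 * v1 * (v0 * v1) = (- (al * be))%:M.
    rewrite mulrA -(mulrA v0) w10 mulrN mulrA q0 scal mulNr -scalerAl q1.
    by rewrite scale_scalar_mx raddfN.
  rewrite v2E -scalerAl -scalerAr scalerA W scale_scalar_mx.
  by congr (_%:M); ring.
rewrite q2 => /matrixP /(_ 0 0); rewrite !mxE !eqxx !mulr1n => ->.
by ring.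
Qed.
End FourDim.

Lemma quadric_field (k : fieldType) (al be ga : k) : 2%:R != 0 :> k ->
  al != 0 -> be != 0 -> ga != 0 ->
  exists (K : fieldType) (j : {rmorphism ratf (ratf k) -> K}) (r : K), quad_over j r (quadric al be ga).
Proof.
move=> two a0 b0 c0; apply: quad_ext_exists => x.
have := quadric_nsq x two a0 b0 c0 (oner_neq0 k).
by rewrite !(rmorph1 (ratc _)) mulr1.
Qed.

Section RatMap.
Variables (k E : fieldType) (h : {rmorphism k -> E}).
Lemma rat_map : {h' : {rmorphism ratf k -> ratf E} |
  forall p, h' (ratp k p) = ratp E (map_poly h p)}.
Proof.
have inj : injective (ratp E \o map_poly h)%FUN.
  by move=> p q /= /ratp_inj /map_poly_inj.
by apply: cid; have [h' hE] := rat_lift inj; exists h'.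
Qed.
Definition ratm : {rmorphism ratf k -> ratf E} := sval rat_map.
Lemma ratmP p : ratm (ratp k p) = ratp E (map_poly h p).
Proof. exact: (svalP rat_map). Qed.
Lemma ratmC a : ratm (ratc k a) = ratc E (h a).
Proof. by rewrite /ratc /= ratmP map_polyC. Qed.
Lemma ratmX : ratm (ratX k) = ratX E.
Proof. by rewrite /ratX ratmP map_polyX. Qed.
Lemma ratm_rquad a b : ratm (rquad a b) = rquad (h a) (h b).
Proof. by rewrite /rquad rmorphD rmorphM rmorphXn ratmX !ratmC. Qed.
End RatMap.

Lemma ratm_comp (k E L : fieldType) (g : {rmorphism k -> E}) (f : {rmorphism E -> L})
  (h : {rmorphism k -> L}) : (forall a, f (g a) = h a) -> forall x, ratm f (ratm g x) = ratm h x.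
Proof.
move=> fg x; have [p [q [q0 e]]] := ratP x.
have q0' : ratm h (ratp k q) != 0 by rewrite fmorph_eq0 ratp_eq0.
have E1 u : ratm f (ratm g (ratp k u)) = ratm h (ratp k u).
  by rewrite !ratmP; congr (ratp _ _); apply/polyP => i; rewrite !coef_map; exact: fg.
by apply: (mulIf q0'); rewrite -{1}E1 -!rmorphM e E1.
Qed.

Notation ratm2 h := (ratm (ratm h)).
Lemma ratm2C (k E : fieldType) (h : {rmorphism k -> E}) a :
  ratm2 h (ratc _ (ratc k a)) = ratc _ (ratc E (h a)).
Proof. by rewrite !ratmC. Qed.
Lemma ratm2_quadric (k E : fieldType) (h : {rmorphism k -> E}) al be ga :
  ratm2 h (quadric al be ga) = quadric (h al) (h be) (h ga).
Proof. by rewrite /quadric ratm_rquad ratm_rquad ratmC. Qed.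

Lemma quadric_map (k E : fieldType) (h : {rmorphism k -> E}) (al be ga : k)
  (K : fieldType) (j : {rmorphism ratf (ratf k) -> K}) (r : K)
  (K' : fieldType) (j' : {rmorphism ratf (ratf E) -> K'}) (r' : K') :
  quad_over j r (quadric al be ga) -> quad_over j' r' (quadric (h al) (h be) (h ga)) ->
  exists hK : {rmorphism K -> K'}, (forall x, hK (j x) = j' (ratm2 h x)) /\ hK r = r'.
Proof.
move=> jr j'r'.
have [|hK [hKj hKr]] := quad_lift jr (h := (j' \o ratm2 h)%FUN) (s := r').
  by case: j'r' => _ -> _ /=; rewrite ratm2_quadric.
by exists hK.
Qed.

Section Step.
Variables (k : fieldType) (n : nat) (I : Type) (rho : I -> 'M[k]_n.+1).
Hypotheses (two : 2%:R != 0 :> k) (rd : mdiv rho) (r4 : mdim4 rho).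
Variables (al be ga : k).
Hypotheses (al0 : al != 0) (be0 : be != 0) (ga0 : ga != 0).
Hypothesis nsq : forall e : k, e * e != - (al * be * ga).
Variables (K : fieldType) (j : {rmorphism ratf (ratf k) -> K}) (r : K).
Hypothesis jr : quad_over j r (quadric al be ga).

Variables (s : {rmorphism k -> K}) (sE : forall a, s a = j (ratc (ratf k) (ratc k a))).

(** The two variables are harmless by [mdiv_rat]. Only the square root of the form can create zero
    divisors, and by [mdiv_quad] only if the form already has a root in the centralizer over k(Y,Z);
    the two descents then remove Z and Y. *)
Theorem mdiv_quadric : mdiv (fun i => map_mx s (rho i)).
Proof.
have rd1 := mdiv_rat rd; have rd2 := mdiv_rat rd1.
have : mdiv (fun i => map_mx j (map_mx (ratc (ratf k)) (map_mx (ratc k) (rho i)))).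
  apply: (mdiv_quad jr rd2) => u cu; apply/negP => /eqP uu.
  have [u0 [u1 [c0 c1 q0 q1 q01]]] := conic_descent rd1 cu uu.
  have [v0 [v1 [v2 [[d0 d1 d2] [[e0 e1 e2] [e01 e02 e12]]]]]] :=
    quadric_descent rd c0 c1 q0 q1 q01.
  have [e /eqP] := anticommuting_triple two r4 al0 be0 d0 d1 d2 e0 e1 e2 e01 e02 e12.
  by rewrite (negPf (nsq e)).
move=> H M cM; apply: H => i.
have -> : map_mx j (map_mx (ratc (ratf k)) (map_mx (ratc k) (rho i))) = map_mx s (rho i).
  by apply/matrixP => p q; rewrite 4!mxE sE.
exact: cM.
Qed.
End Step.

(** * Square classes over function fields of quadrics *)

Lemma coef_top (R : nzRingType) (p q : {poly R}) a b : (size p <= a.+1)%N -> (size q <= b.+1)%N ->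
  (p * q)`_(a + b) = p`_a * q`_b.
Proof.
move=> sp sq; have ha : (a < (a + b).+1)%N by rewrite ltnS leq_addr.
rewrite coefM (bigD1 (Ordinal ha)) //= addKn big1 ?addr0 // => i ia.
have {}ia : (i : nat) != a by apply: contra_neq ia => e; apply: val_inj.
case: (ltnP i a) => hi; last by rewrite nth_default ?mul0r // (leq_trans sp) // ltn_neqAle eq_sym ia.
by rewrite [q`__]nth_default ?mulr0 // (leq_trans sq) //; lia.
Qed.

Section SquareDescent.
Variables (S E : fieldType) (i : {rmorphism S -> E}).
Hypothesis two : 2%:R != 0 :> S.
Local Notation "p ^i" := (map_poly i p) (at level 2).

(** The coefficients of [u] are found from the top down: once [m] agrees with [u] above a degree b,
    the next coefficient of u^2 = N expresses 2 u_b through elements of [S]. *)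
Lemma monic_sqrt (u : {poly E}) (N : {poly S}) : u \is monic -> u * u = N^i ->
  exists m : {poly S}, u = m^i.
Proof.
move=> um uu; have [d su] : exists d, size u = d.+1.
  by exists (size u).-1; rewrite prednK // size_poly_gt0 monic_neq0.
suff /(_ d) [|m] : forall c, (c <= d)%N -> exists m : {poly S}, (size (u - m^i)%R <= d - c)%N.
- by [].
- by rewrite subnn leqn0 size_poly_eq0 subr_eq0 => /eqP; exists m.
elim=> [_|c IH cd].
  exists 'X^d; rewrite map_polyXn subn0; apply/leq_sizeP => j.
  rewrite leq_eqVlt => /orP [/eqP <-|dj]; rewrite coefB coefXn ?eqxx.
    by move/eqP: um; rewrite lead_coefE su /= => ->; rewrite subrr.
  by rewrite nth_default ?su // gtn_eqF // subr0.
have [m hm] := IH (ltnW cd); set r := u - m^i in hm.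
have [b db] : exists b, (d - c = b.+1)%N by exists (d - c.+1)%N; lia.
rewrite db in hm; pose s := (N - m * m)`_(d + b) / 2%:R.
(* Read off (u + m)(u - m) = N - m^2 in degree d + b; the leading coefficient of u + m is 2. *)
have top : 2%:R * r`_b = i ((N - m * m)`_(d + b)).
  have : (u + m^i) * r = (N - m * m)^i by rewrite raddfB /= rmorphM /= -uu /r; ring.
  move=> /(congr1 (fun q : {poly E} => q`_(d + b))).
  have bd : (b < d)%N by lia.
  have rd : r`_d = 0 by rewrite nth_default // (leq_trans hm).
  have smd : (size (u + m^i)%R <= d.+1)%N.
    have -> : u + m^i = u + u - r by rewrite /r; ring.
    by apply: leq_trans (size_polyD _ _) _; rewrite geq_max size_polyN (leq_trans hm) ?(leq_trans (size_polyD _ _)) ?maxnn ?su //; lia.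
  rewrite coef_top // coef_map => <-; congr (_ * _).
  have -> : u + m^i = u + u - r by rewrite /r; ring.
  rewrite coefB rd subr0 coefD; move/eqP: um; rewrite lead_coefE su /= => ->; ring.
exists (m + s *: 'X^b); have -> : (d - c.+1 = b)%N by lia.
rewrite rmorphD /= map_polyZ map_polyXn opprD addrA -/r.
apply/leq_sizeP => j; rewrite leq_eqVlt => /orP [/eqP <-|bj]; rewrite coefB coefZ coefXn ?eqxx.
  rewrite mulr1 /s fmorph_div -top rmorph_nat mulrC mulKf ?subrr //.
  by rewrite -(rmorph_nat i) fmorph_eq0.
by rewrite nth_default ?(leq_trans hm) // gtn_eqF // mulr0 subr0.
Qed.

Lemma rat_sqrt_poly (v : ratf E) (P : {poly E}) : v * v = ratp E P ->
  exists u, v = ratp E u /\ u * u = P.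
Proof.
move=> vv; have [c [g [g0 e]]] := ratP v.
have cc : c ^+ 2 = P * g ^+ 2.
  by apply: (@ratp_inj E); rewrite rmorphXn rmorphM rmorphXn -vv -e; ring.
have : g ^+ 2 %| c ^+ 2 by rewrite cc dvdp_mull.
rewrite dvdp_pexp2r // => /dvdpP [u cE]; exists u; split.
  by apply: (mulIf (_ : ratp E g != 0)); rewrite ?ratp_eq0 // e cE rmorphM.
by apply: (mulIf (_ : g ^+ 2 != 0)); rewrite ?expf_neq0 // -cc cE; ring.
Qed.

(* Normalize by leading coefficients: a monic square
   root over E of a polynomial over S has coefficients in S. *)
Lemma rat_square_descent (e : E) (x : ratf S) (v : ratf E) : x != 0 -> e != 0 ->
  ratc E e * ratm i x = v * v ->
  exists s : S, [/\ s != 0, exists w, e * i s = w * w & exists x1, x = ratc S s * (x1 * x1)].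
Proof.
move=> x0 e0 ex; have [p [q [q0 xq]]] := ratP x.
have p0 : p != 0 by rewrite -ratp_eq0 -xq mulf_neq0 ?ratp_eq0.
have [M ME] : exists M, M = p * q by exists (p * q).
have M0 : M != 0 by rewrite ME mulf_neq0.
have [|u [_ uu]] := @rat_sqrt_poly (v * ratm i (ratp S q)) (e *: M^i).
  rewrite ME mulrACA -ex -mul_polyC rmorphM /= -[ratp E e%:P]/(ratc E e) rmorphM /= rmorphM /=.
  by rewrite -!ratmP -xq rmorphM /=; ring.
have u0 : u != 0.
  by apply: contraNneq M0 => u0; move: uu; rewrite u0 mulr0 => /esym/eqP;
     rewrite scaler_eq0 (negPf e0) map_poly_eq0.
have lM : lead_coef M != 0 by rewrite lead_coef_eq0.
have lu : lead_coef u != 0 by rewrite lead_coef_eq0.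
have luu : e * i (lead_coef M) = lead_coef u * lead_coef u.
  by rewrite -lead_coefM uu lead_coefZ lead_coef_map.
have [m umE] : exists m, (lead_coef u)^-1 *: u = m^i.
  apply: (@monic_sqrt _ ((lead_coef M)^-1 *: M)).
    by rewrite monicE lead_coefZ mulVf.
  rewrite -scalerAl -scalerAr uu !scalerA map_polyZ fmorphV; congr (_ *: _).
  by apply: (mulIf (_ : i (lead_coef M) != 0)); rewrite ?fmorph_eq0 // -!mulrA luu mulVf ?fmorph_eq0 //; field.
exists (lead_coef M); split=> //; first by exists (lead_coef u).
have MM : M = lead_coef M *: (m * m).
  apply: (map_poly_inj i); rewrite map_polyZ rmorphM /= -umE -scalerAl -scalerAr uu !scalerA.
  rewrite -[LHS]scale1r; congr (_ *: _); apply: (mulIf (mulf_neq0 lu lu)).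
  by rewrite mul1r -[LHS]luu; field.
exists (ratp S m / ratp S q).
have rq0 : ratp S q != 0 by rewrite ratp_eq0.
apply: (mulIf (mulf_neq0 rq0 rq0)); rewrite mulrA xq -rmorphM -ME [LHS](congr1 (ratp S) MM) -mul_polyC !rmorphM /=.
have -> : ratp S (lead_coef M)%:P = ratc S (lead_coef M) by [].
by field.
Qed.

End SquareDescent.

Lemma rat2_square_descent (S E : fieldType) (i : {rmorphism S -> E}) (e : E)
  (x : ratf (ratf S)) (v : ratf (ratf E)) : 2%:R != 0 :> S -> x != 0 -> e != 0 ->
  ratc _ (ratc E e) * ratm2 i x = v * v ->
  exists s : S, [/\ s != 0, exists w, e * i s = w * w & exists x1, x = ratc _ (ratc S s) * (x1 * x1)].
Proof.
move=> two x0 e0 ex.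
have [|s1 [s10 [w1 w1E] [x1 x1E]]] := rat_square_descent (char2_rat two) x0 _ ex.
  by rewrite fmorph_eq0.
have [s [s0 hw [x2 x2E]]] := rat_square_descent two s10 e0 w1E.
exists s; split=> //; exists (ratc _ x2 * x1); rewrite x1E x2E !rmorphM.
by ring.
Qed.

Lemma norm_identity (F : fieldType) (t z q qb two : F) : z != 0 -> q != 0 -> qb != 0 -> two != 0 ->
  t / (two * z) * (t / (two * z)) * (z * z) = q * qb * (t / (two * q) * (t / (two * qb))).
Proof. by move=> z0 q0 qb0 t0; field; rewrite ?z0 ?q0 ?qb0 ?t0. Qed.

Lemma ratio_identity (F : fieldType) (u v G D A B : F) : u != 0 -> v != 0 -> D != 0 ->
  2%:R != 0 :> F -> u * u + G * (v * v) = D * A -> 2%:R * (u * v) = D * B ->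
  2%:R * (u / v) * (A / B) = (u / v) * (u / v) + G.
Proof.
move=> u0 v0 D0 t0 e1 e2.
have -> : A = (u * u + G * (v * v)) / D by rewrite e1 mulrC mulKf.
have -> : B = 2%:R * (u * v) / D by rewrite e2 mulrC mulKf.
by field; rewrite ?u0 ?v0 ?D0 ?t0.
Qed.

Lemma square_identity (F : fieldType) (q h G : F) : 2%:R * q * h = q * q + G ->
  (q - h) * (q - h) = h * h - G.
Proof.
move=> e; have -> : G = 2%:R * q * h - q * q by rewrite e; ring.
by ring.
Qed.

Section SquareClass.
Variables (P E : fieldType) (i : {rmorphism P -> E}) (al be ga : P).
Hypotheses (two : 2%:R != 0 :> P) (al0 : al != 0) (be0 : be != 0) (ga0 : ga != 0).
Variables (K : fieldType) (j : {rmorphism ratf (ratf P) -> K}) (r : K).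
Variable g : ratf (ratf P).
Hypotheses (gdef : g = quadric al be ga) (jr : quad_over j r g).
Variables (K' : fieldType) (j' : {rmorphism ratf (ratf E) -> K'}) (r' : K').
Hypothesis jr' : quad_over j' r' (quadric (i al) (i be) (i ga)).
Variable hK : {rmorphism K -> K'}.
Hypotheses (hKj : forall x, hK (j x) = j' (ratm2 i x)) (hKr : hK r = r').
Variable d : E.
Hypotheses (d0 : d != 0) (hd : forall a, a != 0 -> forall y, y * y != d * i a).

Let h2 : {rmorphism ratf (ratf P) -> ratf (ratf E)} := ratm2 i.
Let D := ratc (ratf E) (ratc E d).
Let two2 : 2%:R != 0 :> ratf (ratf P). Proof. exact/char2_rat/char2_rat. Qed.
Let twoE2 : 2%:R != 0 :> ratf (ratf E).
Proof. by rewrite -(rmorph_nat h2) fmorph_eq0. Qed.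

Lemma rat2_not_square x v : x != 0 -> D * h2 x != v * v.
Proof.
move=> x0; apply/negP => /eqP e.
have [s [s0 [w wE] _]] := rat2_square_descent two x0 d0 e.
by have /negP := hd s0 w; rewrite wE.
Qed.

Let g0 : g != 0.
Proof.
apply/negP => /eqP gz; have := quadric_nsq 0 two al0 be0 ga0 (oner_neq0 P).
by rewrite mul0r mul0r -gdef gz eqxx.
Qed.

(* The remaining case of the theorem: q = rho + pi e is conjugate to g / q over P(y,z),
   and taking norms from P(e)(y,z) makes g a constant times a square. *)
Lemma conjugate_contradiction (e : E) (rho pi s2 : ratf (ratf P)) (c : P) (v : ratf (ratf E)) :
  e * e = i c -> (forall e0, i e0 != e) -> rho * rho - ratc _ (ratc _ c) * (pi * pi) = g ->
  s2 != 0 -> D * (h2 s2 / (2%:R * (h2 rho + ratc _ (ratc _ e) * h2 pi))) != v * v.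
Proof.
move=> ee enP gE s20; apply/negP => /eqP dv.
have c_nsq x : x * x != c.
  apply/negP => /eqP xc; have : (i x - e) * (i x + e) = 0.
    by rewrite -subr_sqr !expr2 ee -xc rmorphM subrr.
  move/eqP; rewrite mulf_eq0 subr_eq0 addr_eq0 => /orP [].
    exact/negP.
  by move/eqP => xe; have /negP[] := enP (- x); rewrite rmorphN xe opprK.
have [S [m [ep Sm]]] := quad_ext_exists c_nsq.
have [i' [i'm i'ep]] := quad_lift Sm ee.
have epep : ep * ep = m c by case: Sm.
have [|chi [chim chiep]] := quad_lift Sm (h := m) (s := - ep).
  by rewrite mulrNN epep.
pose m2 := ratm2 m; pose I2 := ratm2 i'; pose X2 := ratm2 chi.
have I2m2 x : I2 (m2 x) = h2 x by apply: ratm_comp => y; apply: ratm_comp.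
have X2m2 x : X2 (m2 x) = m2 x by apply: ratm_comp => y; apply: ratm_comp.
have twoS : 2%:R != 0 :> S by rewrite -(rmorph_nat m) fmorph_eq0.
have twoS2 : 2%:R != 0 :> ratf (ratf S) by exact/char2_rat/char2_rat.
pose EP := ratc (ratf S) (ratc S ep).
pose q := m2 rho + EP * m2 pi; pose qb := m2 rho - EP * m2 pi.
have qqb : q * qb = m2 g.
  rewrite /q /qb -gE rmorphB !rmorphM /= ratm2C -epep !rmorphM -/EP; ring.
have [q0 qb0] : q != 0 /\ qb != 0.
  by apply/andP; rewrite -negb_or -mulf_eq0 qqb fmorph_eq0.
pose x := m2 s2 / (2%:R * q).
have x0 : x != 0 by rewrite mulf_neq0 ?fmorph_eq0 // invr_eq0 mulf_neq0.
have I2q : I2 q = h2 rho + ratc _ (ratc _ e) * h2 pi.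
  by rewrite rmorphD rmorphM /= !I2m2 ratm2C i'ep.
have dx : D * I2 x = v * v.
  by rewrite -dv /x fmorph_div I2m2 rmorphM rmorph_nat I2q.
have [ka [ka0 _ [x1 xE]]] := rat2_square_descent twoS x0 d0 dx.
have Xq : X2 q = qb by rewrite rmorphD rmorphM /= !X2m2 ratm2C chiep !rmorphN mulNr.
have Xx : X2 x = m2 s2 / (2%:R * qb) by rewrite fmorph_div X2m2 rmorphM rmorph_nat Xq.
have XxE : X2 x = ratc _ (ratc _ (chi ka)) * (X2 x1 * X2 x1).
  by rewrite xE !rmorphM /= ratm2C.
pose N := (ka * chi ka)^-1.
have kk0 : ka * chi ka != 0 by rewrite mulf_neq0 ?fmorph_eq0.
have N0 : N != 0 by rewrite invr_eq0.
have x10 : x1 * X2 x1 != 0.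
  rewrite mulf_neq0 ?fmorph_eq0 //; apply: contra_neq x0 => z; by rewrite xE z mul0r mulr0.
have [A0 B0 C0] : [/\ m al != 0, m be != 0 & m ga != 0] by rewrite !fmorph_eq0.
have /negP[] := quadric_nsq (m2 s2 / (2%:R * (x1 * X2 x1))) twoS A0 B0 C0 N0.
apply/eqP.
rewrite -ratm2_quadric -/m2 -gdef -qqb.
have nx : (m2 s2 / (2%:R * q)) * (m2 s2 / (2%:R * qb)) =
   ratc _ (ratc _ (ka * chi ka)) * ((x1 * X2 x1) * (x1 * X2 x1)).
  by rewrite -/x -Xx XxE {1}xE !rmorphM; ring.
have rk0 : ratc (ratf S) (ratc S (ka * chi ka)) != 0 by rewrite !fmorph_eq0.
rewrite /N !fmorphV; apply: (mulIf rk0); rewrite divfK //.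
move: nx; move: (ratc _ (ratc S _)) rk0 => kk kk0' nx.
apply: (mulIf (mulf_neq0 x10 x10)).
rewrite -[RHS]mulrA -nx; move: (m2 s2) (x1 * X2 x1) x10 => t z z0.
exact: norm_identity.
Qed.

(** Let y = u + v sqrt g and a = s1 + s2 sqrt g. If s2 = 0 then u or v vanishes, and the question is
    one over P(Y,Z), which descends to [hd]. Otherwise q = u/v is a root of X^2 - 2 (s1/s2) X + g
    over P(Y,Z), and D times s2/(2q) is a square; it matters whether q lies in P(Y,Z) or only in its
    extension by a constant of [E]. *)
Theorem square_class_preserved a y : a != 0 -> y * y != j' D * hK a.
Proof.
move=> a0; apply/negP => /eqP e.
have [_ rr sp] := jr; have [_ rr' sp'] := jr'.
have [s1 [s2 aE]] := sp a; have [u [v yE]] := sp' y.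
have hg : quadric (i al) (i be) (i ga) = h2 g by rewrite gdef /h2 ratm2_quadric.
have [e1 e2] : u * u + h2 g * (v * v) = D * h2 s1 /\ 2%:R * (u * v) = D * h2 s2.
  apply: (quad_over_uniq jr').
  move: e; rewrite yE aE rmorphD rmorphM !hKj hKr -/h2 => e.
  transitivity ((j' u + j' v * r') * (j' u + j' v * r')).
    by rewrite !rmorphD !rmorphM rmorph_nat -hg -rr'; ring.
  by rewrite e !rmorphM; ring.
have [s20|s20] := eqVneq s2 0.
  have s10 : s1 != 0.
    by apply: contra_neq a0 => s10; rewrite aE s10 s20 !rmorph0 mul0r addr0.
  move: e2; rewrite s20 rmorph0 mulr0 => /eqP; rewrite !mulf_eq0 (negPf twoE2) /=.
  case/orP => /eqP z; move: e1; rewrite z mulr0.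
    rewrite add0r => e1; have /negP[] := rat2_not_square (h2 g * v) (mulf_neq0 s10 g0).
    by rewrite rmorphM mulrA -e1; apply/eqP; ring.
  by rewrite mulr0 addr0 => e1; have /negP[] := rat2_not_square u s10; rewrite -e1.
have uv0 : 2%:R * (u * v) != 0 by rewrite e2 mulf_neq0 ?fmorph_eq0.
have [u0 v0] : u != 0 /\ v != 0.
  by move: uv0; rewrite !mulf_eq0 !negb_or => /andP [_ /andP[]].
have [q qE] : exists q, q = u / v by exists (u / v).
have [rho rhoE] : exists rho, rho = s1 / s2 by exists (s1 / s2).
have q0 : q != 0 by rewrite qE mulf_neq0 ?invr_eq0.
have D0 : D != 0 by rewrite !fmorph_eq0.
have hs2 : h2 s2 != 0 by rewrite fmorph_eq0.
have hrho : 2%:R * q * h2 rho = q * q + h2 g.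
  by rewrite rhoE qE fmorph_div; apply: ratio_identity e1 e2.
have hD : (q - h2 rho) * (q - h2 rho) = h2 (rho * rho - g).
  by rewrite rmorphB rmorphM; apply: square_identity.
have dq : D * (h2 s2 / (2%:R * q)) = v * v.
  by rewrite mulrA -e2 qE; field; rewrite v0 u0 twoE2.
have De0 : rho * rho - g != 0.
  rewrite subr_eq0; have := quadric_nsq rho two al0 be0 ga0 (oner_neq0 P).
  by rewrite -gdef !(rmorph1 (ratc _)) mulr1.
(* The discriminant rho^2 - g is a square over E(Y,Z); hence over P(Y,Z) it is a constant [c] times
   a square, and [c] has a root in [E]. *)
have [|c [c0 [e0 e0E] [pi piE]]] := rat2_square_descent two De0 (oner_neq0 E) (i := i) (v := q - h2 rho).
  by rewrite !(rmorph1 (ratc _)) mul1r -hD.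
rewrite mul1r in e0E.
have : (q - h2 rho) ^+ 2 == (ratc _ (ratc _ e0) * h2 pi) ^+ 2.
  by rewrite expr2 hD piE !rmorphM /= /h2 ratm2C e0E !rmorphM; apply/eqP; ring.
rewrite eqf_sqr => sgn.
have [f [ff qf]] : exists f, f * f = i c /\ q = h2 rho + ratc _ (ratc _ f) * h2 pi.
  case/orP: sgn => /eqP z; [exists e0 | exists (- e0)]; rewrite ?mulrNN; split=> //.
    by rewrite -z; ring.
  by rewrite !rmorphN mulNr -z; ring.
(* If the root [f] of [c] lies in [P], then q lies in P(Y,Z) and the rational case applies;
   otherwise q has a conjugate over P(Y,Z). *)
case: (pselect (exists f0, i f0 = f)) => [[f0 f0E]|nf].
  pose qP := rho + ratc _ (ratc _ f0) * pi.
  have qPE : h2 qP = q by rewrite qf rmorphD rmorphM /= /h2 ratm2C f0E.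
  have qP0 : 2%:R * qP != 0 by rewrite mulf_neq0 // -(fmorph_eq0 h2) qPE.
  have x0 : s2 / (2%:R * qP) != 0 by rewrite mulf_neq0 // invr_eq0.
  case/negP: (rat2_not_square v x0); rewrite fmorph_div rmorphM rmorph_nat qPE.
  exact/eqP.
have gE : rho * rho - ratc _ (ratc _ c) * (pi * pi) = g by rewrite -piE; ring.
have nf' f0 : i f0 != f by apply/negP => /eqP z; apply: nf; exists f0.
case/negP: (conjugate_contradiction v ff nf' gE s20); rewrite -qf.
exact/eqP.
Qed.

End SquareClass.

(** * Ultraproducts of fields *)

Module Ultra.
Import classical_sets filter.

Section Ultraproduct.
Variables (S : Type) (U : set_system S) (UF : UltraFilter U) (F : S -> fieldType).

Definition uprod : Type := forall s, F s.
HB.instance Definition _ := gen_eqMixin uprod.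
HB.instance Definition _ := gen_choiceMixin uprod.

Definition ueq (a b : uprod) : bool := `[< U (fun s => a s = b s) >].

Lemma ueq_refl : reflexive ueq.
Proof. by move=> a; apply/asboolP; apply: filterS filterT. Qed.
Lemma ueq_sym : symmetric ueq.
Proof.
by move=> a b; apply/asboolP/asboolP; apply: filterS => s ->.
Qed.
Lemma ueq_trans : transitive ueq.
Proof.
move=> b a c /asboolP ab /asboolP bc; apply/asboolP; apply: filterS2 ab bc.
by move=> s -> ->.
Qed.
Canonical ueq_equiv := EquivRel ueq ueq_refl ueq_sym ueq_trans.

Definition ultra : Type := {eq_quot ueq}%qT.
HB.instance Definition _ := Choice.on ultra.
Definition upi (a : uprod) : ultra := (\pi_({eq_quot ueq}) a)%qT.
Definition urepr (x : ultra) : uprod := repr (x : {eq_quot ueq}%qT).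

Lemma upiP a b : upi a = upi b <-> U (fun s => a s = b s).
Proof.
by split=> [/eqmodP /= /asboolP //|h]; apply/eqmodP => /=; apply/asboolP.
Qed.
Lemma ureprK x : upi (urepr x) = x. Proof. exact: reprK. Qed.
Lemma urepr_pi a : U (fun s => urepr (upi a) s = a s).
Proof. by apply/upiP; rewrite ureprK. Qed.

Definition uadd x y := upi (fun s => urepr x s + urepr y s).
Definition umul x y := upi (fun s => urepr x s * urepr y s).
Definition uopp x := upi (fun s => - urepr x s).
Definition uinv x := upi (fun s => (urepr x s)^-1).

Lemma uaddE a b : uadd (upi a) (upi b) = upi (fun s => a s + b s).
Proof. by apply/upiP; apply: filterS2 (urepr_pi a) (urepr_pi b) => s -> ->. Qed.
Lemma umulE a b : umul (upi a) (upi b) = upi (fun s => a s * b s).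
Proof. by apply/upiP; apply: filterS2 (urepr_pi a) (urepr_pi b) => s -> ->. Qed.
Lemma uoppE a : uopp (upi a) = upi (fun s => - a s).
Proof. by apply/upiP; apply: filterS (urepr_pi a) => s ->. Qed.
Lemma uinvE a : uinv (upi a) = upi (fun s => (a s)^-1).
Proof. by apply/upiP; apply: filterS (urepr_pi a) => s ->. Qed.
Lemma upi_ext a b : (forall s, a s = b s) -> upi a = upi b.
Proof. by move=> h; apply/upiP; apply: filterS filterT => s _. Qed.

Lemma uaddA : associative uadd.
Proof.
move=> x y z; rewrite -(ureprK x) -(ureprK y) -(ureprK z) !uaddE.
by apply: upi_ext => s; rewrite addrA.
Qed.
Lemma uaddC : commutative uadd.
Proof. by move=> x y; apply: upi_ext => s; rewrite addrC. Qed.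
Lemma uadd0 : left_id (upi (fun _ => 0)) uadd.
Proof. by move=> x; rewrite -(ureprK x) uaddE; apply: upi_ext => s; rewrite add0r. Qed.
Lemma uaddN : left_inverse (upi (fun _ => 0)) uopp uadd.
Proof. by move=> x; rewrite -(ureprK x) uoppE uaddE; apply: upi_ext => s; rewrite addNr. Qed.
HB.instance Definition _ := GRing.isZmodule.Build ultra uaddA uaddC uadd0 uaddN.

Lemma umulA : associative umul.
Proof.
move=> x y z; rewrite -(ureprK x) -(ureprK y) -(ureprK z) !umulE.
by apply: upi_ext => s; rewrite mulrA.
Qed.
Lemma umulC : commutative umul.
Proof. by move=> x y; apply: upi_ext => s; rewrite mulrC. Qed.
Lemma umul1 : left_id (upi (fun _ => 1)) umul.
Proof. by move=> x; rewrite -(ureprK x) umulE; apply: upi_ext => s; rewrite mul1r. Qed.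
Lemma umulD : left_distributive umul uadd.
Proof.
move=> x y z; rewrite -(ureprK x) -(ureprK y) -(ureprK z) !(umulE, uaddE).
by apply: upi_ext => s; rewrite mulrDl.
Qed.
Lemma u1neq0 : upi (fun _ => 1) != 0.
Proof.
apply/eqP => /upiP h; apply: (@filter_not_empty _ U _).
by apply: filterS h => s /eqP; rewrite oner_eq0.
Qed.
HB.instance Definition _ := GRing.Zmodule_isComNzRing.Build ultra umulA umulC umul1 umulD u1neq0.

Lemma umulV x : x != 0 -> uinv x * x = 1.
Proof.
rewrite -(ureprK x); move: (urepr x) => a /eqP a0; rewrite uinvE.
rewrite [LHS]umulE; apply/upiP.
have [h|h] := in_ultra_setVsetC (fun s => a s = 0) UF; first by case: a0; apply/upiP.
by apply: filterS h => s /eqP s0; rewrite mulVf.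
Qed.
Lemma uinv0 : uinv 0 = 0.
Proof. by rewrite [LHS]uinvE; apply: upi_ext => s; rewrite invr0. Qed.
HB.instance Definition _ := GRing.ComNzRing_isField.Build ultra umulV uinv0.

End Ultraproduct.

(** All that is used of an ultraproduct: representatives exist, equality holds on a set of the
    ultrafilter, operations are coordinatewise. The quotient stays hidden. *)
Definition ultra_proj (S : Type) (U : set_system S) (F : S -> fieldType) (O : fieldType)
    (pi : (forall s, F s) -> O) :=
  [/\ forall x, exists a, x = pi a,
      forall a b, pi a = pi b <-> U (fun s => a s = b s),
      forall a b, pi a + pi b = pi (fun s => a s + b s),
      forall a b, pi a * pi b = pi (fun s => a s * b s) &
      pi (fun _ => 1) = 1].

Lemma ultraproduct (S : Type) (U : set_system S) (F : S -> fieldType) : UltraFilter U ->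
  exists (O : fieldType) (pi : (forall s, F s) -> O), ultra_proj U pi.
Proof.
move=> UF; exists (ultra UF F), (@upi S U UF F); split.
- by move=> x; exists (urepr x); rewrite ureprK.
- exact: upiP.
- exact: uaddE.
- exact: umulE.
- by [].
Qed.

Section UltraProj.
Variables (S : Type) (U : set_system S) (UF : UltraFilter U) (F : S -> fieldType) (O : fieldType).
Variable pi : (forall s, F s) -> O.
Hypothesis h : ultra_proj U pi.

Lemma upi0 : pi (fun _ => 0) = 0.
Proof.
case: h => _ hE hD _ _; apply: (addrI (pi (fun _ => 0))); rewrite addr0 hD.
by apply/hE; apply: filterS filterT => s _; rewrite addr0.
Qed.

Lemma upi_sum (I : Type) (r : seq I) (a : I -> forall s, F s) :
  \sum_(i <- r) pi (a i) = pi (fun s => \sum_(i <- r) a i s).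
Proof.
case: (h) => _ hE hD _ _; elim: r => [|i r IH].
  by rewrite big_nil -upi0; apply/hE; apply: filterS filterT => s _; rewrite big_nil.
rewrite big_cons IH hD; apply/hE; apply: filterS filterT => s _; by rewrite big_cons.
Qed.

Lemma upi_eq0 a : pi a = 0 -> U (fun s => a s = 0).
Proof. by case: h => _ hE _ _ _; rewrite -upi0 => /hE. Qed.

Lemma upi_neq0 a : pi a != 0 -> U (fun s => a s != 0).
Proof.
move=> a0; have [h0|h0] := in_ultra_setVsetC (fun s => a s = 0) UF.
  by case: h => _ hE _ _ _; case/eqP: a0; rewrite -upi0; apply/hE.
by apply: filterS h0 => s /eqP.
Qed.

Lemma filter_forallT (T : finType) (Q : T -> S -> Prop) :
  (forall t, U (Q t)) -> U (fun s => forall t, Q t s).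
Proof.
move=> hQ; have : U (fun s => forall t, t \in enum T -> Q t s).
  elim: (enum T) => [|t r IH]; first by apply: filterS filterT.
  apply: filterS2 (hQ t) IH => s h1 h2 u; rewrite inE => /orP [/eqP ->|] //.
  exact: h2.
by apply: filterS => s hs t; apply: hs; rewrite mem_enum.
Qed.

Lemma upi_fin (T : Type) (x : T -> O) : exists a : T -> forall s, F s, forall t, x t = pi (a t).
Proof. by case: h => hs _ _ _ _; have /choice [a ha] t := hs (x t); exists a. Qed.

Lemma upi_morph (P : fieldType) (sg : forall s, {rmorphism P -> F s}) :
  exists sO : {rmorphism P -> O}, forall x, sO x = pi (fun s => sg s x).
Proof.
case: (h) => _ hE hD hM h1; pose f x := pi (fun s => sg s x).
have fB : zmod_morphism f.
  move=> x y; apply/eqP; rewrite eq_sym subr_eq; apply/eqP; rewrite hD; apply/hE.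
  by apply: filterS filterT => s _; rewrite rmorphB subrK.
have fM : monoid_morphism f.
  split=> [|x y]; rewrite -?h1 ?hM; apply/hE; apply: filterS filterT => s _.
    by rewrite rmorph1.
  by rewrite rmorphM.
pose fA := GRing.isZmodMorphism.Build _ _ f fB.
pose fMM := GRing.isMonoidMorphism.Build _ _ f fM.
by exists (HB.pack f fA fMM : {rmorphism P -> O}).
Qed.
End UltraProj.

(** In finite dimension this is the property of being division, in a form that is the unsolvability
    of polynomial systems. *)
Definition nzd (k : fieldType) (I : finType) (A : salg k I) :=
  forall x y : vec k I, amul A x y = 0 -> x = 0 \/ y = 0.

Definition is_rep (k : fieldType) (I : finType) (A : salg k I) (e : vec k I) (n : nat)
    (rho : I -> 'M[k]_n) :=
  (forall i j, rho i *m rho j = \sum_l sc A i j l *: rho l) /\ \sum_i e i *: rho i = 1%:M.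

(** * The invariant of the tower and its transfer *)

Section Invariant.
Variable F : fieldType.
Variable DD : forall T : finType, salg F T -> Prop.
Variable KK : forall T : finType, salg F T -> vec F T -> Prop.
Variable XX : forall T : finType, salg F T -> vec F T -> nat -> Prop.

(* Everything that the construction has to preserve, as non-solvability of
   finite systems of equations with coefficients in F. *)
Definition inv (P : fieldType) (s : {rmorphism F -> P}) :=
  [/\ forall (T : finType) (D : salg F T), DD D -> nzd (base s D),
      forall (T : finType) (K : salg F T) (d : vec F T), KK K d ->
        forall (a : P) (y : vec P T), a != 0 -> amul (base s K) y y <> vscale a (bmap s d) &
      forall (T : finType) (X : salg F T) (e : vec F T) (n : nat), XX X e n ->
        forall rho : T -> 'M[P]_n, ~ is_rep (base s X) (bmap s e) rho].

(** A forbidden solution over the smaller field maps to one over the larger; its nonvanishing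
    conditions survive since field morphisms are injective. *)
Lemma inv_sub (P Q : fieldType) (s : {rmorphism F -> P}) (t : {rmorphism F -> Q})
  (h : {rmorphism P -> Q}) : (forall x, h (s x) = t x) -> inv t -> inv s.
Proof.
move=> hst [h1 h2 h3].
have bE (T : finType) (A : salg F T) : base h (base s A) = base t A.
  by congr SAlg; apply/funext => i; apply/funext => j; apply/funext => l; rewrite /= hst.
have mE (T : finType) (x : vec F T) : bmap h (bmap s x) = bmap t x.
  by apply/ffunP => i; rewrite !ffunE hst.
split=> [T D DDD x y xy|T K d hK a y a0 yy|T X e n hX rho [hr he]].
- have := congr1 (bmap h) xy; rewrite bmap_amul bE.
  have b0 : bmap h (0 : vec P T) = 0 by apply/ffunP => i; rewrite !ffunE rmorph0.
  by rewrite b0 => /(h1 _ _ DDD) [] e; [left|right]; apply: (bmap_inj (s := h)); rewrite b0.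
- have a0' : h a != 0 by rewrite fmorph_eq0.
  apply: (h2 _ _ _ hK _ (bmap h y) a0'); rewrite -bE -bmap_amul yy -mE.
  by apply/ffunP => i; rewrite !ffunE rmorphM.
apply: (h3 _ _ _ _ hX (fun i => map_mx h (rho i))); split=> [i j|].
  rewrite -map_mxM hr raddf_sum; apply: eq_bigr => l _; by rewrite /= map_mxZ hst.
rewrite -(map_mx1 h) -he raddf_sum; apply: eq_bigr => l _.
by rewrite /= map_mxZ !ffunE hst.
Qed.

(** The needed case of the theorem of Los: the systems are finite, so a solution in the ultraproduct
    has representatives that solve the system on a set of the ultrafilter, and any index in that set
    contradicts [hinv]. *)
Lemma inv_ultra (S : Type) (U : set_system S) (UF : UltraFilter U) (G : S -> fieldType)
  (sg : forall s, {rmorphism F -> G s}) (O : fieldType) (pi : (forall s, G s) -> O)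
  (sO : {rmorphism F -> O}) : ultra_proj U pi -> (forall x, sO x = pi (fun s => sg s x)) ->
  (forall s, inv (sg s)) -> inv sO.
Proof.
move=> hpi hsO hinv; case: (hpi) => hs hE hD hM h1.
have nonempty (Q : S -> Prop) : U Q -> exists s, Q s.
  by move=> hQ; apply: (@filter_ex _ U _).
split=> [T D DDD x y xy|T K d hK a y a0 yy|T X e n hX rho [hr he]].
- have [a ha] := upi_fin hpi x; have [b hb] := upi_fin hpi y.
  case: (pselect (x = 0 \/ y = 0)) => // nxy; exfalso.
  have [[i xi] [j yj]] : (exists i, x i != 0) /\ (exists j, y j != 0).
    split; apply/not_existsP => hh; apply: nxy; [left|right]; apply/ffunP => i;
      by rewrite ffunE; apply/eqP/negPn/negP/hh.
  rewrite ha in xi; rewrite hb in yj.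
  have hl l : U (fun s => amul (base (sg s) D) [ffun i => a i s] [ffun i => b i s] l = 0).
    have /(upi_eq0 UF hpi) : pi (fun s => \sum_i \sum_j a i s * b j s * sg s (sc D i j l)) = 0.
      move/ffunP/(_ l): xy; rewrite !ffunE => e0; rewrite -[RHS]e0 -(upi_sum UF hpi).
      apply: eq_bigr => p _; rewrite -(upi_sum UF hpi); apply: eq_bigr => q _.
      by rewrite ha hb hM /= hsO hM.
    apply: filterS => s <-; rewrite ffunE; apply: eq_bigr => p _; apply: eq_bigr => q _.
    by rewrite !ffunE.
  have [s [[hsl ai] bj]] := nonempty _ (filterI (filterI (filter_forallT UF hl)
      (upi_neq0 UF hpi xi)) (upi_neq0 UF hpi yj)).
  have [hnz _ _] := hinv s.
  have /(hnz _ _ DDD) [] : amul (base (sg s) D) [ffun i => a i s] [ffun i => b i s] = 0.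
    by apply/ffunP => l; rewrite hsl ffunE.
    by move/ffunP/(_ i); rewrite !ffunE; apply/eqP.
  by move/ffunP/(_ j); rewrite !ffunE; apply/eqP.
- have [b hb] := upi_fin hpi y; have [c hc] := hs a; rewrite hc in a0.
  have hl l : U (fun s => amul (base (sg s) K) [ffun i => b i s] [ffun i => b i s] l =
      vscale (c s) (bmap (sg s) d) l).
    have /hE : pi (fun s => \sum_i \sum_j b i s * b j s * sg s (sc K i j l)) =
       pi (fun s => c s * sg s (d l)).
      move/ffunP/(_ l): yy; rewrite !ffunE hc hsO hM => <-.
      rewrite -(upi_sum UF hpi); apply: eq_bigr => p _; rewrite -(upi_sum UF hpi).
      by apply: eq_bigr => q _; rewrite !hb hM /= hsO hM.
    apply: filterS => s; rewrite !ffunE => <-; apply: eq_bigr => p _; apply: eq_bigr => q _.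
    by rewrite !ffunE.
  have [s [hsl cs]] := nonempty _ (filterI (filter_forallT UF hl) (upi_neq0 UF hpi a0)).
  have [_ hk _] := hinv s; apply: (hk _ _ _ hK _ [ffun i => b i s] cs).
  by apply/ffunP => l; rewrite hsl.
have [a ha] := upi_fin hpi (fun x : T * ('I_n * 'I_n) => rho x.1 x.2.1 x.2.2).
pose R s i : 'M[G s]_n := \matrix_(p, q) a (i, (p, q)) s.
have hrep (x : (T * T) * ('I_n * 'I_n)) : U (fun s => (R s x.1.1 *m R s x.1.2) x.2.1 x.2.2 =
   (\sum_l sg s (sc X x.1.1 x.1.2 l) *: R s l) x.2.1 x.2.2).
  case: x => [[i j] [p q]] /=.
  have /hE : pi (fun s => \sum_u a (i, (p, u)) s * a (j, (u, q)) s) =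
     pi (fun s => \sum_l sg s (sc X i j l) * a (l, (p, q)) s).
    rewrite -!(upi_sum UF hpi); move/matrixP/(_ p q): (hr i j); rewrite mxE summxE.
    under eq_bigr => u _ do rewrite (ha (i, (p, u))) (ha (j, (u, q))) hM.
    move=> ->; apply: eq_bigr => l _.
    by rewrite mxE (ha (l, (p, q))) /= hsO hM.
  apply: filterS => s E; rewrite mxE summxE; transitivity (\sum_u a (i, (p, u)) s * a (j, (u, q)) s).
    by apply: eq_bigr => u _; rewrite !mxE.
  by rewrite E; apply: eq_bigr => l _; rewrite !mxE.
have hunit (x : 'I_n * 'I_n) : U (fun s => (\sum_i sg s (e i) *: R s i) x.1 x.2 = (1%:M : 'M[G s]_n) x.1 x.2).
  case: x => [p q] /=.
  have /hE : pi (fun s => \sum_i sg s (e i) * a (i, (p, q)) s) = pi (fun s => (p == q)%:R).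
    rewrite -(upi_sum UF hpi); move/matrixP/(_ p q): he; rewrite summxE mxE => E.
    transitivity ((p == q)%:R : O); last first.
      by case: (p == q); rewrite ?h1 ?(upi0 UF hpi).
    rewrite -E; apply: eq_bigr => l _.
    by rewrite mxE (ha (l, (p, q))) /= ffunE hsO hM.
  apply: filterS => s E; rewrite summxE mxE -E; apply: eq_bigr => l _; by rewrite !mxE.
have [s [hs1 hs2]] := nonempty _ (filterI (filter_forallT UF hrep) (filter_forallT UF hunit)).
have [_ _ hx] := hinv s; apply: (hx _ _ _ _ hX (R s)); split=> [i j|].
  by apply/matrixP => p q; have := hs1 ((i, j), (p, q)).
apply/matrixP => p q; rewrite -(hs2 (p, q)) !summxE; apply: eq_bigr => l _.
by rewrite !mxE ffunE.
Qed.

End Invariant.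

End Ultra.
Import Ultra.

(** * Subfields of an ultraproduct *)

Section Subfield.
Variables (O : fieldType) (Q : O -> Prop).
Hypotheses (Q1 : Q 1) (QB : forall x y, Q x -> Q y -> Q (x - y))
  (QD : forall x y, Q x -> Q y -> Q (x / y)).

Definition subf_pred : {pred O} := fun x => `[< Q x >].
Lemma subf_closed : divring_closed subf_pred.
Proof.
split; first exact/asboolP.
  by move=> x y /asboolP hx /asboolP hy; apply/asboolP; apply: QB.
by move=> x y /asboolP hx /asboolP hy; apply/asboolP; apply: QD.
Qed.
HB.instance Definition _ := GRing.isDivringClosed.Build O subf_pred subf_closed.
Record subf := SubF { subf_val :> O; _ : subf_val \in subf_pred }.
HB.instance Definition _ := [isSub of subf for subf_val].
HB.instance Definition _ := [Choice of subf by <:].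
HB.instance Definition _ := [SubChoice_isSubComUnitRing of subf by <:].
HB.instance Definition _ := [SubComUnitRing_isSubIntegralDomain of subf by <:].
HB.instance Definition _ := [SubIntegralDomain_isSubField of subf by <:].

Lemma subfield_exists : exists (L : fieldType) (i : {rmorphism L -> O}),
  forall x, Q x <-> exists y, x = i y.
Proof.
exists subf, (val : {rmorphism subf -> O}) => x; split=> [/asboolP hx|[y ->]].
  by exists (SubF hx).
by apply/asboolP; exact: (valP y).
Qed.
End Subfield.

Lemma morph_factor (P L O : fieldType) (i : {rmorphism L -> O}) (s : {rmorphism P -> O}) :
  (forall x, exists y, s x = i y) -> exists t : {rmorphism P -> L}, forall x, i (t x) = s x.
Proof.
move=> /choice [f hf]; have inj := fmorph_inj i.
have fB : zmod_morphism f by move=> x y; apply: inj; rewrite rmorphB -!hf rmorphB.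
have fM : monoid_morphism f.
  by split=> [|x y]; apply: inj; rewrite ?rmorphM ?rmorph1 -!hf ?rmorphM ?rmorph1.
pose fA := GRing.isZmodMorphism.Build _ _ f fB.
pose fMM := GRing.isMonoidMorphism.Build _ _ f fM.
by exists (HB.pack f fA fMM : {rmorphism P -> L}) => x; rewrite -hf.
Qed.

(** Nothing is claimed below [n], where the values are set to 0; the induction shifts the whole
    tower so that [x] sits at stage 0. *)
Lemma coherent_extension (P : nat -> fieldType) (h : forall m, {rmorphism P m -> P m.+1}) n (x : P n) :
  exists b : forall m, P m, b n = x /\ forall m, (n <= m)%N -> b m.+1 = h m (b m).
Proof.
elim: n P h x => [|n IH] P h x.
  by exists (nat_rect (fun m => P m : Type) x (fun m y => h m y)).
have [b [bn bh]] := IH (fun m => P m.+1) (fun m => h m.+1) x.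
exists (nat_rect (fun m => P m : Type) (0 : P 0%N) (fun m _ => b m)); split=> // -[|m] //= nm; exact: bh.
Qed.

(** The scalars with a square root in [A]; over the final field these sets decide which quadratic
    extensions embed. *)
Definition sqin (k : fieldType) (I : finType) (A : salg k I) (e : vec k I) (a : k) :=
  exists x, amul A x x = vscale a e.

(** * Towers of fields *)

Module Tower.
Import classical_sets filter.

Section Tower.
Variables (F : fieldType) (Inv : forall P : fieldType, {rmorphism F -> P} -> Prop).
Hypothesis Inv_ultra : forall (S : Type) (U : set_system S) (UF : UltraFilter U)
  (G : S -> fieldType) (sg : forall s, {rmorphism F -> G s}) (O : fieldType)
  (pi : (forall s, G s) -> O) (sO : {rmorphism F -> O}), ultra_proj U pi ->
  (forall x, sO x = pi (fun s => sg s x)) -> (forall s, Inv (sg s)) -> Inv sO.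
Hypothesis Inv_sub : forall (P Q : fieldType) (s : {rmorphism F -> P}) (t : {rmorphism F -> Q})
  (h : {rmorphism P -> Q}), (forall x, h (s x) = t x) -> Inv t -> Inv s.
Variables (I J : finType) (A : salg F I) (B : salg F J) (eA : vec F I) (eB : vec F J).

Definition QA (P : fieldType) (s : {rmorphism F -> P}) a := sqin (base s A) (bmap s eA) a.
Definition QB (P : fieldType) (s : {rmorphism F -> P}) a := sqin (base s B) (bmap s eB) a.
Definition Qor (P : fieldType) (s : {rmorphism F -> P}) a := QA s a \/ QB s a.
Definition Qand (P : fieldType) (s : {rmorphism F -> P}) a := QA s a /\ QB s a.

Hypothesis step : forall (P : fieldType) (s : {rmorphism F -> P}), Inv s -> forall a, Qor s a ->
  exists (P' : fieldType) (h : {rmorphism P -> P'}), Inv (h \o s)%FUN /\ Qand (h \o s)%FUN (h a).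

Lemma sqin_map (P Q : fieldType) (s : {rmorphism F -> P}) (t : {rmorphism F -> Q})
  (h : {rmorphism P -> Q}) (T : finType) (D : salg F T) (e : vec F T) a :
  (forall x, h (s x) = t x) -> sqin (base s D) (bmap s e) a -> sqin (base t D) (bmap t e) (h a).
Proof.
move=> hst [x xx]; exists (bmap h x); have := congr1 (bmap h) xx; rewrite bmap_amul => E.
apply/ffunP => l; move/ffunP/(_ l): E; rewrite !ffunE rmorphM hst => <-.
apply: eq_bigr => p _; apply: eq_bigr => q _; by rewrite /= hst.
Qed.

Lemma Qand_map (P Q : fieldType) (s : {rmorphism F -> P}) (t : {rmorphism F -> Q})
  (h : {rmorphism P -> Q}) a : (forall x, h (s x) = t x) -> Qand s a -> Qand t (h a).
Proof. by move=> hst [ha hb]; split; apply: (sqin_map hst). Qed.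
Lemma Qor_map (P Q : fieldType) (s : {rmorphism F -> P}) (t : {rmorphism F -> Q})
  (h : {rmorphism P -> Q}) a : (forall x, h (s x) = t x) -> Qor s a -> Qor t (h a).
Proof. by move=> hst [ha|hb]; [left|right]; apply: (sqin_map hst). Qed.

(** Finitely many scalars are treated one after another; what was gained for earlier ones persists
    by [Qand_map]. *)
Lemma step_list (P : fieldType) (s : {rmorphism F -> P}) (r : seq P) : Inv s ->
  exists (P' : fieldType) (h : {rmorphism P -> P'}),
    Inv (h \o s)%FUN /\ forall a, a \in r -> Qor s a -> Qand (h \o s)%FUN (h a).
Proof.
move=> hs; elim: r => [|a r [P1 [h1 [i1 q1]]]].
  exists P, idfun; split=> //; exact: (@Inv_sub _ _ _ s idfun).
case: (pselect (Qor s a)) => [qa|nqa]; last first.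
  exists P1, h1; split=> // b; rewrite inE => /orP [/eqP ->|] // hb; exact: q1.
have [|P2 [h2 [i2 q2]]] := step i1 (a := h1 a).
  exact: (@Qor_map _ _ s (h1 \o s)%FUN h1).
exists P2, (h2 \o h1)%FUN; split.
  exact: (@Inv_sub _ _ _ (h2 \o (h1 \o s))%FUN idfun).
move=> b; rewrite inE => /orP [/eqP ->|br] hb.
  exact: (@Qand_map _ _ (h2 \o (h1 \o s))%FUN _ idfun).
exact: (@Qand_map _ _ (h1 \o s)%FUN _ h2 _ _ (q1 b br hb)).
Qed.

Lemma sqin_ultra (S : Type) (U : set_system S) (UF : UltraFilter U)
  (G : S -> fieldType) (sg : forall s, {rmorphism F -> G s}) (O : fieldType)
  (pi : (forall s, G s) -> O) (sO : {rmorphism F -> O}) (T : finType) (D : salg F T)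
  (e : vec F T) (a : forall s, G s) : ultra_proj U pi ->
  (forall x, sO x = pi (fun s => sg s x)) ->
  U (fun s => sqin (base (sg s) D) (bmap (sg s) e) (a s)) ->
  sqin (base sO D) (bmap sO e) (pi a).
Proof.
move=> hpi hsO hU; case: (hpi) => _ hE _ hM _.
have [x hx] : exists x : forall s, vec (G s) T, forall s,
    sqin (base (sg s) D) (bmap (sg s) e) (a s) ->
    amul (base (sg s) D) (x s) (x s) = vscale (a s) (bmap (sg s) e).
  have hs s : exists y : vec (G s) T, sqin (base (sg s) D) (bmap (sg s) e) (a s) ->
    amul (base (sg s) D) y y = vscale (a s) (bmap (sg s) e).
    by case: (pselect (sqin (base (sg s) D) (bmap (sg s) e) (a s))) => [[y yy]|n]; [exists y|exists 0].
  by exists (fun s => sval (cid (hs s))) => s; exact: (svalP (cid (hs s))).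
exists [ffun i => pi (fun s => x s i)]; apply/ffunP => l.
rewrite !ffunE hsO hM; transitivity (pi (fun s => \sum_i \sum_j x s i * x s j * sg s (sc D i j l))).
  rewrite -(upi_sum UF hpi); apply: eq_bigr => p _; rewrite -(upi_sum UF hpi).
  by apply: eq_bigr => q _; rewrite !ffunE /= hsO !hM.
apply/hE; apply: filterS hU => s /hx /ffunP /(_ l); by rewrite !ffunE.
Qed.

(** Compactness replaces a transfinite iteration: the fields are indexed by finite lists of scalars,
    and for a suitable ultrafilter every scalar belongs to almost every list. *)
Lemma step_all (P : fieldType) (s : {rmorphism F -> P}) : Inv s ->
  exists (P' : fieldType) (h : {rmorphism P -> P'}),
    Inv (h \o s)%FUN /\ forall a, Qor s a -> Qand (h \o s)%FUN (h a).
Proof.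
move=> hs; pose G0 r := step_list r hs.
pose G (r : seq P) : fieldType := sval (cid (G0 r)).
pose H0 r := svalP (cid (G0 r)).
pose h (r : seq P) : {rmorphism P -> G r} := sval (cid (H0 r)).
have hI r : Inv (h r \o s)%FUN by have [] := svalP (cid (H0 r)).
have hQ r a : a \in r -> Qor s a -> Qand (h r \o s)%FUN (h r a).
  by have [_ hq] := svalP (cid (H0 r)); apply: hq.
(* The filter generated by the cones of lists containing a given list; two cones meet in the cone
   over the concatenation. *)
pose F0 : set_system (seq P) := fun V => exists t : seq P, forall r, {subset t <= r} -> V r.
have F0f : ProperFilter F0.
  apply: Build_ProperFilter_ex => [V [t ht]|]; first by exists t; apply: ht.
  split.
  - by exists [::].
  - move=> V W [t ht] [t' ht']; exists (t ++ t') => r hr; split; [apply: ht|apply: ht'];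
      by move=> x xt; apply: hr; rewrite mem_cat xt ?orbT.
  - by move=> V W VW [t ht]; exists t => r /ht /VW.
have [U [UF FU]] := ultraFilterLemma F0f.
have [O [pi hpi]] := ultraproduct G UF.
have [sO hsO] := upi_morph UF hpi h.
exists O, sO; split.
  by apply: (@Inv_ultra _ U UF G (fun r => (h r \o s)%FUN) O pi) => // x; rewrite -hsO.
move=> a qa; have Ua : U (fun r => a \in r).
  by apply: FU; exists [:: a] => r; apply; rewrite mem_head.
split; rewrite hsO.
  apply: (@sqin_ultra _ U UF G (fun r => (h r \o s)%FUN)) => // [x|]; first by rewrite -hsO.
  by apply: filterS Ua => r /hQ /(_ qa) [].
apply: (@sqin_ultra _ U UF G (fun r => (h r \o s)%FUN)) => // [x|]; first by rewrite -hsO.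
by apply: filterS Ua => r /hQ /(_ qa) [].
Qed.

Let stage := {P : fieldType & {s : {rmorphism F -> P} | Inv s}}.
Let nextP (x : stage) : fieldType := sval (cid (step_all (svalP (projT2 x)))).
Let next_h0 (x : stage) := svalP (cid (step_all (svalP (projT2 x)))).
Let nexth (x : stage) : {rmorphism projT1 x -> nextP x} := sval (cid (next_h0 x)).
Let next_prop (x : stage) := svalP (cid (next_h0 x)).
Let next (x : stage) : stage := existT _ (nextP x) (exist _ _ (next_prop x).1).

(** The union of the tower is realized inside the ultraproduct of its stages, by the sequences that
    eventually follow the maps [h]. A scalar of [L] with a root in one algebra has it at some late
    stage, and the next stage supplies the root in the other. *)
Theorem square_closure : Inv (idfun : {rmorphism F -> F}) ->
  exists (L : fieldType) (s : {rmorphism F -> L}), Inv s /\ forall a, QA s a <-> QB s a.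
Proof.
move=> i0; pose st n : stage := iter n next (existT _ F (exist _ _ i0)).
pose P n : fieldType := projT1 (st n).
pose s n : {rmorphism F -> P n} := sval (projT2 (st n)).
have sI n : Inv (s n) := svalP (projT2 (st n)).
pose h n : {rmorphism P n -> P n.+1} := nexth (st n).
have hs n x : s n.+1 x = h n (s n x) by [].
have hQ n a : Qor (s n) a -> Qand (s n.+1) (h n a).
  by move=> /(next_prop (st n)).2.
have [U [UF FU]] := ultraFilterLemma eventually_filter.
have [O [pi hpi]] := ultraproduct P UF; case: (hpi) => hsur hE hD hM h1.
pose coh (a : forall n, P n) := exists N, forall m, (N <= m)%N -> a m.+1 = h m (a m).
pose Q (x : O) := exists a, x = pi a /\ coh a.
have late (V : nat -> Prop) N : (forall m, (N <= m)%N -> V m) -> U V.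
  by move=> hV; apply: FU; exists N.
have pieq a b : (forall m, a m = b m) -> pi a = pi b.
  by move=> e; apply/hE; apply: filterS filterT => m _.
have piN a : - pi a = pi (fun m => - a m).
  apply: (addrI (pi a)); rewrite subrr hD -(upi0 UF hpi); apply: pieq => m.
  by rewrite subrr.
have pi0 a : pi a = 0 <-> U (fun m => a m = 0).
  by rewrite -(upi0 UF hpi); exact: hE.
have piV a : (pi a)^-1 = pi (fun m => (a m)^-1).
  have [a0|a0] := eqVneq (pi a) 0.
    rewrite a0 invr0; apply/esym/pi0; move/pi0: a0; apply: filterS => m ->.
    by rewrite invr0.
  apply: (mulfI a0); rewrite mulfV // hM -h1; apply/esym/hE.
  by apply: filterS (upi_neq0 UF hpi a0) => m am; rewrite mulfV.
have Q1 : Q 1 by exists (fun=> 1); split=> //; exists 0%N => m _; rewrite rmorph1.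
have QsubB x y : Q x -> Q y -> Q (x - y).
  move=> [a [-> [N ha]]] [b [-> [M hb]]]; exists (fun m => a m - b m); split; first by rewrite piN hD.
  by exists (maxn N M) => m; rewrite geq_max => /andP [n1 n2]; rewrite ha // hb // rmorphB.
have QD x y : Q x -> Q y -> Q (x / y).
  move=> [a [-> [N ha]]] [b [-> [M hb]]]; exists (fun m => a m / b m); split; first by rewrite piV hM.
  by exists (maxn N M) => m; rewrite geq_max => /andP [n1 n2]; rewrite ha // hb // fmorph_div.
have [L [i hi]] := subfield_exists Q1 QsubB QD.
have [sO hsO] := upi_morph UF hpi s.
have [|t ht] := @morph_factor F L O i sO.
  by move=> x; apply/hi; exists (fun m => s m x); split; [exact: hsO|exists 0%N => m _; rewrite hs].
exists L, t; split.
  apply: (@Inv_sub _ _ _ sO i ht); exact: (@Inv_ultra _ U UF P s O pi).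
(* A vector over stage [n], followed up the tower, becomes a vector over [L]. *)
have lift (T : finType) n (x : vec (P n) T) : exists y : vec L T, exists b : forall m, vec (P m) T,
    [/\ b n = x, forall u, i (y u) = pi (fun m => b m u) &
     forall m, (n <= m)%N -> b m.+1 = bmap (h m) (b m)].
  have /choice [c hc] u := coherent_extension h (x u).
  have /choice [y hy] u : exists z : L, i z = pi (c u).
    have /hi [z zE] : Q (pi (c u)) by exists (c u); split=> //; exists n; exact: (hc u).2.
    by exists z.
  exists [ffun u => y u], (fun m => [ffun u => c u m]); split=> [|u|m nm].
  - by apply/ffunP => u; rewrite ffunE (hc u).1.
  - by rewrite ffunE hy; apply: pieq => m; rewrite ffunE.
  by apply/ffunP => u; rewrite !ffunE (hc u).2.
have bring (a : L) n c : i a = pi c -> (forall m, (n <= m)%N -> c m.+1 = h m (c m)) ->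
   forall (T : finType) (D : salg F T) (e : vec F T),
   sqin (base (s n) D) (bmap (s n) e) (c n) -> sqin (base t D) (bmap t e) a.
  move=> ac hc T D e [x xx]; have [y [b [bn yb hb]]] := lift T n x.
  have E m : (n <= m)%N -> amul (base (s m) D) (b m) (b m) = vscale (c m) (bmap (s m) e).
    elim: m => [|m IH].
      by rewrite leqn0 => /eqP n0; subst n; rewrite bn.
    rewrite leq_eqVlt => /orP [/eqP nm|]; first by subst n; rewrite bn.
    rewrite ltnS => nm; have := congr1 (bmap (h m)) (IH nm).
    rewrite bmap_amul -hb // => E1.
    have -> : base (s m.+1) D = base (h m) (base (s m) D) by [].
    by rewrite E1; apply/ffunP => l; rewrite !ffunE rmorphM hc // hs.
  exists y; apply/ffunP => l; apply: (fmorph_inj i).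
  rewrite !ffunE rmorphM /= ht hsO ac hM.
  transitivity (pi (fun m => \sum_p \sum_q b m p * b m q * s m (sc D p q l))).
    rewrite -(upi_sum UF hpi) rmorph_sum; apply: eq_bigr => p _.
    rewrite -(upi_sum UF hpi) rmorph_sum; apply: eq_bigr => q _.
    by rewrite !rmorphM /= ht hsO !yb !hM.
  apply/hE; apply: (@late _ n) => m /E /ffunP /(_ l).
  by rewrite !ffunE.
have key a : Qor t a -> Qand t a.
  move=> qa; have /hi [c [ac [N hc]]] : exists y, i a = i y by exists a.
  have [n [Nn qn]] : exists n, (N <= n)%N /\ Qor (s n) (c n).
    (* Any representatives of the root will do: the equation holds at almost every stage, hence at
       one past [N]. *)
    have descend (T : finType) (D : salg F T) (e : vec F T) : sqin (base t D) (bmap t e) a ->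
       exists n, (N <= n)%N /\ sqin (base (s n) D) (bmap (s n) e) (c n).
      move=> [y yy]; have [b hb] := upi_fin hpi (fun u => i (y u)).
      have hl l : U (fun m => \sum_p \sum_q b p m * b q m * s m (sc D p q l) = c m * s m (e l)).
        apply/hE; rewrite -hM -ac -hsO -ht; move/ffunP/(_ l): yy; rewrite !ffunE -rmorphM => <-.
        rewrite rmorph_sum -(upi_sum UF hpi); apply: eq_bigr => p _.
        rewrite rmorph_sum -(upi_sum UF hpi); apply: eq_bigr => q _.
        by rewrite !rmorphM /= ht hsO !hb !hM.
      have [m [hm Nm]] := @filter_ex _ U _ _ (filterI (filter_forallT UF hl) (@late (fun m => (N <= m)%N) N (fun _ => id))).
      exists m; split=> //; exists [ffun u => b u m]; apply/ffunP => l.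
      rewrite !ffunE -hm; apply: eq_bigr => p _; apply: eq_bigr => q _.
      by rewrite !ffunE.
    by case: qa => /descend [n [? ?]]; exists n; split=> //; [left|right].
  have [qA qB] := hQ _ _ qn; rewrite -hc // in qA qB.
  have hc' m : (n.+1 <= m)%N -> c m.+1 = h m (c m) by move=> nm; apply: hc; lia.
  by split; apply: (bring _ _ _ ac hc').
by move=> a; split=> q; [apply: (key a (or_introl q)).2|apply: (key a (or_intror q)).1].
Qed.
End Tower.

End Tower.
Import Tower.

(** * Realizations of algebras in rings *)

Section Tensor.
Variables (k : fieldType) (I J : finType) (A : salg k I) (B : salg k J).

Lemma sum_pair_mul (f : I -> k) (g : J -> k) :
  \sum_(x : I * J) f x.1 * g x.2 = (\sum_i f i) * (\sum_j g j).
Proof.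
rewrite -(pair_bigA _ (fun i j => f i * g j)) big_distrl /=; apply: eq_bigr => i _.
by rewrite big_distrr.
Qed.

Definition vtensor (u : vec k I) (v : vec k J) : vec k (I * J)%type := [ffun x => u x.1 * v x.2].

Lemma tensor_unit eA eB : is_unit_of A eA -> is_unit_of B eB ->
  is_unit_of (tensor A B) (vtensor eA eB).
Proof.
move=> /unit_tbl uA /unit_tbl uB; apply: tbl_amul1 => -[j1 j2] [l1 l2] /=.
have d : ((j1, j2) == (l1, l2))%:R = (j1 == l1)%:R * (j2 == l2)%:R :> k.
  by rewrite -natrM mulnb -pair_eqE.
rewrite d; split.
  rewrite -(uA j1 l1).1 -(uB j2 l2).1 -sum_pair_mul; apply: eq_bigr => x _.
  by rewrite ffunE /=; ring.
rewrite -(uA j1 l1).2 -(uB j2 l2).2 -sum_pair_mul; apply: eq_bigr => x _.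
by rewrite ffunE /=; ring.
Qed.

Lemma tensor_algebra : is_algebra A -> is_algebra B -> is_algebra (tensor A B).
Proof.
move=> [/assoc_tbl aA [eA uA]] [/assoc_tbl aB [eB uB]]; split; last first.
  by exists (vtensor eA eB); apply: tensor_unit.
apply: tbl_amulA => i j l m /=.
transitivity ((\sum_p sc A j.1 l.1 p * sc A i.1 p m.1) * (\sum_p sc B j.2 l.2 p * sc B i.2 p m.2)).
  by rewrite -sum_pair_mul; apply: eq_bigr => x _; ring.
by rewrite aA aB -sum_pair_mul; apply: eq_bigr => x _; ring.
Qed.
End Tensor.

(* kap realizes the basis of A inside R; scalars act through iota, which only
   has to commute with the image. *)
Section Real.
Variables (k : fieldType) (R : nzRingType) (iota : {rmorphism k -> R}).

Definition ev (I : finType) (kap : I -> R) (v : vec k I) : R := \sum_i iota (v i) * kap i.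

Definition real (I : finType) (A : salg k I) (kap : I -> R) :=
  [/\ forall a i, iota a * kap i = kap i * iota a,
      forall i j, kap i * kap j = \sum_l iota (sc A i j l) * kap l &
      forall e, is_unit_of A e -> ev kap e = 1].

Section Ev.
Variables (I : finType) (kap : I -> R).
Lemma evD u v : ev kap (u + v) = ev kap u + ev kap v.
Proof. by rewrite /ev -big_split; apply: eq_bigr => i _; rewrite ffunE rmorphD mulrDl. Qed.
Lemma evN u : ev kap (- u) = - ev kap u.
Proof. by rewrite /ev -sumrN; apply: eq_bigr => i _; rewrite ffunE rmorphN mulNr. Qed.
Lemma evB u v : ev kap (u - v) = ev kap u - ev kap v.
Proof. by rewrite evD evN. Qed.
Lemma ev0 : ev kap 0 = 0.
Proof. by rewrite /ev big1 // => i _; rewrite ffunE rmorph0 mul0r. Qed.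
Lemma evZ a u : ev kap (vscale a u) = iota a * ev kap u.
Proof. by rewrite /ev big_distrr /=; apply: eq_bigr => i _; rewrite ffunE rmorphM mulrA. Qed.
Lemma ev_bvec i : ev kap (bvec k i) = kap i.
Proof.
rewrite /ev (bigD1 i) //= ffunE eqxx rmorph1 mul1r big1 ?addr0 // => j ji.
by rewrite ffunE eq_sym (negPf ji) rmorph0 mul0r.
Qed.
Lemma ev_sum (T : Type) (r : seq T) (u : T -> vec k I) :
  ev kap (\sum_(t <- r) u t) = \sum_(t <- r) ev kap (u t).
Proof. by elim: r => [|t r IH]; rewrite ?big_nil ?ev0 // !big_cons evD IH. Qed.

Variables (A : salg k I).
Hypothesis hA : real A kap.
Lemma ev_comm a u : iota a * ev kap u = ev kap u * iota a.
Proof.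
case: hA => hc _ _; rewrite /ev big_distrr big_distrl; apply: eq_bigr => i _ /=.
by rewrite mulrA -rmorphM mulrC rmorphM -!mulrA hc.
Qed.
Lemma ev_mul u v : ev kap (amul A u v) = ev kap u * ev kap v.
Proof.
case: (hA) => hc ht _; rewrite amul_sum ev_sum [in RHS]/ev big_distrl /=.
apply: eq_bigr => i _; rewrite ev_sum big_distrr /=; apply: eq_bigr => j _.
rewrite evZ rmorphM -!mulrA (mulrA (kap i)) -hc -!mulrA ht; do 2 congr (_ * _).
by apply: eq_bigr => l _; rewrite amul_bvec.
Qed.
End Ev.

Lemma real_unit (I : finType) (A : salg k I) (kap : I -> R) e : is_unit_of A e ->
  (forall a i, iota a * kap i = kap i * iota a) ->
  (forall i j, kap i * kap j = \sum_l iota (sc A i j l) * kap l) ->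
  ev kap e = 1 -> real A kap.
Proof. by move=> he hc ht h1; split=> // e' he'; rewrite (unit_uniq he' he). Qed.

Lemma real_tensor (I J : finType) (A : salg k I) (B : salg k J) kA kB eA eB :
  is_unit_of A eA -> is_unit_of B eB -> real A kA -> real B kB ->
  (forall i j, kA i * kB j = kB j * kA i) ->
  real (tensor A B) (fun x => kA x.1 * kB x.2).
Proof.
move=> uA uB [cA tA oA] [cB tB oB] cAB.
have tab (x y : I * J) : (kA x.1 * kB x.2) * (kA y.1 * kB y.2) =
    \sum_l iota (sc (tensor A B) x y l) * (kA l.1 * kB l.2).
  rewrite -!mulrA (mulrA (kB _)) -cAB !mulrA tA -mulrA tB big_distrl /=.
  rewrite -(pair_bigA _ (fun i j => iota (sc A x.1 y.1 i * sc B x.2 y.2 j) * (kA i * kB j))) /=.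
  apply: eq_bigr => i _; rewrite big_distrr /=; apply: eq_bigr => j _.
  by rewrite rmorphM -!mulrA; congr (_ * _); rewrite !mulrA cA.
apply: (real_unit (tensor_unit uA uB)) => // [a x|].
  by rewrite mulrA cA -mulrA cB mulrA.
transitivity (ev kA eA * ev kB eB); last by rewrite oA // oB // mulr1.
rewrite /ev big_distrl /=.
rewrite (eq_bigr (fun x => iota (eA x.1 * eB x.2) * (kA x.1 * kB x.2))) => [|x _]; last by rewrite ffunE.
rewrite -(pair_bigA _ (fun i j => iota (eA i * eB j) * (kA i * kB j))) /=.
apply: eq_bigr => i _; rewrite big_distrr /=; apply: eq_bigr => j _.
by rewrite rmorphM -!mulrA; congr (_ * _); rewrite !mulrA cA.
Qed.

(** With [iota] central and [kap] a basis, [R] is a copy of [A] as a ring. *)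
Definition freal (I : finType) (A : salg k I) (kap : I -> R) :=
  [/\ real A kap, forall a x, iota a * x = x * iota a,
     forall x, exists v, x = ev kap v & forall v, ev kap v = 0 -> v = 0].

Lemma ev_inj (I : finType) (kap : I -> R) : (forall v, ev kap v = 0 -> v = 0) -> injective (ev kap).
Proof. by move=> h u v e; apply/eqP; rewrite -subr_eq0; apply/eqP/h; rewrite evB e subrr. Qed.
End Real.

Section Rng.
Variables (k : fieldType) (I : finType) (A : salg k I) (e : vec k I) (i0 : I).
Hypotheses (assoc : forall x y z, amul A x (amul A y z) = amul A (amul A x y) z)
  (ue : is_unit_of A e).
Definition rng of (is_unit_of A e) : Type := vec k I.
Local Notation T := (rng ue).
HB.instance Definition _ := GRing.Zmodule.on T.
Lemma rng_1neq0 : e != 0.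
Proof.
apply/negP => /eqP e0; have := (ue (bvec k i0)).1; rewrite e0 => /ffunP /(_ i0).
rewrite !ffunE eqxx big1 => [/eqP|p _]; first by rewrite eq_sym oner_eq0.
by rewrite big1 // => q _; rewrite ffunE !mul0r.
Qed.
HB.instance Definition _ := GRing.Zmodule_isNzRing.Build T assoc (fun x => (ue x).1)
  (fun x => (ue x).2) (@amulDl k I A) (@amulDr k I A) rng_1neq0.

Definition rng_scal (a : k) : T := vscale a e.
Lemma rng_scalB : zmod_morphism rng_scal.
Proof. by move=> a b; apply/ffunP => i; rewrite !ffunE mulrBl. Qed.
Lemma rng_scalM : monoid_morphism rng_scal.
Proof.
split=> [|a b]; first by apply/ffunP => i; rewrite !ffunE mul1r.
rewrite -[RHS]/(amul A (vscale a e) (vscale b e)) amulZl amulZr (ue e).1.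
by apply/ffunP => i; rewrite !ffunE mulrA.
Qed.
HB.instance Definition _ := GRing.isZmodMorphism.Build k T rng_scal rng_scalB.
HB.instance Definition _ := GRing.isMonoidMorphism.Build k T rng_scal rng_scalM.

Lemma rng_freal : freal (rng_scal : {rmorphism k -> T}) A (fun i => bvec k i : T).
Proof.
have sc x a : (rng_scal a : T) * (x : T) = vscale a x.
  by rewrite -[LHS]/(amul A (vscale a e) x) amulZl (ue x).1.
have cs x a : (x : T) * (rng_scal a : T) = vscale a x.
  by rewrite -[LHS]/(amul A x (vscale a e)) amulZr (ue x).2.
have evE v : ev (rng_scal : {rmorphism k -> T}) (fun i => bvec k i : T) v = v.
  by rewrite [RHS]sum_bvec /ev; apply: eq_bigr => i _; rewrite sc.
split=> [|a x|x|v]; first split=> [a i|i j|e' ue'].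
- by rewrite sc cs.
- rewrite -[LHS]/(amul A (bvec k i) (bvec k j)) [LHS]sum_bvec; apply: eq_bigr => l _.
  by rewrite amul_bvec sc.
- by rewrite evE (unit_uniq ue' ue).
- by rewrite sc cs.
- by exists x; rewrite evE.
by rewrite evE.
Qed.
End Rng.

Lemma rng_exists (k : fieldType) (I : finType) (A : salg k I) : is_algebra A -> (0 < #|I|)%N ->
  exists (R : nzRingType) (iota : {rmorphism k -> R}) (kap : I -> R), freal iota A kap.
Proof.
move=> [h [e ue]] /card_gt0P [i0 _].
do 3 eexists; exact: (rng_freal i0 h ue).
Qed.

Lemma freal_nzd (k : fieldType) (R : nzRingType) (iota : {rmorphism k -> R}) (I : finType)
  (A : salg k I) (kap : I -> R) : freal iota A kap ->
  nzd A <-> (forall a b : R, a * b = 0 -> a = 0 \/ b = 0).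
Proof.
move=> [hr _ hs hi]; split=> [h a b|h x y xy].
  have [u ->] := hs a; have [v ->] := hs b; rewrite -(ev_mul hr) => /hi /h [] ->.
    by rewrite ev0; left.
  by rewrite ev0; right.
have : ev iota kap x * ev iota kap y = 0 by rewrite -(ev_mul hr) xy ev0.
by move=> /h [] /hi ->; [left|right].
Qed.

(** * Regular representations and their centralizers *)

Section RegularRep.
Variables (k : fieldType) (I : finType) (A : salg k I) (n : nat) (b : 'I_n -> I) (b' : I -> 'I_n).
Hypotheses (bK : cancel b b') (b'K : cancel b' b).

Definition toR (v : vec k I) : 'rV[k]_n := \row_j v (b j).
Definition ofR (r : 'rV[k]_n) : vec k I := [ffun i => r 0 (b' i)].
Lemma toRK : cancel toR ofR. Proof. by move=> v; apply/ffunP => i; rewrite ffunE mxE b'K. Qed.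
Lemma ofRK : cancel ofR toR. Proof. by move=> r; apply/rowP => i; rewrite mxE ffunE bK. Qed.
Lemma toRD u v : toR (u + v) = toR u + toR v. Proof. by apply/rowP => i; rewrite !mxE ffunE. Qed.
Lemma toRZ a v : toR (vscale a v) = a *: toR v. Proof. by apply/rowP => i; rewrite !mxE ffunE. Qed.
Lemma toR0 : toR 0 = 0. Proof. by apply/rowP => i; rewrite !mxE ffunE. Qed.
Lemma toR_eq0 v : toR v = 0 -> v = 0.
Proof. by move=> h; rewrite -(toRK v) h -toR0 toRK. Qed.
Lemma toR_sum (T : Type) (r : seq T) (u : T -> vec k I) :
  toR (\sum_(t <- r) u t) = \sum_(t <- r) toR (u t).
Proof. by elim: r => [|t r IH]; rewrite ?big_nil ?toR0 // !big_cons toRD IH. Qed.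

(** Matrices act on row vectors, so right multiplications compose in the given order and left
    multiplications in the reverse one. *)
Definition Rmx (x : vec k I) : 'M[k]_n := \matrix_(i, j) amul A (bvec k (b i)) x (b j).
Definition Lmx (x : vec k I) : 'M[k]_n := \matrix_(i, j) amul A x (bvec k (b i)) (b j).

Lemma sum_b (F : I -> k) : \sum_i F i = \sum_j F (b j).
Proof. by rewrite (reindex b) //; exists b' => i _. Qed.

Lemma RmxE v x : toR v *m Rmx x = toR (amul A v x).
Proof.
apply/rowP => j; rewrite !mxE; under eq_bigr => i _ do rewrite !mxE.
rewrite -(sum_b (fun i => v i * amul A (bvec k i) x (b j))).
rewrite [in RHS](sum_bvec v) amul_suml sum_ffunE; apply: eq_bigr => i _.
by rewrite amulZl [RHS]ffunE.
Qed.

Lemma LmxE v x : toR v *m Lmx x = toR (amul A x v).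
Proof.
apply/rowP => j; rewrite !mxE; under eq_bigr => i _ do rewrite !mxE.
rewrite -(sum_b (fun i => v i * amul A x (bvec k i) (b j))).
rewrite [in RHS](sum_bvec v) amul_sumr sum_ffunE; apply: eq_bigr => i _.
by rewrite amulZr [RHS]ffunE.
Qed.

Lemma mxR_eq (M N : 'M[k]_n) : (forall v, toR v *m M = toR v *m N) -> M = N.
Proof. by move=> h; apply/row_matrixP => i; rewrite !rowE -(ofRK (delta_mx 0 i)) h. Qed.

Hypothesis hA : is_algebra A.
Let assoc := hA.1.

Lemma Rmx_mul x y : Rmx (amul A x y) = Rmx x *m Rmx y.
Proof. by apply: mxR_eq => v; rewrite mulmxA !RmxE assoc. Qed.
Lemma Lmx_mul x y : Lmx (amul A x y) = Lmx y *m Lmx x.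
Proof. by apply: mxR_eq => v; rewrite mulmxA !LmxE assoc. Qed.
Lemma LRmx x y : Lmx x *m Rmx y = Rmx y *m Lmx x.
Proof. by apply: mxR_eq => v; rewrite !mulmxA LmxE !RmxE LmxE assoc. Qed.

Definition rreg (i : I) := Rmx (bvec k i).

Lemma Rmx_sum x : Rmx x = \sum_i x i *: rreg i.
Proof.
apply/matrixP => p q; rewrite summxE mxE {1}(sum_bvec x).
rewrite amul_sumr sum_ffunE; apply: eq_bigr => i _.
by rewrite amulZr [LHS]ffunE !mxE.
Qed.

(** The element sought is the image of the unit under [M]. *)
Lemma rreg_cent M : mcent rreg M <-> exists x, M = Lmx x.
Proof.
have [e ue] := hA.2; split=> [cM|[x ->] i]; last exact: LRmx.
have cR y : M *m Rmx y = Rmx y *m M.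
  by rewrite Rmx_sum mulmx_sumr mulmx_suml; apply: eq_bigr => i _; rewrite -scalemxAr -scalemxAl cM.
exists (ofR (toR e *m M)); apply: mxR_eq => v.
by rewrite LmxE -RmxE ofRK -mulmxA cR mulmxA RmxE (ue v).1.
Qed.

Lemma Lmx_inj x y : Lmx x = Lmx y -> x = y.
Proof.
have [e ue] := hA.2; move=> h; have := LmxE e x; rewrite h LmxE (ue x).2 (ue y).2.
by move=> /(can_inj toRK).
Qed.

(** Right multiplication by a nonzero element is injective, hence bijective in finite dimension; a
    left inverse of the left inverse makes it two-sided. *)
Lemma nzd_inverse x : nzd A -> x != 0 -> forall e, is_unit_of A e ->
  exists y, amul A x y = e /\ amul A y x = e.
Proof.
move=> hn x0 e ue.
have unit z : z != 0 -> exists y, amul A y z = e.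
  move=> z0; have u : row_free (Rmx z).
    apply/row_freeP; have : kermx (Rmx z) == 0.
      apply/rowV0P => v /sub_kermxP; rewrite -(ofRK v) RmxE => /toR_eq0 /hn [->|/eqP].
        by rewrite toR0.
      by rewrite (negPf z0).
    by rewrite kermx_eq0 => /row_freeP.
  rewrite row_free_unit in u; exists (ofR (toR e *m invmx (Rmx z))).
  by apply: (can_inj toRK); rewrite -RmxE ofRK mulmxKV.
have [y yx] := unit x x0; exists y; split=> //.
have y0 : y != 0.
  apply/negP => /eqP y0; move: yx; rewrite y0 amul0l => e0.
  by case/negP: x0; rewrite -(ue x).1 -e0 amul0l.
have [z zy] := unit y y0.
suff -> : x = z by [].
by rewrite -(ue x).1 -zy -assoc yx (ue z).2.
Qed.

Lemma nzd_mdiv : nzd A -> mdiv rreg.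
Proof.
move=> hn M /rreg_cent [x ->] M0; have [e ue] := hA.2.
have x0 : x != 0.
  by apply: contra_neq M0 => ->; apply: mxR_eq => v; rewrite LmxE mulmx0 amul0l toR0.
have [y [xy _]] := nzd_inverse hn x0 ue.
have : Lmx y *m Lmx x = 1%:M.
  by rewrite -Lmx_mul xy; apply: mxR_eq => v; rewrite LmxE (ue v).1 mulmx1.
by move/mulmx1_unit => [].
Qed.

Lemma rreg_dim4 : (n <= 4)%N -> mdim4 rreg.
Proof.
move=> n4 M hM; have /choice [x hx] i : exists x, M i = Lmx x by apply/rreg_cent.
pose X := \matrix_(i < 5) toR (x i).
have : kermx X != 0.
  by rewrite kermx_eq0 /row_free; apply/negP => /eqP e; have := rank_leq_col X; rewrite e; lia.
move/rowV0Pn => [v /sub_kermxP vX v0]; exists (fun i => v 0 i); split.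
  apply/existsP; apply: contraNT v0 => /existsPn h; apply/eqP/rowP => i.
  by rewrite mxE; apply/eqP/negPn/h.
apply: mxR_eq => w; rewrite mulmx0 mulmx_sumr.
transitivity (toR (amul A (ofR (v *m X)) w)); last first.
  by rewrite vX -toR0 toRK amul0l.
have -> : ofR (v *m X) = \sum_i vscale (v 0 i) (x i).
  apply: (can_inj toRK); rewrite ofRK toR_sum mulmx_sum_row; apply: eq_bigr => i _.
  by rewrite rowK toRZ.
rewrite amul_suml toR_sum; apply: eq_bigr => i _.
by rewrite -scalemxAr hx LmxE amulZl toRZ.
Qed.

End RegularRep.

Module CommutativeRing.
Section FieldOfRing.
Variables (R : nzRingType) (mulC : commutative (@GRing.mul R)) (V : R -> R).
Hypothesis mulV : forall x, x != 0 -> V x * x = 1.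
Definition fring of (commutative (@GRing.mul R)) : Type := R.
Local Notation T := (fring mulC).
HB.instance Definition _ := GRing.NzRing.on T.
HB.instance Definition _ := GRing.PzSemiRing_hasCommutativeMul.Build T mulC.
Definition fring_inv (x : T) : T := if x == 0 then 0 else V x.
Lemma fring_mulV (x : T) : x != 0 -> fring_inv x * x = 1.
Proof. by move=> x0; rewrite /fring_inv (negPf x0) mulV. Qed.
Lemma fring_inv0 : fring_inv 0 = 0. Proof. by rewrite /fring_inv eqxx. Qed.
HB.instance Definition _ := GRing.ComNzRing_isField.Build T fring_mulV fring_inv0.
Lemma field_of_ring : exists (E : fieldType) (f : {rmorphism R -> E}), bijective f.
Proof.
exists (T : fieldType), (idfun : {rmorphism T -> T}).
by exists id.
Qed.
End FieldOfRing.
End CommutativeRing.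

Lemma field_alg_card (k : fieldType) (T : finType) (E : salg k T) : is_division E -> (0 < #|T|)%N.
Proof.
move=> [_ [e [_ [e0 _]]]]; apply/card_gt0P; case: (pickP (fun _ : T => true)) => [t _|h]; first by exists t.
by case: e0; apply/ffunP => t; have := h t.
Qed.

Lemma division_nzd (k : fieldType) (T : finType) (E : salg k T) : is_division E -> nzd E.
Proof.
move=> [[assoc _] [e [ue [_ hinv]]]] x y xy; case: (pselect (x = 0)) => [|x0]; first by left.
have [z [_ zx]] := hinv x x0; right.
by rewrite -(ue y).1 -zx -assoc xy amul0r.
Qed.

Lemma nzd_division (k : fieldType) (T : finType) (E : salg k T) : is_algebra E -> (0 < #|T|)%N ->
  nzd E -> is_division E.
Proof.
move=> hA T0 hn; split=> //; have [_ [e ue]] := hA; exists e; split=> //.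
have [t0 _] := card_gt0P T0; split; first by apply/eqP; exact: (rng_1neq0 t0 ue).
move=> x /eqP x0; exact: (nzd_inverse (@enum_valK T) (@enum_rankK T) hA hn x0 ue).
Qed.

Lemma field_of_salg (k : fieldType) (T : finType) (E : salg k T) : is_field_alg E ->
  exists (EE : fieldType) (iota : {rmorphism k -> EE}) (kap : T -> EE), freal iota E kap.
Proof.
move=> [hdiv hC]; have [R [io [ka hf]]] := rng_exists hdiv.1 (field_alg_card hdiv).
have [hr hc hs hi] := hf.
have mC : commutative (@GRing.mul R).
  by move=> a b; have [u ->] := hs a; have [v ->] := hs b; rewrite -!(ev_mul hr) hC.
have [_ [e [ue [_ hinv]]]] := hdiv.
have /choice [V hV] (x : R) : exists y, x != 0 -> y * x = 1.
  have [u ->] := hs x; case: (pselect (u = 0)) => [->|u0]; first by exists 0; rewrite ev0 eqxx.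
  have [v [_ vu]] := hinv u u0; exists (ev io ka v) => _.
  by rewrite -(ev_mul hr) vu; case: hr => _ _; apply.
have [EE [f [g fK gK]]] := CommutativeRing.field_of_ring mC hV.
exists EE, (f \o io)%FUN, (fun t => f (ka t)).
have evE v : ev (f \o io)%FUN (fun t => f (ka t)) v = f (ev io ka v).
  by rewrite /ev rmorph_sum; apply: eq_bigr => i _; rewrite rmorphM.
case: hr => h1 h2 h3; split=> [|a x|x|v]; first split=> [a i|i j|e' ue'].
- by rewrite mulrC.
- by rewrite -rmorphM h2 rmorph_sum; apply: eq_bigr => l _; rewrite rmorphM.
- by rewrite evE h3 // rmorph1.
- by rewrite mulrC.
- by have [v hv] := hs (g x); exists v; rewrite evE -hv gK.
by rewrite evE -(rmorph0 f) => /(can_inj fK) /hi.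
Qed.

Lemma freal_tbl (k : fieldType) (R : nzRingType) (iota : {rmorphism k -> R}) (I : finType)
   (A : salg k I) (kap : I -> R) :
  (forall a x, iota a * x = x * iota a) -> (forall v, ev iota kap v = 0 -> v = 0) ->
  (forall i j, kap i * kap j = \sum_l iota (sc A i j l) * kap l) ->
  (exists e, 1 = ev iota kap e) -> is_algebra A.
Proof.
move=> hc hi ht [e eE].
have em u v : ev iota kap (amul A u v) = ev iota kap u * ev iota kap v.
  rewrite amul_sum ev_sum [in RHS]/ev big_distrl /=.
  apply: eq_bigr => i _; rewrite ev_sum big_distrr /=; apply: eq_bigr => j _.
  rewrite evZ rmorphM -!mulrA (mulrA (kap i)) -hc -!mulrA ht; do 2 congr (_ * _).
  by apply: eq_bigr => l _; rewrite amul_bvec.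
have inj := ev_inj hi.
split; first by move=> x y z; apply: inj; rewrite !em mulrA.
by exists e => x; split; apply: inj; rewrite em -eE ?mul1r ?mulr1.
Qed.

Lemma salg_of_basis (k EE : fieldType) (iota : {rmorphism k -> EE}) (T : finType) (kap : T -> EE) :
  (forall x, exists v, x = ev iota kap v) -> (forall v, ev iota kap v = 0 -> v = 0) ->
  exists E : salg k T, freal iota E kap.
Proof.
move=> hs hi; have /choice [f hf] (x : T * T) : exists v, kap x.1 * kap x.2 = ev iota kap v by exact: hs.
pose E := SAlg (fun i j l => f (i, j) l).
have ht i j : kap i * kap j = \sum_l iota (sc E i j l) * kap l by rewrite (hf (i, j)).
exists E; split=> // [|a x]; last by rewrite mulrC.
split=> // [a i|e ue]; first by rewrite mulrC.
have [v hv] := hs 1.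
have hA : is_algebra E.
  by apply: (@freal_tbl _ _ iota _ E kap (fun a x => mulrC _ _) hi ht); exists v.
have r : forall u w, ev iota kap (amul E u w) = ev iota kap u * ev iota kap w.
  move=> u w; rewrite amul_sum ev_sum [in RHS]/ev big_distrl /=.
  apply: eq_bigr => i _; rewrite ev_sum big_distrr /=; apply: eq_bigr => j _.
  rewrite evZ rmorphM -!mulrA [kap i * _]mulrCA ht; do 2 congr (_ * _).
  by apply: eq_bigr => l _; rewrite amul_bvec.
by rewrite -[LHS]mulr1 hv -r (ue v).1.
Qed.

Lemma freal_field_alg (k EE : fieldType) (iota : {rmorphism k -> EE}) (T : finType) (E : salg k T)
  (kap : T -> EE) : freal iota E kap -> is_field_alg E.
Proof.
move=> hf; have [hr hc hs hi] := hf; have [h1 h2 h3] := hr.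
have hA : is_algebra E.
  by apply: (freal_tbl hc hi h2); apply: hs.
split; last by move=> x y; apply: (ev_inj hi); rewrite !(ev_mul hr) mulrC.
apply: nzd_division => //.
  apply/card_gt0P; case: (pickP (fun _ : T => true)) => [t _|h]; first by exists t.
  have [v hv] := hs 1; have e0 : ev iota kap v = 0.
    by rewrite /ev big1 // => t _; have := h t.
  by have := oner_neq0 EE; rewrite hv e0 eqxx.
by apply/(freal_nzd hf) => a b /eqP; rewrite mulf_eq0 => /orP [] /eqP ->; [left|right].
Qed.

(** * Tensor products with field algebras as scalar extensions *)

Section TensorField.
Variables (F k EE : fieldType) (s : {rmorphism F -> k}) (h : {rmorphism k -> EE}).
Variables (I T : finType) (A : salg F I) (E : salg F T) (kap : T -> EE).
Hypotheses (hA : is_algebra A) (hE : is_algebra E) (I0 : (0 < #|I|)%N).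
Hypothesis hr : real h (base s E) kap.
Hypothesis hi : forall v, ev h kap v = 0 -> v = 0.
Variable hs : {rmorphism F -> EE}.
Hypothesis hsE : forall a, hs a = h (s a).

Let cut (x : vec k (I * T)%type) (i : I) : vec k T := [ffun t => x (i, t)].

(** If [EE] is the field described by [E], then A (x) E is [A] with scalars extended to [EE]: the
    coordinates (i, t) for fixed i combine to one coordinate in [EE]. *)
Lemma tensor_field_ring : exists (R : nzRingType) (io : {rmorphism EE -> R}) (ka : I -> R),
  freal io (base hs A) ka /\
  real (io \o h)%FUN (base s (tensor A E)) (fun x => ka x.1 * io (kap x.2)) /\
  forall x, ev (io \o h)%FUN (fun x => ka x.1 * io (kap x.2)) x =
     ev io ka [ffun i => ev h kap (cut x i)].
Proof.
have [R [io [ka hf]]] := rng_exists (base_algebra hs hA) I0; exists R, io, ka.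
have [[c1 c2 c3] hc _ _] := hf; have [d1 d2 d3] := hr.
have [_ [eA uA]] := hA; have [_ [eE uE]] := hE.
split=> //; split.
  have r1 : real (io \o h)%FUN (base s A) ka.
    split=> [a i|i j|e ue]; first exact: c1.
      by rewrite c2; apply: eq_bigr => l _; rewrite /= hsE.
    rewrite -(c3 _ (base_unit hs uA)); apply: eq_bigr => i _.
    by rewrite (unit_uniq ue (base_unit s uA)) !ffunE hsE.
  have r2 : real (io \o h)%FUN (base s E) (fun t => io (kap t)).
    split=> [a i|i j|e ue]; first by rewrite /= -!rmorphM mulrC.
      by rewrite -rmorphM d2 rmorph_sum; apply: eq_bigr => l _; rewrite rmorphM.
    by rewrite -(rmorph1 io) -(d3 _ ue) rmorph_sum; apply: eq_bigr => l _; rewrite rmorphM.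
  have := real_tensor (base_unit s uA) (base_unit s uE) r1 r2 (fun i j => esym (hc _ _)).
  suff -> : base s (tensor A E) = tensor (base s A) (base s E) by [].
  congr SAlg; apply/funext => x; apply/funext => y; apply/funext => z.
  by rewrite /= rmorphM.
move=> x; rewrite /ev; transitivity (\sum_(p : I * T) (io \o h)%FUN (x (p.1, p.2)) * (ka p.1 * io (kap p.2))).
  by apply: eq_bigr => -[i t] _.
rewrite -(pair_bigA _ (fun i t => (io \o h)%FUN (x (i, t)) * (ka i * io (kap t)))) /=.
apply: eq_bigr => i _; rewrite ffunE /ev rmorph_sum big_distrl /=; apply: eq_bigr => t _.
by rewrite ffunE rmorphM -mulrA; congr (_ * _); rewrite hc.
Qed.

(** Only independence of [kap] enters, not that it spans; this allows [EE] to be a field larger than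
    the one described by [E]. *)
Lemma nzd_tensor_of_field : nzd (base hs A) -> nzd (base s (tensor A E)).
Proof.
move=> hn x y xy; have [R [io [ka [hf [r evE]]]]] := tensor_field_ring.
have [_ _ _ inj] := hf.
have := ev_mul r x y; rewrite xy ev0 => /esym /((freal_nzd hf).1 hn).
have key z : ev (io \o h)%FUN (fun x => ka x.1 * io (kap x.2)) z = 0 -> z = 0.
  rewrite evE => /inj e; apply/ffunP => -[i t]; move/ffunP/(_ i): e; rewrite !ffunE.
  by move/hi/ffunP/(_ t); rewrite !ffunE.
by case=> /key; [left|right].
Qed.

Lemma nzd_field_of_tensor : (forall z, exists v, z = ev h kap v) ->
  nzd (base s (tensor A E)) -> nzd (base hs A).
Proof.
move=> sur hn x y xy; have [R [io [ka [hf [r evE]]]]] := tensor_field_ring.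
have [rA _ _ inj] := hf.
have lift (z : vec EE I) : exists Z, z = [ffun i => ev h kap (cut Z i)].
  have /choice [f hf'] i := sur (z i); exists [ffun x => f x.1 x.2].
  by apply/ffunP => i; rewrite ffunE hf'; congr ev; apply/ffunP => t; rewrite !ffunE.
have [X xX] := lift x; have [Y yY] := lift y.
have z0 : [ffun i => ev h kap (cut 0 i)] = 0.
  apply/ffunP => i; rewrite !ffunE -[RHS](ev0 h kap); congr ev.
  by apply/ffunP => t; rewrite !ffunE.
have : amul (base s (tensor A E)) X Y = 0.
  have e0 : ev (io \o h)%FUN (fun x => ka x.1 * io (kap x.2)) (amul (base s (tensor A E)) X Y) = 0.
    by rewrite (ev_mul r) !evE -xX -yY -(ev_mul rA) xy ev0.
  move: e0; rewrite evE => /inj e; apply/ffunP => -[i t]; move/ffunP/(_ i): e.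
  rewrite [RHS]ffunE ffunE => /hi /ffunP /(_ t); by rewrite !ffunE.
by case/hn => z; [left; rewrite xX z|right; rewrite yY z].
Qed.
End TensorField.

Section LinearDisjoint.
Variables (P EE : fieldType) (iota : {rmorphism P -> EE}) (T : finType) (kap : T -> EE).
Hypothesis hi : forall v, ev iota kap v = 0 -> v = 0.

(** With denominators cleared, a relation over P(X) is a polynomial relation, and its coefficients
    are relations over P. *)
Lemma rat_indep v : ev (ratm iota) (fun t => ratc EE (kap t)) v = 0 -> v = 0.
Proof.
move=> e; have [f [f0 [p hp]]] := rat_common v.
have rf0 : ratp P f != 0 by rewrite ratp_eq0.
have e1 : \sum_t map_poly iota (p t) * (kap t)%:P = 0.
  have e' : ratm iota (ratp P f) * ev (ratm iota) (fun t => ratc EE (kap t)) v = 0.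
    by rewrite e mulr0.
  apply: (@ratp_inj EE); rewrite rmorph0 rmorph_sum /= -[RHS]e'.
  rewrite /ev big_distrr /=; apply: eq_bigr => t _.
  by rewrite rmorphM /= -ratmP -hp rmorphM mulrA.
have p0 t : p t = 0.
  apply/polyP => i; rewrite coef0; have /hi /ffunP /(_ t) : ev iota kap [ffun t => (p t)`_i] = 0.
    have := congr1 (fun q : {poly EE} => q`_i) e1; rewrite coef0 coef_sum => <-.
    by apply: eq_bigr => u _; rewrite ffunE coefMC coef_map.
  by rewrite !ffunE.
by apply/ffunP => t; apply: (mulfI rf0); rewrite hp p0 rmorph0 ffunE mulr0.
Qed.
End LinearDisjoint.

Section QuadricStep.
Variables (F P : fieldType) (s : {rmorphism F -> P}) (al be ga : P).
Hypotheses (two : 2%:R != 0 :> P) (al0 : al != 0) (be0 : be != 0) (ga0 : ga != 0).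
Variables (K : fieldType) (j : {rmorphism ratf (ratf P) -> K}) (r : K).
Hypothesis jr : quad_over j r (quadric al be ga).
Variables (u : {rmorphism P -> K}) (uE : forall a, u a = j (ratc _ (ratc P a))).

(** Zero divisors of [A] are seen in the centralizer of its right regular representation, which
    consists of left multiplications and so has dimension at most 4. *)
Lemma nzd4_quadric (I : finType) (A : salg P I) : is_algebra A -> (0 < #|I| <= 4)%N ->
  (forall e, e * e != - (al * be * ga)) -> nzd A -> nzd (base u A).
Proof.
move=> hA hI nsq hn.
have [n nI] : exists n, #|I| = n.+1 by exists #|I|.-1; lia.
pose b (i : 'I_n.+1) : I := enum_val (cast_ord (esym nI) i).
pose b' (i : I) : 'I_n.+1 := cast_ord nI (enum_rank i).
have bK : cancel b b' by move=> i; rewrite /b /b' enum_valK cast_ordKV.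
have b'K : cancel b' b by move=> i; rewrite /b /b' cast_ordK enum_rankK.
have rd := nzd_mdiv bK b'K hA hn.
have r4 : mdim4 (rreg A b) by apply: (rreg_dim4 bK b'K hA); lia.
have H := mdiv_quadric two rd r4 al0 be0 nsq jr uE.
have hA' := base_algebra u hA.
have rE : rreg (base u A) b = (fun i => map_mx u (rreg A b i)).
  by apply/funext => i; apply/matrixP => p q; rewrite !mxE !amul_bvec.
move=> x y xy; case: (pselect (x = 0)) => [|x0]; [by left|right].
have Lx0 : Lmx (base u A) b x != 0.
  apply/negP => /eqP L0; apply: x0; apply: (Lmx_inj bK b'K hA').
  by rewrite L0; apply/matrixP => p q; rewrite !mxE amul0l ffunE.
have cL : mcent (fun i => map_mx u (rreg A b i)) (Lmx (base u A) b x).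
  by rewrite -rE; apply/(rreg_cent bK b'K hA'); exists x.
have uL := H _ cL Lx0; apply: (toR_eq0 b'K).
by rewrite -[LHS](mulmxK uL) (LmxE _ bK b'K) xy toR0 mul0mx.
Qed.

Section FieldExt.
Variables (EE : fieldType) (iota : {rmorphism P -> EE}) (T : finType) (E : salg F T) (kap : T -> EE).
Hypothesis hf : freal iota (base s E) kap.
Hypothesis hE : is_algebra E.
Variables (K' : fieldType) (j' : {rmorphism ratf (ratf EE) -> K'}) (r' : K').
Hypothesis jr' : quad_over j' r' (quadric (iota al) (iota be) (iota ga)).
Variable hK : {rmorphism K -> K'}.
Hypotheses (hKj : forall x, hK (j x) = j' (ratm2 iota x)) (hKr : hK r = r').
Variables (u' : {rmorphism EE -> K'}) (uE' : forall a, u' a = j' (ratc _ (ratc EE a))).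

Lemma hKu a : hK (u a) = u' (iota a).
Proof. by rewrite uE hKj ratm2C uE'. Qed.

Lemma ext_real : real hK (base (u \o s)%FUN E) (fun t => u' (kap t)).
Proof.
have [[h1 h2 h3] _ _ _] := hf; have [_ [e ue]] := hE.
split=> [a i|i l|e' ue']; first by rewrite mulrC.
  by rewrite -rmorphM h2 rmorph_sum; apply: eq_bigr => m _; rewrite rmorphM /= hKu.
rewrite (unit_uniq ue' (base_unit _ ue)) -(rmorph1 u') -(h3 _ (base_unit s ue)) rmorph_sum.
by apply: eq_bigr => t _; rewrite !ffunE rmorphM -hKu.
Qed.

(** The basis of [EE] over [P] stays independent through the two variables, and through sqrt g by
    separating the components at 1 and sqrt g. *)
Lemma ext_indep v : ev hK (fun t => u' (kap t)) v = 0 -> v = 0.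
Proof.
move=> e; have [_ _ _ hi] := hf; have [_ _ sp] := jr.
have /choice [f hf'] t : exists ab, v t = j ab.1 + j ab.2 * r.
  by have [a [b ab]] := sp (v t); exists (a, b).
have indep := rat_indep (rat_indep hi).
have [E1 E2] : ev (ratm2 iota) (fun t => ratc _ (ratc EE (kap t))) [ffun t => (f t).1] = 0 /\
   ev (ratm2 iota) (fun t => ratc _ (ratc EE (kap t))) [ffun t => (f t).2] = 0.
  apply: (quad_over_eq0 jr'); rewrite -[RHS]e /ev !rmorph_sum big_distrl -big_split /=.
  apply: eq_bigr => t _; rewrite !ffunE hf' rmorphD rmorphM !hKj hKr uE' !rmorphM; ring.
apply/ffunP => t; rewrite hf'; move/indep/ffunP/(_ t): E1; move/indep/ffunP/(_ t): E2.
by rewrite !ffunE => -> ->; rewrite rmorph0 mul0r addr0.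
Qed.

Lemma nzd_field_step : nzd (base (u \o s)%FUN E).
Proof.
move=> x y xy; have r0 := ext_real; have := ev_mul r0 x y; rewrite xy ev0 => /esym/eqP.
by rewrite mulf_eq0 => /orP [] /eqP /ext_indep ->; [left|right].
Qed.

End FieldExt.
End QuadricStep.

(** The bound 4 on the dimension fails for the tensor product over [P]. It is therefore read as [A]
    over the field [EE], extended to the function field of the same quadric over [EE], and
    restricted again. *)
Lemma nzd_tensor_step (F P : fieldType) (s : {rmorphism F -> P}) (al be ga : P)
  (K : fieldType) (j : {rmorphism ratf (ratf P) -> K}) (r : K)
  (u : {rmorphism P -> K}) (EE : fieldType) (iota : {rmorphism P -> EE})
  (T : finType) (E : salg F T) (kap : T -> EE) (K' : fieldType)
  (j' : {rmorphism ratf (ratf EE) -> K'}) (r' : K') (hK : {rmorphism K -> K'})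
  (u' : {rmorphism EE -> K'}) (I : finType) (A : salg F I) :
  2%:R != 0 :> P -> al != 0 -> be != 0 -> ga != 0 ->
  quad_over j r (quadric al be ga) -> (forall a, u a = j (ratc _ (ratc P a))) ->
  freal iota (base s E) kap -> is_algebra E ->
  quad_over j' r' (quadric (iota al) (iota be) (iota ga)) ->
  (forall x, hK (j x) = j' (ratm2 iota x)) -> hK r = r' ->
  (forall a, u' a = j' (ratc _ (ratc EE a))) ->
  is_algebra A -> (0 < #|I| <= 4)%N ->
  (forall e, e * e != iota (- (al * be * ga))) ->
  nzd (base s (tensor A E)) -> nzd (base (u \o s)%FUN (tensor A E)).
Proof.
move=> two al0 be0 ga0 jr uE hf hE jr' hKj hKr uE' hA hI nsq hn; have [hr _ hs hi] := hf.
have I0 : (0 < #|I|)%N by case/andP: hI.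
have twoE : 2%:R != 0 :> EE by rewrite -(rmorph_nat iota) fmorph_eq0.
have n1 : nzd (base (iota \o s)%FUN A).
  exact: (@nzd_field_of_tensor _ _ _ s iota I T A E kap hA hE I0 hr hi (iota \o s)%FUN (fun _ => erefl) hs hn).
have [a0 b0 c0] : [/\ iota al != 0, iota be != 0 & iota ga != 0] by rewrite !fmorph_eq0.
have nsq' e : e * e != - (iota al * iota be * iota ga).
  by have := nsq e; rewrite rmorphN !rmorphM.
have n2 := nzd4_quadric twoE a0 b0 c0 jr' uE' (base_algebra _ hA) hI nsq' n1.
apply: (nzd_tensor_of_field hA hE I0 (ext_real uE hf hE hKj uE')
   (ext_indep jr hf jr' hKj hKr uE') (hs := (u' \o (iota \o s))%FUN)) => // a.
by rewrite /= (hKu uE hKj uE').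
Qed.

(** * One step of the tower *)

(* The quadratic extension K(sqrt d): (t, false) stands for e_t, (t, true) for e_t sqrt d. *)
Definition quadsalg (k : fieldType) (T : finType) (K : salg k T) (d : vec k T) : salg k (T * bool)%type :=
  SAlg (fun x y z => if x.2 && y.2
    then (if z.2 then 0 else amul K (amul K (bvec k x.1) (bvec k y.1)) d z.1)
    else (if z.2 == (x.2 || y.2) then sc K x.1 y.1 z.1 else 0)).

Lemma bmap_bvec (k L : fieldType) (s : {rmorphism k -> L}) (I : finType) (i : I) :
  bmap s (bvec k i) = bvec L i.
Proof. by apply/ffunP => j; rewrite !ffunE rmorph_nat. Qed.

Lemma base_quadsalg (k L : fieldType) (s : {rmorphism k -> L}) (T : finType) (K : salg k T) d :
  base s (quadsalg K d) = quadsalg (base s K) (bmap s d).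
Proof.
congr SAlg; apply/funext => -[x b]; apply/funext => -[y c]; apply/funext => -[z c'] /=.
have -> : amul (base s K) (amul (base s K) (bvec L x) (bvec L y)) (bmap s d) z =
    s (amul K (amul K (bvec k x) (bvec k y)) d z).
  by rewrite -!(bmap_bvec s) -!bmap_amul [LHS]ffunE.
by case: (b && c); [case: c'; rewrite ?rmorph0 | case: ifP; rewrite ?rmorph0].
Qed.

Lemma base_comp (k L M : fieldType) (s : {rmorphism k -> L}) (u : {rmorphism L -> M})
  (I : finType) (A : salg k I) : base (u \o s)%FUN A = base u (base s A).
Proof. by []. Qed.

Section QuadReal.
Variables (k EE : fieldType) (iota : {rmorphism k -> EE}) (T : finType) (K : salg k T) (kap : T -> EE).
Variables (d : vec k T) (M : fieldType) (j : {rmorphism EE -> M}) (r : M).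
Hypotheses (hf : freal iota K kap) (jr : quad_over j r (ev iota kap d)).

Definition qkap (x : T * bool) : M := j (kap x.1) * r ^+ x.2.

Lemma qkap_ev v : ev (j \o iota)%FUN qkap v =
  j (ev iota kap [ffun t => v (t, false)]) + j (ev iota kap [ffun t => v (t, true)]) * r.
Proof.
rewrite /ev; transitivity (\sum_(p : T * bool) (j \o iota)%FUN (v (p.1, p.2)) * qkap (p.1, p.2)).
  by apply: eq_bigr => -[t b] _.
rewrite -(pair_bigA _ (fun t b => (j \o iota)%FUN (v (t, b)) * qkap (t, b))) /= !rmorph_sum.
rewrite big_distrl -big_split /=; apply: eq_bigr => t _.
by rewrite big_bool /qkap /= !ffunE !rmorphM; ring.
Qed.

Lemma quad_freal e : is_unit_of K e -> freal (j \o iota)%FUN (quadsalg K d) qkap.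
Proof.
move=> ue; have [hr hc hs hi] := hf; have [_ rr sp] := jr.
have inj v : ev (j \o iota)%FUN qkap v = 0 -> v = 0.
  rewrite qkap_ev => /(quad_over_eq0 jr) [/hi e1 /hi e2]; apply/ffunP => -[t b].
  move/ffunP/(_ t): e1; move/ffunP/(_ t): e2; rewrite !ffunE.
  by case: b.
have tab x y : qkap x * qkap y = \sum_l (j \o iota)%FUN (sc (quadsalg K d) x y l) * qkap l.
  have := qkap_ev [ffun l => sc (quadsalg K d) x y l]; rewrite {1}/ev.
  under eq_bigr => l _ do rewrite ffunE.
  move=> ->; case: hr => h1 h2 h3; rewrite /qkap; case: x => x b; case: y => y c /=.
  have evd : ev iota kap [ffun t => amul K (amul K (bvec k x) (bvec k y)) d t] =
     kap x * kap y * ev iota kap d.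
    have -> : [ffun t => amul K (amul K (bvec k x) (bvec k y)) d t] = amul K (amul K (bvec k x) (bvec k y)) d.
      by apply/ffunP => t; rewrite ffunE.
    by rewrite !(ev_mul (And3 h1 h2 h3)) !ev_bvec.
  have evk : ev iota kap [ffun t => sc K x y t] = kap x * kap y.
    by rewrite h2; apply: eq_bigr => t _; rewrite ffunE.
  have ev00 : ev iota kap [ffun t => 0] = 0 by rewrite -[RHS](ev0 iota kap); congr ev; apply/ffunP => t; rewrite !ffunE.
  have red (f : T * bool -> k) c' : [ffun t => [ffun l => f l] (t, c')] = [ffun t => f (t, c')].
    by apply/ffunP => t; rewrite !ffunE.
  rewrite !red /=; case: b; case: c => /=; rewrite ?evd ?evk ?ev00 !rmorphM ?rmorph0 -?rr; ring.
split=> [|a x|x|//]; last 2 first.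
- by rewrite mulrC.
- have [a [b ->]] := sp x; have [u ->] := hs a; have [v ->] := hs b.
  exists [ffun p => if p.2 then v p.1 else u p.1]; rewrite qkap_ev.
  by congr (j _ + j _ * r); congr ev; apply/ffunP => t; rewrite !ffunE.
split=> [a x|//|e' ue']; first by rewrite mulrC.
have inj' := ev_inj inj.
have tabr : forall v w, ev (j \o iota)%FUN qkap (amul (quadsalg K d) v w) =
    ev (j \o iota)%FUN qkap v * ev (j \o iota)%FUN qkap w.
  move=> v w; rewrite amul_sum ev_sum [in RHS]/ev big_distrl /=.
  apply: eq_bigr => i _; rewrite ev_sum big_distrr /=; apply: eq_bigr => l _.
  rewrite evZ !rmorphM mulrACA; congr (_ * _); rewrite tab.
  by apply: eq_bigr => m _; rewrite amul_bvec.
case: hr => _ _ /(_ _ ue) h1.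
pose E1 : vec k (T * bool)%type := [ffun p => if p.2 then 0 else e p.1].
have E1E : ev (j \o iota)%FUN qkap E1 = 1.
  rewrite qkap_ev; have -> : [ffun t => E1 (t, true)] = 0 by apply/ffunP => t; rewrite !ffunE.
  have -> : [ffun t => E1 (t, false)] = e by apply/ffunP => t; rewrite !ffunE.
  by rewrite h1 ev0 rmorph0 rmorph1 mul0r addr0.
by rewrite -[LHS]mulr1 -E1E -tabr (ue' E1).1.
Qed.
End QuadReal.

(** If c^2 = a in [EE] and x is the root of a in the algebra, then (x - c)(x + c) = 0, so x is c or
    - c. But x has coordinates in [P], which puts c in [P]. *)
Lemma sqrt_nonsquare (F P EE : fieldType) (s : {rmorphism F -> P}) (iota : {rmorphism P -> EE})
  (I T : finType) (D : salg F I) (E : salg F T) (kap : T -> EE) (e : vec F I) (a : P) :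
  is_algebra D -> is_unit_of D e -> is_algebra E -> (0 < #|I|)%N -> freal iota (base s E) kap ->
  nzd (base s (tensor D E)) -> (forall c, c * c != a) -> sqin (base s D) (bmap s e) a ->
  forall c, c * c != iota a.
Proof.
move=> hD ue hE I0 hf hn nsq [x xx] c; apply/negP => /eqP cc; have [hr _ hs hi] := hf.
have nD : nzd (base (iota \o s)%FUN D).
  exact: (@nzd_field_of_tensor _ _ _ s iota I T D E kap hD hE I0 hr hi (iota \o s)%FUN (fun _ => erefl) hs hn).
pose X := bmap iota x; pose e' := bmap (iota \o s)%FUN e.
have ue' : is_unit_of (base (iota \o s)%FUN D) e' := base_unit _ ue.
have XX : amul (base (iota \o s)%FUN D) X X = vscale (iota a) e'.
  have := congr1 (bmap iota) xx; rewrite bmap_amul => ->.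
  by apply/ffunP => i; rewrite !ffunE rmorphM.
have z : amul (base (iota \o s)%FUN D) (X - vscale c e') (X + vscale c e') = 0.
  rewrite amulDl !amulDr XX amulZr (ue' X).2.
  have -> : - vscale c e' = vscale (- c) e' by apply/ffunP => i; rewrite !ffunE mulNr.
  rewrite !amulZl amulZr (ue' X).1 (ue' e').1; apply/ffunP => i; rewrite !ffunE -cc; ring.
have [i0 ei0] : exists i, e i != 0.
  have [t _] := card_gt0P I0; have e0 := rng_1neq0 t ue.
  apply/existsP; apply: contraNT e0 => /existsPn h; apply/eqP/ffunP => i; rewrite ffunE.
  exact/eqP/negPn/h.
have sei : s (e i0) != 0 by rewrite fmorph_eq0.
have fin (c' : EE) : c' * c' = iota a -> X = vscale c' e' -> False.
  move=> cc' /ffunP /(_ i0); rewrite !ffunE /= => E1.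
  have c'E : c' = iota (x i0 / s (e i0)) by rewrite fmorph_div E1 mulfK // fmorph_eq0.
  have /negP[] := nsq (x i0 / s (e i0)); apply/eqP; apply: (fmorph_inj iota).
  by rewrite rmorphM -c'E.
case: (nD _ _ z) => /eqP.
  by rewrite subr_eq0 => /eqP; apply: fin.
rewrite addr_eq0 => /eqP Xc; apply: (fin (- c)); first by rewrite mulrNN.
by rewrite Xc; apply/ffunP => i; rewrite !ffunE mulNr.
Qed.

(** The witness is the pure quaternion x i + y j + z ij; its cross terms cancel because i, j and ij
    anticommute. *)
Lemma pure_square (k : fieldType) (I : finType) (A : salg k I) (e i j : vec k I) (a1 a2 x y z : k) :
  is_algebra A -> is_unit_of A e -> amul A i i = vscale a1 e -> amul A j j = vscale a2 e ->
  amul A i j + amul A j i = 0 ->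
  sqin A e (x * x * a1 + y * y * a2 - z * z * a1 * a2).
Proof.
move=> hA ue ii jj ij; have assoc := hA.1.
have ji : amul A j i = - amul A i j by apply/eqP; rewrite -addr_eq0 addrC ij.
have negl u v : amul A (- u) v = - amul A u v.
  by apply/eqP; rewrite -addr_eq0 -amulDl addNr amul0l.
have negr u v : amul A u (- v) = - amul A u v.
  by apply/eqP; rewrite -addr_eq0 -amulDr addNr amul0r.
pose l := amul A i j.
have il : amul A i l = vscale a1 j by rewrite /l assoc ii amulZl (ue j).1.
have li : amul A l i = - vscale a1 j by rewrite /l -assoc ji negr assoc ii amulZl (ue j).1.
have jl : amul A j l = - vscale a2 i.
  by rewrite /l assoc ji negl -assoc jj amulZr (ue i).2.
have lj : amul A l j = vscale a2 i by rewrite /l -assoc jj amulZr (ue i).2.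
have ll : amul A l l = vscale (- (a1 * a2)) e.
  rewrite {1}/l -assoc jl negr amulZr ii; apply/ffunP => t; rewrite !ffunE; ring.
exists (vscale x i + vscale y j + vscale z l).
rewrite !amulDl !amulDr !amulZl !amulZr ii jj ll il li jl lj -/l ji -/l.
apply/ffunP => t; rewrite !ffunE; move: (i t) (j t) (l t) (e t) => ? ? ? ?; ring.
Qed.

Section Step.
Variables (F : fieldType) (I J : finType) (A : salg F I) (B : salg F J).
Hypotheses (two : 2%:R != 0 :> F) (hA : is_algebra A) (hB : is_algebra B).
Hypotheses (I4 : #|I| = 4%N) (J4 : #|J| = 4%N).
Variables (eA : vec F I) (eB : vec F J).
Hypotheses (uA : is_unit_of A eA) (uB : is_unit_of B eB).

Definition quat_gens (T : finType) (D : salg F T) (e : vec F T) :=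
  exists i j a1 a2, [/\ a1 != 0, a2 != 0, amul D i i = vscale a1 e, amul D j j = vscale a2 e &
     amul D i j + amul D j i = 0].
Hypotheses (gA : quat_gens A eA) (gB : quat_gens B eB).

(** Conditions (A)-(C) for tables over F, with [quadsalg K d] for K(sqrt d); (B) and one half of (C)
    become absence of zero divisors. That K(sqrt d) splits [B] asserts a solution instead, extends
    by itself to larger fields, and is recorded separately. *)
Definition abc (T : finType) (K : salg F T) (d : vec F T) :=
  [/\ is_field_alg K, is_field_alg (quadsalg K d), d != 0 &
   [/\ forall a y, a != 0 -> amul K y y <> vscale a d,
    nzd (tensor B K) & nzd (tensor A (quadsalg K d))]].

(** The constructor for all field algebras is what makes the final extension regular; the last two
    carry the second half of (C) and condition (B). *)
Inductive DD : forall T : finType, salg F T -> Prop :=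
| DDfield (T : finType) (E : salg F T) of is_field_alg E : DD E
| DDA : DD A
| DDB : DD B
| DDM (T : finType) (K : salg F T) (d : vec F T) of abc K d : DD (tensor A (quadsalg K d))
| DDK (T : finType) (K : salg F T) (d : vec F T) of abc K d : DD (tensor B K).

Variable XX : forall T : finType, salg F T -> vec F T -> nat -> Prop.
Hypothesis XXstep : forall (P : fieldType) (s : {rmorphism F -> P}) (al be ga : P)
  (K : fieldType) (j : {rmorphism ratf (ratf P) -> K}) (r : K) (u : {rmorphism P -> K}),
  inv DD abc XX s -> 2%:R != 0 :> P -> al != 0 -> be != 0 -> ga != 0 ->
  (forall e, e * e != - (al * be * ga)) ->
  quad_over j r (quadric al be ga) -> (forall a, u a = j (ratc _ (ratc P a))) ->
  forall (T : finType) (X : salg F T) (e : vec F T) (n : nat), XX X e n ->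
        forall rho : T -> 'M[K]_n, ~ is_rep (base (u \o s)%FUN X) (bmap (u \o s)%FUN e) rho.

Section OneStep.
Variables (P : fieldType) (s : {rmorphism F -> P}).
Hypothesis hinv : inv DD abc XX s.
Let twoP : 2%:R != 0 :> P. Proof. by rewrite -(rmorph_nat s) fmorph_eq0. Qed.

Section Adjoin.
Variables (a al be ga : P).
Hypotheses (a_nsq : forall c, c * c != a) (al0 : al != 0) (be0 : be != 0) (ga0 : ga != 0).
Variables (q : P) (q0 : q != 0) (aE : - (al * be * ga) = a * (q * q)).
Hypothesis nsqM : forall (T : finType) (K : salg F T) (d : vec F T), abc K d ->
  forall (EE : fieldType) (iota : {rmorphism P -> EE}) kap, freal iota (base s (quadsalg K d)) kap ->
  forall c, c * c != iota a.
Hypothesis nsqK : forall (T : finType) (K : salg F T) (d : vec F T), abc K d ->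
  forall (EE : fieldType) (iota : {rmorphism P -> EE}) kap, freal iota (base s K) kap ->
  forall c, c * c != iota a.
Variables (K : fieldType) (j : {rmorphism ratf (ratf P) -> K}) (r : K).
Hypothesis jr : quad_over j r (quadric al be ga).
Variables (u : {rmorphism P -> K}) (uE : forall a, u a = j (ratc _ (ratc P a))).

Lemma adjoin_nsq (EE : fieldType) (iota : {rmorphism P -> EE}) :
  (forall c, c * c != iota a) -> forall e, e * e != iota (- (al * be * ga)).
Proof.
move=> h e; apply/negP => /eqP E; have /negP[] := h (e / iota q); apply/eqP.
have iq0 : iota q != 0 by rewrite fmorph_eq0.
apply: (mulIf (mulf_neq0 iq0 iq0)); rewrite -rmorphM -rmorphM -aE -E rmorphM; field.
by rewrite iq0.
Qed.

Lemma adjoin_inv : inv DD abc XX (u \o s)%FUN.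
Proof.
have [h1 h2 h3] := hinv.
have nsqP : forall e, e * e != - (al * be * ga) := @adjoin_nsq P idfun a_nsq.
(* A field algebra over [P] is realized as a field [EE], together with the function field of the
   same quadric over [EE] and the map from [K] into it. *)
have ext (T : finType) (E : salg F T) : is_field_alg E -> nzd (base s E) ->
  exists (EE : fieldType) (iota : {rmorphism P -> EE}) (kap : T -> EE)
   (K' : fieldType) (j' : {rmorphism ratf (ratf EE) -> K'}) (r' : K')
   (hK : {rmorphism K -> K'}) (u' : {rmorphism EE -> K'}),
   [/\ freal iota (base s E) kap, quad_over j' r' (quadric (iota al) (iota be) (iota ga)),
       forall x, hK (j x) = j' (ratm2 iota x), hK r = r' & forall b, u' b = j' (ratc _ (ratc EE b))].
  move=> fE nE; have [hE hC] := fE.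
  have fEP : is_field_alg (base s E).
    split; first by apply: nzd_division => //; [exact: base_algebra hE.1 | exact: field_alg_card hE].
    have /unit_tbl _ := uA; have ht : forall p q l, sc E p q l = sc E q p l.
      by move=> p q' l; rewrite -!amul_bvec hC.
    move=> x y; apply/ffunP => l; rewrite !ffunE exchange_big /=; apply: eq_bigr => p _.
    by apply: eq_bigr => q' _; rewrite ht [x _ * _]mulrC.
  have [EE [iota [kap hf]]] := field_of_salg fEP.
  have twoE : 2%:R != 0 :> EE by rewrite -(rmorph_nat iota) fmorph_eq0.
  have [a0 b0 c0] : [/\ iota al != 0, iota be != 0 & iota ga != 0] by rewrite !fmorph_eq0.
  have [K' [j' [r' jr']]] := quadric_field twoE a0 b0 c0.
  have [hK [hKj hKr]] := quadric_map jr jr'.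
  exists EE, iota, kap, K', j', r', hK, (j' \o (ratc (ratf EE) \o ratc EE))%FUN.
  by split.
split.
- move=> T D; case=> {T D}.
  + move=> T E fE; have nE := h1 _ _ (DDfield fE).
    have [EE [iota [kap [K' [j' [r' [hK [u' [hf jr' hKj hKr uE']]]]]]]]] := ext _ _ fE nE.
    exact: (nzd_field_step jr uE hf fE.1.1 jr' hKj hKr uE').
  + rewrite base_comp; apply: (nzd4_quadric twoP al0 be0 ga0 jr uE (base_algebra s hA) _ nsqP (h1 _ _ DDA)).
    by rewrite I4.
  + rewrite base_comp; apply: (nzd4_quadric twoP al0 be0 ga0 jr uE (base_algebra s hB) _ nsqP (h1 _ _ DDB)).
    by rewrite J4.
  + move=> T E d habc; have [fK fM d0 [hy nBK nAM]] := habc; have hM := fM.1.1.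
    have nM := h1 _ _ (DDfield fM).
    have [EE [iota [kap [K' [j' [r' [hK [u' [hf jr' hKj hKr uE']]]]]]]]] := ext _ _ fM nM.
    apply: (nzd_tensor_step twoP al0 be0 ga0 jr uE hf hM jr' hKj hKr uE' hA) => //.
    * by rewrite I4.
    * exact: (adjoin_nsq (nsqM habc hf)).
    exact: h1 (DDM habc).
  move=> T E d habc; have [fK _ d0 [hy nBK nAM]] := habc.
  have nK := h1 _ _ (DDfield fK).
  have [EE [iota [kap [K' [j' [r' [hK [u' [hf jr' hKj hKr uE']]]]]]]]] := ext _ _ fK nK.
  apply: (nzd_tensor_step twoP al0 be0 ga0 jr uE hf fK.1.1 jr' hKj hKr uE' hB) => //.
  * by rewrite J4.
  * exact: (adjoin_nsq (nsqK habc hf)).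
  exact: h1 (DDK habc).
- move=> T E d habc b y b0 yy; have [fK _ d0 _] := habc.
  have nK := h1 _ _ (DDfield fK).
  have [EE [iota [kap [K' [j' [r' [hK [u' [hf jr' hKj hKr uE']]]]]]]]] := ext _ _ fK nK.
  have [hr hc hs hi] := hf.
  (* Condition (A) is read for the element [D] of the field [EE] over [P], which is the setting of
     the square-class theorem. *)
  pose D := ev iota kap (bmap s d).
  have D0 : D != 0.
    apply/negP => /eqP /hi dz; case/negP: d0; apply/eqP; apply: (bmap_inj (s := s)).
    by rewrite dz; apply/ffunP => t; rewrite !ffunE rmorph0.
  have hD : forall c, c != 0 -> forall z, z * z != D * iota c.
    move=> c c0 z; apply/negP => /eqP zz; have [v vE] := hs z.
    apply: (h2 _ _ _ habc c v c0); apply: (ev_inj hi).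
    by rewrite (ev_mul hr) -vE zz evZ mulrC.
  have := square_class_preserved twoP al0 be0 ga0 erefl jr jr' hKj hKr D0 hD.
  move/(_ b (ev hK (fun t => u' (kap t)) y) b0)/negP; apply; apply/eqP.
  have rr := ext_real uE hf fK.1.1 hKj uE'.
  rewrite -(ev_mul rr) yy evZ mulrC; congr (_ * _).
  rewrite -uE' /D /ev rmorph_sum; apply: eq_bigr => t _.
  by rewrite !ffunE /= (hKu uE hKj uE') rmorphM.
exact: (XXstep hinv twoP al0 be0 ga0 nsqP jr uE).
Qed.
End Adjoin.

Lemma field_realization (T : finType) (E : salg F T) : is_field_alg E ->
  exists (EE : fieldType) (iota : {rmorphism P -> EE}) (kap : T -> EE), freal iota (base s E) kap.
Proof.
move=> fE; have [h1 _ _] := hinv; have nE := h1 _ _ (DDfield fE); have [hE hC] := fE.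
apply: field_of_salg; split.
  by apply: nzd_division => //; [exact: base_algebra hE.1 | exact: field_alg_card hE].
have ht : forall p q l, sc E p q l = sc E q p l by move=> p q' l; rewrite -!amul_bvec hC.
move=> x y; apply/ffunP => l; rewrite !ffunE exchange_big /=; apply: eq_bigr => p _.
by apply: eq_bigr => q' _; rewrite ht [x _ * _]mulrC.
Qed.

(** That d is still a nonsquare is the preserved form of (A) for the scalar 1. *)
Lemma quad_realization (T : finType) (K : salg F T) (d : vec F T) : abc K d ->
  forall (EE : fieldType) (iota : {rmorphism P -> EE}) kap, freal iota (base s K) kap ->
  exists (M : fieldType) (j : {rmorphism EE -> M}) (r : M),
    quad_over j r (ev iota kap (bmap s d)) /\
    freal (j \o iota)%FUN (base s (quadsalg K d)) (qkap kap j r).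
Proof.
move=> habc EE iota kap hf; have [fK fM d0 _] := habc; have [_ h2 _] := hinv.
have [hr hc hs hi] := hf; have [_ [e ue]] := fK.1.1.
have nsq x : x * x != ev iota kap (bmap s d).
  apply/negP => /eqP xx; have [v vE] := hs x.
  apply: (h2 _ _ _ habc 1 v (oner_neq0 P)); apply: (ev_inj hi).
  by rewrite (ev_mul hr) -vE xx evZ rmorph1 mul1r.
have [M [j [r jr]]] := quad_ext_exists nsq; exists M, j, r; split=> //.
by rewrite base_quadsalg; exact: (quad_freal hf jr (base_unit s ue)).
Qed.

Lemma sqin_freal (T : finType) (E : salg F T) (e : vec F T) (EE : fieldType)
  (iota : {rmorphism P -> EE}) kap (a : P) : is_unit_of E e -> freal iota (base s E) kap ->
  (exists c, c * c = iota a) <-> sqin (base s E) (bmap s e) a.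
Proof.
move=> ue [hr hc hs hi]; have e1 : ev iota kap (bmap s e) = 1.
  by case: hr => _ _; apply; apply: base_unit.
split=> [[c cc]|[x xx]].
  have [v vE] := hs c; exists v; apply: (ev_inj hi).
  by rewrite (ev_mul hr) -vE cc evZ e1 mulr1.
by exists (ev iota kap x); rewrite -(ev_mul hr) xx evZ e1 mulr1.
Qed.

Lemma I0 : (0 < #|I|)%N. Proof. by rewrite I4. Qed.
Lemma J0 : (0 < #|J|)%N. Proof. by rewrite J4. Qed.

Section NonSquares.
Variable a : P.
Hypothesis a_nsq : forall c, c * c != a.
Variables (T : finType) (K : salg F T) (d : vec F T).
Hypothesis habc : abc K d.

Lemma nsqM_of_A (EE : fieldType) (iota : {rmorphism P -> EE}) kap : QA A eA s a ->
  freal iota (base s (quadsalg K d)) kap -> forall c, c * c != iota a.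
Proof.
move=> qa hf; have [h1 _ _] := hinv; have [_ fM _ _] := habc.
exact: (sqrt_nonsquare hA uA fM.1.1 I0 hf (h1 _ _ (DDM habc)) a_nsq qa).
Qed.

Lemma nsqK_of_A (EE : fieldType) (iota : {rmorphism P -> EE}) kap : QA A eA s a ->
  freal iota (base s K) kap -> forall c, c * c != iota a.
Proof.
move=> qa hf c; have [M [j [r [jr hM]]]] := quad_realization habc hf.
have := nsqM_of_A qa hM (j c); apply: contra_neq => cc.
by rewrite -rmorphM cc.
Qed.

Lemma nsqK_of_B (EE : fieldType) (iota : {rmorphism P -> EE}) kap : QB B eB s a ->
  freal iota (base s K) kap -> forall c, c * c != iota a.
Proof.
move=> qb hf; have [h1 _ _] := hinv; have [fK _ _ _] := habc.
exact: (sqrt_nonsquare hB uB fK.1.1 J0 hf (h1 _ _ (DDK habc)) a_nsq qb).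
Qed.

(** [B] may be split by K(sqrt d), and then gives no information there. If (x + y sqrt d)^2 = a then
    x y = 0: either a = x^2, excluded by B (x) K, or a = d y^2, and then d a is the square of d y,
    excluded by (A). *)
Lemma nsqM_of_B (EE : fieldType) (iota : {rmorphism P -> EE}) kap : QB B eB s a ->
  freal iota (base s (quadsalg K d)) kap -> forall c, c * c != iota a.
Proof.
move=> qb hf c; apply/negP => /eqP cc; have [_ h2 _] := hinv; have [fK fM d0 _] := habc.
have [_ [e ue]] := fM.1.1.
have [KK [io [ka hK]]] := field_realization fK.
have [M [j [r [jr hM]]]] := quad_realization habc hK.
have /(sqin_freal a ue hM) [w ww] : sqin (base s (quadsalg K d)) (bmap s e) a.
  by apply/(sqin_freal a ue hf); exists c.
have [_ rr sp] := jr; have [x [y wE]] := sp w.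
have twoK : 2%:R != 0 :> KK by rewrite -(rmorph_nat io) fmorph_eq0.
have [e1 e2] : x * x + ev io ka (bmap s d) * (y * y) = io a /\ 2%:R * (x * y) = 0.
  apply: (quad_over_uniq jr); rewrite rmorph0 mul0r addr0 -[RHS]ww wE.
  by rewrite !rmorphD !rmorphM rmorph_nat -rr; ring.
move/eqP: e2; rewrite !mulf_eq0 (negPf twoK) /= => /orP [] /eqP z; move: e1; rewrite z.
  rewrite mul0r add0r => yy; have [hr hc hs hi] := hK.
  have a0 : a != 0 by apply: contra_neq (a_nsq 0) => ->; rewrite mul0r.
  have [v vE] := hs (ev io ka (bmap s d) * y).
  apply: (h2 _ _ _ habc a v a0); apply: (ev_inj hi).
  rewrite (ev_mul hr) -vE evZ -yy; ring.
rewrite mulr0 mulr0 addr0 => xx.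
by have /negP[] := nsqK_of_B qb hK x; rewrite xx.
Qed.
End NonSquares.

Theorem step_main a : Qor A B eA eB s a ->
  exists (P' : fieldType) (h : {rmorphism P -> P'}),
    inv DD abc XX (h \o s)%FUN /\ Qand A B eA eB (h \o s)%FUN (h a).
Proof.
move=> qa; case: (pselect (exists c, c * c = a)) => [[c cc]|nc].
  (* A scalar that is already a square has a root in both algebras. *)
  exists P, idfun; split; first exact: (@inv_sub _ _ _ _ _ _ _ s idfun).
  have sq (T : finType) (D : salg F T) (e : vec F T) : is_unit_of D e ->
     sqin (base s D) (bmap s e) a.
    move=> ue; exists (vscale c (bmap s e)); rewrite amulZl amulZr (base_unit s ue _).1 -cc.
    by apply/ffunP => t; rewrite !ffunE mulrA.
  by split; [exact: (sq _ A eA)|exact: (sq _ B eB)].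
have a_nsq c : c * c != a by apply/negP => /eqP cc; apply: nc; exists c.
have a0 : a != 0 by apply: contra_neq (a_nsq 0) => ->; rewrite mul0r.
have main (T : finType) (D : salg F T) (e : vec F T) : is_algebra D -> is_unit_of D e -> quat_gens D e ->
  (forall (T : finType) (K : salg F T) (d : vec F T), abc K d ->
   forall (EE : fieldType) (iota : {rmorphism P -> EE}) kap, freal iota (base s (quadsalg K d)) kap ->
   forall c, c * c != iota a) ->
  (forall (T : finType) (K : salg F T) (d : vec F T), abc K d ->
   forall (EE : fieldType) (iota : {rmorphism P -> EE}) kap, freal iota (base s K) kap ->
   forall c, c * c != iota a) ->
  exists (P' : fieldType) (h : {rmorphism P -> P'}),
    inv DD abc XX (h \o s)%FUN /\ sqin (base (h \o s)%FUN D) (bmap (h \o s)%FUN e) (h a).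
  move=> hD ue [i [j [a1 [a2 [a10 a20 ii jj ij]]]]] nM nK.
  (* With these values r^2 = al + be Y^2 + ga Z^2 says that r i + Y j + Z ij is a square root of
     [a]. *)
  pose al := a / s a1; pose be := - (s a2 / s a1); pose ga := s a2.
  have sa1 : s a1 != 0 by rewrite fmorph_eq0.
  have sa2 : s a2 != 0 by rewrite fmorph_eq0.
  have al0 : al != 0 by rewrite mulf_neq0 // invr_eq0.
  have be0 : be != 0 by rewrite oppr_eq0 mulf_neq0 // invr_eq0.
  have q0 : s a2 / s a1 != 0 by rewrite mulf_neq0 // invr_eq0.
  have aE : - (al * be * ga) = a * (s a2 / s a1 * (s a2 / s a1)).
    by rewrite /al /be /ga; field.
  have [K [jj' [r jr]]] := quadric_field twoP al0 be0 (sa2 : ga != 0).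
  pose u : {rmorphism P -> K} := (jj' \o (ratc (ratf P) \o ratc P))%FUN.
  have uE b : u b = jj' (ratc _ (ratc P b)) by [].
  exists K, u; split; first exact: (adjoin_inv a_nsq al0 be0 sa2 q0 aE nM nK jr uE).
  clearbody u.
  have toK x y z : amul D x y = vscale z e ->
    amul (base (u \o s)%FUN D) (bmap (u \o s)%FUN x) (bmap (u \o s)%FUN y) =
    vscale (u (s z)) (bmap (u \o s)%FUN e).
    by move=> E; rewrite -bmap_amul E; apply/ffunP => t; rewrite !ffunE rmorphM.
  have ij' : amul (base (u \o s)%FUN D) (bmap (u \o s)%FUN i) (bmap (u \o s)%FUN j) +
     amul (base (u \o s)%FUN D) (bmap (u \o s)%FUN j) (bmap (u \o s)%FUN i) = 0.
    rewrite -!bmap_amul; apply/ffunP => t; move/ffunP/(_ t): ij.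
    by rewrite !ffunE -rmorphD => ->; rewrite rmorph0.
  pose Y := jj' (ratc _ (ratX P)); pose Z := jj' (ratX (ratf P)).
  have rr : r * r = u al + u be * (Y * Y) + u ga * (Z * Z).
    case: jr => _ -> _; rewrite /quadric /rquad !expr2 !rmorphD !rmorphM.
    by rewrite !uE /Y /Z.
  have := pure_square r Y Z (base_algebra (u \o s)%FUN hD) (base_unit (u \o s)%FUN ue)
     (toK _ _ _ ii) (toK _ _ _ jj) ij'.
  suff -> : r * r * u (s a1) + Y * Y * u (s a2) - Z * Z * u (s a1) * u (s a2) = u a by [].
  have us1 : u (s a1) != 0 by rewrite fmorph_eq0.
  rewrite rr /al /be /ga rmorphN !fmorph_div; field.
  by rewrite us1.
(* The root in one algebra protects the invariant, while the quadric is built from the generators of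
   the other. *)
case: (qa) => q.
  have [P' [h [hI hq]]] := main _ B eB hB uB gB
     (fun T K d habc EE iota kap => @nsqM_of_A a a_nsq T K d habc EE iota kap q)
     (fun T K d habc EE iota kap => @nsqK_of_A a a_nsq T K d habc EE iota kap q).
  exists P', h; split=> //; split=> //; exact: (sqin_map (s := s) (t := (h \o s)%FUN) (h := h) (fun x => erefl) q).
have [P' [h [hI hq]]] := main _ A eA hA uA gA
     (fun T K d habc EE iota kap => @nsqM_of_B a a_nsq T K d habc EE iota kap q)
     (fun T K d habc EE iota kap => @nsqK_of_B a a_nsq T K d habc EE iota kap q).
exists P', h; split=> //; split=> //; exact: (sqin_map (s := s) (t := (h \o s)%FUN) (h := h) (fun x => erefl) q).
Qed.
End OneStep.

Theorem closure_field : inv DD abc XX (idfun : {rmorphism F -> F}) ->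
  exists (L : fieldType) (s : {rmorphism F -> L}), inv DD abc XX s /\
    forall a, QA A eA s a <-> QB B eB s a.
Proof.
apply: square_closure.
- exact: inv_ultra.
- exact: inv_sub.
exact: step_main.
Qed.
End Step.

(** * Representations *)

Section RepEv.
Variables (k : fieldType) (T : finType) (X : salg k T) (e : vec k T) (n : nat) (rho : T -> 'M[k]_n).
Definition repev (c : vec k T) : 'M[k]_n := \sum_t c t *: rho t.

Lemma repevD c d : repev (c + d) = repev c + repev d.
Proof. by rewrite /repev -big_split; apply: eq_bigr => t _; rewrite ffunE scalerDl. Qed.
Lemma repevZ a c : repev (vscale a c) = a *: repev c.
Proof. by rewrite /repev scaler_sumr; apply: eq_bigr => t _; rewrite ffunE scalerA. Qed.
Lemma repev0 : repev 0 = 0.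
Proof. by rewrite /repev big1 // => t _; rewrite ffunE scale0r. Qed.
Lemma repev_sum (U : Type) (r : seq U) (c : U -> vec k T) :
  repev (\sum_(u <- r) c u) = \sum_(u <- r) repev (c u).
Proof. by elim: r => [|u r IH]; rewrite ?big_nil ?repev0 // !big_cons repevD IH. Qed.
Lemma repev_bvec t : repev (bvec k t) = rho t.
Proof.
rewrite /repev (bigD1 t) //= ffunE eqxx scale1r big1 ?addr0 // => u ut.
by rewrite ffunE eq_sym (negPf ut) scale0r.
Qed.
Hypothesis hr : is_rep X e rho.
Lemma repev1 : repev e = 1%:M. Proof. exact: hr.2. Qed.
Lemma repev_mul c d : repev (amul X c d) = repev c *m repev d.
Proof.
rewrite amul_sum repev_sum mulmx_suml; apply: eq_bigr => i _.
rewrite repev_sum mulmx_sumr; apply: eq_bigr => j _.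
rewrite repevZ -scalemxAl -scalemxAr scalerA hr.1; congr (_ *: _).
by apply: eq_bigr => l _; rewrite amul_bvec.
Qed.
End RepEv.

Lemma is_rep_map (F k L : fieldType) (s : {rmorphism F -> k}) (u : {rmorphism k -> L}) (t : {rmorphism F -> L})
  (T : finType) (X : salg F T) (e : vec F T) (n : nat) (rho : T -> 'M[k]_n) :
  (forall a, t a = u (s a)) ->
  is_rep (base s X) (bmap s e) rho -> is_rep (base t X) (bmap t e) (fun i => map_mx u (rho i)).
Proof.
move=> tE [hr he]; split=> [i j|].
  by rewrite -map_mxM hr raddf_sum; apply: eq_bigr => l _; rewrite /= map_mxZ tE.
rewrite -(map_mx1 u) -he raddf_sum; apply: eq_bigr => l _.
by rewrite /= map_mxZ !ffunE tE.
Qed.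

Lemma subrep (k : fieldType) (T : finType) (X : salg k T) (e : vec k T) (n r : nat)
  (rho : T -> 'M[k]_n) (U : 'M[k]_(r, n)) : is_rep X e rho -> row_free U ->
  (forall t, (U *m rho t <= U)%MS) ->
  exists B : T -> 'M[k]_r, is_rep X e B /\ forall t, U *m rho t = B t *m U.
Proof.
move=> [hr he] fU st; have /choice [B hB] t : exists B, U *m rho t = B *m U.
  by have /submxP := st t.
exists B; split=> //; split=> [i j|]; apply: (row_free_inj fU).
  rewrite /= -mulmxA -hB mulmxA -hB -mulmxA hr mulmx_sumr mulmx_suml.
  by apply: eq_bigr => l _; rewrite -scalemxAr hB -scalemxAl.
rewrite /= mul1mx -[RHS]mulmx1 -he mulmx_suml mulmx_sumr.
by apply: eq_bigr => l _; rewrite -scalemxAr hB -scalemxAl.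
Qed.

(** The rank of a matrix is unchanged by field extension, and with it the existence of a nonzero
    kernel vector. *)
Lemma lin_descent (k E : fieldType) (i : {rmorphism k -> E}) (V L : finType) (a : L -> V -> k)
  (x : V -> E) (v0 : V) : x v0 != 0 -> (forall l, \sum_v i (a l v) * x v = 0) ->
  exists y : V -> k, (exists v, y v != 0) /\ forall l, \sum_v a l v * y v = 0.
Proof.
move=> x0 hx; pose M := \matrix_(p < #|V|, q < #|L|) a (enum_val q) (enum_val p).
have sumV (R : nzRingType) (f : V -> R) : \sum_v f v = \sum_(p < #|V|) f (enum_val p).
  by rewrite (reindex (@enum_val V V)) //; apply: onW_bij; exact: enum_val_bij.
have : kermx (map_mx i M) != 0.
  apply/rowV0Pn; exists (\row_p x (enum_val p)).
    apply/sub_kermxP/rowP => q; rewrite !mxE -[RHS](hx (enum_val q)) [RHS]sumV.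
    by apply: eq_bigr => p _; rewrite !mxE mulrC.
  by apply: contraNneq x0 => /rowP /(_ (enum_rank v0)); rewrite !mxE enum_rankK => ->.
rewrite -map_kermx map_mx_eq0 => /rowV0Pn [y /sub_kermxP yM y0].
exists (fun v => y 0 (enum_rank v)); split.
  apply/existsP; apply: contraNT y0 => /existsPn h; apply/eqP/rowP => p; rewrite mxE.
  by have := h (enum_val p); rewrite enum_valK negbK => /eqP.
move=> l; move/rowP/(_ (enum_rank l)): yM; rewrite !mxE sumV => E0; rewrite -[RHS]E0.
by apply: eq_bigr => p _; rewrite mxE enum_valK enum_rankK mulrC.
Qed.

(** The space is the direct sum of the images of the idempotents U p p, and U p0 p carries the image
    of U p0 p0 isomorphically onto the p-th one. *)
Lemma units_basis (k : fieldType) N n (U : 'I_N -> 'I_N -> 'M[k]_n) (p0 : 'I_N) :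
  (forall p q q' r, U p q *m U q' r = if q == q' then U p r else 0) -> \sum_p U p p = 1%:M ->
  n = (N * \rank (U p0 p0))%N /\
  row_free (\matrix_(x < #|{: 'I_N * 'I_(\rank (U p0 p0))}|)
    (row (enum_val x).2 (row_base (U p0 p0)) *m U p0 (enum_val x).1)).
Proof.
move=> hU h1; have hUU p q r : U p q *m U q r = U p r by rewrite hU eqxx.
pose r := \rank (U p0 p0); pose B : 'M_(r, n) := row_base (U p0 p0).
have fB : row_free B := row_base_free _.
have BU : B *m U p0 p0 = B.
  have /submxP [D ->] : (B <= U p0 p0)%MS by rewrite eq_row_base.
  by rewrite -mulmxA hU eqxx.
have nle : (n <= N * r)%N.
  have -> : n = \rank (1%:M : 'M[k]_n) by rewrite mxrank1.
  rewrite -h1; apply: leq_trans (_ : \sum_p \rank (U p p) <= _)%N.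
    elim/big_ind2: _ => [|x1 x2 y1 y2 hx hy|p _] //; first by rewrite mxrank0.
    by apply: leq_trans (mxrank_add _ _) _; apply: leq_add.
  rewrite -[X in (_ <= X * _)%N]card_ord -sum_nat_const; apply: leq_sum => p _.
  have -> : U p p = U p p0 *m U p0 p0 *m U p0 p by rewrite !hUU.
  by apply: leq_trans (mxrankM_maxl _ _) _; exact: mxrankM_maxr.
pose M := \matrix_(x < #|{: 'I_N * 'I_r}|) (row (enum_val x).2 B *m U p0 (enum_val x).1).
have fM : row_free M.
  rewrite -kermx_eq0; apply/rowV0P => y /sub_kermxP yM; apply/rowP => x; rewrite mxE.
  case E: (enum_val x) => [p a].
  have : (\row_b y 0 (enum_rank (p, b))) *m B = 0.
    have := congr1 (mulmx^~ (U p p0)) yM; rewrite mul0mx => E0; rewrite -[RHS]E0.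
    rewrite mulmx_sum_row [in RHS](mulmx_sum_row y) mulmx_suml [in RHS](reindex (@enum_rank {: 'I_N * 'I_r})) /=; last first.
      by apply: onW_bij; exact: enum_rank_bij.
    under [RHS]eq_bigr => z _ do rewrite rowK -scalemxAl enum_rankK -mulmxA hU.
    pose f q b := y 0 (enum_rank (q, b)) *: (row b B *m if q == p then U p0 p0 else 0).
    transitivity (\sum_z f z.1 z.2); last by apply: eq_bigr => -[q b] _.
    rewrite -pair_bigA (bigD1 p) //= [X in _ + X]big1 ?addr0 => [|q qp]; last first.
      by rewrite big1 // => b _; rewrite /f (negPf qp) mulmx0 scaler0.
    by apply: eq_bigr => b _; rewrite /f mxE eqxx -row_mul BU.
  move/eqP; rewrite mulmx_free_eq0 // => /eqP /rowP /(_ a).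
  by rewrite !mxE -E enum_valK.
have ger : (N * r <= n)%N.
  by have := rank_leq_col M; rewrite (eqP fM) card_prod !card_ord.
have nE : n = (N * r)%N by lia.
by split.
Qed.

(** * Representations of split algebras and their descent *)

Section Split.
Variables (k : fieldType) (T : finType) (X : salg k T) (e : vec k T) (N : nat) (w : T -> 'M[k]_N).
Definition wmx : 'M[k]_(#|T|, N * N) := \matrix_i mxvec (w (enum_val i)).
(** An isomorphism with the matrix algebra of degree [N], expressed by independent images of the
    basis and a dimension count. *)
Definition splitrep := [/\ is_rep X e w, #|T| = (N * N)%N, row_free wmx & (0 < N)%N].
Hypothesis hs : splitrep.

Lemma wmx_repev (c : vec k T) : toR (@enum_val T T) c *m wmx = mxvec (repev w c).
Proof.
rewrite mulmx_sum_row /repev raddf_sum (reindex (@enum_val T T)) /=; last first.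
  by apply: onW_bij; exact: enum_val_bij.
by apply: eq_bigr => i _; rewrite rowK mxE linearZ.
Qed.

Lemma split_inj c : repev w c = 0 -> c = 0.
Proof.
move=> c0; case: hs => _ _ fw _; apply: (@toR_eq0 _ _ _ _ (@enum_rank T) (@enum_rankK T)).
by apply: (row_free_inj fw); rewrite /= wmx_repev c0 mul0mx raddf0.
Qed.

Lemma split_surj M : exists c, M = repev w c.
Proof.
case: hs => _ cT fw _; have ff : row_full wmx by rewrite /row_full (eqP fw) cT.
have /submxP [y yE] : (mxvec M <= wmx)%MS by apply: submx_full.
exists (ofR (@enum_rank T) y); apply: (can_inj mxvecK).
by rewrite -wmx_repev ofRK // => i; exact: enum_valK.
Qed.

Variables (n : nat) (rho : T -> 'M[k]_n).
Hypothesis hr : is_rep X e rho.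

(** The elementary matrices are pulled back through the isomorphism [w] and evaluated in [rho]. *)
Lemma matrix_units : exists U : 'I_N -> 'I_N -> 'M[k]_n,
  [/\ forall p q q' r, U p q *m U q' r = if q == q' then U p r else 0,
      \sum_p U p p = 1%:M,
      forall t p q, U p q *m rho t = \sum_r w t q r *: U p r,
      forall t p q, rho t *m U p q = \sum_r w t r p *: U r q &
      forall M, mcent rho M -> forall p q, M *m U p q = U p q *m M].
Proof.
have /choice [c hc] (x : 'I_N * 'I_N) : exists c, delta_mx x.1 x.2 = repev w c by exact: split_surj.
case: (hs) => hw _ _ _.
have inj u v : repev w u = repev w v -> u = v.
  move=> E; apply/eqP; rewrite -subr_eq0; apply/eqP/split_inj.
  have -> : u - v = u + vscale (-1) v by apply/ffunP => t; rewrite !ffunE mulN1r.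
  by rewrite repevD repevZ E scaleN1r subrr.
exists (fun p q => repev rho (c (p, q))); split.
- move=> p q q' r; rewrite -(repev_mul hr).
  have -> : amul X (c (p, q)) (c (q', r)) = if q == q' then c (p, r) else 0.
    apply: inj; rewrite (repev_mul hw) -!hc mul_delta_mx_cond; case: eqP => _; rewrite ?mulr1n ?mulr0n.
      exact: hc (p, r).
    by rewrite repev0.
  by case: eqP => _; rewrite ?repev0.
- rewrite -repev_sum -(repev1 hr); congr repev; apply: inj; rewrite (repev1 hw) repev_sum.
  rewrite [RHS]matrix_sum_delta; apply: eq_bigr => p _; rewrite -hc (bigD1 p) //= mxE eqxx scale1r.
  by rewrite big1 ?addr0 // => q qp; rewrite mxE eq_sym (negPf qp) scale0r.
- move=> t p q; rewrite -(repev_bvec rho t) -(repev_mul hr).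
  under [RHS]eq_bigr => r _ do rewrite -repevZ.
  rewrite -repev_sum; congr repev; apply: inj; rewrite (repev_mul hw) repev_bvec repev_sum -hc.
  under [RHS]eq_bigr => r _ do rewrite repevZ -hc.
  apply/matrixP => a b; rewrite mxE summxE (bigD1 q) //= big1 ?addr0 => [|r rq]; last first.
    by rewrite mxE (negPf rq) andbF mul0r.
  rewrite !mxE eqxx andbT (bigD1 b) //= !mxE eqxx andbT big1 ?addr0 => [|r rb]; last first.
    by rewrite !mxE [b == r]eq_sym (negPf rb) andbF mulr0.
  by rewrite mulrC.
- move=> t p q; rewrite -(repev_bvec rho t) -(repev_mul hr).
  under [RHS]eq_bigr => r _ do rewrite -repevZ.
  rewrite -repev_sum; congr repev; apply: inj; rewrite (repev_mul hw) repev_bvec repev_sum -hc.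
  under [RHS]eq_bigr => r _ do rewrite repevZ -hc.
  apply/matrixP => a b; rewrite mxE summxE (bigD1 p) //= big1 ?addr0 => [|r rq]; last first.
    by rewrite mxE (negPf rq) mulr0.
  rewrite !mxE eqxx /= (bigD1 a) //= !mxE eqxx /= big1 ?addr0 => [|r rb]; last first.
    by rewrite !mxE eq_sym (negPf rb) mulr0.
  by [].
move=> M cM p q; rewrite /repev mulmx_sumr mulmx_suml; apply: eq_bigr => t _.
by rewrite -scalemxAr -scalemxAl cM.
Qed.

(** Every representation is [w] tensored with a multiplicity space of dimension r, and the
    centralizer acts faithfully on that space; for r = 2 it sits in the 2 by 2 matrices, so five
    elements are dependent. The rows of [M] are an adapted basis. *)
Lemma rep_dim : (0 < n)%N -> exists2 r, n = (N * r)%N &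
  [/\ (0 < r)%N, r = 2 -> mdim4 rho & exists M : 'M[k]_(#|{: 'I_N * 'I_r}|, n), row_free M /\
    forall t p a, row (enum_rank (p, a)) M *m rho t = \sum_q w t p q *: row (enum_rank (q, a)) M].
Proof.
move=> n0; have [U [hU h1 wU _ hc]] := matrix_units; case: (hs) => _ _ _ N0.
have hUU p q r : U p q *m U q r = U p r by rewrite hU eqxx.
pose p0 := Ordinal N0; pose r := \rank (U p0 p0); pose B : 'M_(r, n) := row_base (U p0 p0).
have BU : B *m U p0 p0 = B.
  have /submxP [D ->] : (B <= U p0 p0)%MS by rewrite eq_row_base.
  by rewrite -mulmxA hUU.
have [nE fM] := units_basis p0 hU h1; rewrite -/r -/B in nE fM.
pose M := \matrix_(x < #|{: 'I_N * 'I_r}|) (row (enum_val x).2 B *m U p0 (enum_val x).1).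
exists r => //; split; first by move: n0; rewrite nE muln_gt0 => /andP[].
  2: { exists M; split=> // t p a; rewrite rowK enum_rankK /= -mulmxA wU mulmx_sumr.
       by apply: eq_bigr => q _; rewrite -scalemxAr rowK enum_rankK. }
move=> r2 {fM}M cM.
(* The centralizer commutes with the idempotent U p0 p0 and so preserves the row space of [B]. *)
have stM i : B *m M i = (B *m M i *m pinvmx B) *m B.
  rewrite mulmxKpV //; have -> : B *m M i = B *m M i *m U p0 p0 by rewrite -mulmxA hc // mulmxA BU.
  by rewrite /B eq_row_base submxMl.
pose V := \matrix_(i < 5) mxvec (B *m M i *m pinvmx B).
have : kermx V != 0.
  rewrite kermx_eq0 /row_free; apply/negP => /eqP rV; have := rank_leq_col V; rewrite rV.
  by rewrite r2.
move/rowV0Pn => [v /sub_kermxP vV v0]; exists (fun i => v 0 i); split.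
  apply/existsP; apply: contraNT v0 => /existsPn h; apply/eqP/rowP => i.
  by rewrite mxE; apply/eqP/negPn/h.
pose Y := \sum_i v 0 i *: M i; rewrite -/Y.
have cY : mcent rho Y.
  move=> t; rewrite mulmx_suml mulmx_sumr; apply: eq_bigr => i _.
  by rewrite -scalemxAl -scalemxAr cM.
have BY : B *m Y = 0.
  have e0 : \sum_i v 0 i *: (B *m M i *m pinvmx B) = 0.
    apply: (can_inj mxvecK); rewrite raddf0 -[RHS]vV mulmx_sum_row raddf_sum.
    by apply: eq_bigr => i _; rewrite rowK; exact: linearZ.
  rewrite mulmx_sumr -[RHS](mul0mx _ B) -e0 mulmx_suml; apply: eq_bigr => i _.
  by rewrite -scalemxAr -scalemxAl -stM.
have U0Y : U p0 p0 *m Y = 0.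
  have /submxP [D ->] : (U p0 p0 <= B)%MS by rewrite eq_row_base.
  by rewrite -mulmxA BY mulmx0.
(* The combination kills the image of one idempotent, hence all of them, since it commutes with the
   matrix units that connect them. *)
rewrite -[LHS]mul1mx -h1 mulmx_suml big1 // => p _.
have -> : U p p = U p p0 *m U p0 p0 *m U p0 p by rewrite !hUU.
by rewrite -2!mulmxA -(hc Y cY) [U p0 p0 *m _]mulmxA U0Y mul0mx mulmx0.
Qed.
End Split.

(** Averaging any matrix over the matrix units gives an intertwiner. The elementary matrix [phi]
    meets nonzero entries of the two idempotents, which keeps the average from vanishing. *)
Lemma split_intertwiner (k : fieldType) (T : finType) (X : salg k T) (e : vec k T) (N : nat)
  (w : T -> 'M[k]_N) n1 n2 (r1 : T -> 'M[k]_n1) (r2 : T -> 'M[k]_n2) : splitrep X e w ->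
  is_rep X e r1 -> is_rep X e r2 -> (0 < n1)%N -> (0 < n2)%N ->
  exists f : 'M_(n1, n2), f != 0 /\ forall t, r1 t *m f = f *m r2 t.
Proof.
move=> hs h1 h2 n10 n20; have [U1 [hU1 s1 _ w1 _]] := matrix_units hs h1.
have [U2 [hU2 s2 w2 _ _]] := matrix_units hs h2; have [_ _ _ N0] := hs.
pose p0 := Ordinal N0.
have nz n (U : 'I_N -> 'I_N -> 'M[k]_n) : (0 < n)%N -> (forall p q q' r, U p q *m U q' r = if q == q' then U p r else 0) ->
    \sum_p U p p = 1%:M -> exists i j, U p0 p0 i j != 0.
  move=> n0 hU s; apply: contrapT => h.
  have hUU p q r : U p q *m U q r = U p r by rewrite hU eqxx.
  have U0 : U p0 p0 = 0.
    apply/matrixP => i j; rewrite mxE; apply/eqP/negPn/negP => ij.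
    by apply: h; exists i, j.
  have : (1%:M : 'M[k]_n) = 0.
    rewrite -s big1 // => p _.
    have -> : U p p = U p p0 *m U p0 p0 *m U p0 p by rewrite !hUU.
    by rewrite U0 mulmx0 mul0mx.
  move/matrixP/(_ (Ordinal n0) (Ordinal n0)); rewrite !mxE eqxx => /eqP.
  by rewrite oner_eq0.
have [i [i' ui]] := nz _ _ n10 hU1 s1; have [j [j' uj]] := nz _ _ n20 hU2 s2.
pose phi : 'M[k]_(n1, n2) := delta_mx i' j.
exists (\sum_p U1 p p0 *m phi *m U2 p0 p); split.
  apply/negP => /eqP /(congr1 (fun M => U1 p0 p0 *m M *m U2 p0 p0)).
  rewrite mulmx0 mul0mx mulmx_sumr mulmx_suml (bigD1 p0) //= big1 ?addr0 => [|p pp]; last first.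
    by rewrite !mulmxA hU1 eq_sym (negPf pp) !mul0mx.
  rewrite !mulmxA hU1 eqxx -mulmxA hU2 eqxx => /matrixP /(_ i j'); rewrite !mxE (bigD1 j) //=.
  rewrite big1 ?addr0 => [|q qj]; last first.
    by rewrite !mxE big1 ?mul0r // => l _; rewrite mxE (negPf qj) andbF mulr0.
  rewrite mxE (bigD1 i') //= big1 ?addr0 => [|q qj]; last first.
    by rewrite mxE (negPf qj) mulr0.
  by rewrite mxE !eqxx mulr1 => /eqP; rewrite mulf_eq0 (negPf ui) (negPf uj).
move=> t; rewrite mulmx_sumr mulmx_suml.
under eq_bigr => p _ do rewrite !mulmxA w1 2!mulmx_suml.
under [RHS]eq_bigr => p _ do rewrite -mulmxA w2 mulmx_sumr.
rewrite exchange_big; apply: eq_bigr => p _; apply: eq_bigr => q _.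
by rewrite -!scalemxAl -scalemxAr.
Qed.

Lemma splitrep_map (F k L : fieldType) (s : {rmorphism F -> k}) (u : {rmorphism k -> L})
  (t : {rmorphism F -> L}) (T : finType) (X : salg F T) (e : vec F T) (N : nat) (w : T -> 'M[k]_N) :
  (forall a, t a = u (s a)) -> splitrep (base s X) (bmap s e) w ->
  splitrep (base t X) (bmap t e) (fun i => map_mx u (w i)).
Proof.
move=> tE [hw cT fw N0]; split=> //; first exact: is_rep_map tE hw.
have -> : wmx (fun i => map_mx u (w i)) = map_mx u (wmx w).
  by apply/row_matrixP => i; rewrite rowK -map_row rowK map_mxvec.
by rewrite row_free_map.
Qed.

Section Descent.
Variables (F k E : fieldType) (s : {rmorphism F -> k}) (u : {rmorphism k -> E}) (t : {rmorphism F -> E}).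
Hypothesis tE : forall a, t a = u (s a).
Variables (T : finType) (X : salg F T) (e : vec F T) (N : nat) (w : T -> 'M[E]_N).
Hypothesis hs : splitrep (base t X) (bmap t e) w.

(** Intertwiners solve a linear system over k, and a nonzero solution exists over [E], where the
    algebra splits. *)
Lemma intertwiner n1 n2 (r1 : T -> 'M[k]_n1) (r2 : T -> 'M[k]_n2) :
  is_rep (base s X) (bmap s e) r1 -> is_rep (base s X) (bmap s e) r2 -> (0 < n1)%N -> (0 < n2)%N ->
  exists f : 'M_(n1, n2), f != 0 /\ forall t, r1 t *m f = f *m r2 t.
Proof.
move=> h1 h2 n10 n20.
have [f [f0 hf]] := split_intertwiner hs (is_rep_map tE h1) (is_rep_map tE h2) n10 n20.
have /existsP [[i0 j0] fij] : [exists x : 'I_n1 * 'I_n2, f x.1 x.2 != 0].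
  apply: contraNT f0 => /existsPn h; apply/eqP/matrixP => i j; rewrite mxE.
  by have := h (i, j); rewrite negbK => /eqP.
pose a (l : T * ('I_n1 * 'I_n2)) (v : 'I_n1 * 'I_n2) : k :=
  r1 l.1 l.2.1 v.1 * (v.2 == l.2.2)%:R - (v.1 == l.2.1)%:R * r2 l.1 v.2 l.2.2.
have sumE (R : comNzRingType) (g : 'M[R]_(n1, n2)) (q1 : 'M[R]_n1) (q2 : 'M[R]_n2) i j :
    \sum_(v : 'I_n1 * 'I_n2) (q1 i v.1 * (v.2 == j)%:R - (v.1 == i)%:R * q2 v.2 j) * g v.1 v.2
    = (q1 *m g - g *m q2) i j.
  pose h x y := (q1 i x * (y == j)%:R - (x == i)%:R * q2 y j) * g x y.
  rewrite -(pair_bigA _ h) /h /=.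
  transitivity (\sum_x \sum_y q1 i x * (y == j)%:R * g x y - \sum_x \sum_y (x == i)%:R * q2 y j * g x y).
    rewrite -sumrB; apply: eq_bigr => x _; rewrite -sumrB; apply: eq_bigr => y _.
    by rewrite mulrBl.
  rewrite !mxE; congr (_ - _).
    apply: eq_bigr => x _; rewrite (bigD1 j) //= eqxx mulr1 big1 ?addr0 // => y yj.
    by rewrite (negPf yj) mulr0 mul0r.
  rewrite (bigD1 i) //= [X in _ + X]big1 ?addr0 => [|x xi].
    by apply: eq_bigr => y _; rewrite eqxx mul1r mulrC.
  by rewrite big1 // => y _; rewrite (negPf xi) !mul0r.
have fa l : \sum_v u (a l v) * f v.1 v.2 = 0.
  have E0 := sumE E f (map_mx u (r1 l.1)) (map_mx u (r2 l.1)) l.2.1 l.2.2.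
  rewrite hf subrr mxE in E0; rewrite -[RHS]E0; apply: eq_bigr => v _.
  by rewrite !mxE rmorphB !rmorphM !rmorph_nat.
have [y [[[i j] yij] hy]] := lin_descent (x := fun v => f v.1 v.2) (v0 := (i0, j0)) fij fa.
exists (\matrix_(i, j) y (i, j)); split.
  by apply: contraNneq yij => /matrixP /(_ i j); rewrite !mxE => ->.
move=> l; apply/eqP; rewrite -subr_eq0; apply/eqP/matrixP => p q; rewrite [RHS]mxE -sumE.
by rewrite -[RHS](hy (l, (p, q))); apply: eq_bigr => -[x z] _; rewrite mxE.
Qed.

Lemma rep_dim_descent n (r : T -> 'M[k]_n) : is_rep (base s X) (bmap s e) r -> (0 < n)%N ->
  exists2 m, n = (N * m)%N & (0 < m)%N /\ (m = 2 -> mdim4 r).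
Proof.
move=> hr n0; have [m nE [m0 h4 _]] := rep_dim hs (is_rep_map tE hr) n0.
exists m => //; split=> // m2 M cM.
have [|c [[i ci] hc]] := h4 m2 (fun i => map_mx u (M i)).
  by move=> i t'; rewrite -!map_mxM cM.
have fa (l : 'I_n * 'I_n) : \sum_v u (M v l.1 l.2) * c v = 0.
  have /matrixP /(_ l.1 l.2) := hc; rewrite summxE mxE => E0; rewrite -[RHS]E0.
  by apply: eq_bigr => v _; rewrite !mxE mulrC.
have [y [[v yv] hy]] := lin_descent ci fa.
exists y; split; first by exists v.
apply/matrixP => a b; rewrite summxE [RHS]mxE -[RHS](hy (a, b)); apply: eq_bigr => x _.
by rewrite mxE mulrC.
Qed.
End Descent.

Lemma rreg_rep (k : fieldType) (I : finType) (A : salg k I) (e : vec k I) (n : nat)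
  (b : 'I_n -> I) (b' : I -> 'I_n) : cancel b b' -> cancel b' b -> is_algebra A -> is_unit_of A e ->
  is_rep A e (rreg A b).
Proof.
move=> bK b'K hA ue; split=> [i j|].
  rewrite -(Rmx_mul bK b'K hA) Rmx_sum //; apply: eq_bigr => l _.
  by rewrite amul_bvec.
rewrite -Rmx_sum //; apply: (mxR_eq bK) => v.
by rewrite (RmxE _ bK b'K) (ue v).2 mulmx1.
Qed.

Lemma freal_morph (F KK : fieldType) (EE : nzRingType) (io : {rmorphism F -> KK}) (t : {rmorphism F -> EE})
  (T : finType) (E : salg F T) ka kap : is_algebra E -> freal io E ka -> real t E kap ->
  exists h : {rmorphism KK -> EE}, (forall a, h (io a) = t a) /\
    forall v, h (ev io ka v) = ev t kap v.
Proof.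
move=> [_ [e ue]] [hr _ hs hi] hr'; have inj := ev_inj hi; have /choice [c hc] := hs.
pose f x := ev t kap (c x).
have fE v : f (ev io ka v) = ev t kap v by congr ev; apply: inj; rewrite -hc.
have fB : zmod_morphism f.
  by move=> x y; rewrite (hc x) (hc y) -evB !fE evB.
have fM : monoid_morphism f.
  split=> [|x y]; last by rewrite (hc x) (hc y) -(ev_mul hr) !fE (ev_mul hr').
  by case: hr => _ _ /(_ _ ue) <-; rewrite fE; case: hr' => _ _ /(_ _ ue).
pose fA := GRing.isZmodMorphism.Build _ _ f fB.
pose fMM := GRing.isMonoidMorphism.Build _ _ f fM.
exists (HB.pack f fA fMM : {rmorphism KK -> EE}); split=> // a.
have -> : io a = ev io ka (vscale a e) by rewrite evZ; case: hr => _ _ ->; rewrite ?mulr1.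
by rewrite /= fE evZ; case: hr' => _ _ ->; rewrite ?mulr1.
Qed.

Lemma real_comp (F k EE : fieldType) (s : {rmorphism F -> k}) (iota : {rmorphism k -> EE})
  (T : finType) (E : salg F T) kap : real iota (base s E) kap -> real (iota \o s)%FUN E kap.
Proof.
move=> [h1 h2 h3]; split=> // [a i|e ue]; first by rewrite mulrC.
by rewrite -(h3 _ (base_unit s ue)); apply: eq_bigr => i _; rewrite ffunE.
Qed.

(** Restriction of scalars: A + B sqrt g acts on pairs of rows over k by the block matrix with rows
    (A, B) and (g B, A). *)
Lemma restrict_rep (F k K : fieldType) (j : {rmorphism k -> K}) (r : K) (g : k) :
  quad_over j r g -> forall (s : {rmorphism F -> k}) (t : {rmorphism F -> K}), (forall a, t a = j (s a)) ->
  forall (T : finType) (X : salg F T) (e : vec F T) n (rho : T -> 'M[K]_n),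
  is_rep (base t X) (bmap t e) rho ->
  exists W : T -> 'M[k]_(n + n), is_rep (base s X) (bmap s e) W.
Proof.
move=> jr s t tE T X e n rho [hr he]; have [_ rr sp] := jr.
pose cmb (A B : 'M[k]_n) : 'M[K]_n := map_mx j A + r *: map_mx j B.
have cmb_inj A B A' B' : cmb A B = cmb A' B' -> A = A' /\ B = B'.
  move=> /matrixP E; have E' a b : A a b = A' a b /\ B a b = B' a b.
    by apply: (quad_over_uniq jr); have := E a b; rewrite !mxE ![r * _]mulrC.
  by split; apply/matrixP => a b; have [] := E' a b.
have /choice [d hd] M : exists AB, M = cmb AB.1 AB.2.
  have /choice [f hf] (x : 'I_n * 'I_n) : exists ab, M x.1 x.2 = j ab.1 + j ab.2 * r.
    by have [a [b ab]] := sp (M x.1 x.2); exists (a, b).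
  exists (\matrix_(a, b) (f (a, b)).1, \matrix_(a, b) (f (a, b)).2).
  by apply/matrixP => a b; rewrite !mxE (hf (a, b)) mulrC.
have cmbM A B A' B' : cmb A B *m cmb A' B' = cmb (A *m A' + g *: (B *m B')) (A *m B' + B *m A').
  rewrite /cmb mulmxDl !mulmxDr -!scalemxAr -!scalemxAl scalerA rr !map_mxD map_mxZ !map_mxM scalerDr.
  by rewrite [X in _ + X = _]addrC addrACA.
pose blk (AB : 'M[k]_n * 'M[k]_n) : 'M[k]_(n + n) := block_mx AB.1 AB.2 (g *: AB.2) AB.1.
have blkD (U : Type) (q : seq U) (c : U -> k) (AB : U -> 'M[k]_n * 'M[k]_n) :
    blk (\sum_(l <- q) c l *: (AB l).1, \sum_(l <- q) c l *: (AB l).2) = \sum_(l <- q) c l *: blk (AB l).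
  elim: q => [|l q IH]; rewrite ?big_nil ?big_cons -?IH /blk /= ?big_nil ?scaler0 ?block_mx0 //.
  rewrite scale_block_mx add_block_mx scalerDr.
  by rewrite [g *: (c l *: _)]scalerA mulrC -scalerA.
have dsum (U : Type) (q : seq U) (c : U -> F) (M : U -> 'M[K]_n) :
    d (\sum_(l <- q) t (c l) *: M l) = (\sum_(l <- q) s (c l) *: (d (M l)).1, \sum_(l <- q) s (c l) *: (d (M l)).2).
  have E : cmb (d (\sum_(l <- q) t (c l) *: M l)).1 (d (\sum_(l <- q) t (c l) *: M l)).2 =
     cmb (\sum_(l <- q) s (c l) *: (d (M l)).1) (\sum_(l <- q) s (c l) *: (d (M l)).2).
    rewrite -hd /cmb !raddf_sum -big_split; apply: eq_bigr => l _ /=.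
    by rewrite [in LHS](hd (M l)) /cmb scalerDr !map_mxZ tE !scalerA [r * _]mulrC.
  by have [] := cmb_inj _ _ _ _ E; case: (d _) => ? ? /= -> ->.
exists (fun i => blk (d (rho i))); split=> [i l|].
  have E := hr i l; rewrite (hd (rho i)) (hd (rho l)) cmbM in E.
  have := dsum _ (index_enum T) (sc X i l) rho; rewrite -E => E2.
  have := hd (cmb ((d (rho i)).1 *m (d (rho l)).1 + g *: ((d (rho i)).2 *m (d (rho l)).2))
         ((d (rho i)).1 *m (d (rho l)).2 + (d (rho i)).2 *m (d (rho l)).1)).
  rewrite E2 /= => /cmb_inj [E3 E4].
  rewrite -blkD /blk /= -E3 -E4 mulmx_block -!scalemxAr -!scalemxAl scalerDr.
  by congr block_mx; rewrite // addrC.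
have := dsum _ (index_enum T) e rho.
have -> : \sum_(l <- index_enum T) t (e l) *: rho l = 1%:M.
  by rewrite -he; apply: eq_bigr => l _; rewrite ffunE.
move=> E2; have := hd 1%:M; rewrite E2 /=.
have -> : (1%:M : 'M[K]_n) = cmb 1%:M 0 by rewrite /cmb map_mx1 map_mx0 scaler0 addr0.
move=> /cmb_inj [E3 E4].
transitivity (\sum_(l <- index_enum T) s (e l) *: blk (d (rho l))).
  by apply: eq_bigr => l _; rewrite ffunE.
by rewrite -blkD -E3 -E4 /blk /= scaler0 -scalar_mx_block.
Qed.

(** A nonzero intertwiner f from [S] to [W] is injective: a nonzero intertwiner from [S] to the
    kernel of f, followed by the inclusion, would be invertible by [hd], so the kernel would be
    everything and f zero. *)
Lemma mdiv_bound (F k EE : fieldType) (s : {rmorphism F -> k}) (u : {rmorphism k -> EE})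
  (t : {rmorphism F -> EE}) (T : finType) (X : salg F T) (e : vec F T) (N : nat) (w : T -> 'M[EE]_N)
  m n (S : T -> 'M[k]_m) (W : T -> 'M[k]_n) :
  (forall a, t a = u (s a)) -> splitrep (base t X) (bmap t e) w ->
  is_rep (base s X) (bmap s e) S -> is_rep (base s X) (bmap s e) W -> mdiv S -> (0 < m)%N -> (0 < n)%N ->
  (m <= n)%N.
Proof.
move=> tE hs hS hW hd m0 n0; have [f [f0 hf]] := intertwiner tE hs hS hW m0 n0.
suff : row_free f by move/eqP => <-; exact: rank_leq_col.
rewrite -kermx_eq0; apply/negPn/negP => k0.
pose U := row_base (kermx f).
have [|B [hB BU]] := subrep (U := U) hS (row_base_free _).
  move=> i; rewrite eq_row_base; apply/sub_kermxP; rewrite -mulmxA hf mulmxA.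
  suff -> : U *m f = 0 by rewrite mul0mx.
  by apply/sub_kermxP; rewrite eq_row_base.
have r0 : (0 < \rank (kermx f))%N by rewrite lt0n mxrank_eq0.
have [h [h0 hh]] := intertwiner tE hs hS hB m0 r0.
have : h *m U \in unitmx.
  apply: hd; last by rewrite mulmx_free_eq0 ?row_base_free.
  by move=> i; rewrite mulmxA hh -mulmxA BU mulmxA.
rewrite -row_free_unit /row_free => /eqP E.
have := mxrankM_maxl h U; rewrite E => l1; have l2 := rank_leq_col h.
have := mxrank_ker f; have : f != 0 by [].
by rewrite -mxrank_eq0; lia.
Qed.

(** In a nonzero representation of least dimension the image of a nonzero element of the centralizer
    is a subrepresentation, hence everything. *)
Lemma minimal_rep (k : fieldType) (T : finType) (X : salg k T) (e : vec k T) n (rho : T -> 'M[k]_n) :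
  is_rep X e rho -> (0 < n)%N ->
  exists m (S : T -> 'M[k]_m.+1), is_rep X e S /\ mdiv S.
Proof.
move=> hrho n0; pose Q m := `[< (0 < m)%N /\ exists S : T -> 'M[k]_m, is_rep X e S >].
have ex : exists m, Q m by exists n; apply/asboolP; split=> //; exists rho.
have [m /asboolP [m0 [S hS]] mmin] := ex_minnP ex.
case: m m0 S hS mmin => // m _ S hS mmin; exists m, S; split=> // M cM M0.
rewrite -row_free_unit /row_free eqn_leq rank_leq_col /=.
apply: mmin; apply/asboolP; rewrite lt0n mxrank_eq0; split=> //.
have [|B [hB _]] := subrep (U := row_base M) hS (row_base_free _); last by exists B.
move=> t; rewrite eq_row_base (eqmxMr _ (eq_row_base M)) cM.
exact: submxMl.
Qed.

Section XXStep.
Variables (F : fieldType).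
(** [X] has degree [n] but does not split over F. Its splitting field is described by a field
    algebra [E], so that it remains a field over every stage of the tower. *)
Definition XX (T : finType) (X : salg F T) (e : vec F T) (n : nat) :=
  [/\ is_algebra X, is_unit_of X e, forall rho : T -> 'M[F]_n, ~ is_rep X e rho &
   exists (T' : finType) (E : salg F T') (KK : fieldType) (io : {rmorphism F -> KK}) ka,
     [/\ is_field_alg E, freal io E ka & exists w : T -> 'M[KK]_n, splitrep (base io X) (bmap io e) w]].

Variables (I J : finType) (A : salg F I) (B : salg F J).
(** A minimal representation [S] over P has dimension n q with q at least 2. One of dimension n over
    [K] restricts to dimension 2 n over P(Y,Z), where the centralizer of [S] is still division; so q
    = 2 and that centralizer has dimension at most 4. By [mdiv_quadric] it stays division over [K],
    which forces 2 n to be at most n. *)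
Theorem no_small_rep (P : fieldType) (s : {rmorphism F -> P}) (al be ga : P)
  (K : fieldType) (j : {rmorphism ratf (ratf P) -> K}) (r : K) (u : {rmorphism P -> K}) :
  inv (DD A B) (abc A B) XX s -> 2%:R != 0 :> P -> al != 0 -> be != 0 -> ga != 0 ->
  (forall e, e * e != - (al * be * ga)) ->
  quad_over j r (quadric al be ga) -> (forall a, u a = j (ratc _ (ratc P a))) ->
  forall (T : finType) (X : salg F T) (e : vec F T) (n : nat), XX X e n ->
        forall rho : T -> 'M[K]_n, ~ is_rep (base (u \o s)%FUN X) (bmap (u \o s)%FUN e) rho.
Proof.
move=> hinv two al0 be0 ga0 nsq jr uE T X e n hX rho hrho.
have [hA ue _ [T' [E [KK [io [ka [fE hka [w hw]]]]]]]] := hX.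
have [EE [iota [kap hf]]] := field_realization hinv fE.
have [hr _ _ _] := hf; have [h [hio _]] := freal_morph fE.1.1 hka (real_comp hr).
have {}hw := splitrep_map (fun a => esym (hio a)) hw.
have [_ cT _ n0] := hw.
have bK := @enum_valK T; have b'K := @enum_rankK T.
have T0 : (0 < #|T|)%N by rewrite cT; lia.
have [m [S [hS dS]]] := minimal_rep (rreg_rep bK b'K (base_algebra s hA) (base_unit s ue)) T0.
have [q mE [q0 q2]] := rep_dim_descent (s := s) (u := iota) (t := (iota \o s)%FUN) (fun a => erefl) hw hS isT.
have q1 : q != 1%N.
  apply/eqP => q1; have [_ _ h3] := hinv; have mn : m.+1 = n by lia.
  by move: S hS {dS q2}; rewrite mn => S; exact: h3 hX S.
have twoE : 2%:R != 0 :> EE by rewrite -(rmorph_nat iota) fmorph_eq0.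
have [a0 b0 c0] : [/\ iota al != 0, iota be != 0 & iota ga != 0] by rewrite !fmorph_eq0.
have [K' [j' [r' jr']]] := quadric_field twoE a0 b0 c0.
have [hK [hKj hKr]] := quadric_map jr jr'.
pose u' : {rmorphism EE -> K'} := (j' \o (ratc (ratf EE) \o ratc EE))%FUN.
have uE' a : u' a = j' (ratc _ (ratc EE a)) by [].
clearbody u'.
have hw' := splitrep_map (t := (u' \o (iota \o s))%FUN) (fun a => erefl) hw.
have tE a : (u' \o (iota \o s))%FUN a = hK ((u \o s)%FUN a) by rewrite /= (hKu uE hKj uE').
pose s2 : {rmorphism F -> ratf (ratf P)} := (ratc (ratf P) \o (ratc P \o s))%FUN.
have s2E a : (u \o s)%FUN a = j (s2 a) by rewrite /= uE.
have [W hW] := restrict_rep jr s2E hrho.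
have tE2 a : (u' \o (iota \o s))%FUN a = (hK \o j)%FUN (s2 a) by rewrite tE s2E.
have hS2 : is_rep (base s2 X) (bmap s2 e) (fun i => map_mx (ratc _) (map_mx (ratc P) (S i))).
  apply: (is_rep_map (s := (ratc P \o s)%FUN)) => [a //|].
  exact: (is_rep_map (s := s)) hS.
have mle := mdiv_bound tE2 hw' hS2 hW (mdiv_rat (mdiv_rat dS)) isT (ltn_addr n n0).
have : (n * q <= n * 2)%N by rewrite -mE muln2 -addnn.
rewrite leq_pmul2l // => qle; have qq : q = 2%N by move: q0 q1 qle; case: q {mE q2} => [|[|[|]]].
have dK := mdiv_quadric two dS (q2 qq) al0 be0 nsq jr uE.
have hSK : is_rep (base (u \o s)%FUN X) (bmap (u \o s)%FUN e) (fun i => map_mx u (S i)).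
  exact: (is_rep_map (s := s)) hS.
have := mdiv_bound tE hw' hSK hrho dK isT n0.
rewrite mE qq muln2 -addnn -[X in (_ <= X)%N]addn0 leq_add2l leqNgt n0.
by [].
Qed.
End XXStep.

(** * Tensor powers and the Goldman element *)

Section TensorPower.
Variables (k : fieldType) (s : nat).

(** An entry of the tensor product of the matrices [M l]; rows and columns are indexed by
    functions. *)
Definition tp (X Y : finType) (M : 'I_s -> X -> Y -> k) (x : {ffun 'I_s -> X}) (y : {ffun 'I_s -> Y}) :=
  \prod_l M l (x l) (y l).

Lemma tp_mul (X Y Z : finType) (M : 'I_s -> X -> Y -> k) (M' : 'I_s -> Y -> Z -> k) x z :
  \sum_y tp M x y * tp M' y z = tp (fun l a c => \sum_b M l a b * M' l b c) x z.
Proof.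
rewrite /tp bigA_distr_bigA; apply: eq_bigr => y _.
by rewrite -big_split.
Qed.

Lemma tp_delta (X : finType) (x y : {ffun 'I_s -> X}) :
  tp (fun l a b => (a == b)%:R) x y = (x == y)%:R.
Proof.
case: eqVneq => [->|xy]; first by rewrite /tp big1 // => l _; rewrite eqxx.
have [l xl] : exists l, x l != y l.
  apply/existsP; apply: contraNT xy => /existsPn h; apply/eqP/ffunP => l.
  by apply/eqP/negPn/h.
by rewrite /tp (bigD1 l) //= (negPf xl) mul0r.
Qed.

Lemma tp_perm (X Y : finType) (M : 'I_s -> X -> Y -> k) (x : {ffun 'I_s -> X}) (y : {ffun 'I_s -> Y}) (t : 'S_s) :
  tp M [ffun l => x (t l)] [ffun l => y (t l)] = tp (fun l => M ((t^-1)%g l)) x y.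
Proof.
rewrite /tp [RHS](reindex_inj (@perm_inj _ t)); apply: eq_bigr => l _.
by rewrite !ffunE permK.
Qed.

Lemma eq_tp (X Y : finType) (M M' : 'I_s -> X -> Y -> k) x y :
  (forall l a b, M l a b = M' l a b) -> tp M x y = tp M' x y.
Proof. by move=> h; apply: eq_bigr => l _. Qed.

Variables (T : finType) (X : salg k T) (e : vec k T).
Definition tunit : vec k {ffun 'I_s -> T} := [ffun t : {ffun 'I_s -> T} => \prod_l e (t l)].

Lemma tpow_unit : is_unit_of X e -> is_unit_of (tpow X s) tunit.
Proof.
move=> /unit_tbl h; apply: tbl_amul1 => j m; split.
  transitivity (\sum_(i : {ffun 'I_s -> T}) \prod_l (e (i l) * sc X (i l) (j l) (m l))).
    by apply: eq_bigr => i _; rewrite ffunE -big_split.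
  rewrite -(bigA_distr_bigA (fun l i => e i * sc X i (j l) (m l))) -tp_delta.
  by apply: eq_bigr => l _; have [-> _] := h (j l) (m l).
transitivity (\sum_(i : {ffun 'I_s -> T}) \prod_l (e (i l) * sc X (j l) (i l) (m l))).
  by apply: eq_bigr => i _; rewrite ffunE -big_split.
rewrite -(bigA_distr_bigA (fun l i => e i * sc X (j l) i (m l))) -tp_delta.
by apply: eq_bigr => l _; have [_ ->] := h (j l) (m l).
Qed.

Lemma tpow_algebra : is_algebra X -> is_unit_of X e -> is_algebra (tpow X s).
Proof.
move=> [/assoc_tbl h _] ue; split; last by exists tunit; exact: tpow_unit.
apply: tbl_amulA => i j l m /=.
transitivity (\prod_t \sum_p sc X (j t) (l t) p * sc X (i t) p (m t)).
  by rewrite bigA_distr_bigA; apply: eq_bigr => p _; rewrite -big_split.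
transitivity (\prod_t \sum_p sc X (i t) (j t) p * sc X p (l t) (m t)).
  by apply: eq_bigr => t _; rewrite h.
by rewrite bigA_distr_bigA; apply: eq_bigr => p _; rewrite -big_split.
Qed.

Definition tpmx (n : nat) (rho : T -> 'M[k]_n) (t : {ffun 'I_s -> T}) : 'M[k]_#|{ffun 'I_s -> 'I_n}| :=
  \matrix_(a, b) tp (fun l => rho (t l)) (enum_val a) (enum_val b).

Lemma sum_enum (U : finType) (f : U -> k) : \sum_(a < #|U|) f (enum_val a) = \sum_u f u.
Proof. by rewrite [RHS](reindex (@enum_val U U)) //; apply: onW_bij; exact: enum_val_bij. Qed.

Lemma tpow_rep n (rho : T -> 'M[k]_n) : is_rep X e rho -> is_rep (tpow X s) tunit (tpmx rho).
Proof.
move=> [hr he]; split=> [i j|]; apply/matrixP => a b.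
  rewrite mxE; under eq_bigr => c _ do rewrite !mxE.
  rewrite (sum_enum (fun y => tp (fun l => rho (i l)) (enum_val a) y * tp (fun l => rho (j l)) y (enum_val b))).
  rewrite tp_mul summxE.
  transitivity (\prod_l \sum_t sc X (i l) (j l) t * rho t (enum_val a l) (enum_val b l)).
    apply: eq_bigr => l _; have /matrixP := hr (i l) (j l) => /(_ (enum_val a l) (enum_val b l)).
    by rewrite mxE summxE => ->; apply: eq_bigr => t _; rewrite mxE.
  rewrite bigA_distr_bigA; apply: eq_bigr => t _.
  by rewrite big_split !mxE.
rewrite summxE; transitivity (\prod_l \sum_t e t * rho t (enum_val a l) (enum_val b l)).
  rewrite bigA_distr_bigA; apply: eq_bigr => t _.
  by rewrite big_split !mxE ffunE.
transitivity (tp (fun l a b => (a == b)%:R) (enum_val a) (enum_val b)).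
  apply: eq_bigr => l _; have /matrixP := he => /(_ (enum_val a l) (enum_val b l)).
  by rewrite summxE mxE => <-; apply: eq_bigr => t _; rewrite mxE.
by rewrite tp_delta mxE (inj_eq enum_val_inj).
Qed.

Lemma tpow_split N (w : T -> 'M[k]_N) : splitrep X e w -> splitrep (tpow X s) tunit (tpmx w).
Proof.
move=> [hw cT fw N0]; split.
- exact: tpow_rep.
- by rewrite !card_ffun cT !card_ord expnMn.
(* A right inverse of [wmx] is a dual basis for [w]; products of dual vectors are dual to the tensor
   products, which proves independence. *)
- have /row_freeP [D hD] := fw.
  have dual i j : \sum_a \sum_b w i a b * D (mxvec_index a b) (enum_rank j) = (i == j)%:R.
    move/matrixP/(_ (enum_rank i) (enum_rank j)): hD; rewrite !mxE (inj_eq enum_rank_inj) => <-.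
    rewrite pair_bigA [RHS](reindex _ (curry_mxvec_bij _ _)) /=; apply: eq_bigr => -[a b] _ /=.
    by rewrite !mxE enum_rankK mxvecE.
  rewrite -kermx_eq0; apply/rowV0P => c /sub_kermxP cM; apply/rowP => t0; rewrite mxE.
  have hc x y : \sum_(t : {ffun 'I_s -> T}) c 0 (enum_rank t) * tp (fun l => w (t l)) x y = 0.
    move/rowP/(_ (mxvec_index (enum_rank x) (enum_rank y))): cM; rewrite !mxE => E0.
    rewrite -[RHS]E0 -[LHS]sum_enum; apply: eq_bigr => t _.
    by rewrite !mxE mxvecE mxE enum_valK !enum_rankK.
  pose u0 := enum_val t0.
  have : \sum_(x : {ffun 'I_s -> 'I_N}) \sum_(y : {ffun 'I_s -> 'I_N})
     (\sum_(t : {ffun 'I_s -> T}) c 0 (enum_rank t) * tp (fun l => w (t l)) x y) *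
     \prod_l D (mxvec_index (x l) (y l)) (enum_rank (u0 l)) = 0.
    by rewrite big1 // => x _; rewrite big1 // => y _; rewrite hc mul0r.
  have -> : \sum_(x : {ffun 'I_s -> 'I_N}) \sum_(y : {ffun 'I_s -> 'I_N})
     (\sum_(t : {ffun 'I_s -> T}) c 0 (enum_rank t) * tp (fun l => w (t l)) x y) *
     \prod_l D (mxvec_index (x l) (y l)) (enum_rank (u0 l)) =
     \sum_(t : {ffun 'I_s -> T}) c 0 (enum_rank t) * (t == u0)%:R.
    transitivity (\sum_(t : {ffun 'I_s -> T}) \sum_(x : {ffun 'I_s -> 'I_N}) \sum_(y : {ffun 'I_s -> 'I_N})
       c 0 (enum_rank t) * tp (fun l => w (t l)) x y * \prod_l D (mxvec_index (x l) (y l)) (enum_rank (u0 l))).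
      rewrite [RHS]exchange_big; apply: eq_bigr => x _; rewrite [RHS]exchange_big; apply: eq_bigr => y _.
      by rewrite mulr_suml.
    apply: eq_bigr => t _; rewrite -tp_delta.
    have -> : tp (fun (l : 'I_s) a b => (a == b)%:R) t u0 = \sum_(x : {ffun 'I_s -> 'I_N})
       \sum_(y : {ffun 'I_s -> 'I_N}) \prod_l (w (t l) (x l) (y l) * D (mxvec_index (x l) (y l)) (enum_rank (u0 l))).
      under eq_bigr => x _ do rewrite -(bigA_distr_bigA (fun l b => w (t l) (x l) b * D (mxvec_index (x l) b) (enum_rank (u0 l)))).
      rewrite -(bigA_distr_bigA (fun l a => \sum_b w (t l) a b * D (mxvec_index a b) (enum_rank (u0 l)))).
      by apply: eq_bigr => l _; rewrite dual.
    rewrite big_distrr; apply: eq_bigr => x _ /=; rewrite big_distrr; apply: eq_bigr => y _ /=.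
    by rewrite big_split mulrA.
  rewrite (bigD1 u0) //= eqxx mulr1 big1 ?addr0 => [|t tu]; last by rewrite (negPf tu) mulr0.
  by rewrite enum_valK.
by rewrite card_ffun !card_ord expn_gt0 N0.
Qed.
End TensorPower.

Lemma base_tpow (k L : fieldType) (u : {rmorphism k -> L}) (s : nat) (T : finType) (X : salg k T) :
  base u (tpow X s) = tpow (base u X) s.
Proof.
congr SAlg; apply/funext => i; apply/funext => j; apply/funext => l.
by rewrite /= rmorph_prod.
Qed.

Lemma bmap_tunit (k L : fieldType) (u : {rmorphism k -> L}) (s : nat) (T : finType) (e : vec k T) :
  bmap u (tunit s e) = tunit s (bmap u e).
Proof. by apply/ffunP => t; rewrite !ffunE rmorph_prod; apply: eq_bigr => l _; rewrite ffunE. Qed.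

Lemma is_rep_id (k : fieldType) (T : finType) (X : salg k T) (e : vec k T) n (rho : T -> 'M[k]_n) :
  is_rep X e rho -> is_rep (base idfun X) (bmap idfun e) rho.
Proof.
case=> h1 h2; split=> [i j|]; first by rewrite h1.
by rewrite -h2; apply: eq_bigr => i _; rewrite ffunE.
Qed.

(** * Antisymmetric tensors *)

Section Swap.
Variables (r N : nat).
Local Notation Z := ('I_N * 'I_r)%type.
Definition mkz (P : {ffun 'I_r -> 'I_N}) (Q : 'I_r -> 'I_r) : {ffun 'I_r -> Z} := [ffun m => (P m, Q m)].
(** Over a splitting field the representation is E^N (x) E^r with basis [Z]. Exchanging two whole
    tensor factors and undoing the exchange of their E^N parts by the Goldman element leaves this
    exchange of the E^r parts. *)
Definition swz (p l : 'I_r) (z : {ffun 'I_r -> Z}) : {ffun 'I_r -> Z} :=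
  [ffun m => ((z m).1, (z (tperm p l m)).2)].
Definition permf (U : finType) (p l : 'I_r) (y : {ffun 'I_r -> U}) : {ffun 'I_r -> U} :=
  [ffun m => y (tperm p l m)].
Lemma swzK p l : involutive (swz p l).
Proof. by move=> z; apply/ffunP => m; rewrite !ffunE /= tpermK; case: (z m). Qed.
Lemma swz_mkz p l P Q : swz p l (mkz P Q) = mkz P (fun m => Q (tperm p l m)).
Proof. by apply/ffunP => m; rewrite !ffunE. Qed.
End Swap.

Section Goldman.
Variables (k E : fieldType) (u : {rmorphism k -> E}) (T : finType) (X : salg k T) (e : vec k T).
Variables (N : nat) (w : T -> 'M[E]_N).
Hypothesis two : 2%:R != 0 :> k.
Hypothesis hs : splitrep (base u X) (bmap u e) w.
Variable Gam : T -> T -> k.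
(* The tensor with coefficients Gam is the Goldman element: it exchanges the two factors. *)
Hypothesis hGam : forall a b c d,
  \sum_i \sum_j u (Gam i j) * (w i a b * w j c d) = (c == b)%:R * (d == a)%:R.
Variables (r q : nat) (rho : T -> 'M[k]_q).
Hypotheses (hr : is_rep X e rho) (q0 : (0 < q)%N) (hq : q = (N * r)%N).
Local Notation Z := ('I_N * 'I_r)%type.
Local Notation W := {ffun 'I_r -> 'I_q}.

Definition mij (R : nzRingType) (f : T -> 'M[R]_q) i j (p l : 'I_r) (m : 'I_r) (a b : 'I_q) : R :=
  if m == p then f i a b else if m == l then f j a b else (a == b)%:R.

(** Its left kernel consists of the tensors that change sign under every exchange of E^r parts. The
    equations have coefficients in k because the Goldman element has, although the decomposition E^N
    (x) E^r exists only over [E]. Columns with p = l are zero. *)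
Definition anti_mx : 'M[k]_(#|{: W}|, #|{: W * ('I_r * 'I_r)}|) := \matrix_(x, y)
  let: (y, (p, l)) := (enum_val y : W * ('I_r * 'I_r)) in
  if p == l then 0 else
  \sum_i \sum_j Gam i j * tp (mij rho i j p l) (enum_val x) (permf p l y)
    + (enum_val x == y)%:R.

(** The adapted basis of [rep_dim] as a change of basis [G] with inverse [G']; in it [rho] is [w]
    tensored with the identity of E^r. *)
Lemma split_basis : exists (G : Z -> 'I_q -> E) (G' : 'I_q -> Z -> E),
  [/\ forall z z', \sum_x G z x * G' x z' = (z == z')%:R,
      forall x y, \sum_z G' x z * G z y = (x == y)%:R &
      forall t a c, \sum_b u (rho t a b) * G' b c = \sum_d G' a d * (w t d.1 c.1 * (d.2 == c.2)%:R)].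
Proof.
have hr' : is_rep (base u X) (bmap u e) (fun i => map_mx u (rho i)).
  exact: (is_rep_map (s := idfun) (t := u) (fun a => erefl) (is_rep_id hr)).
have [r' qE [_ _ [M [fM hM]]]] := rep_dim hs hr' q0.
have [_ _ _ N0] := hs; have rr : r' = r.
  by apply/eqP; rewrite -(eqn_pmul2l N0) -qE hq.
subst r'; have ff : row_full M by rewrite /row_full (eqP fM) card_prod !card_ord hq.
exists (fun z x => M (enum_rank z) x), (fun x z => pinvmx M x (enum_rank z)).
have MM' := mulmxVp fM; have M'M := mulVpmx ff.
split=> [z z'|x y|t a c].
- by move/matrixP/(_ (enum_rank z) (enum_rank z')): MM'; rewrite !mxE (inj_eq enum_rank_inj).
- move/matrixP/(_ x y): M'M; rewrite !mxE => <-; rewrite -[LHS]sum_enum.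
  by apply: eq_bigr => z _; rewrite enum_valK.
pose V : 'M[E]_#|{: Z}| := \matrix_(i, j) (w t (enum_val i).1 (enum_val j).1 * ((enum_val i).2 == (enum_val j).2)%:R).
have MV : M *m map_mx u (rho t) = V *m M.
  apply/row_matrixP => i; rewrite !row_mul; case E0 : (enum_val i) => [p b].
  have iE : i = enum_rank (p, b) by rewrite -E0 enum_valK.
  rewrite {1}iE hM mulmx_sum_row (reindex (@enum_rank {: Z})) /=; last first.
    by apply: onW_bij; exact: enum_rank_bij.
  pose f x y := w t p x * (b == y)%:R *: row (enum_rank (x, y)) M.
  transitivity (\sum_z f z.1 z.2); last first.
    by apply: eq_bigr => -[x y] _; rewrite !mxE enum_rankK E0.
  rewrite -pair_bigA; apply: eq_bigr => x _; rewrite (bigD1 b) //= big1 ?addr0 => [|y yb].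
    by rewrite /f eqxx mulr1.
  by rewrite /f eq_sym (negPf yb) mulr0 scale0r.
have : map_mx u (rho t) *m pinvmx M = pinvmx M *m V.
  by rewrite -[LHS]mul1mx -M'M -!mulmxA [M *m (_ *m _)]mulmxA MV -mulmxA MM' mulmx1.
move/matrixP/(_ a (enum_rank c)); rewrite [LHS]mxE [RHS]mxE => E0.
transitivity (\sum_b map_mx u (rho t) a b * pinvmx M b (enum_rank c)).
  by apply: eq_bigr => b _; rewrite [map_mx u _ a b]mxE.
rewrite E0 -[RHS]sum_enum; apply: eq_bigr => d _.
by rewrite [V _ _]mxE !enum_rankK enum_valK.
Qed.

Section Coordinates.
Variables (G : Z -> 'I_q -> E) (G' : 'I_q -> Z -> E).
Hypotheses (GG' : forall z z', \sum_x G z x * G' x z' = (z == z')%:R)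
  (G'G : forall x y, \sum_z G' x z * G z y = (x == y)%:R)
  (rhoG : forall t a c, \sum_b u (rho t a b) * G' b c = \sum_d G' a d * (w t d.1 c.1 * (d.2 == c.2)%:R)).

Definition coordz (f : W -> E) (z : {ffun 'I_r -> Z}) : E := \sum_x f x * tp (fun _ => G') x z.
Definition antisym (f : W -> E) := forall p l z, p != l -> coordz f (swz p l z) = - coordz f z.

Lemma sum_deltal (U : finType) (f : U -> E) y : \sum_x f x * (x == y)%:R = f y.
Proof.
by rewrite (bigD1 y) //= eqxx mulr1 big1 ?addr0 // => x /negPf ->; rewrite mulr0.
Qed.

Lemma coordzK f y : \sum_z coordz f z * tp (fun _ => G) z y = f y.
Proof.
under eq_bigr => z _ do rewrite mulr_suml.
rewrite exchange_big -[RHS]sum_deltal; apply: eq_bigr => x _.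
rewrite -tp_delta -(eq_tp (M := fun l a b => \sum_z G' a z * G z b)) // -tp_mul big_distrr.
by apply: eq_bigr => z _ /=; rewrite mulrA.
Qed.

Lemma coordz_inv (f : {ffun 'I_r -> Z} -> E) z :
  coordz (fun x => \sum_z f z * tp (fun _ => G) z x) z = f z.
Proof.
rewrite /coordz; under eq_bigr => x _ do rewrite mulr_suml.
rewrite exchange_big -[RHS]sum_deltal; apply: eq_bigr => y _.
rewrite -tp_delta -(eq_tp (M := fun l a b => \sum_x G a x * G' x b)) // -tp_mul big_distrr.
by apply: eq_bigr => x _ /=; rewrite mulrA.
Qed.

Lemma coordz_eq0 f : (forall z, coordz f z = 0) -> forall x, f x = 0.
Proof. by move=> h x; rewrite -coordzK big1 // => z _; rewrite h mul0r. Qed.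

Lemma coordz_rho f (t : 'I_r -> T) z :
  coordz (fun y => \sum_x f x * tp (fun l a b => u (rho (t l) a b)) x y) z =
  \sum_d coordz f d * tp (fun l (d c : Z) => w (t l) d.1 c.1 * (d.2 == c.2)%:R) d z.
Proof.
rewrite /coordz; under eq_bigr => x _ do rewrite mulr_suml.
under [RHS]eq_bigr => x _ do rewrite mulr_suml.
rewrite exchange_big [RHS]exchange_big; apply: eq_bigr => x _.
under eq_bigr => y _ do rewrite -mulrA.
under [RHS]eq_bigr => y _ do rewrite -mulrA.
rewrite -!big_distrr /= !tp_mul; congr (_ * _); apply: eq_tp => l a b.
exact: rhoG.
Qed.

(** The algebra acts on the E^N parts alone, so it commutes with exchanges of the E^r parts. *)
Lemma antisym_rho f (t : 'I_r -> T) : antisym f ->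
  antisym (fun y => \sum_x f x * tp (fun l a b => u (rho (t l) a b)) x y).
Proof.
move=> hf p l z pl; rewrite !coordz_rho (reindex_inj (inv_inj (swzK p l))) -sumrN.
apply: eq_bigr => d _; rewrite hf // mulNr; congr (- (_ * _)).
rewrite /tp !big_split; congr (_ * _); first by apply: eq_bigr => m _; rewrite !ffunE.
rewrite [RHS](reindex_inj (@perm_inj _ (tperm p l))); apply: eq_bigr => m _.
by rewrite !ffunE.
Qed.

(** By [hGam] the Goldman element exchanges first components, while [permf] exchanges the pairs;
    what remains is the exchange of second components. *)
Lemma goldman_swap p l (d z : {ffun 'I_r -> Z}) : p != l ->
  \sum_i \sum_j u (Gam i j) * tp (fun m (d c : Z) => if m == p then w i d.1 c.1 * (d.2 == c.2)%:R
     else if m == l then w j d.1 c.1 * (d.2 == c.2)%:R else (d == c)%:R) d (permf p l z) =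
  (d == swz p l z)%:R.
Proof.
move=> pl; have lp : l != p by rewrite eq_sym.
pose R := \prod_(m < r | (m != p) && (m != l)) (d m == z m)%:R : E.
transitivity (\sum_i \sum_j u (Gam i j) * (w i (d p).1 (z l).1 * w j (d l).1 (z p).1) *
    (((d p).2 == (z l).2)%:R * ((d l).2 == (z p).2)%:R * R)).
  apply: eq_bigr => i _; apply: eq_bigr => j _.
  rewrite /tp (bigD1 p) // (bigD1 l) //= !ffunE eqxx (negPf lp) tpermL tpermR.
  have -> : \prod_(i0 < r | (i0 != p) && (i0 != l))
      (if i0 == p then w i (d i0).1 (permf p l z i0).1 * ((d i0).2 == (permf p l z i0).2)%:R
       else if i0 == l then w j (d i0).1 (permf p l z i0).1 * ((d i0).2 == (permf p l z i0).2)%:R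
       else (d i0 == (permf p l z) i0)%:R) = R.
    apply: eq_bigr => m /andP [mp ml]; rewrite (negPf mp) (negPf ml) ffunE tpermD //; by rewrite eq_sym.
  rewrite eqxx; ring.
under eq_bigr => i _ do rewrite -mulr_suml.
rewrite -mulr_suml hGam -tp_delta /tp (bigD1 p) // (bigD1 l) //= !ffunE tpermL tpermR.
have -> : \prod_(i < r | (i != p) && (i != l)) (d i == swz p l z i)%:R = R :> E.
  apply: eq_bigr => m /andP [mp ml]; rewrite ffunE tpermD ?[p == _]eq_sym ?[l == _]eq_sym //; case: (z m).
rewrite -!pair_eqE /pair_eq /= -!mulnb !natrM [(z p).1 == _]eq_sym; ring.
Qed.

Definition goldop (f : W -> E) (p l : 'I_r) (y : W) : E :=
  \sum_x f x * \sum_i \sum_j u (Gam i j) * tp (mij (fun t => map_mx u (rho t)) i j p l) x (permf p l y).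

Lemma coordz_goldop f p l z : p != l -> coordz (goldop f p l) z = coordz f (swz p l z).
Proof.
move=> pl; rewrite -[RHS](sum_deltal (coordz f)).
pose nij i j := fun m (d c : Z) => if m == p then w i d.1 c.1 * (d.2 == c.2)%:R
     else if m == l then w j d.1 c.1 * (d.2 == c.2)%:R else (d == c)%:R : E.
under [RHS]eq_bigr => d _ do rewrite -goldman_swap //.
rewrite /coordz /goldop; under [LHS]eq_bigr => y _ do rewrite mulr_suml.
under [RHS]eq_bigr => y _ do rewrite mulr_suml.
rewrite exchange_big [RHS]exchange_big; apply: eq_bigr => x _.
under eq_bigr => y _ do rewrite -mulrA.
under [RHS]eq_bigr => y _ do rewrite -mulrA.
rewrite -!big_distrr /=; congr (_ * _).
under eq_bigr => y _ do rewrite mulr_suml.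
under [RHS]eq_bigr => y _ do rewrite mulr_sumr.
rewrite exchange_big [RHS]exchange_big; apply: eq_bigr => i _ /=.
under eq_bigr => y _ do rewrite mulr_suml.
under [RHS]eq_bigr => y _ do rewrite mulr_sumr.
rewrite exchange_big [RHS]exchange_big; apply: eq_bigr => j _ /=.
under eq_bigr => y _ do rewrite -mulrA.
under [RHS]eq_bigr => y _ do rewrite mulrCA.
rewrite -!big_distrr /=; congr (_ * _); rewrite tp_mul.
have inv : involutive (fun y : W => (permf p l y)).
  by move=> y; apply/ffunP => m; rewrite !ffunE tpermK.
rewrite (reindex_inj (inv_inj inv)).
transitivity (\sum_(y : W) tp (mij (fun t => map_mx u (rho t)) i j p l) x y * tp (fun _ => G') y (permf p l z)).
  apply: eq_bigr => y _; rewrite inv; congr (_ * _).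
  rewrite -(tp_perm _ _ _ (tperm p l)) /=; congr tp; apply/ffunP => m; by rewrite !ffunE ?tpermK.
rewrite tp_mul; apply: eq_tp => m a c; rewrite /mij.
case: (m == p).
  by rewrite -rhoG; apply: eq_bigr => b _; rewrite mxE.
case: (m == l).
  by rewrite -rhoG; apply: eq_bigr => b _; rewrite mxE.
rewrite (sum_deltal (G' a)) -[RHS](sum_deltal (fun b => G' b c) a); apply: eq_bigr => b _.
by rewrite mulrC eq_sym.
Qed.

Lemma antisymP (f : W -> E) : antisym f <-> forall p l y, p != l -> goldop f p l y + f y = 0.
Proof.
have add p l z : p != l -> coordz (fun y => goldop f p l y + f y) z = coordz f (swz p l z) + coordz f z.
  move=> pl; rewrite -coordz_goldop // /coordz -big_split; apply: eq_bigr => x _.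
  by rewrite mulrDl.
split=> [h p l y pl|h p l z pl].
  by apply: (coordz_eq0 (f := fun y => goldop f p l y + f y)) => z; rewrite add // h // addNr.
apply/eqP; rewrite -addr_eq0 -add //; apply/eqP; rewrite /coordz big1 // => x _.
by rewrite h // mul0r.
Qed.

Lemma antisym_kermx (v : 'rV[E]_#|{: W}|) : v *m map_mx u anti_mx = 0 <-> antisym (fun x => v 0 (enum_rank x)).
Proof.
have key y p l : (v *m map_mx u anti_mx) 0 (enum_rank (y, (p, l))) =
    if p == l then 0 else goldop (fun x => v 0 (enum_rank x)) p l y + v 0 (enum_rank y).
  rewrite mxE /anti_mx; under eq_bigr => x _ do rewrite !mxE enum_rankK.
  case: ifP => pl; first by rewrite big1 // => x _; rewrite rmorph0 mulr0.
  rewrite -(sum_deltal (fun y => v 0 (enum_rank y)) y) /goldop -big_split -[RHS]sum_enum.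
  apply: eq_bigr => x _; rewrite enum_valK /= -mulrDr rmorphD rmorph_nat; congr (_ * (_ + _)).
  rewrite rmorph_sum; apply: eq_bigr => i _; rewrite rmorph_sum; apply: eq_bigr => j _.
  rewrite rmorphM rmorph_prod; congr (_ * _); apply: eq_bigr => m _.
  by rewrite /mij !mxE; case: (m == p) => //; case: (m == l) => //; rewrite rmorph_nat.
rewrite antisymP; split=> [h p l y pl|h].
  by have := key y p l; rewrite h mxE (negPf pl) => <-.
apply/rowP => x; rewrite -(enum_valK x); case: (enum_val x) => y [p l]; rewrite key mxE.
by case: eqVneq => // pl; exact: h.
Qed.

(** A coordinate with a repeated second component is its own negative, hence zero as 2 is
    invertible; one whose second components form a permutation agrees up to sign with one where they
    form the identity. *)
Lemma antisym_id0 f : antisym f -> (forall P, coordz f (mkz P id) = 0) -> forall x, f x = 0.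
Proof.
move=> hf h0; apply: coordz_eq0 => z.
have twoE : 2%:R != 0 :> E by rewrite -(rmorph_nat u) fmorph_eq0.
pose P := [ffun m => (z m).1]; pose Q := [ffun m => (z m).2].
have zE : z = mkz P Q by apply/ffunP => m; rewrite !ffunE; case: (z m).
have [/injectiveP inj|] := boolP (injectiveb Q).
  have [ts sE dts] := prod_tpermP (perm inj).
  have -> : z = mkz P (\prod_(t <- ts) tperm t.1 t.2)%g.
    by rewrite zE -sE; apply/ffunP => m; rewrite !ffunE permE ffunE.
  elim: ts {sE} dts => [_|t ts IH /= /andP [dt dts]].
    by rewrite big_nil -(h0 P); congr coordz; apply/ffunP => m; rewrite !ffunE perm1.
  rewrite big_cons; have -> : mkz P (tperm t.1 t.2 * \prod_(t <- ts) tperm t.1 t.2)%g =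
     swz t.1 t.2 (mkz P (\prod_(t <- ts) tperm t.1 t.2)%g).
    by rewrite swz_mkz; apply/ffunP => m; rewrite !ffunE permM.
  by rewrite hf // IH // oppr0.
move/injectivePn => [p [l pl Qpl]].
have := hf p l z pl; have -> : swz p l z = z.
  apply/ffunP => m; rewrite !ffunE; case: tpermP => [->|->|]; last by case: (z m).
    by move: Qpl; rewrite !ffunE => <-; case: (z p).
  by move: Qpl; rewrite !ffunE => ->; case: (z l).
move/eqP; rewrite -addr_eq0 -mulr2n -mulr_natl mulf_eq0 (negPf twoE) => /eqP //.
Qed.

(** The witness is a basis tensor in the E^N parts times the determinant tensor in the E^r parts. *)
Lemma antisym_det (P : {ffun 'I_r -> 'I_N}) : exists f, antisym f /\ exists x, f x != 0.
Proof.
pose g (z : {ffun 'I_r -> Z}) : E := [forall m, (z m).1 == P m]%:R * \det (\matrix_(a, b) ((z a).2 == b)%:R).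
exists (fun x => \sum_z g z * tp (fun _ => G) z x); split.
  move=> p l z pl; rewrite !coordz_inv /g -mulrN; congr (_ * _).
    by congr (_%:R); congr nat_of_bool; apply: eq_forallb => m; rewrite ffunE.
  have -> : \matrix_(a, b) ((swz p l z a).2 == b)%:R = row_perm (tperm p l) (\matrix_(a, b) ((z a).2 == b)%:R) :> 'M[E]_r.
    by apply/matrixP => a b; rewrite !mxE ffunE.
  by rewrite row_permE det_mulmx det_perm odd_tperm pl expr1 mulN1r.
apply: contrapT => h0.
have : g (mkz P id) = 0.
  rewrite -coordz_inv /coordz big1 // => x _; case: (eqVneq (\sum_z g z * tp (fun _ => G) z x) 0) => [->|n0].
    by rewrite mul0r.
  by case: h0; exists x.
rewrite /g; have -> : [forall m, (mkz P id m).1 == P m] by apply/forallP => m; rewrite ffunE.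
have -> : \matrix_(a, b) ((mkz P id a).2 == b)%:R = 1%:M :> 'M[E]_r.
  by apply/matrixP => a b; rewrite !mxE ffunE.
by rewrite det1 mulr1 => /eqP; rewrite oner_eq0.
Qed.
End Coordinates.

(** Over [E] the antisymmetric tensors are the r-th tensor power of E^N times the top exterior power
    of E^r, of dimension N^r. It is enough that they are nonzero and of dimension at most N^r, since
    the dimension is a multiple of the degree N^r of the tensor power. *)
Theorem antisymmetric_power : exists B : {ffun 'I_r -> T} -> 'M[k]_(N ^ r), is_rep (tpow X r) (tunit r e) B.
Proof.
have [G [G' [GG' G'G rhoG]]] := split_basis; have [_ _ _ N0] := hs.
have tE := tpow_rep r hr.
have mapE t (v : 'rV[k]_#|{: W}|) x :
   map_mx u (v *m tpmx rho t) 0 (enum_rank x) =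
   \sum_y map_mx u v 0 (enum_rank y) * tp (fun l a b => u (rho (t l) a b)) y x.
  rewrite !mxE rmorph_sum -[RHS]sum_enum; apply: eq_bigr => y _.
  rewrite !mxE rmorphM enum_valK enum_rankK; congr (_ * _).
  by rewrite rmorph_prod.
pose K := kermx anti_mx.
have [|B [hB BU]] := subrep (U := row_base K) tE (row_base_free _).
  move=> t; rewrite eq_row_base (eqmxMr _ (eq_row_base _)); apply/row_subP => i.
  rewrite row_mul; apply/sub_kermxP/eqP; rewrite -(map_mx_eq0 u) map_mxM; apply/eqP.
  apply/(antisym_kermx G'G rhoG).
  have : row i K *m anti_mx = 0 by apply/sub_kermxP; exact: row_sub.
  move/(congr1 (map_mx u)); rewrite map_mxM raddf0 => /(antisym_kermx G'G rhoG).
  move/(antisym_rho rhoG (fun l => t l)); rewrite /antisym => h p l z pl.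
  have := h p l z pl; rewrite /coordz => {}h.
  transitivity (\sum_x (\sum_x0 map_mx u (row i K) 0 (enum_rank x0) *
      tp (fun l a b => u (rho (t l) a b)) x0 x) * tp (fun=> G') x (swz p l z)).
    by apply: eq_bigr => x _; rewrite mapE.
  by rewrite h; congr (- _); apply: eq_bigr => x _; rewrite mapE.
have c0 : (0 < \rank K)%N.
  have [f [af [x fx]]] := antisym_det GG' [ffun=> Ordinal N0].
  rewrite lt0n mxrank_eq0 -(map_mx_eq0 u) map_kermx; apply/rowV0Pn.
  exists (\row_a f (enum_val a)).
    apply/sub_kermxP/(antisym_kermx G'G rhoG) => p l z pl.
    have E1 z' : coordz G' (fun x0 => (\row_a f (enum_val a)) 0 (enum_rank x0)) z' = coordz G' f z'.
      by apply: eq_bigr => y _; rewrite mxE enum_rankK.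
    by rewrite !E1 af.
  by apply: contraNneq fx => /rowP /(_ (enum_rank x)); rewrite !mxE enum_rankK => ->.
(* By [antisym_id0] the N^r coordinates with identity second components are injective on the
   kernel. *)
have cle : (\rank K <= N ^ r)%N.
  pose U := map_mx u (row_base K).
  pose Phi : 'M[E]_(#|{: W}|, #|{: {ffun 'I_r -> 'I_N}}|) :=
    \matrix_(x, P) tp (fun _ => G') (enum_val x) (mkz (enum_val P) id).
  have : row_free (U *m Phi).
    rewrite -kermx_eq0; apply/rowV0P => y /sub_kermxP; rewrite mulmxA => yU.
    have v0 : y *m U = 0.
      have aU : y *m U *m map_mx u anti_mx = 0.
        rewrite -mulmxA -map_mxM; have /sub_kermxP -> : (row_base K <= K)%MS by rewrite eq_row_base.
        by rewrite raddf0 mulmx0.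
      have /(antisym_kermx G'G rhoG) af := aU.
      apply/rowP => x; rewrite [RHS]mxE -(enum_valK x).
      apply: (antisym_id0 G'G af _ (enum_val x)) => P.
      move/rowP/(_ (enum_rank P)): yU; rewrite [LHS]mxE [RHS]mxE => E0; rewrite -[RHS]E0.
      by rewrite /coordz -sum_enum; apply: eq_bigr => a _; rewrite enum_valK [Phi _ _]mxE enum_rankK.
    by apply/eqP; move/eqP: v0; rewrite mulmx_free_eq0 // row_free_map row_base_free.
  by move/eqP => rU; have := rank_leq_col (U *m Phi); rewrite rU [X in (_ <= X)%N]card_ffun !card_ord.
have hsT : splitrep (base u (tpow X r)) (bmap u (tunit r e)) (tpmx w).
  by rewrite base_tpow bmap_tunit; exact: tpow_split.
have [m mE [m0 _]] := rep_dim_descent (s := idfun) (u := u) (t := u) (fun a => erefl) hsT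
  (is_rep_id hB) c0.
have cE : \rank K = (N ^ r)%N.
  apply/eqP; rewrite eqn_leq cle mE [X in (_ <= X * _)%N]card_ffun !card_ord.
  by rewrite -{1}[(N ^ r)%N]muln1 leq_pmul2l ?expn_gt0 ?N0.
by move: B hB {BU}; rewrite cE => B hB; exists B.
Qed.
End Goldman.

(** * Reduced characteristic polynomial and reduced trace *)

Section Stack.
Variables (R : comNzRingType) (m n : nat).
Fixpoint kron (A : 'M[R]_m) r : 'M[R]_(r * m) :=
  if r is r'.+1 then block_mx A 0 0 (kron A r') else 1%:M.
Fixpoint stack (U : nat -> 'M[R]_(m, n)) r : 'M[R]_(r * m, n) :=
  if r is r'.+1 then col_mx (U r') (stack U r') else 0.

Lemma stack_mul (A : 'M[R]_m) (L : 'M[R]_n) U r : (forall i, U i *m L = A *m U i) ->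
  stack U r *m L = kron A r *m stack U r.
Proof.
move=> h; elim: r => [|r IH] /=; first by rewrite mul0mx mulmx0.
by rewrite mul_col_mx mul_block_col !mul0mx addr0 add0r h IH.
Qed.

Lemma det_kron (A : 'M[R]_m) r : \det (kron A r) = \det A ^+ r.
Proof. by elim: r => [|r IH] /=; rewrite ?det1 // det_ublock IH exprS. Qed.
End Stack.

Lemma stack_sub (k : fieldType) m n (U : nat -> 'M[k]_(m, n)) r i : (i < r)%N -> (U i <= stack U r)%MS.
Proof.
elim: r => // r IH; rewrite ltnS leq_eqVlt /= -addsmxE => /orP [/eqP ->|/IH h].
  exact: addsmxSl.
exact: submx_trans h (addsmxSr _ _).
Qed.

Lemma map_stack (k R : comNzRingType) (f : {rmorphism k -> R}) m n (U : nat -> 'M[k]_(m, n)) r :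
  map_mx f (stack U r) = stack (fun i => map_mx f (U i)) r.
Proof. by elim: r => [|r IH] /=; rewrite ?map_mx0 // map_col_mx IH. Qed.

(** As a right module over itself the matrix algebra is the sum of its [N] row spaces, each a copy
    of the standard representation; [P] collects their bases. *)
Lemma char_poly_split (k : fieldType) (T : finType) (X : salg k T) (e : vec k T) (N : nat) (w : T -> 'M[k]_N)
  (b : 'I_(N * N) -> T) (b' : T -> 'I_(N * N)) (x : vec k T) :
  cancel b b' -> cancel b' b -> splitrep X e w ->
  char_poly (Rmx X b x) = char_poly (repev w x) ^+ N.
Proof.
move=> bK b'K hs; have [hw _ _ _] := hs.
have /choice [c hc] (z : 'I_N * 'I_N) : exists c, delta_mx z.1 z.2 = repev w c by exact: split_surj hs _.
have inj u v : repev w u = repev w v -> u = v.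
  move=> E; apply/eqP; rewrite -subr_eq0; apply/eqP/(split_inj hs).
  have -> : u - v = u + vscale (-1) v by apply/ffunP => t; rewrite !ffunE mulN1r.
  by rewrite repevD repevZ E scaleN1r subrr.
(* The elementary matrices of row i; for i out of range the value 0 is only a default. *)
pose U (i : nat) : 'M[k]_(N, N * N) := \matrix_a toR b (if insub i is Some i' then c (i', a) else 0).
have hU i : U i *m Rmx X b x = repev w x *m U i.
  apply/row_matrixP => a; rewrite !row_mul rowK (RmxE _ bK b'K) mulmx_sum_row.
  case E0 : (insub i) => [i'|]; last first.
    by rewrite amul0l toR0 big1 // => j _; rewrite rowK E0 toR0 scaler0.
  transitivity (toR b (\sum_j vscale (repev w x a j) (c (i', j)))); last first.
    rewrite toR_sum; apply: eq_bigr => j _; by rewrite rowK E0 toRZ !mxE.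
  congr toR; apply: inj; rewrite (repev_mul hw) -hc repev_sum.
  apply/matrixP => p q; rewrite summxE mxE (bigD1 a) //= big1 ?addr0 => [|j ja]; last first.
    by rewrite mxE (negPf ja) andbF mul0r.
  rewrite mxE eqxx andbT (bigD1 q) //= big1 ?addr0 => [|j jq]; last first.
    by rewrite repevZ -hc !mxE [q == j]eq_sym (negPf jq) andbF mulr0.
  by rewrite repevZ -hc !mxE eqxx andbT mulrC.
pose P := stack U N.
have Pu : P \in unitmx.
  rewrite -row_full_unit -sub1mx; apply/row_subP => i.
  pose v : vec k T := ofR b' (row i 1%:M).
  have -> : row i 1%:M = toR b v by rewrite ofRK.
  have -> : v = \sum_p \sum_a vscale (repev w v p a) (c (p, a)).
    apply: inj; rewrite repev_sum [LHS]matrix_sum_delta; apply: eq_bigr => p _.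
    by rewrite repev_sum; apply: eq_bigr => a _; rewrite repevZ -hc.
  rewrite toR_sum; apply: summx_sub => p _; rewrite toR_sum; apply: summx_sub => a _.
  rewrite toRZ; apply: scalemx_sub; apply: submx_trans (stack_sub U (ltn_ord p)).
  have -> : toR b (c (p, a)) = row a (U p).
    by rewrite rowK; case: insubP => [p' _ /val_inj -> //|]; rewrite ltn_ord.
  exact: row_sub.
have := stack_mul (U := fun i => map_mx polyC (U i)) (A := char_poly_mx (repev w x))
   (L := char_poly_mx (Rmx X b x)) N.
rewrite -map_stack -/P /char_poly => E.
have /(congr1 determinant) : map_mx polyC P *m char_poly_mx (Rmx X b x) =
    kron (char_poly_mx (repev w x)) N *m map_mx polyC P.
  apply: E => i; rewrite /char_poly_mx mulmxBr mulmxBl -!map_mxM hU.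
  by rewrite scalar_mxC.
rewrite !det_mulmx det_kron mulrC => /mulIf; apply.
by rewrite det_map_mx polyC_eq0 -unitfE -unitmxE.
Qed.

Section TopCoef.
Variable (R : idomainType).
Implicit Types f g : {poly R}.
(** A monic polynomial with nothing between degrees d + q and d. With q a power of the
    characteristic, such a gap allows the trace to be read off a power of a characteristic
    polynomial even if the characteristic divides [N]. *)
Definition top q (a : R) d f := exists2 r : {poly R}, f = 'X^(d + q) + a *: 'X^d + r & (size r <= d)%N.

Lemma top_coef q a d f : (0 < q)%N -> top q a d f -> f`_d = a.
Proof.
move=> q0 [r -> sr]; rewrite !coefD coefZ !coefXn eqxx mulr1 nth_default // addr0.
by rewrite -{1}[d]addn0 eqn_add2l eq_sym gtn_eqF // add0r.
Qed.

Lemma top_mul q a d f b d' g : (0 < q)%N -> top q a d f -> top q b d' g ->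
  top q (a + b) (d + d' + q) (f * g).
Proof.
move=> q0 [r -> sr] [r' -> sr'].
have sXM i j (p : {poly R}) : (size p <= j)%N -> (size (('X^i : {poly R}) * p)%R <= i + j)%N.
  by move=> sp; apply: leq_trans (size_polyMleq _ _) _; rewrite size_polyXn addSn /= leq_add2l.
exists ((a * b)%:P * 'X^(d + d') + 'X^(d + q) * r' + 'X^(d' + q) * r + a%:P * ('X^d * r') + b%:P * ('X^d' * r) + r * r').
  rewrite -!mul_polyC polyCM polyCD !exprD; ring.
have szZ (c : R) (p : {poly R}) j : (size p <= j)%N -> (size (c%:P * p)%R <= j)%N.
  by rewrite mul_polyC; exact: leq_trans (size_scale_leq _ _).
have szD (p p' : {poly R}) j : (size p <= j)%N -> (size p' <= j)%N -> (size (p + p')%R <= j)%N.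
  by move=> h h'; rewrite (leq_trans (size_polyD _ _)) // geq_max h h'.
have le i j (p : {poly R}) : (size p <= i)%N -> (i <= j)%N -> (size p <= j)%N by exact: leq_trans.
repeat apply: (szD _ _ _).

- by apply: (szZ); rewrite size_polyXn; lia.
- by apply: le (sXM _ _ _ sr') _; lia.
- by apply: le (sXM _ _ _ sr) _; lia.
- by apply: (szZ); apply: le (sXM _ _ _ sr') _; lia.
- by apply: (szZ); apply: le (sXM _ _ _ sr) _; lia.
by apply: le (size_polyMleq _ _) _; lia.
Qed.

Lemma top_exp q a d f m : (0 < q)%N -> top q a d f -> exists d', top q (a *+ m.+1) d' (f ^+ m.+1).
Proof.
move=> q0 hf; elim: m => [|m [d' IH]]; first by exists d; rewrite expr1.
by exists (d + d' + q)%N; rewrite exprS mulrS; exact: top_mul.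
Qed.

(** The q-th power is additive and stretches a gap of length 1 to length q. *)
Lemma top_frobenius q a d f : [pchar R].-nat q -> top 1 a d f -> top q (a ^+ q) (d * q) (f ^+ q).
Proof.
move=> hq [r -> sr]; have q0 : (0 < q)%N by case/andP: hq.
have hq' : [pchar {poly R}].-nat q.
  by apply: sub_in_pnat hq => p _ hp; rewrite (rmorph_pchar polyC).
exists (r ^+ q); last first.
  case: (eqVneq r 0) => [->|r0]; first by rewrite expr0n gtn_eqF // size_poly0.
  apply: leq_trans (size_poly_exp_leq _ _) _; have : (0 < size r)%N by rewrite size_poly_gt0.
  nia.
rewrite !exprDn_pchar // exprZn -!exprM mulnDl mul1n.
by [].
Qed.
End TopCoef.

Section ReducedTrace.
Variables (F : fieldType) (K : fieldExtType F).
Hypothesis sepK : separable 1%VS {: K}.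
Variables (T : finType) (C : salg F T) (e : vec F T) (N : nat) (w : T -> 'M[K]_N).
Hypothesis (hs : splitrep (base (in_alg K) C) (bmap (in_alg K) e) w).

(** Such an x is purely inseparable over F, yet lies in a separable extension. *)
Lemma inseparable_base (x : K) q c : [pchar K].-nat q -> x ^+ q = c%:A -> exists a, x = a%:A.
Proof.
move=> hq xq; have : x \in (1%AS : {vspace K}).
  rewrite -separable_inseparable_element; apply/andP; split.
    by move/separableP: sepK; apply; exact: memvf.
  by apply/purely_inseparable_elementP_pchar; exists q => //; rewrite xq; apply: rpredZ; exact: rpred1.
by case/vlineP => a ->; exists a.
Qed.

(** If N vanishes in F, q is the p-part of N for the characteristic p; otherwise q = 1. *)
Lemma nat_split : (0 < N)%N -> exists q m, [/\ N = (m.+1 * q)%N, [pchar K].-nat q & m.+1%:R != 0 :> F].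
Proof.
move=> N0; case: (eqVneq (N%:R : F) 0) => [n0|n0]; last by exists 1%N, N.-1; rewrite prednK ?muln1.
have [p hp] := natf0_pchar N0 (introT eqP n0).
have m0 : (0 < N`_p^')%N by rewrite part_gt0.
exists (N`_p)%N, (N`_p^').-1%N; rewrite prednK //; split.
- by rewrite mulnC partnC.
- apply: sub_in_pnat (part_pnat p N) => l _ /eqP ->; by rewrite pchar_lalg.
rewrite -(dvdn_pcharf hp); have := part_pnat p^' N; rewrite p'natE //.
exact: pcharf_prime hp.
Qed.

(** The N-th power of the characteristic polynomial of w t is that of a right multiplication, so its
    coefficients lie in F. For N = (m+1) q one of them is (m+1) times the q-th power of minus the
    trace; separability of [K] brings the trace itself into F. *)
Lemma reduced_trace t : exists a : F, \tr (w t) = a%:A.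
Proof.
have [hw cT _ N0] := hs.
pose b (i : 'I_(N * N)) : T := enum_val (cast_ord (esym cT) i).
pose b' (i : T) : 'I_(N * N) := cast_ord cT (enum_rank i).
have bK : cancel b b' by move=> i; rewrite /b /b' enum_valK cast_ordKV.
have b'K : cancel b' b by move=> i; rewrite /b /b' cast_ordK enum_rankK.
have := char_poly_split (bvec K t) bK b'K hs; rewrite repev_bvec.
have -> : Rmx (base (in_alg K) C) b (bvec K t) = map_mx (in_alg K) (Rmx C b (bvec F t)).
  by apply/matrixP => p q; rewrite !mxE !amul_bvec.
rewrite -map_char_poly => E.
have htop : top 1 (- \tr (w t)) N.-1 (char_poly (w t)).
  exists (char_poly (w t) - 'X^N + \tr (w t) *: 'X^(N.-1)).
    by rewrite addn1 prednK // scaleNr; ring.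
  apply/leq_sizeP => i; rewrite leq_eqVlt => /orP [/eqP <-|iN].
    rewrite !coefD coefN coefZ !coefXn eqxx mulr1 char_poly_trace // ltn_eqF ?prednK // subr0.
    by rewrite addNr.
  rewrite !coefD coefN coefZ !coefXn.
  have [->|iN'] := eqVneq i N.
    have := char_poly_monic (w t); rewrite monicE /lead_coef size_char_poly /= => /eqP ->.
    by rewrite subrr gtn_eqF ?mulr0 ?addr0 // prednK.
  rewrite nth_default ?size_char_poly; last by move: iN iN'; lia.
  by rewrite gtn_eqF // mulr0 subr0 addr0.
have [q [m [NE hq m0]]] := nat_split N0.
have q0 : (0 < q)%N by case/andP: hq.
have [d' hd] := top_exp m q0 (top_frobenius hq htop).
have := top_coef q0 hd; rewrite -exprM mulnC -NE -E coef_map /= => E2.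
have [a aE] : exists a, - \tr (w t) = a%:A.
  apply: (inseparable_base (q := q) (c := (char_poly (Rmx C b (bvec F t)))`_d' / m.+1%:R) hq).
  have m0' : m.+1%:R != 0 :> K by rewrite -(rmorph_nat (in_alg K)) fmorph_eq0.
  apply: (mulIf m0'); rewrite -[_%:A]/(in_alg K _) fmorph_div rmorph_nat divfK //.
  by rewrite mulr_natr -E2.
by exists (- a); rewrite scaleNr -aE opprK.
Qed.

Lemma trace_nondegenerate (k : fieldType) (X : salg k T) e' (w' : T -> 'M[k]_N) D : splitrep X e' w' ->
  (forall l, \tr (D *m w' l) = 0) -> D = 0.
Proof.
move=> hs' h; have hM M : \tr (D *m M) = 0.
  have [c ->] := split_surj hs' M; rewrite mulmx_sumr raddf_sum big1 // => l _.
  by rewrite /= -scalemxAr mxtraceZ h mulr0.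
apply/matrixP => p q; rewrite mxE -[RHS](hM (delta_mx q p)) /mxtrace (bigD1 p) //= big1 ?addr0.
  rewrite mxE (bigD1 q) //= big1 ?addr0 => [|j jq]; first by rewrite mxE !eqxx mulr1.
  by rewrite mxE (negPf jq) mulr0.
by move=> i ip; rewrite mxE big1 // => j _; rewrite mxE (negPf ip) andbF mulr0.
Qed.

(* The inverse of the Gram matrix of the reduced trace form. *)
Lemma goldman_element : exists Gam : T -> T -> F, forall a b c d,
  \sum_i \sum_j (Gam i j)%:A * (w i a b * w j c d) = (c == b)%:R * (d == a)%:R.
Proof.
have [hw cT _ N0] := hs; have /choice [th hth] := reduced_trace.
pose t i j := \sum_l sc C i j l * th l.
have tE i j : \tr (w i *m w j) = (t i j)%:A.
  rewrite hw.1 raddf_sum -[RHS]/(in_alg K _) rmorph_sum; apply: eq_bigr => l _.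
  by rewrite /= mxtraceZ hth -[in RHS]/(in_alg K _) rmorphM.
pose M : 'M[F]_#|T| := \matrix_(i, j) t (enum_val i) (enum_val j).
have Mu : M \in unitmx.
  rewrite -row_free_unit -kermx_eq0; apply/rowV0P => v /sub_kermxP vM.
  pose x : vec K T := [ffun i => (v 0 (enum_rank i))%:A].
  suff /(split_inj hs) x0 : repev w x = 0.
    apply/rowP => i; have /ffunP /(_ (enum_val i)) := x0; rewrite !ffunE enum_valK mxE => /eqP.
    by rewrite -[_%:A]/(in_alg K _) fmorph_eq0 => /eqP.
  apply: (trace_nondegenerate hs) => l; move/rowP/(_ (enum_rank l)): vM; rewrite !mxE => E0.
  rewrite -[RHS](rmorph0 (in_alg K)) -E0 rmorph_sum mulmx_suml raddf_sum.
  rewrite (reindex (@enum_val T T)) /=; last by apply: onW_bij; exact: enum_val_bij.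
  apply: eq_bigr => i _; rewrite ffunE enum_valK -scalemxAl mxtraceZ tE.
  by rewrite mxE enum_rankK -[RHS]/(in_alg K _) rmorphM.
exists (fun i j => invmx M (enum_rank i) (enum_rank j)) => a b c d.
pose y := \sum_i \sum_j ((invmx M (enum_rank i) (enum_rank j))%:A * w i a b) *: w j.
have yE : y = delta_mx b a.
  apply/eqP; rewrite -subr_eq0; apply/eqP/(trace_nondegenerate hs) => l.
  rewrite mulmxBl raddfB /=; apply/eqP; rewrite subr_eq0; apply/eqP.
  transitivity (w l a b); last first.
    rewrite /mxtrace (bigD1 b) //= big1 ?addr0 => [|i ib]; last first.
      by rewrite mxE big1 // => j _; rewrite mxE (negPf ib) mul0r.
    rewrite mxE (bigD1 a) //= big1 ?addr0 => [|j ja]; first by rewrite mxE !eqxx mul1r.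
    by rewrite mxE (negPf ja) andbF mul0r.
  rewrite mulmx_suml raddf_sum /=.
  transitivity (\sum_i (i == l)%:R * w i a b).
    apply: eq_bigr => i _; rewrite mulmx_suml raddf_sum /=.
    have := mulVmx Mu => /matrixP /(_ (enum_rank i) (enum_rank l)); rewrite !mxE => E0.
    rewrite -(inj_eq enum_rank_inj) -(rmorph_nat (in_alg K)) -E0 rmorph_sum mulr_suml.
    rewrite (reindex (@enum_val T T)) /=; last by apply: onW_bij; exact: enum_val_bij.
    apply: eq_bigr => j _; rewrite -scalemxAl mxtraceZ tE enum_valK mxE enum_rankK.
    by rewrite -[in RHS]/(in_alg K _) rmorphM mulrAC.
  rewrite (bigD1 l) //= eqxx mul1r big1 ?addr0 // => i il.
  by rewrite (negPf il) mul0r.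
transitivity (y c d); last by rewrite yE mxE -natrM mulnb.
rewrite summxE; apply: eq_bigr => i _; rewrite summxE; apply: eq_bigr => j _.
by rewrite mxE mulrA.
Qed.
End ReducedTrace.

(** * Degree and exponent *)

Section Matalg.
Variables (k : fieldType) (d : nat).
Definition vmat (u : vec k ('I_d * 'I_d)%type) : 'M[k]_d := \matrix_(a, b) u (a, b).
Lemma vmat_inj : injective vmat.
Proof. by move=> u v /matrixP E; apply/ffunP => -[a b]; have := E a b; rewrite !mxE. Qed.
Lemma vmat_mul u v : vmat (amul (matalg k d) u v) = vmat u *m vmat v.
Proof.
apply/matrixP => a b; rewrite !mxE ffunE.
transitivity (\sum_(i : 'I_d * 'I_d) \sum_j u i * v j * sc (matalg k d) i j (a, b)); first by [].
rewrite (eq_bigr (fun i : 'I_d * 'I_d => u (i.1, i.2) * v (i.2, b) * (i.1 == a)%:R)); last first.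
  move=> [p c] _ /=; rewrite (bigD1 (c, b)) //= !eqxx big1 ?addr0.
    by rewrite andbT eq_sym; case: eqVneq.
  move=> [c' b'] /= h; case: ifP; rewrite ?mulr0 // => /and3P [/eqP cc _ /eqP bb].
  by move: h; rewrite cc bb eqxx.
rewrite -(pair_bigA _ (fun p c => u (p, c) * v (c, b) * (p == a)%:R)) (bigD1 a) //= [X in _ + X]big1 ?addr0.
  by apply: eq_bigr => c _; rewrite eqxx mulr1 !mxE.
by move=> p pa; rewrite big1 // => c _; rewrite (negPf pa) mulr0.
Qed.
Lemma vmat_sum (U : Type) (r : seq U) (c : U -> k) (u : U -> vec k ('I_d * 'I_d)%type) :
  vmat (\sum_(t <- r) vscale (c t) (u t)) = \sum_(t <- r) c t *: vmat (u t).
Proof.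
elim: r => [|t r IH]; first by rewrite !big_nil; apply/matrixP => a b; rewrite !mxE ffunE.
by rewrite !big_cons -IH; apply/matrixP => a b; rewrite !mxE !ffunE.
Qed.
Definition matv (M : 'M[k]_d) : vec k ('I_d * 'I_d)%type := [ffun z => M z.1 z.2].
Lemma matvK : cancel matv vmat.
Proof. by move=> M; apply/matrixP => a b; rewrite mxE ffunE. Qed.
Lemma matalg_unit : is_unit_of (matalg k d) (matv 1%:M).
Proof. by move=> x; split; apply: vmat_inj; rewrite vmat_mul matvK ?mul1mx ?mulmx1. Qed.
End Matalg.

Lemma lin_sum (k : fieldType) (I J : finType) (M : I -> J -> k) (c : vec k I) :
  lin M c = \sum_i vscale (c i) (lin M (bvec k i)).
Proof.
apply/ffunP => j; rewrite sum_ffunE ffunE; apply: eq_bigr => i _; rewrite !ffunE.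
rewrite (bigD1 i) //= ffunE eqxx mul1r big1 ?addr0 // => l li.
by rewrite ffunE eq_sym (negPf li) mul0r.
Qed.

Lemma brauer_splitrep (k : fieldType) (T : finType) (X : salg k T) (e : vec k T) :
  is_unit_of X e -> (0 < #|T|)%N ->
  brauer_trivial X <-> exists d (w : T -> 'M[k]_d), splitrep X e w.
Proof.
move=> ue T0; split=> [[d [M [N [[hm [e' [ue' uM]]] [NM MN]]]]]|[d [w hs]]].
  have eE := unit_uniq ue' ue; rewrite eE {e' ue' eE} in uM.
  exists d, (fun t => vmat (lin M (bvec k t))).
  have vE c : vmat (lin M c) = repev (fun t => vmat (lin M (bvec k t))) c.
    by rewrite lin_sum vmat_sum.
  have Mx1 : (#|T| <= #|{: 'I_d * 'I_d}|)%N /\ (#|{: 'I_d * 'I_d}| <= #|T|)%N.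
    pose Mx := \matrix_(i < #|T|, j < #|{: 'I_d * 'I_d}|) M (enum_val i) (enum_val j).
    pose Nx := \matrix_(i < #|{: 'I_d * 'I_d}|, j < #|T|) N (enum_val i) (enum_val j).
    have prod (I J : finType) (P : I -> J -> k) (Q : J -> I -> k) : (forall u, lin Q (lin P u) = u) ->
       (\matrix_(i < #|I|, j < #|J|) P (enum_val i) (enum_val j)) *m (\matrix_(i < #|J|, j < #|I|) Q (enum_val i) (enum_val j)) = 1%:M :> 'M[k]_#|I|.
      move=> h; apply/matrixP => a b; rewrite !mxE.
      have /ffunP /(_ (enum_val b)) := h (bvec k (enum_val a)); rewrite !ffunE (inj_eq enum_val_inj) => <-.
      rewrite -[RHS]sum_enum; apply: eq_bigr => j _; rewrite !mxE ffunE; congr (_ * _).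
      rewrite (bigD1 (enum_val a)) //= ffunE eqxx mul1r big1 ?addr0 // => i ia.
      by rewrite ffunE eq_sym (negPf ia) mul0r.
    by split; [have := mulmx1_min (prod _ _ M N NM)|have := mulmx1_min (prod _ _ N M MN)].
  have cT : #|T| = (d * d)%N by have [] := Mx1; rewrite card_prod !card_ord; lia.
  split=> //; last by case: d {hm uM NM MN M N vE Mx1} cT => // cT; rewrite cT in T0.
    split=> [i j|]; last first.
      by rewrite -/(repev _ e) -vE (unit_uniq uM (@matalg_unit k d)) matvK.
    rewrite -vmat_mul -hm vE; apply: eq_bigr => l _.
    by rewrite amul_bvec.
  rewrite -kermx_eq0; apply/rowV0P => c /sub_kermxP cM.
  pose c' : vec k T := [ffun t => c 0 (enum_rank t)].
  suff : c' = 0.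
    by move/ffunP => c0; apply/rowP => i; have := c0 (enum_val i); rewrite !ffunE enum_valK mxE.
  rewrite -(NM c'); have -> : lin M c' = 0.
    apply: vmat_inj; rewrite vE.
    have -> : repev (fun t => vmat (lin M (bvec k t))) c' = 0.
      apply: (can_inj mxvecK); rewrite raddf0 -[RHS]cM mulmx_sum_row /repev raddf_sum.
      rewrite (reindex (@enum_val T T)) /=; last by apply: onW_bij; exact: enum_val_bij.
      by apply: eq_bigr => i _; rewrite rowK ffunE enum_valK; exact: linearZ.
    by apply/matrixP => a b; rewrite !mxE ffunE.
  by apply/ffunP => t; rewrite !ffunE big1 // => z _; rewrite ffunE mul0r.
have [hw cT fw d0] := hs; exists d.
pose M t (z : 'I_d * 'I_d) := w t z.1 z.2.
have ME c : lin M c = matv (repev w c).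
  by apply/ffunP => z; rewrite !ffunE summxE; apply: eq_bigr => t _; rewrite mxE.
have [D hD] := row_freeP fw.
have hD' : D *m wmx w = 1%:M.
  move: (wmx w) D hD fw => W; move: W; rewrite cT => W D hD _; exact: mulmx1C.
exists M, (fun z t => D (mxvec_index z.1 z.2) (enum_rank t)).
have NE (u : 'M[k]_d) : lin (fun (z : 'I_d * 'I_d) t => D (mxvec_index z.1 z.2) (enum_rank t)) (matv u) =
    [ffun t => (mxvec u *m D) 0 (enum_rank t)].
  apply/ffunP => t; rewrite !ffunE mxE [RHS](reindex _ (curry_mxvec_bij _ _)) /=.
  by apply: eq_bigr => -[a b] _ /=; rewrite ffunE mxvecE.
split.
  split=> [x y|]; first by rewrite !ME; apply: vmat_inj; rewrite vmat_mul !matvK (repev_mul hw).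
  by exists e; split=> //; rewrite ME (repev1 hw); exact: matalg_unit.
split=> [c|v]; last first.
  rewrite -{1}[v](_ : matv (vmat v) = v); last by apply/ffunP => -[a b]; rewrite ffunE mxE.
  rewrite NE ME; apply: vmat_inj; rewrite matvK.
  apply: (can_inj mxvecK); rewrite -(wmx_repev w) -[RHS]mulmx1 -hD' mulmxA; congr (_ *m _).
  by apply/rowP => i; rewrite !mxE ffunE enum_valK mxE.
rewrite ME NE; apply/ffunP => t; rewrite ffunE -(wmx_repev w) -mulmxA hD mulmx1 mxE.
by rewrite enum_rankK.
Qed.

Lemma splitrep_id (k : fieldType) (T : finType) (X : salg k T) (e : vec k T) n (rho : T -> 'M[k]_n) :
  splitrep X e rho -> splitrep (base idfun X) (bmap idfun e) rho.
Proof. by case=> h1 h2 h3 h4; split=> //; exact: is_rep_id. Qed.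

Lemma bmap_id (k : fieldType) (T : finType) (e : vec k T) : bmap idfun e = e.
Proof. by apply/ffunP => t; rewrite ffunE. Qed.

Lemma base_id (k : fieldType) (T : finType) (X : salg k T) : base idfun X = X.
Proof. by case: X. Qed.

Lemma splitrep_base (F L : fieldType) (u : {rmorphism F -> L}) (T : finType) (X : salg F T) (e : vec F T)
  n (w : T -> 'M[F]_n) : splitrep X e w -> splitrep (base u X) (bmap u e) (fun t => map_mx u (w t)).
Proof. by move=> h; apply: (splitrep_map (s := idfun) (u := u)) => //; exact: splitrep_id. Qed.

Lemma brauer_trivial_base (F L : fieldType) (u : {rmorphism F -> L}) (T : finType) (X : salg F T) e :
  is_unit_of X e -> (0 < #|T|)%N -> brauer_trivial X -> brauer_trivial (base u X).
Proof.
move=> ue T0 /(brauer_splitrep ue T0) [d [w hs]]; apply/(brauer_splitrep (base_unit u ue) T0).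
by exists d; eexists; exact: (splitrep_base u hs).
Qed.

(** The orbit map of a nonzero vector is injective because nonzero elements are invertible. *)
Lemma division_rep_dim (k : fieldType) (T : finType) (X : salg k T) (e : vec k T) n (rho : T -> 'M[k]_n) :
  is_algebra X -> is_unit_of X e -> nzd X -> is_rep X e rho -> (0 < n)%N -> (#|T| <= n)%N.
Proof.
move=> hX ue nX hr n0; pose v : 'rV[k]_n := delta_mx 0 (Ordinal n0).
pose M := \matrix_(i < #|T|) (v *m rho (enum_val i)).
suff : row_free M by move/eqP => <-; exact: rank_leq_col.
rewrite -kermx_eq0; apply/rowV0P => c /sub_kermxP cM; apply/eqP; apply: contraT => c0.
pose x : vec k T := ofR (@enum_rank T) c.
have x0 : x != 0.
  apply: contra_neq c0 => E0; rewrite -(ofRK (@enum_valK T) c) -/x E0; exact: toR0.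
have [y [xy _]] := nzd_inverse (@enum_valK T) (@enum_rankK T) hX nX x0 ue.
have vx : v *m repev rho x = 0.
  rewrite -[RHS]cM [RHS]mulmx_sum_row /repev mulmx_sumr (reindex (@enum_val T T)) /=; last first.
    by apply: onW_bij; exact: enum_val_bij.
  by apply: eq_bigr => i _; rewrite ffunE enum_valK rowK scalemxAr.
have : v = 0 by rewrite -[v]mulmx1 -(repev1 hr) -xy (repev_mul hr) mulmxA vx mul0mx.
by move/rowP/(_ (Ordinal n0)); rewrite !mxE !eqxx => /eqP; rewrite oner_eq0.
Qed.

(** Over [E] the image of a nonzero intertwiner from [w] to [rho] is a representation, so its
    dimension is a multiple of [N]. The two are thus equivalent, and [rho] inherits independence. *)
Lemma rep_splitrep (k E : fieldType) (u : {rmorphism k -> E}) (T : finType) (X : salg k T) (e : vec k T)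
  (N : nat) (w : T -> 'M[E]_N) (rho : T -> 'M[k]_N) :
  splitrep (base u X) (bmap u e) w -> is_rep X e rho -> splitrep X e rho.
Proof.
move=> hs hr; have [hw cT _ N0] := hs; split=> //.
have hr' : is_rep (base u X) (bmap u e) (fun i => map_mx u (rho i)).
  exact: (is_rep_map (s := idfun) (t := u) (fun a => erefl) (is_rep_id hr)).
have [f [f0 hf]] := split_intertwiner hs hw hr' N0 N0.
have fu : f \in unitmx.
  rewrite -row_full_unit.
  have [|B [hB BU]] := subrep (U := row_base f) hr' (row_base_free _).
    by move=> t; rewrite eq_row_base (eqmxMr _ (eq_row_base f)) -hf submxMl.
  have r0 : (0 < \rank f)%N by rewrite lt0n mxrank_eq0.
  have [m mE [m0 _ _]] := rep_dim hs hB r0.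
  by rewrite /row_full eqn_leq rank_leq_col mE leq_pmulr.
rewrite -(row_free_map u) -kermx_eq0; apply/rowV0P => c /sub_kermxP cM.
pose x : vec E T := ofR (@enum_rank T) c.
suff x0 : x = 0 by rewrite -(ofRK (@enum_valK T) c) -/x x0; exact: toR0.
apply: (split_inj hs).
have rx : repev (fun t => map_mx u (rho t)) x = 0.
  apply: (can_inj mxvecK); rewrite raddf0 -[RHS]cM mulmx_sum_row /repev raddf_sum.
  rewrite (reindex (@enum_val T T)) /=; last by apply: onW_bij; exact: enum_val_bij.
  apply: eq_bigr => i _; rewrite ffunE enum_valK -map_row rowK map_mxvec; exact: linearZ.
have : repev w x *m f = 0.
  rewrite -[RHS](mulmx0 _ f) -rx /repev mulmx_suml mulmx_sumr; apply: eq_bigr => t _.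
  by rewrite -scalemxAl hf scalemxAr.
by move/(congr1 (mulmx^~ (invmx f))); rewrite mulmxK // mul0mx.
Qed.

(** The right annihilator of x is a right ideal, nonzero because of y and proper because x is not
    zero. *)
Lemma zero_divisor_rep (k : fieldType) (T : finType) (X : salg k T) (e : vec k T) x y :
  is_algebra X -> is_unit_of X e -> amul X x y = 0 -> x <> 0 -> y <> 0 ->
  exists r (rho : T -> 'M[k]_r), is_rep X e rho /\ (0 < r < #|T|)%N.
Proof.
move=> hX ue xy x0 y0; have bK := @enum_valK T; have b'K := @enum_rankK T.
pose M := kermx (Lmx X (@enum_val T T) x).
have yM : (toR (@enum_val T T) y <= M)%MS.
  by apply/sub_kermxP; rewrite (LmxE _ bK b'K) xy toR0.
have M0 : M != 0.
  by apply/eqP => M0; apply: y0; apply: (toR_eq0 b'K); apply/eqP; rewrite -submx0 -M0.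
have [|B [hB _]] := subrep (U := row_base M) (rreg_rep bK b'K hX ue) (row_base_free _).
  move=> t; rewrite eq_row_base (eqmxMr _ (eq_row_base M)); apply/sub_kermxP.
  by rewrite -mulmxA -(LRmx bK b'K hX) mulmxA mulmx_ker mul0mx.
exists (\rank M), B; split=> //; rewrite lt0n mxrank_eq0 M0 ltn_neqAle rank_leq_col andbT.
apply: contra_notN x0; rewrite -[_ == _]/(row_full M) -sub1mx.
move=> /(submx_trans (submx1 (toR (@enum_val T T) e))) /sub_kermxP.
by rewrite (LmxE _ bK b'K) (ue x).2 => /(toR_eq0 b'K).
Qed.

Lemma fieldExt_salg (F : fieldType) (K : fieldExtType F) :
  exists (E : salg F 'I_(\dim {: K})) kap, freal (in_alg K) E kap.
Proof.
pose kap (i : 'I_(\dim {: K})) : K := (vbasis {: K})`_i.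
have evE v : ev (in_alg K) kap v = \sum_i v i *: kap i.
  by apply: eq_bigr => i _; rewrite /= mulr_algl.
have [|v /= v0|E hE] := @salg_of_basis F K (in_alg K) _ kap; last by exists E, kap.
  move=> x; exists [ffun i => coord (vbasis {: K}) i x].
  rewrite evE {1}(coord_vbasis (memvf x)); apply: eq_bigr => i _.
  by rewrite ffunE.
apply/ffunP => i; rewrite ffunE; have /freeP := basis_free (vbasisP {: K}); apply.
by rewrite -evE.
Qed.

Lemma division_algebra (F : fieldType) (T : finType) (C : salg F T) : is_division C ->
  exists e, [/\ is_algebra C, is_unit_of C e, nzd C & (0 < #|T|)%N].
Proof.
move=> hd; have [[_ [e ue]] _] := hd; exists e; split=> //; first exact: hd.1.
  exact: division_nzd.
exact: field_alg_card hd.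
Qed.

(** * Division algebras whose exponent is the degree of a splitting field *)

Section Exponent.
Variables (F : fieldType) (K : fieldExtType F) (n : nat).
Hypotheses (dimK : \dim {: K} = n) (sepK : separable 1%VS {: K}) (two : 2%:R != 0 :> F).
Variables (T : finType) (C : salg F T) (e : vec F T).
Hypotheses (hC : is_algebra C) (ue : is_unit_of C e) (nC : nzd C) (T0 : (0 < #|T|)%N).
Hypotheses (expC : exponent_is C n) (spC : splits (in_alg K) C).

Lemma tpow_card_gt0 k : (0 < #|{ffun 'I_k -> T}|)%N.
Proof. by rewrite card_ffun expn_gt0 T0. Qed.

Lemma orbit_inj N (w : T -> 'M[K]_N) (i0 : 'I_N) x : is_rep (base (in_alg K) C) (bmap (in_alg K) e) w ->
  row i0 (repev w (bmap (in_alg K) x)) = 0 -> x = 0.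
Proof.
move=> hw rx; apply/eqP; apply: contraT => x0.
have [y [xy _]] := nzd_inverse (@enum_valK T) (@enum_rankK T) hC nC x0 ue.
have : row i0 (1%:M : 'M[K]_N) = 0 by rewrite -(repev1 hw) -xy bmap_amul (repev_mul hw) row_mul rx mul0mx.
by move/rowP/(_ i0); rewrite !mxE eqxx => /eqP; rewrite oner_eq0.
Qed.

Section Orbit.
Variables (N : nat) (w : T -> 'M[K]_N) (i0 : 'I_N).
Hypothesis hw : is_rep (base (in_alg K) C) (bmap (in_alg K) e) w.
Variables (kap : 'I_(\dim {: K}) -> K) (cf : K -> vec F 'I_(\dim {: K})).
Hypothesis hcf : forall x, x = ev (in_alg K) kap (cf x).

(** The F-linear map from [C] to K^N given by one row of [w], in coordinates over F. It is injective
    since [C] is division, and bijective once N = [K:F]. *)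
Definition orbit_mx := \matrix_(i < #|T|, j < #|{: 'I_N * 'I_(\dim {: K})}|)
   cf (w (enum_val i) i0 (enum_val j).1) (enum_val j).2.

Lemma orbit_entry x j : repev w (bmap (in_alg K) x) i0 j =
  ev (in_alg K) kap [ffun l => (toR (@enum_val T T) x *m orbit_mx) 0 (enum_rank (j, l))].
Proof.
rewrite summxE; transitivity (ev (in_alg K) kap (\sum_t vscale (x t) (cf (w t i0 j)))).
  rewrite ev_sum; apply: eq_bigr => t _.
  by rewrite evZ -hcf mxE ffunE.
congr ev; apply/ffunP => l; rewrite sum_ffunE ffunE mxE -[LHS]sum_enum; apply: eq_bigr => i _.
by rewrite !mxE ffunE enum_rankK.
Qed.

Lemma orbit_free : row_free orbit_mx.
Proof.
rewrite -kermx_eq0; apply/rowV0P => c /sub_kermxP cM.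
suff c0 : ofR (@enum_rank T) c = 0 by rewrite -(ofRK (@enum_valK T) c) c0; exact: toR0.
apply: (orbit_inj (w := w) (i0 := i0) hw); apply/rowP => j.
rewrite mxE orbit_entry (ofRK (@enum_valK T)) cM [RHS]mxE -[RHS](ev0 (in_alg K) kap).
by congr ev; apply/ffunP => l; rewrite ffunE mxE ffunE.
Qed.
End Orbit.

(** Two inequalities between the degree N and n. The regular representation has dimension N N, so
    its antisymmetric power splits the N-th tensor power, and the exponent n is at most N. The
    injection of [C] into K^N gives N^2 at most N n. *)
Lemma degree_exponent : exists w : T -> 'M[K]_n, splitrep (base (in_alg K) C) (bmap (in_alg K) e) w.
Proof.
have /(brauer_splitrep (base_unit _ ue) T0) [N [w hs]] := spC; have [hw cT _ N0] := hs.
suff NE : N = n by subst N; exists w.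
apply/eqP; rewrite eqn_leq; apply/andP; split; last first.
  rewrite leqNgt; apply/negP => Nn; have [n0 [_ hmin]] := expC.
  have [Gam hGam] := goldman_element sepK hs.
  have hreg := rreg_rep (@enum_valK T) (@enum_rankK T) hC ue.
  have [B hB] := antisymmetric_power (u := in_alg K) two hs hGam hreg T0 cT.
  have hsT : splitrep (base (in_alg K) (tpow C N)) (bmap (in_alg K) (tunit N e)) (tpmx w).
    by rewrite base_tpow bmap_tunit; exact: tpow_split.
  apply: (hmin N); first by rewrite N0.
  apply: (proj2 (brauer_splitrep (tpow_unit (s := N) ue) (tpow_card_gt0 N))).
  exists #|{ffun 'I_N -> 'I_N}|.
  move: B hB; have -> : (N ^ N)%N = #|{ffun 'I_N -> 'I_N}| by rewrite card_ffun !card_ord.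
  by move=> B hB; exists B; exact: rep_splitrep hsT hB.
have [E [kap [_ _ hsur _]]] := fieldExt_salg K.
have /choice [cf hcf] (x : K) : exists v, x = ev (in_alg K) kap v by exact: hsur.
have /eqP rM := orbit_free (Ordinal N0) hw hcf.
have := rank_leq_col (orbit_mx w (Ordinal N0) cf); rewrite rM cT card_prod !card_ord dimK.
by rewrite leq_pmul2l.
Qed.

(** A representation of dimension n^k would split the k-th tensor power, against the minimality of
    the exponent. *)
Lemma XX_tpow k : (0 < k < n)%N -> XX (tpow C k) (tunit k e) (n ^ k).
Proof.
move=> kn; have [w hs] := degree_exponent; have [n0 [_ hmin]] := expC.
have hsT : splitrep (base (in_alg K) (tpow C k)) (bmap (in_alg K) (tunit k e)) (tpmx w).
  by rewrite base_tpow bmap_tunit; exact: tpow_split.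
have cE : #|{ffun 'I_k -> 'I_n}| = (n ^ k)%N by rewrite card_ffun !card_ord.
split; [exact: tpow_algebra|exact: tpow_unit| |].
  move=> rho hr; apply: (hmin k kn).
  apply: (proj2 (brauer_splitrep (tpow_unit (s := k) ue) (tpow_card_gt0 k))).
  exists #|{ffun 'I_k -> 'I_n}|.
  move: rho hr; rewrite -cE => rho hr; exists rho; exact: rep_splitrep hsT hr.
have [E [kap hE]] := fieldExt_salg K.
exists _, E, K, (in_alg K), kap; split=> //; first exact: freal_field_alg hE.
by move: (tpmx w) hsT; rewrite cE => w' hw'; exists w'.
Qed.

Section OverL.
Variables (I J : finType) (A : salg F I) (B : salg F J) (L : fieldType) (s : {rmorphism F -> L}).
Hypothesis hinv : inv (DD A B) (abc A B) (@XX F) s.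

Lemma exponent_base : exponent_is (base s C) n.
Proof.
have [n0 [hn hmin]] := expC.
split=> //; split.
  by rewrite -base_tpow; exact: (brauer_trivial_base s (tpow_unit (s := n) ue) (tpow_card_gt0 n) hn).
move=> k kn; rewrite -base_tpow => /(brauer_splitrep (base_unit s (tpow_unit (s := k) ue)) (tpow_card_gt0 k)).
move=> [d [w [hw cT _ _]]]; have [_ _ h3] := hinv.
have [w0 [_ cT0 _ _]] := degree_exponent.
have dE : d = (n ^ k)%N.
  move: cT; rewrite card_ffun cT0 card_ord expnMn => /eqP; rewrite !mulnn eqn_sqr => /eqP //.
by subst d; exact: h3 (XX_tpow kn) w hw.
Qed.

Lemma division_base : nzd (base s C).
Proof.
have [w hs] := degree_exponent; have [hw cT _ n0] := hs.
have [Gam hGam] := goldman_element sepK hs.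
have [E [ka hka]] := fieldExt_salg K; have fE := freal_field_alg hka.
have [EE [iota [kap hf]]] := field_realization hinv fE; have [hr _ _ _] := hf.
have [h [hio _]] := freal_morph fE.1.1 hka (real_comp hr).
have {}hs := splitrep_map (fun a => esym (hio a)) hs.
have {}hGam a b c d : \sum_i \sum_j iota (s (Gam i j)) * (map_mx h (w i) a b * map_mx h (w j) c d) =
    (c == b)%:R * (d == a)%:R.
  rewrite -!(rmorph_nat h) -rmorphM -hGam rmorph_sum; apply: eq_bigr => i _.
  rewrite rmorph_sum; apply: eq_bigr => j _.
  by rewrite !rmorphM !mxE -[_%:A]/(in_alg K _) hio.
have hC' := base_algebra s hC; have ue' := base_unit s ue.
move=> x y xy; case: (pselect (x = 0)) => [|x0]; [by left|right].
apply: contrapT => y0.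
have [q [B' [hB' /andP [r0 rT]]]] := zero_divisor_rep hC' ue' xy x0 y0.
have [m mE [m0 _]] := rep_dim_descent (s := s) (u := iota) (t := (iota \o s)%FUN) (fun a => erefl) hs hB' r0.
(* A proper right ideal has dimension n m with m < n, and its m-th antisymmetric power is excluded
   by [XX_tpow]. *)
have mn : (m < n)%N by rewrite mE cT ltn_pmul2l in rT.
have hs' : splitrep (base iota (base s C)) (bmap iota (bmap s e)) (fun i => map_mx h (w i)).
  suff -> : bmap iota (bmap s e) = bmap (iota \o s)%FUN e by [].
  by apply/ffunP => t; rewrite !ffunE.
have two' : 2%:R != 0 :> L by rewrite -(rmorph_nat s) fmorph_eq0.
have [R hR] := antisymmetric_power two' hs' hGam hB' r0 mE.
have [_ _ h3] := hinv; have mk : (0 < m < n)%N by rewrite m0.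
apply: (h3 _ _ _ _ (XX_tpow mk) R).
by rewrite base_tpow bmap_tunit.
Qed.
End OverL.
End Exponent.

(** * Quaternion algebras *)

Lemma exists_nonscalar (F : fieldType) (I : finType) (e : vec F I) : (1 < #|I|)%N ->
  exists x, forall a, x <> vscale a e.
Proof.
move=> I1; apply: contrapT => h; have h' x : exists a, x = vscale a e.
  by apply: contrapT => nx; apply: h; exists x => a xa; apply: nx; exists a.
have /choice [c hc] := h'; have bK := @enum_valK I.
pose M : 'cV[F]_#|I| := \col_i c (bvec F (enum_val i)).
have : row_free M.
  apply/row_freeP; exists (toR (@enum_val I I) e); apply: (mxR_eq bK) => v.
  rewrite mulmx1 mulmxA; apply/rowP => j; rewrite !mxE big_ord_recl big_ord0 addr0 !mxE.
  have -> : v (enum_val j) = (\sum_i vscale (v i) (vscale (c (bvec F i)) e)) (enum_val j).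
    by rewrite {1}(sum_bvec v) !sum_ffunE; apply: eq_bigr => i _; rewrite -hc.
  rewrite sum_ffunE mulr_suml -[RHS]sum_enum; apply: eq_bigr => i _.
  by rewrite !mxE !ffunE mulrA.
by move/eqP => rM; have := rank_leq_col M; rewrite rM leqNgt I1.
Qed.

Section Quaternion.
Variables (F : fieldType) (I : finType) (A : salg F I) (e : vec F I).
Hypotheses (two : 2%:R != 0 :> F) (hA : is_algebra A) (ue : is_unit_of A e) (nA : nzd A).
Hypotheses (cA : is_central A) (I4 : #|I| = 4).
Let b := @enum_val I I.
Let b' := @enum_rank I.
Let bK : cancel b b' := @enum_valK I.
Let b'K : cancel b' b := @enum_rankK I.
Let assoc := hA.1.
Let e0 : e != 0.
Proof. by have /card_gt0P [i _] : (0 < #|I|)%N by [rewrite I4]; exact: (rng_1neq0 i ue). Qed.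

Let amulNl x y : amul A (- x) y = - amul A x y.
Proof. by apply/eqP; rewrite -addr_eq0 -amulDl addNr amul0l. Qed.
Let amulNr x y : amul A x (- y) = - amul A x y.
Proof. by apply/eqP; rewrite -addr_eq0 -amulDr addNr amul0r. Qed.

(* If the centralizer C of x has dimension at least 3 then every y satisfies y C /\ C <> 0, so y commutes with x. *)
Lemma quaternion_quadratic x : (forall a, x <> vscale a e) ->
  exists p q, amul A x x = vscale p x + vscale q e.
Proof.
move=> xe; pose C := kermx (Lmx A b x - Rmx A b x).
have inC y : (toR b y <= C)%MS = (amul A x y == amul A y x).
  apply/sub_kermxP/eqP; rewrite mulmxBr (LmxE _ bK b'K) (RmxE _ bK b'K).
    by move/eqP; rewrite subr_eq0 => /eqP /(can_inj (toRK b'K)).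
  by move=> ->; rewrite subrr.
have rC : (\rank C <= 2)%N.
  rewrite leqNgt; apply/negP => C3; suff [a xa] : exists a, x = vscale a e by exact: xe xa.
  apply: cA ue _ _ => y; case: (eqVneq y 0) => [->|y0]; first by rewrite amul0l amul0r.
  have yu : Lmx A b y \in unitmx.
    apply: (nzd_mdiv bK b'K hA nA); first by apply/(rreg_cent bK b'K hA); exists y.
    apply/eqP => L0; move/eqP: y0; apply; apply: (Lmx_inj bK b'K hA); rewrite L0.
    by apply: (mxR_eq bK) => v; rewrite (LmxE _ bK b'K) amul0l toR0 mulmx0.
  have := mxrank_sum_cap (C *m Lmx A b y)%MS C; rewrite mxrankMfree ?row_free_unit //.
  have h1 := rank_leq_col (C *m Lmx A b y + C)%MS; move=> h2.
  have h4 : (\rank (C *m Lmx A b y + C)%MS <= 4)%N by apply: leq_trans h1 _; rewrite I4.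
  have : (C *m Lmx A b y :&: C)%MS != 0 by rewrite -mxrank_eq0; lia.
  move/rowV0Pn => [v]; rewrite sub_capmx => /andP [/submxP [c vE] vC] v0.
  pose d := ofR b' (c *m C); have dE : toR b d = c *m C by rewrite ofRK.
  have dC : amul A x d == amul A d x by rewrite -inC dE submxMl.
  have vE' : v = toR b (amul A y d) by rewrite vE mulmxA -dE (LmxE _ bK b'K).
  have d0 : d != 0.
    by apply: contraNneq v0 => d0; rewrite vE' d0 amul0r toR0.
  rewrite vE' inC in vC.
  have : amul A (amul A x y - amul A y x) d = 0.
    by rewrite amulDl amulNl -!assoc (eqP vC) (eqP dC) assoc subrr.
  by case/nA => /eqP; rewrite ?(negPf d0) // subr_eq0 => /eqP.
pose V := \matrix_(i < 3) toR b (nth 0 [:: e; x; amul A x x] i).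
have VC : (V <= C)%MS.
  apply/row_subP => i; rewrite rowK inC; case: i => [[|[|[]]]] //= _; rewrite ?assoc //.
  by rewrite (ue x).1 (ue x).2.
have : kermx V != 0.
  rewrite kermx_eq0 /row_free; apply/negP => /eqP rV.
  by have := mxrankS VC; rewrite rV => /leq_trans /(_ rC).
move/rowV0Pn => [c /sub_kermxP cV c0].
have E : vscale (c 0 0) e + vscale (c 0 1) x + vscale (c 0 2%:R) (amul A x x) = 0.
  apply: (can_inj (toRK b'K)); rewrite toR0 -[RHS]cV mulmx_sum_row !big_ord_recl big_ord0 addr0 !rowK /=.
  rewrite !toRD !toRZ addrA; congr (_ + _ *: _ + _ *: _); congr (c _ _); exact: val_inj.
have c2 : c 0 2%:R != 0.
  apply/eqP => c2; have c1 : c 0 1 = 0.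
    apply/eqP; apply: contraT => c1; case: (xe (- (c 0 0 / c 0 1))).
    apply/ffunP => i; move/ffunP/(_ i): E; rewrite c2 !ffunE mul0r addr0 => E.
    apply: (mulfI c1); rewrite mulrA mulrN mulrCA divff // mulr1 mulNr.
    by apply/eqP; rewrite -addr_eq0 addrC E.
  have c00 : c 0 0 = 0.
    apply/eqP; apply: contraNT e0 => c00; apply/eqP/ffunP => i; move/ffunP/(_ i): E.
    rewrite c2 c1 !ffunE !mul0r !addr0 => /eqP; rewrite mulf_eq0 (negPf c00) => /eqP //.
  case/eqP: c0; apply/rowP => i; rewrite mxE; case: i => [[|[|[]]]] //= h.
  - by rewrite -[RHS]c00; congr (c _ _); exact: val_inj.
  - by rewrite -[RHS]c1; congr (c _ _); exact: val_inj.
  by rewrite -[RHS]c2; congr (c _ _); exact: val_inj.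
exists (- (c 0 1 / c 0 2%:R)), (- (c 0 0 / c 0 2%:R)).
apply/ffunP => i; move/ffunP/(_ i): E; rewrite !ffunE.
set xx := \sum_i _; move=> E; apply: (mulfI c2).
have -> : c 0 2%:R * xx = - (c 0 0 * e i) - c 0 1 * x i.
  by apply: (addrI (c 0 0 * e i + c 0 1 * x i)); rewrite E; ring.
move: (c 0 0) (c 0 1) (c 0 2%:R) c2 (e i) (x i) => c00 c1 c2 c20 ei xi; field.
by rewrite c20.
Qed.

Lemma square_neq0 x a : x != 0 -> amul A x x = vscale a e -> a != 0.
Proof.
move=> x0 xx; apply: contra_neq x0 => a0.
have : amul A x x = 0 by rewrite xx a0; apply/ffunP => i; rewrite !ffunE mul0r.
by case/nA.
Qed.

(** i is a nonscalar x with the square completed, and j = i y - y i anticommutes with i because i^2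
    is scalar. So j is not scalar and j^2 = p' j + q'; here p' = 0, since j^2 commutes with i while
    j does not. *)
Lemma quaternion_gens : quat_gens A e.
Proof.
have [x xe] := exists_nonscalar e (ltac:(by rewrite I4) : (1 < #|I|)%N).
have [p [q xx]] := quaternion_quadratic xe.
pose i := x - vscale (p / 2%:R) e.
have ii : amul A i i = vscale (q + p * p / 4%:R) e.
  have four : 4%:R != 0 :> F by rewrite (natrM _ 2 2) mulf_neq0.
  rewrite /i amulDl !amulDr !(amulNl, amulNr, amulZl, amulZr) (ue x).1 (ue x).2 (ue e).1 xx.
  apply/ffunP => t; rewrite !ffunE; move: (x t) (e t) => xt et.
  by field; rewrite four two.
have ie a : i <> vscale a e.
  move=> E; apply: (xe (a + p / 2%:R)); apply/ffunP => t; move/ffunP/(_ t): E; rewrite !ffunE => E.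
  by rewrite mulrDl -E subrK.
have i0 : i != 0 by apply/eqP => i0; apply: (ie 0); rewrite i0; apply/ffunP => t; rewrite !ffunE mul0r.
have [y iy] : exists y, amul A i y <> amul A y i.
  apply: contrapT => h; have [a ia] : exists a, i = vscale a e; last exact: ie ia.
  by apply: cA ue _ _ => y; apply: contrapT => iy; apply: h; exists y.
pose j := amul A i y - amul A y i.
have j0 : j != 0 by rewrite subr_eq0; apply/eqP.
have ij : amul A i j + amul A j i = 0.
  have e1 : amul A i (amul A i y) = vscale (q + p * p / 4%:R) y by rewrite assoc ii amulZl (ue y).1.
  have e2 : amul A (amul A y i) i = vscale (q + p * p / 4%:R) y by rewrite -assoc ii amulZr (ue y).2.
  by rewrite /j amulDl amulDr amulNl amulNr e1 e2 assoc addrA subrK subrr.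
have je a : j <> vscale a e.
  move=> E; have : vscale (2%:R * a) i = 0.
    move: ij; rewrite E amulZl amulZr (ue i).1 (ue i).2 => ij.
    by apply/ffunP => t; move/ffunP/(_ t): ij; rewrite !ffunE => <-; ring.
  move=> z; have a0 : a != 0.
    by apply: contra_neq j0 => a0; rewrite E a0; apply/ffunP => t; rewrite !ffunE mul0r.
  case/eqP: i0; apply/ffunP => t; move/ffunP/(_ t): z; rewrite !ffunE => /eqP.
  by rewrite mulf_eq0 mulf_eq0 (negPf two) (negPf a0) => /eqP.
have [p' [q' jj]] := quaternion_quadratic je.
have p0 : p' = 0.
  have ji : amul A j i = - amul A i j by apply/eqP; rewrite -addr_eq0 addrC ij.
  have com : amul A i (amul A j j) = amul A (amul A j j) i.
    have ij' : amul A i j = - amul A j i by rewrite ji opprK.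
    by rewrite assoc ij' amulNl -assoc ij' amulNr opprK assoc.
  move: com; rewrite jj amulDl amulDr !(amulZl, amulZr) (ue i).1 (ue i).2 ji => /addIr.
  have u0 : amul A i j != 0 by apply/eqP => /nA [] E; [case/eqP: i0|case/eqP: j0].
  move: (amul A i j) u0 => u u0 com; apply/eqP; apply: contraNT u0 => p0.
  apply/eqP/ffunP => t; move/ffunP/(_ t): com; rewrite !ffunE => com.
  apply: (mulfI (mulf_neq0 two p0)); rewrite mulr0 -mulrA mulr_natl mulr2n {2}com; ring.
have jj' : amul A j j = vscale q' e by rewrite jj p0; apply/ffunP => t; rewrite !ffunE mul0r add0r.
exists i, j, (q + p * p / 4%:R), q'; split=> //.
  exact: square_neq0 i0 ii.
exact: square_neq0 j0 jj'.
Qed.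
End Quaternion.

(** Anticommuting the relation with I, J and IJ leaves two terms each time, such as x I + y a1 = 0.
    If x were nonzero, I would be a nonzero scalar and could not anticommute with J. *)
Lemma quat_mx_indep (k : fieldType) n (Im Jm : 'M[k]_n) a1 a2 x y z t : 2%:R != 0 :> k -> (0 < n)%N ->
  a1 != 0 -> a2 != 0 -> Im *m Im = a1%:M -> Jm *m Jm = a2%:M -> Im *m Jm + Jm *m Im = 0 ->
  x%:M + y *: Im + z *: Jm + t *: (Im *m Jm) = 0 -> [/\ x = 0, y = 0, z = 0 & t = 0].
Proof.
move=> two n0 a10 a20 II JJ IJ E.
have half (M : 'M[k]_n) : M + M = 0 -> M = 0.
  by rewrite -mulr2n -scaler_nat => /eqP; rewrite scaler_eq0 (negPf two) => /eqP.
have scal0 c : (c%:M : 'M[k]_n) = 0 -> c = 0.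
  by move/matrixP/(_ (Ordinal n0) (Ordinal n0)); rewrite !mxE eqxx mulr1n.
have ac (U : 'M[k]_n) : x *: (U + U) + y *: (Im *m U + U *m Im) + z *: (Jm *m U + U *m Jm) +
    t *: (Im *m Jm *m U + U *m (Im *m Jm)) = 0.
  have : (x%:M + y *: Im + z *: Jm + t *: (Im *m Jm)) *m U +
     U *m (x%:M + y *: Im + z *: Jm + t *: (Im *m Jm)) = 0 by rewrite E mul0mx mulmx0 addr0.
  rewrite !mulmxDl !mulmxDr -!scalemxAl -!scalemxAr mul_scalar_mx mul_mx_scalar => <-.
  rewrite !scalerDr [RHS]addrACA; congr (_ + _); rewrite [RHS]addrACA; congr (_ + _).
  by rewrite [RHS]addrACA.
have JI : Jm *m Im = - (Im *m Jm) by apply/eqP; rewrite -addr_eq0 addrC IJ.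
have IJI : Im *m Jm *m Im + Im *m (Im *m Jm) = 0 by rewrite -mulmxA -mulmxDr addrC IJ mulmx0.
have IJJ : Im *m Jm *m Jm + Jm *m (Im *m Jm) = 0 by rewrite [Jm *m _]mulmxA -mulmxDl IJ mul0mx.
have EI : x *: Im + (y * a1)%:M = 0.
  apply: half; have := ac Im; rewrite II IJI [Jm *m _ + _]addrC IJ !scaler0 !addr0 !scalerDr scale_scalar_mx.
  by rewrite addrACA.
have EJ : x *: Jm + (z * a2)%:M = 0.
  apply: half; have := ac Jm; rewrite JJ IJJ IJ !scaler0 !addr0 !scalerDr scale_scalar_mx.
  by rewrite addrACA.
have EK : x *: (Im *m Jm) - (t * (a1 * a2))%:M = 0.
  have KK : Im *m Jm *m (Im *m Jm) = - (a1 * a2)%:M.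
    by rewrite mulmxA -[Im *m Jm *m Im]mulmxA JI mulmxN mulNmx mulmxA II mul_scalar_mx -scalemxAl JJ scale_scalar_mx.
  apply: half; have := ac (Im *m Jm); rewrite KK [Im *m (_ *m _) + _]addrC IJI [Jm *m _ + _]addrC IJJ.
  rewrite !scaler0 !addr0 !scalerDr scalerN scale_scalar_mx.
  by rewrite addrACA.
have x0 : x = 0.
  apply/eqP; apply: contraT => x0; pose c := - (y * a1 / x).
  have IE : Im = c%:M.
    apply: (scalerI x0); rewrite scale_scalar_mx /c mulrN mulrCA divff // mulr1 raddfN.
    by apply/eqP; rewrite -addr_eq0 EI.
  have c0 : c != 0.
    by apply: contraNneq a10 => c0; apply/eqP/scal0; rewrite -II IE c0 raddf0 mul0mx.
  move: IJ; rewrite IE mul_scalar_mx mul_mx_scalar => /half /eqP; rewrite scaler_eq0 (negPf c0) => /eqP J0.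
  by case/eqP: a20; apply: scal0; rewrite -JJ J0 mul0mx.
move: EI EJ EK; rewrite x0 !scale0r !add0r -raddfN => /scal0 EI /scal0 EJ /scal0 /eqP EK.
split=> //.
- by apply/eqP; move/eqP: EI; rewrite mulf_eq0 (negPf a10) orbF.
- by apply/eqP; move/eqP: EJ; rewrite mulf_eq0 (negPf a20) orbF.
by apply/eqP; move: EK; rewrite oppr_eq0 !mulf_eq0 (negPf a10) (negPf a20) !orbF.
Qed.

(** * Splitting of quaternion algebras *)

Section QuaternionSplitting.
Variables (F : fieldType) (I : finType) (A : salg F I) (e : vec F I).
Hypotheses (two : 2%:R != 0 :> F) (hA : is_algebra A) (ue : is_unit_of A e) (I4 : #|I| = 4).
Hypothesis gA : quat_gens A e.
Variables (M : fieldType) (tau : {rmorphism F -> M}).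
Let twoM : 2%:R != 0 :> M. Proof. by rewrite -(rmorph_nat tau) fmorph_eq0. Qed.

Lemma quat_rep_gens (k : fieldType) (u : {rmorphism F -> k}) n (rho : I -> 'M[k]_n) i j a1 a2 :
  is_rep (base u A) (bmap u e) rho ->
  amul A i i = vscale a1 e -> amul A j j = vscale a2 e -> amul A i j + amul A j i = 0 ->
  let Im := repev rho (bmap u i) in let Jm := repev rho (bmap u j) in
  [/\ Im *m Im = (u a1)%:M, Jm *m Jm = (u a2)%:M, Im *m Jm + Jm *m Im = 0 &
      repev rho (bmap u (amul A i j)) = Im *m Jm].
Proof.
move=> hr ii jj ij Im Jm.
have sq x a : amul A x x = vscale a e -> repev rho (bmap u x) *m repev rho (bmap u x) = (u a)%:M.
  move=> xx; rewrite -(repev_mul hr) -bmap_amul xx.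
  have -> : bmap u (vscale a e) = vscale (u a) (bmap u e) by apply/ffunP => t; rewrite !ffunE rmorphM.
  by rewrite repevZ (repev1 hr) scale_scalar_mx mulr1.
rewrite /Im /Jm; split; [exact: sq ii|exact: sq jj| |by rewrite bmap_amul (repev_mul hr)].
rewrite -!(repev_mul hr) -!bmap_amul -repevD.
have -> : bmap u (amul A i j) + bmap u (amul A j i) = 0; last by rewrite repev0.
by apply/ffunP => t; move/ffunP/(_ t): ij; rewrite !ffunE -rmorphD => ->; rewrite rmorph0.
Qed.

(** Independence of 1, i, j, ij in the regular representation makes them a basis over F, hence over
    [M]; independence of their images in [rho] then gives faithfulness. *)
Lemma quat_rep_faithful n (rho : I -> 'M[M]_n) c : is_rep (base tau A) (bmap tau e) rho -> (0 < n)%N ->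
  repev rho c = 0 -> c = 0.
Proof.
move=> hr n0 c0; have [i [j [a1 [a2 [a10 a20 ii jj ij]]]]] := gA.
pose v (l : 'I_4) := nth 0 [:: e; i; j; amul A i j] l.
have comb (k : fieldType) (u : {rmorphism F -> k}) m (r : I -> 'M[k]_m) (y : 'I_4 -> k) :
    2%:R != 0 :> k -> is_rep (base u A) (bmap u e) r -> (0 < m)%N ->
    repev r (\sum_l vscale (y l) (bmap u (v l))) = 0 -> forall l, y l = 0.
  move=> twok h m0; have [II JJ IJ eIJ] := quat_rep_gens h ii jj ij.
  rewrite !big_ord_recl big_ord0 addr0 !repevD !repevZ /v /= eIJ (repev1 h) scale_scalar_mx mulr1 !addrA => E.
  have u0 a : a != 0 -> u a != 0 by rewrite fmorph_eq0.
  have [y0 y1 y2 y3] := quat_mx_indep twok m0 (u0 _ a10) (u0 _ a20) II JJ IJ E.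
  case=> [[|[|[|[|]]]]] // h4; [rewrite -[RHS]y0|rewrite -[RHS]y1|rewrite -[RHS]y2|rewrite -[RHS]y3];
    congr y; exact: val_inj.
pose b := @enum_val I I; have bK : cancel b enum_rank := @enum_valK I; have b'K : cancel enum_rank b := @enum_rankK I.
pose V := \matrix_(l < 4) toR b (v l).
have fV : row_free V.
  rewrite -kermx_eq0; apply/rowV0P => y /sub_kermxP yV; apply/rowP => l; rewrite mxE.
  have hreg := rreg_rep bK b'K hA ue.
  have I0 : (0 < #|I|)%N by rewrite I4.
  apply: (comb F idfun _ (rreg A b) (fun l => y 0 l) two (is_rep_id hreg) I0).
  have -> : \sum_l0 vscale (y 0 l0) (bmap idfun (v l0)) = 0; last by rewrite repev0.
  apply: (toR_eq0 b'K); rewrite toR_sum -[RHS]yV mulmx_sum_row; apply: eq_bigr => l' _.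
  by rewrite rowK toRZ bmap_id.
have ffV : row_full (map_mx tau V) by rewrite row_full_map /row_full (eqP fV) I4.
have /submxP [y yE] : (toR b c <= map_mx tau V)%MS by apply: submx_full.
have cE : c = \sum_l vscale (y 0 l) (bmap tau (v l)).
  apply: (can_inj (toRK b'K)); rewrite yE mulmx_sum_row toR_sum; apply: eq_bigr => l _.
  by rewrite toRZ -map_row rowK; congr (_ *: _); apply/rowP => t; rewrite !mxE ffunE.
rewrite cE in c0 *; have y0 := comb _ _ _ _ (fun l => y 0 l) twoM hr n0 c0.
by rewrite big1 // => l _; rewrite y0; apply/ffunP => t; rewrite !ffunE mul0r.
Qed.

(** Taking determinants in j i = - i j, with invertible factors, gives (-1)^n = 1. *)
Lemma quat_rep_even n (rho : I -> 'M[M]_n) : is_rep (base tau A) (bmap tau e) rho -> ~~ odd n.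
Proof.
move=> hr; have [i [j [a1 [a2 [a10 a20 ii jj ij]]]]] := gA.
have [II JJ IJ _] := quat_rep_gens hr ii jj ij; apply/negP => on.
have /(congr1 determinant) : repev rho (bmap tau j) *m repev rho (bmap tau i) =
    - 1 *: (repev rho (bmap tau i) *m repev rho (bmap tau j)).
  by rewrite scaleN1r; apply/eqP; rewrite -addr_eq0 addrC IJ.
have u0 a : a != 0 -> (tau a)%:M \in @unitmx M n.
  by move=> a0; rewrite -scalemx1 unitmxZ ?unitmx1 // unitfE fmorph_eq0.
have dI : \det (repev rho (bmap tau i)) != 0.
  rewrite -unitfE -unitmxE; have := u0 _ a10; rewrite -II unitmx_mul => /andP[] //.
have dJ : \det (repev rho (bmap tau j)) != 0.
  rewrite -unitfE -unitmxE; have := u0 _ a20; rewrite -JJ unitmx_mul => /andP[] //.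
rewrite detZ !det_mulmx -signr_odd on expr1 mulN1r mulrC => /eqP.
rewrite -addr_eq0 -mulr2n -mulr_natl mulf_eq0 (negPf twoM) mulf_eq0.
by rewrite (negPf dI) (negPf dJ).
Qed.

(** A zero divisor gives a representation of dimension below 4, hence 2 by parity, and being
    faithful it is an isomorphism by dimension. Conversely, two diagonal elementary matrices
    multiply to zero. *)
Theorem quat_split : splits tau A <-> ~ nzd (base tau A).
Proof.
have hA' := base_algebra tau hA; have ue' := base_unit tau ue.
have I0 : (0 < #|I|)%N by rewrite I4.
split=> [/(brauer_splitrep ue' I0) [d [w hs]] hn|hn].
  have [hw cT _ d0] := hs; have d2 : d = 2%N.
    by apply/eqP; rewrite -(eqn_sqr d 2) -mulnn -cT I4.
  subst d; have [c hc] := split_surj hs (delta_mx 0 0); have [c' hc'] := split_surj hs (delta_mx 1 1).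
  have nz (x : vec M I) p : delta_mx p p = repev w x -> x <> 0.
    by move=> h x0; move: h; rewrite x0 repev0 => /matrixP /(_ p p) /eqP; rewrite !mxE !eqxx oner_eq0.
  have : amul (base tau A) c c' = 0.
    apply: (split_inj hs); rewrite (repev_mul hw) -hc -hc' mul_delta_mx_cond.
    by rewrite mulr0n.
  by case/hn; [exact: nz hc|exact: nz hc'].
have [x [y [xy x0 y0]]] : exists x y, [/\ amul (base tau A) x y = 0, x <> 0 & y <> 0].
  apply: contrapT => h; apply: hn => x y xy; case: (pselect (x = 0)) => [|x0]; [by left|right].
  by apply: contrapT => y0; apply: h; exists x, y.
have [r [rho [hr /andP [r0 r4]]]] := zero_divisor_rep hA' ue' xy x0 y0.
have r2 : r = 2%N by have := quat_rep_even hr; rewrite I4 in r4; case: r r0 r4 {rho hr} => [|[|[|[|]]]].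
subst r; apply/(brauer_splitrep ue' I0); exists 2%N, rho; split=> //.
rewrite -kermx_eq0; apply/rowV0P => c /sub_kermxP cM.
pose z : vec M I := ofR (@enum_rank I) c.
suff z0 : z = 0 by rewrite -(ofRK (@enum_valK I) c) -/z z0; exact: toR0.
apply: (quat_rep_faithful hr) => //; apply: (can_inj mxvecK); rewrite raddf0 -[RHS]cM mulmx_sum_row /repev raddf_sum.
rewrite (reindex (@enum_val I I)) /=; last by apply: onW_bij; exact: enum_val_bij.
by apply: eq_bigr => i _; rewrite ffunE enum_valK rowK; exact: linearZ.
Qed.
End QuaternionSplitting.

(** * Embeddings of quadratic extensions *)

Lemma real_embeds (k : fieldType) (R : nzRingType) (io : {rmorphism k -> R}) (T T' : finType)
  (Y : salg k T) ka (E : salg k T') kap : freal io Y ka -> is_algebra Y -> is_field_alg E -> real io E kap ->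
  embeds E Y.
Proof.
move=> [hr hc hs hi] hY [[hE [e [ue [_ hinv]]]] _] hE'; have inj := ev_inj hi.
have /choice [M hM] (t : T') : exists v, kap t = ev io ka v by exact: hs.
have lE v : ev io ka (lin (fun t j => M t j) v) = ev io kap v.
  rewrite lin_sum ev_sum; apply: eq_bigr => t _; rewrite evZ hM; congr (_ * ev _ _ _).
  apply/ffunP => j; rewrite ffunE (bigD1 t) //= ffunE eqxx mul1r big1 ?addr0 // => l lt.
  by rewrite ffunE eq_sym (negPf lt) mul0r.
have l1 : ev io ka (lin (fun t j => M t j) e) = 1 by rewrite lE; case: hE' => _ _; apply.
exists (fun t j => M t j); split; first split=> [x y|].
- by apply: inj; rewrite (ev_mul hr) !lE (ev_mul hE').
- exists e; split=> // x; split; apply: inj; rewrite (ev_mul hr) l1 ?mul1r ?mulr1 //.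
move=> u u0; apply: contrapT => un; have [v [uv _]] := hinv u un.
have := l1; rewrite -uv lE (ev_mul hE') -!lE u0 [vzero _ _]/(0 : vec k T) ev0 mul0r => /eqP.
by rewrite eq_sym oner_eq0.
Qed.

Section QuadReal.
Variables (k : fieldType) (R : nzRingType) (io : {rmorphism k -> R}) (T : finType) (K : salg k T).
Variables (phi : T -> R) (z : R) (d e : vec k T).
Hypotheses (ue : is_unit_of K e) (hr : real io K phi) (zphi : forall t, z * phi t = phi t * z).
Hypotheses (zio : forall a, io a * z = z * io a) (zz : z * z = ev io phi d).

Lemma quad_real : real io (quadsalg K d) (fun x : T * bool => phi x.1 * z ^+ nat_of_bool x.2).
Proof.
have [c1 c2 c3] := hr.
have comm a (x : T * bool) : io a * (phi x.1 * z ^+ nat_of_bool x.2) = phi x.1 * z ^+ nat_of_bool x.2 * io a.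
  rewrite mulrA c1 -!mulrA; congr (_ * _); case: (x.2); rewrite ?expr1 //.
  by rewrite expr0 mulr1 mul1r.
have evE v : ev io (fun x : T * bool => phi x.1 * z ^+ nat_of_bool x.2) v =
   ev io phi [ffun t => v (t, false)] + ev io phi [ffun t => v (t, true)] * z.
  rewrite /ev; transitivity (\sum_(p : T * bool) io (v (p.1, p.2)) * (phi p.1 * z ^+ nat_of_bool p.2)).
    by apply: eq_bigr => -[t b] _.
  rewrite -(pair_bigA _ (fun t (b : bool) => io (v (t, b)) * (phi t * z ^+ nat_of_bool b))) /=.
  rewrite mulr_suml -big_split; apply: eq_bigr => t _.
  by rewrite big_bool /= !ffunE expr0 expr1 mulr1 addrC mulrA.
have tab (x y : T * bool) : phi x.1 * z ^+ nat_of_bool x.2 * (phi y.1 * z ^+ nat_of_bool y.2) =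
    \sum_l io (sc (quadsalg K d) x y l) * (phi l.1 * z ^+ nat_of_bool l.2).
  have := evE [ffun l => sc (quadsalg K d) x y l]; rewrite {1}/ev.
  under eq_bigr => l _ do rewrite ffunE.
  move=> ->; case: x => x b; case: y => y c /=.
  have red (f : T * bool -> k) c' : [ffun t => [ffun l => f l] (t, c')] = [ffun t => f (t, c')].
    by apply/ffunP => t; rewrite !ffunE.
  have evd : ev io phi [ffun t => amul K (amul K (bvec k x) (bvec k y)) d t] = phi x * phi y * (z * z).
    have -> : [ffun t => amul K (amul K (bvec k x) (bvec k y)) d t] = amul K (amul K (bvec k x) (bvec k y)) d.
      by apply/ffunP => t; rewrite ffunE.
    by rewrite !(ev_mul hr) !ev_bvec zz.
  have evk : ev io phi [ffun t => sc K x y t] = phi x * phi y.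
    by rewrite c2; apply: eq_bigr => t _; rewrite ffunE.
  have ev00 : ev io phi [ffun t => 0] = 0 by rewrite -[RHS](ev0 io phi); congr ev; apply/ffunP => t; rewrite !ffunE.
  rewrite !red /=; case: b; case: c => /=; rewrite ?evd ?evk ?ev00 ?expr0 ?expr1 ?mulr1 ?mul0r ?addr0 ?add0r //.
  - by rewrite -!mulrA (mulrA z) zphi -!mulrA.
  - by rewrite -mulrA zphi mulrA.
  by rewrite mulrA.
have tabr v w : ev io (fun x : T * bool => phi x.1 * z ^+ nat_of_bool x.2) (amul (quadsalg K d) v w) =
    ev io (fun x : T * bool => phi x.1 * z ^+ nat_of_bool x.2) v * ev io (fun x : T * bool => phi x.1 * z ^+ nat_of_bool x.2) w.
  rewrite amul_sum ev_sum [in RHS]/ev big_distrl /=.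
  apply: eq_bigr => i _; rewrite ev_sum big_distrr /=; apply: eq_bigr => l _.
  rewrite evZ rmorphM -!mulrA; congr (_ * _); rewrite [in RHS]mulrA [in RHS]mulrA -[phi i.1 * _ * io _]comm -!mulrA.
  congr (_ * _); rewrite [RHS]mulrA tab.
  by apply: eq_bigr => m _; rewrite amul_bvec.
pose E1 : vec k (T * bool)%type := [ffun p => if p.2 then 0 else e p.1].
have E1E : ev io (fun x : T * bool => phi x.1 * z ^+ nat_of_bool x.2) E1 = 1.
  rewrite evE; have -> : [ffun t => E1 (t, true)] = 0 by apply/ffunP => t; rewrite !ffunE.
  have -> : [ffun t => E1 (t, false)] = e by apply/ffunP => t; rewrite !ffunE.
  by rewrite c3 // ev0 mul0r addr0.
by split=> // e' ue'; rewrite -[LHS]mulr1 -E1E -tabr (ue' E1).1.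
Qed.
End QuadReal.

Definition sub (k : fieldType) (T I : finType) (Y : salg k T) (eY : vec k T) (A : salg k I) (eA : vec k I)
  (al : I -> vec k T) :=
  (forall i j, amul Y (al i) (al j) = \sum_l vscale (sc A i j l) (al l)) /\ \sum_i vscale (eA i) (al i) = eY.

Lemma sub_real (k : fieldType) (R : nzRingType) (io : {rmorphism k -> R}) (T I : finType) (Y : salg k T) eY
  (A : salg k I) eA al ka : is_unit_of Y eY -> is_unit_of A eA -> sub Y eY A eA al -> real io Y ka ->
  real io A (fun i => ev io ka (al i)).
Proof.
move=> uY uA [h1 h2] hr; apply: (real_unit uA) => [a i|i j|].
- exact: ev_comm hr _ _.
- by rewrite -(ev_mul hr) h1 ev_sum; apply: eq_bigr => l _; rewrite evZ.
case: (hr) => _ _ /(_ _ uY) <-; rewrite -h2 ev_sum; by apply: eq_bigr => i _; rewrite evZ.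
Qed.

Section TensorParts.
Variables (k : fieldType) (I J : finType) (A : salg k I) (B : salg k J) (eA : vec k I) (eB : vec k J).
Hypotheses (uA : is_unit_of A eA) (uB : is_unit_of B eB).

Lemma vtensor_mul u v u' v' : amul (tensor A B) (vtensor u v) (vtensor u' v') =
  vtensor (amul A u u') (amul B v v').
Proof.
apply/ffunP => -[p q]; rewrite !ffunE /= -sum_pair_mul.
apply: eq_bigr => -[i j] _ /=; rewrite -sum_pair_mul; apply: eq_bigr => -[i' j'] _ /=.
by rewrite !ffunE /=; ring.
Qed.

Lemma vtensor_suml (U : finType) (c : U -> k) (u : U -> vec k I) (v : vec k J) :
  vtensor (\sum_l vscale (c l) (u l)) v = \sum_l vscale (c l) (vtensor (u l) v).
Proof.
apply/ffunP => x; rewrite ffunE !sum_ffunE mulr_suml; apply: eq_bigr => l _.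
by rewrite !ffunE mulrA.
Qed.

Lemma vtensor_sumr (U : finType) (c : U -> k) (u : vec k I) (v : U -> vec k J) :
  vtensor u (\sum_l vscale (c l) (v l)) = \sum_l vscale (c l) (vtensor u (v l)).
Proof.
apply/ffunP => x; rewrite ffunE !sum_ffunE mulr_sumr; apply: eq_bigr => l _.
by rewrite !ffunE mulrCA.
Qed.

Lemma tensor_subl : sub (tensor A B) (vtensor eA eB) A eA (fun i => vtensor (bvec k i) eB).
Proof.
split=> [i j|]; last by rewrite -vtensor_suml -sum_bvec.
rewrite vtensor_mul (uB eB).1 -vtensor_suml; congr vtensor; rewrite [LHS]sum_bvec.
by apply: eq_bigr => l _; rewrite amul_bvec.
Qed.

Lemma tensor_subr : sub (tensor A B) (vtensor eA eB) B eB (fun j => vtensor eA (bvec k j)).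
Proof.
split=> [i j|]; last by rewrite -vtensor_sumr -sum_bvec.
rewrite vtensor_mul (uA eA).1 -vtensor_sumr; congr vtensor; rewrite [LHS]sum_bvec.
by apply: eq_bigr => l _; rewrite amul_bvec.
Qed.

Lemma tensor_comm i j : amul (tensor A B) (vtensor (bvec k i) eB) (vtensor eA (bvec k j)) =
  amul (tensor A B) (vtensor eA (bvec k j)) (vtensor (bvec k i) eB).
Proof. by rewrite !vtensor_mul !(uA _).1 !(uA _).2 !(uB _).1 !(uB _).2. Qed.
End TensorParts.

Lemma base_tensor (F L : fieldType) (s : {rmorphism F -> L}) (I J : finType) (A : salg F I) (B : salg F J) :
  base s (tensor A B) = tensor (base s A) (base s B).
Proof.
congr SAlg; apply/funext => x; apply/funext => y; apply/funext => z.
by rewrite /= rmorphM.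
Qed.

Lemma bmap_vtensor (F L : fieldType) (s : {rmorphism F -> L}) (I J : finType) (u : vec F I) (v : vec F J) :
  bmap s (vtensor u v) = vtensor (bmap s u) (bmap s v).
Proof. by apply/ffunP => x; rewrite !ffunE rmorphM. Qed.

Lemma ev_vtensor (k : fieldType) (R : nzRingType) (io : {rmorphism k -> R}) (I J : finType)
  (A : salg k I) (kA : I -> R) (kB : J -> R) u v : real io A kA ->
  ev io (fun x => kA x.1 * kB x.2) (vtensor u v) = ev io kA u * ev io kB v.
Proof.
move=> [cA _ _]; rewrite /ev big_distrl /=.
transitivity (\sum_(x : I * J) io (u x.1 * v x.2) * (kA x.1 * kB x.2)).
  by apply: eq_bigr => x _; rewrite ffunE.
rewrite -(pair_bigA _ (fun i j => io (u i * v j) * (kA i * kB j))); apply: eq_bigr => i _ /=.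
rewrite big_distrr; apply: eq_bigr => j _ /=.
by rewrite rmorphM -!mulrA; congr (_ * _); rewrite !mulrA cA.
Qed.

Lemma sub_base (F L : fieldType) (s : {rmorphism F -> L}) (I T : finType) (Y : salg F T) eY (A : salg F I) eA al :
  sub Y eY A eA al -> sub (base s Y) (bmap s eY) (base s A) (bmap s eA) (fun i => bmap s (al i)).
Proof.
have bs (c : I -> F) : bmap s (\sum_l vscale (c l) (al l)) = \sum_l vscale (s (c l)) (bmap s (al l)).
  apply/ffunP => t; rewrite ffunE !sum_ffunE rmorph_sum; apply: eq_bigr => l _.
  by rewrite !ffunE rmorphM.
move=> [h1 h2]; split=> [i j|]; first by rewrite -bmap_amul h1 bs.
by rewrite -h2 bs; apply: eq_bigr => l _; rewrite ffunE.
Qed.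

Section Embedding.
Variables (F L : fieldType) (s : {rmorphism F -> L}).
Variables (J T TZ : finType) (B : salg F J) (K : salg F T) (Z : salg F TZ).
Variables (eB : vec F J) (eK : vec F T) (eZ : vec F TZ) (d : vec F T).
Hypotheses (uB : is_unit_of B eB) (uK : is_unit_of K eK) (uZ : is_unit_of Z eZ).
Hypothesis Kcomm : forall x y, amul K x y = amul K y x.
Variable (psi : T -> vec F TZ).
Hypothesis hpsi : sub Z eZ K eK psi.
Variable zz : vec F (J * T)%type.
Hypothesis hzz : amul (tensor B K) zz zz = vtensor eB d.
Variables (TY : finType) (Y : salg L TY) (eY : vec L TY).
Hypotheses (hY : is_algebra Y) (uY : is_unit_of Y eY) (Y0 : (0 < #|TY|)%N).
Variables (be : J -> vec L TY) (ze : TZ -> vec L TY).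
Hypotheses (hbe : sub Y eY (base s B) (bmap s eB) be) (hze : sub Y eY (base s Z) (bmap s eZ) ze).
Hypothesis com : forall i j, amul Y (be i) (ze j) = amul Y (ze j) (be i).

(** [zz] is a square root of 1 (x) d in B (x) K. Mapping K into [Z] by [psi] turns it into an
    element of [Y] that commutes with the image of K and has square d, so the two generate a copy of
    K(sqrt d). *)
Theorem quad_embeds : is_field_alg (base s (quadsalg K d)) -> embeds (base s (quadsalg K d)) Y.
Proof.
move=> hE; have [R [io [ka hf]]] := rng_exists hY Y0; have [hr hc _ _] := hf.
have uB' := base_unit s uB; have uK' := base_unit s uK; have uZ' := base_unit s uZ.
pose kB j := ev io ka (be j); pose kZ z := ev io ka (ze z).
have rB : real io (base s B) kB := sub_real uY uB' hbe hr.
have rZ : real io (base s Z) kZ := sub_real uY uZ' hze hr.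
pose phi t := ev io kZ (bmap s (psi t)).
have rK : real io (base s K) phi := sub_real uZ' uK' (sub_base s hpsi) rZ.
have cBphi j t : kB j * phi t = phi t * kB j.
  rewrite /phi /ev mulr_sumr mulr_suml; apply: eq_bigr => z _.
  rewrite mulrA -hc -!mulrA; congr (_ * _).
  by rewrite /kB /kZ -!(ev_mul hr) com.
have rT := real_tensor uB' uK' rB rK cBphi; rewrite -base_tensor in rT.
pose z := ev io (fun x => kB x.1 * phi x.2) (bmap s zz).
have cphi t t' : phi t * phi t' = phi t' * phi t.
  case: rK => _ h _; rewrite !h; apply: eq_bigr => l _; congr (io _ * _).
  by rewrite /= -!amul_bvec Kcomm.
apply: (real_embeds hf hY hE); rewrite base_quadsalg.
apply: (quad_real (z := z) uK' rK) => [t|a|].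
- rewrite /z /ev mulr_suml mulr_sumr; apply: eq_bigr => x _.
  by rewrite -!mulrA -cphi [kB _ * (phi _ * _)]mulrA cBphi -!mulrA mulrA hc -!mulrA.
- exact: hc.
rewrite -(ev_mul rT) -bmap_amul hzz bmap_vtensor (ev_vtensor _ _ _ rB).
by case: rB => _ _ /(_ _ uB') ->; rewrite mul1r.
Qed.
End Embedding.

Lemma real_is_rep (k : fieldType) n (T : finType) (X : salg k T) e (rho : T -> 'M[k]_n.+1) :
  is_unit_of X e -> real (@scalar_mx k n.+1) X rho -> is_rep X e rho.
Proof.
move=> ue [_ h2 h3]; split=> [i j|].
  by rewrite -[LHS]/(rho i * rho j) h2; apply: eq_bigr => l _; rewrite -mul_scalar_mx.
by rewrite -[RHS](h3 _ ue); apply: eq_bigr => l _; rewrite -mul_scalar_mx.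
Qed.

Section NonEmbedding.
Variables (L : fieldType) (TY I TZ TE : finType) (Y : salg L TY) (A : salg L I) (Z : salg L TZ) (E : salg L TE).
Variables (eY : vec L TY) (eA : vec L I) (eZ : vec L TZ) (n : nat).
Hypotheses (hY : is_algebra Y) (uY : is_unit_of Y eY) (hA : is_algebra A) (uA : is_unit_of A eA)
  (uZ : is_unit_of Z eZ) (cY : #|TY| = (4 * (n * n))%N) (n0 : (0 < n)%N).
Variables (al : I -> vec L TY) (ze : TZ -> vec L TY).
Hypotheses (hal : sub Y eY A eA al) (hze : sub Y eY Z eZ ze).
Hypothesis com : forall i j, amul Y (al i) (ze j) = amul Y (ze j) (al i).
Hypotheses (hE : is_field_alg E) (I4 : #|I| = 4%N) (cE : #|TE| = (2 * n)%N) (nD : nzd (tensor A E)).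
Variables (M : fieldType) (iota : {rmorphism L -> M}) (kap : TE -> M).
Hypothesis hf : freal iota E kap.
Variable w : TZ -> 'M[M]_n.
Hypothesis hs : splitrep (base iota Z) (bmap iota eZ) w.

(** If [E] embeds, it acts on [Y] by left multiplications, which commute with the right
    multiplications by [A] and [Z]. The field [E] splits [Z], so together they contain n by n matrix
    units; the image of one diagonal unit has dimension 4 n and is a module over the division
    algebra A (x) E. *)
Theorem quad_not_embeds : ~ embeds E Y.
Proof.
move=> [P [[Pm [eE [uE uP]]] _]]; have hEA := hE.1.1.
have [m mE] : exists m, #|TY| = m.+1 by exists #|TY|.-1; rewrite prednK // cY; lia.
pose b (i : 'I_m.+1) : TY := enum_val (cast_ord (esym mE) i).
pose b' (i : TY) : 'I_m.+1 := cast_ord mE (enum_rank i).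
have bK : cancel b b' by move=> i; rewrite /b /b' enum_valK cast_ordKV.
have b'K : cancel b' b by move=> i; rewrite /b /b' cast_ordK enum_rankK.
pose io := @scalar_mx L m.+1 : {rmorphism L -> 'M[L]_m.+1}.
have ioC a (N : 'M[L]_m.+1) : io a * N = N * io a by rewrite -[RHS]/(N *m a%:M) scalar_mxC.
have rY : real io Y (rreg Y b).
  apply: (real_unit uY) => [a i|i j|]; first exact: ioC.
    have [h _] := rreg_rep bK b'K hY uY.
    by rewrite [LHS]h; apply: eq_bigr => l _; rewrite -mul_scalar_mx.
  have [_ h] := rreg_rep bK b'K hY uY.
  by rewrite -[RHS]h; apply: eq_bigr => l _; rewrite -mul_scalar_mx.
have evR y : ev io (rreg Y b) y = Rmx Y b y.
  by rewrite Rmx_sum //; apply: eq_bigr => i _; rewrite -mul_scalar_mx.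
have rA : real io A (fun i => Rmx Y b (al i)).
  by have := sub_real uY uA hal rY; congr real; apply/funext => i; rewrite evR.
have rZ : real io Z (fun i => Rmx Y b (ze i)).
  by have := sub_real uY uZ hze rY; congr real; apply/funext => i; rewrite evR.
pose eta t := Lmx Y b (lin P (bvec L t)).
have evL v : ev io eta v = Lmx Y b (lin P v).
  apply: (mxR_eq bK) => y; rewrite (LmxE _ bK b'K) lin_sum amul_suml toR_sum /ev mulmx_sumr.
  apply: eq_bigr => t _; rewrite -[io _ * _]/(io _ *m _) mul_scalar_mx -scalemxAr (LmxE _ bK b'K).
  by rewrite amulZl toRZ.
have rE : real io E eta.
  have ePE := unit_uniq uP uY.
  apply: (real_unit uE) => [a i|i j|]; first exact: ioC.
    rewrite -[LHS]/(Lmx Y b (lin P (bvec L i)) *m Lmx Y b (lin P (bvec L j))) -(Lmx_mul bK b'K hY) -Pm hE.2 -evL; apply: eq_bigr => l _.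
    by rewrite amul_bvec.
  by rewrite evL ePE; apply: (mxR_eq bK) => y; rewrite (LmxE _ bK b'K) (uY y).1 [1]/(1%:M) mulmx1.
(* The splitting field now consists of left multiplications; these commute with the image of [Z] but
   are not central among all matrices. *)
have [Lam [LamC LamE]] := freal_morph hEA hf rE.
have Lk t : Lam (kap t) = eta t by rewrite -(ev_bvec iota kap) LamE ev_bvec.
have LR x y : Lam x * Rmx Y b y = Rmx Y b y * Lam x.
  have [_ _ hsur _] := hf; have [v ->] := hsur x; rewrite LamE evL; exact: (LRmx bK b'K hY).
have rZ' : real Lam (base iota Z) (fun i => Rmx Y b (ze i)).
  apply: (real_unit (base_unit iota uZ)) => [a i|i j|]; first exact: LR.
    by case: rZ => _ h _; rewrite h; apply: eq_bigr => l _; rewrite /= LamC.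
  by case: rZ => _ _ /(_ _ uZ) <-; apply: eq_bigr => l _; rewrite ffunE LamC.
have /choice [c hc] (x : 'I_n * 'I_n) : exists c, delta_mx x.1 x.2 = repev w c by exact: split_surj hs _.
have [hw _ _ _] := hs.
have inj u v : repev w u = repev w v -> u = v.
  move=> E0; apply/eqP; rewrite -subr_eq0; apply/eqP/(split_inj hs).
  have -> : u - v = u + vscale (-1) v by apply/ffunP => t; rewrite !ffunE mulN1r.
  by rewrite repevD repevZ E0 scaleN1r subrr.
pose U p q : 'M[L]_m.+1 := ev Lam (fun i => Rmx Y b (ze i)) (c (p, q)).
have hU p q q' r : U p q *m U q' r = if q == q' then U p r else 0.
  rewrite -[LHS]/(U p q * U q' r) -(ev_mul rZ').
  have -> : amul (base iota Z) (c (p, q)) (c (q', r)) = if q == q' then c (p, r) else 0.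
    apply: inj; rewrite (repev_mul hw) -!hc mul_delta_mx_cond; case: eqP => _; rewrite ?mulr1n ?mulr0n.
      exact: hc (p, r).
    by rewrite repev0.
  by case: eqP => _; rewrite ?ev0.
have sU : \sum_p U p p = 1%:M.
  rewrite -ev_sum; have -> : \sum_p c (p, p) = bmap iota eZ.
    apply: inj; rewrite (repev1 hw) repev_sum [RHS]matrix_sum_delta; apply: eq_bigr => p _.
    rewrite -hc (bigD1 p) //= mxE eqxx scale1r big1 ?addr0 // => q qp.
    by rewrite mxE eq_sym (negPf qp) scale0r.
  by case: rZ' => _ _ ->; last exact: base_unit.
pose p0 := Ordinal n0; have [dimE _] := units_basis p0 hU sU.
have cAE i t : Rmx Y b (al i) * Lam (kap t) = Lam (kap t) * Rmx Y b (al i) by rewrite LR.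
have rE' : real io E (fun t => Lam (kap t)) by move: rE; congr real; apply/funext => t; rewrite Lk.
have rD := real_is_rep (tensor_unit uA uE) (real_tensor uA uE rA rE' cAE).
have [|B [hB _]] := subrep (U := row_base (U p0 p0)) rD (row_base_free _).
  move=> [i t]; rewrite eq_row_base (eqmxMr _ (eq_row_base _)).
  suff -> : U p0 p0 *m (Rmx Y b (al i) * Lam (kap t)) = (Rmx Y b (al i) * Lam (kap t)) *m U p0 p0 by exact: submxMl.
  rewrite -[LHS]/(U p0 p0 * _) -[RHS]/(_ * U p0 p0) /U /ev mulr_suml mulr_sumr; apply: eq_bigr => z _.
  have c1 : Rmx Y b (ze z) * Rmx Y b (al i) = Rmx Y b (al i) * Rmx Y b (ze z).
    by rewrite -[LHS](Rmx_mul bK b'K hY) -[RHS](Rmx_mul bK b'K hY) com.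
  rewrite -!mulrA [Rmx Y b (ze z) * (_ * _)]mulrA c1 -mulrA -LR !mulrA LR; congr (_ * _); rewrite -!mulrA.
  by congr (_ * _); rewrite -!rmorphM mulrC.
have := division_rep_dim (tensor_algebra hA hEA) (tensor_unit uA uE) nD hB.
have {dimE} : (n * (4 * n) = n * \rank (U p0 p0))%N by rewrite mulnCA -cY mE.
rewrite card_prod I4 cE => /eqP; rewrite eqn_pmul2l // => /eqP <-.
by lia.
Qed.
End NonEmbedding.

Lemma base_matalg (k L : fieldType) (s : {rmorphism k -> L}) d : base s (matalg k d) = matalg L d.
Proof.
congr SAlg; apply/funext => x; apply/funext => y; apply/funext => z /=.
by case: ifP; rewrite ?rmorph1 ?rmorph0.
Qed.

Lemma bmap_matv1 (k L : fieldType) (s : {rmorphism k -> L}) d :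
  bmap s (matv (1%:M : 'M[k]_d)) = matv (1%:M : 'M[L]_d).
Proof. by apply/ffunP => z; rewrite !ffunE !mxE rmorph_nat. Qed.

Lemma matalg_split (k : fieldType) d : (0 < d)%N ->
  exists w : 'I_d * 'I_d -> 'M[k]_d, splitrep (matalg k d) (matv 1%:M) w.
Proof.
move=> d0; have T0 : (0 < #|{: 'I_d * 'I_d}|)%N by rewrite card_prod card_ord muln_gt0 d0.
have [|d' [w hs]] := (brauer_splitrep (@matalg_unit k d) T0).1.
  have lid u : lin (fun i j : 'I_d * 'I_d => (i == j)%:R : k) u = u.
    by apply/ffunP => j; rewrite ffunE sum_deltal.
  exists d, (fun i j => (i == j)%:R), (fun i j => (i == j)%:R); split; last by split=> u; rewrite !lid.
  split=> [x y|]; first by rewrite !lid.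
  by exists (matv 1%:M); split; rewrite ?lid; exact: matalg_unit.
have [_ cT _ _] := hs; have dE : d = d'.
  by apply/eqP; rewrite -(eqn_sqr d d') -!mulnn -cT card_prod card_ord.
by subst d'; exists w.
Qed.

Lemma matalg_algebra (k : fieldType) d : is_algebra (matalg k d).
Proof.
split; last by exists (matv 1%:M); exact: matalg_unit.
by move=> x y z; apply: vmat_inj; rewrite !vmat_mul mulmxA.
Qed.

Lemma regular_sub (k : fieldType) n (K : salg k 'I_n) e : is_algebra K -> is_unit_of K e ->
  sub (matalg k n) (matv 1%:M) K e (fun t => matv (rreg K id t)).
Proof.
move=> hK ue; have [h1 h2] := rreg_rep (b := id) (b' := id) (fun x => erefl) (fun x => erefl) hK ue.
split=> [i j|]; apply: vmat_inj; rewrite ?vmat_mul vmat_sum !matvK ?h1 -?h2;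
  by apply: eq_bigr => l _; rewrite matvK.
Qed.

(** The map from [C] to K^n given by one row is bijective by dimension, so a unique psi t multiplies
    the unit row by kap t; uniqueness makes psi multiplicative. *)
Lemma division_sub (F : fieldType) (K : fieldExtType F) n (T : finType) (C : salg F T) e
  (w : T -> 'M[K]_n) (E : salg F 'I_(\dim {: K})) eE kap :
  \dim {: K} = n -> is_algebra C -> is_unit_of C e -> nzd C ->
  splitrep (base (in_alg K) C) (bmap (in_alg K) e) w -> is_unit_of E eE -> freal (in_alg K) E kap ->
  exists psi, sub C e E eE psi.
Proof.
move=> dimK hC ue nC [hw cT _ n0] uE [[_ h2 h3] _ hsur _].
have /choice [cf hcf] (x : K) : exists v, x = ev (in_alg K) kap v by exact: hsur.
pose i0 := Ordinal n0; have fM := orbit_free hC ue nC i0 hw hcf.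
have ffM : row_full (orbit_mx w i0 cf).
  by rewrite /row_full (eqP fM) cT card_prod !card_ord dimK.
have /choice [psi hpsi] t : exists y, row i0 (repev w (bmap (in_alg K) y)) = kap t *: row i0 1%:M.
  pose u := \row_(j < #|{: 'I_n * 'I_(\dim {: K})}|) cf (kap t * (i0 == (enum_val j).1)%:R) (enum_val j).2.
  have /submxP [c cE] : (u <= orbit_mx w i0 cf)%MS by apply: submx_full.
  exists (ofR (@enum_rank T) c); apply/rowP => j; rewrite mxE (orbit_entry _ _ hcf).
  rewrite (ofRK (@enum_valK T)) -cE !mxE [RHS]hcf; congr ev; apply/ffunP => l.
  by rewrite ffunE mxE enum_rankK.
have bs (c : 'I_(\dim {: K}) -> F) : row i0 (repev w (bmap (in_alg K) (\sum_l vscale (c l) (psi l)))) =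
    (\sum_l (c l)%:A * kap l) *: row i0 1%:M.
  have -> : bmap (in_alg K) (\sum_l vscale (c l) (psi l)) = \sum_l vscale (in_alg K (c l)) (bmap (in_alg K) (psi l)).
    apply/ffunP => t; rewrite ffunE !sum_ffunE rmorph_sum; apply: eq_bigr => l _.
    by rewrite !ffunE rmorphM.
  rewrite repev_sum raddf_sum scaler_suml; apply: eq_bigr => l _.
  by rewrite /= repevZ linearZ /= hpsi scalerA.
have inj x y : row i0 (repev w (bmap (in_alg K) x)) = row i0 (repev w (bmap (in_alg K) y)) -> x = y.
  move=> E0; apply/eqP; rewrite -subr_eq0; apply/eqP/(orbit_inj hC ue nC (w := w) (i0 := i0) hw).
  have -> : bmap (in_alg K) (x - y) = bmap (in_alg K) x + vscale (-1) (bmap (in_alg K) y).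
    by apply/ffunP => t; rewrite !ffunE rmorphB mulN1r.
  by rewrite repevD repevZ raddfD /= linearZ /= E0 scaleN1r subrr.
exists psi; split=> [i j|]; apply: inj; rewrite bs.
  rewrite bmap_amul (repev_mul hw) row_mul hpsi -scalemxAl -row_mul mul1mx hpsi scalerA.
  by congr (_ *: _); rewrite h2.
rewrite (repev1 hw) -[RHS]scale1r; congr (_ *: _).
exact: h3 _ uE.
Qed.

Section EmbedsTwo.
Variables (L : fieldType) (I J T : finType) (A : salg L I) (B : salg L J) (E : salg L T).
Variables (eA : vec L I) (eB : vec L J).
Hypotheses (two : 2%:R != 0 :> L) (uA : is_unit_of A eA) (hB : is_algebra B) (uB : is_unit_of B eB)
  (J0 : (0 < #|J|)%N) (hE : is_field_alg E) (T2 : #|T| = 2).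
Hypothesis sq : forall a, sqin A eA a -> sqin B eB a.

(** After completing the square, a quadratic extension is generated by a root of a scalar, and
    embedding it into [B] only takes a root of that scalar there. *)
Theorem embeds_two : embeds E A -> embeds E B.
Proof.
move=> [P [[Pm [e [ue uP]]] _]]; have assoc := hE.1.1.1.
have [x xe] := exists_nonscalar e (ltac:(by rewrite T2) : (1 < #|T|)%N).
have e0 : e != 0.
  by have /card_gt0P [t _] : (0 < #|T|)%N by [rewrite T2]; exact: (rng_1neq0 t ue).
have b'K := @enum_rankK T.
have span y : (forall a, y <> vscale a e) -> forall v, exists c, v = vscale c.1 e + vscale c.2 y.
  move=> ye v; pose V := \matrix_(i < 2) toR (@enum_val T T) (if i == 0 then e else y).
  have VE (c : 'rV[L]_2) : c *m V = toR (@enum_val T T) (vscale (c 0 0) e + vscale (c 0 1) y).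
    rewrite mulmx_sum_row !big_ord_recl big_ord0 addr0 !rowK /= toRD !toRZ.
    by congr (_ + c _ _ *: _); exact: val_inj.
  have fV : row_free V.
    rewrite -kermx_eq0; apply/rowV0P => c /sub_kermxP; rewrite VE => /(toR_eq0 b'K) c0.
    have c1 : c 0 1 = 0.
      apply/eqP; apply: contraT => c1; case: (ye (- (c 0 0 / c 0 1))).
      apply/ffunP => i; move/ffunP/(_ i): c0; rewrite !ffunE => E0.
      apply: (mulfI c1); rewrite mulrA mulrN mulrCA divff // mulr1 mulNr.
      by apply/eqP; rewrite -addr_eq0 addrC E0.
    have c00 : c 0 0 = 0.
      apply/eqP; apply: contraNT e0 => c00; apply/eqP/ffunP => i; move/ffunP/(_ i): c0.
      by rewrite c1 !ffunE mul0r addr0 => /eqP; rewrite mulf_eq0 (negPf c00) => /eqP.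
    apply/rowP => i; rewrite mxE; case: i => [[|[|]]] //= h.
      by rewrite -[RHS]c00; congr (c _ _); exact: val_inj.
    by rewrite -[RHS]c1; congr (c _ _); exact: val_inj.
  have ffV : row_full V by rewrite /row_full (eqP fV) T2.
  have /submxP [c cE] : (toR (@enum_val T T) v <= V)%MS by apply: submx_full.
  exists (c 0 0, c 0 1) => /=; apply: (can_inj (toRK b'K)); by rewrite cE VE.
have [[q p] xx] := span x xe (amul E x x); rewrite /= in xx.
pose y := x - vscale (p / 2%:R) e; pose a := q + p * p / 4%:R.
have ye c : y <> vscale c e.
  move=> E0; apply: (xe (c + p / 2%:R)); apply/ffunP => t; move/ffunP/(_ t): E0; rewrite !ffunE => E0.
  by rewrite mulrDl -E0 subrK.
have yy : amul E y y = vscale a e.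
  have four : 4%:R != 0 :> L by rewrite (natrM _ 2 2) mulf_neq0.
  have negl u v : amul E (- u) v = - amul E u v by apply/eqP; rewrite -addr_eq0 -amulDl addNr amul0l.
  have negr u v : amul E u (- v) = - amul E u v by apply/eqP; rewrite -addr_eq0 -amulDr addNr amul0r.
  rewrite /y /a amulDl !amulDr !(negl, negr, amulZl, amulZr) (ue x).1 (ue x).2 (ue e).1 xx.
  apply/ffunP => t; rewrite !ffunE; move: (x t) (e t) => xt et.
  by field; rewrite four two.
have [z zz] : sqin B eB a.
  apply: sq; exists (lin P y); rewrite -Pm yy -(unit_uniq uP uA).
  by rewrite lin_sum; apply/ffunP => j; rewrite !ffunE sum_ffunE mulr_sumr; apply: eq_bigr => t _; rewrite !ffunE mulrA; congr (_ * _); rewrite (bigD1 t) //= ffunE eqxx mul1r big1 ?addr0 // => l lt; rewrite ffunE eq_sym (negPf lt) mul0r.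
have [R [io [ka hf]]] := rng_exists hB J0; have [hr hc _ _] := hf.
pose Z := ev io ka z; have ZZ : Z * Z = io a.
  by rewrite -(ev_mul hr) zz evZ; case: hr => _ _ ->; rewrite ?mulr1.
have /choice [c hc'] t : exists c, bvec L t = vscale c.1 e + vscale c.2 y by exact: span ye _.
have indep c1 c2 d1 d2 : vscale c1 e + vscale c2 y = vscale d1 e + vscale d2 y -> c1 = d1 /\ c2 = d2.
  move=> E0; have c2d : c2 = d2.
    apply/eqP; rewrite -subr_eq0; apply: contraT => cd; case: (ye ((d1 - c1) / (c2 - d2))).
    apply/ffunP => t; move/ffunP/(_ t): E0; rewrite !ffunE => E0.
    apply: (mulfI cd); rewrite mulrA [_ * ((d1 - c1) / _)]mulrC divfK // !mulrBl.
    by apply/eqP; rewrite subr_eq addrAC eq_sym subr_eq -E0 addrC.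
  split=> //; rewrite c2d in E0; move/addIr: E0 => E0.
  apply/eqP; rewrite -subr_eq0; apply: contraNT e0 => cd; apply/eqP/ffunP => t.
  move/ffunP/(_ t): E0; rewrite !ffunE => /eqP; rewrite -subr_eq0 -mulrBl mulf_eq0 (negPf cd).
  by move/eqP.
pose kap t := io (c t).1 + io (c t).2 * Z.
have evE v d1 d2 : v = vscale d1 e + vscale d2 y -> ev io kap v = io d1 + io d2 * Z.
  move=> vE; have : vscale d1 e + vscale d2 y = vscale (\sum_t v t * (c t).1) e + vscale (\sum_t v t * (c t).2) y.
    rewrite -vE [LHS]sum_bvec; apply/ffunP => l; rewrite sum_ffunE !ffunE !mulr_suml -big_split.
    by apply: eq_bigr => t _; rewrite hc' !ffunE mulrDr !mulrA.
  case/indep => -> ->; rewrite !rmorph_sum mulr_suml -big_split; apply: eq_bigr => t _.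
  by rewrite /kap mulrDr !rmorphM mulrA.
have evk v : exists d, v = vscale d.1 e + vscale d.2 y /\ ev io kap v = io d.1 + io d.2 * Z.
  by have [d dE] := span y ye v; exists d; split=> //; exact: evE.
apply: (real_embeds hf hB hE); apply: (real_unit ue) => [b t|t t'|].
- by rewrite hc.
- have := evE (amul E (bvec L t) (bvec L t')) ((c t).1 * (c t').1 + a * ((c t).2 * (c t').2)) ((c t).1 * (c t').2 + (c t).2 * (c t').1).
  rewrite {1}hc' {1}(hc' t') => h.
  transitivity (ev io kap (amul E (bvec L t) (bvec L t'))); last by apply: eq_bigr => l _; rewrite amul_bvec.
  rewrite h /kap.
    have t1 b b' : io b * (io b' * Z) = io (b * b') * Z by rewrite mulrA -rmorphM.
    have t2 b b' : io b * Z * io b' = io (b * b') * Z by rewrite -mulrA -hc t1.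
    have t3 b b' : io b * Z * (io b' * Z) = io (a * (b * b')).
      by rewrite mulrA t2 -mulrA ZZ -rmorphM mulrC.
    rewrite mulrDl !mulrDr t1 t2 t3 -rmorphM !rmorphD mulrDl -!addrA; congr (_ + _).
    by rewrite addrA -[X in X + _ = _]mulrDl addrC.
  rewrite amulDl !amulDr !(amulZl, amulZr) (ue e).1 (ue y).1 (ue y).2 yy.
  apply/ffunP => l; rewrite !ffunE; move: (e l) (y l) (c t).1 (c t).2 (c t').1 (c t').2 => ? ? ? ? ? ?; ring.
rewrite (evE e 1 0) ?rmorph1 ?rmorph0 ?mul0r ?addr0 //.
by apply/ffunP => l; rewrite !ffunE mul1r mul0r addr0.
Qed.
End EmbedsTwo.

Lemma mdiv_nzd (k : fieldType) (I : finType) (A : salg k I) n (b : 'I_n -> I) b' :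
  cancel b b' -> cancel b' b -> is_algebra A -> mdiv (rreg A b) -> nzd A.
Proof.
move=> bK b'K hA hd x y xy; case: (pselect (x = 0)) => [|x0]; [by left|right].
have xu : Lmx A b x \in unitmx.
  apply: hd; first by apply/(rreg_cent bK b'K hA); exists x.
  apply/eqP => L0; apply: x0; apply: (Lmx_inj bK b'K hA); rewrite L0.
  by apply: (mxR_eq bK) => v; rewrite (LmxE _ bK b'K) amul0l toR0 mulmx0.
by apply: (toR_eq0 b'K); rewrite -[LHS](mulmxK xu) (LmxE _ bK b'K) xy toR0 mul0mx.
Qed.

(** * From conditions (A)-(C) to structure constants *)

Section Conditions.
Variables (F : fieldType) (I J : finType) (A : salg F I) (B : salg F J) (eA : vec F I) (eB : vec F J).
Hypotheses (two : 2%:R != 0 :> F) (hA : is_algebra A) (hB : is_algebra B).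
Hypotheses (uA : is_unit_of A eA) (uB : is_unit_of B eB) (I4 : #|I| = 4%N) (J4 : #|J| = 4%N).
Hypotheses (gA : quat_gens A eA) (gB : quat_gens B eB).
Variables (K : fieldExtType F) (T : finType) (E : salg F T) (eE : vec F T) (kap : T -> K).
Hypotheses (uE : is_unit_of E eE) (hf : freal (in_alg K) E kap).

(** By [mdiv_quad], zero divisors over K(sqrt d) appear only if d has a root in the centralizer of
    the regular representation, that is, in [B] over [K]. *)
Lemma split_sqrt (d : K) (M : fieldType) (tau : {rmorphism K -> M}) r : quad_over tau r d ->
  nzd (base (in_alg K) B) -> ~ nzd (base (tau \o in_alg K)%FUN B) ->
  exists z, amul (base (in_alg K) B) z z = vscale d (bmap (in_alg K) eB).
Proof.
move=> jr nB nBM; pose b (i : 'I_4) : J := enum_val (cast_ord (esym J4) i).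
pose b' (i : J) : 'I_4 := cast_ord J4 (enum_rank i).
have bK : cancel b b' by move=> i; rewrite /b /b' enum_valK cast_ordKV.
have b'K : cancel b' b by move=> i; rewrite /b /b' cast_ordK enum_rankK.
have hBK := base_algebra (in_alg K) hB; have rd := nzd_mdiv bK b'K hBK nB.
apply: contrapT => nz; apply: nBM.
apply: (mdiv_nzd bK b'K); first exact: base_algebra.
have -> : rreg (base (tau \o in_alg K)%FUN B) b = (fun i => map_mx tau (rreg (base (in_alg K) B) b i)).
  by apply/funext => i; apply/matrixP => p q; rewrite !mxE !amul_bvec.
apply: (mdiv_quad jr rd) => u /(rreg_cent bK b'K hBK) [z uz]; apply/negP => /eqP uu.
apply: nz; exists z; apply: (Lmx_inj bK b'K hBK); rewrite (Lmx_mul bK b'K hBK) -uz [LHS]uu.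
apply: (mxR_eq bK) => v; rewrite (LmxE _ bK b'K) amulZl (base_unit _ uB _).1 toRZ.
by rewrite mul_mx_scalar.
Qed.

Lemma tensor_square d dv z : d = ev (in_alg K) kap dv ->
  amul (base (in_alg K) B) z z = vscale d (bmap (in_alg K) eB) ->
  exists zz, amul (tensor B E) zz zz = vtensor eB dv.
Proof.
move=> dE zd; have hf' := hf; rewrite -{1}[E]base_id in hf'; have [hr _ hsur hi] := hf'.
have hE := (freal_field_alg hf).1.1; have J0 : (0 < #|J|)%N by rewrite J4.
have [R [io [ka [hfR [r evE]]]]] := tensor_field_ring hB hE J0 hr (fun a => erefl : in_alg K a = in_alg K (idfun a)).
have [rR _ _ injR] := hfR.
have /choice [cf hcf] (x : K) : exists v, x = ev (in_alg K) kap v by exact: hsur.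
exists [ffun x => cf (z x.1) x.2].
have inj x y : ev (io \o in_alg K)%FUN (fun x => ka x.1 * io (kap x.2)) x =
   ev (io \o in_alg K)%FUN (fun x => ka x.1 * io (kap x.2)) y -> x = y.
  apply: ev_inj => v; rewrite evE => /injR e0; apply/ffunP => -[i t]; move/ffunP/(_ i): e0; rewrite !ffunE.
  by move/hi/ffunP/(_ t); rewrite !ffunE.
apply: inj; rewrite base_id in r; rewrite (ev_mul r) !evE.
have -> : [ffun i => ev (in_alg K) kap [ffun t => [ffun x => cf (z x.1) x.2] (i, t)]] = z.
  by apply/ffunP => i; rewrite ffunE [RHS]hcf; congr ev; apply/ffunP => t; rewrite !ffunE.
rewrite -(ev_mul rR) zd; congr ev; apply/ffunP => i; rewrite !ffunE.
have -> : [ffun t => vtensor eB dv (i, t)] = vscale (eB i) dv by apply/ffunP => t; rewrite !ffunE.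
by rewrite evZ dE mulrC.
Qed.

(** [quat_split] turns splitting into zero divisors. The half of (C) saying that K(sqrt d) splits
    [B] becomes the square root of d in B (x) K. *)
Lemma abc_of_conditions : conditions_ABC K A B ->
  exists dv, abc A B E dv /\ exists zz, amul (tensor B E) zz zz = vtensor eB dv.
Proof.
move=> [d [[d0 [nsq nsqF]] [nsB [M [tau [r [rr [sp [spB nspA]]]]]]]]].
have [hr hc hsur hi] := hf; have [dv dE] := hsur d.
have jr : quad_over tau r d.
  split=> //.
  by move=> x; apply/negP => /eqP xx; apply: nsq; exists x; rewrite expr2.
have jr' := jr; rewrite dE in jr'.
have hq := quad_freal hf jr' uE; have fM := freal_field_alg hq; have fE := freal_field_alg hf.
have nB : nzd (base (in_alg K) B).
  by apply: contrapT => h; apply: nsB; apply: (proj2 (quat_split two hB uB J4 gB (in_alg K))).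
have nA : nzd (base (tau \o in_alg K)%FUN A).
  by apply: contrapT => h; apply: nspA; exact: (proj2 (quat_split two hA uA I4 gA (tau \o in_alg K)%FUN) h).
have nBM := proj1 (quat_split two hB uB J4 gB (tau \o in_alg K)%FUN) spB.
have [z zd] := split_sqrt jr nB nBM.
exists dv; split; last exact: tensor_square dE zd.
split=> //; first by apply: contra_neq d0 => dv0; rewrite dE dv0 ev0.
split.
- move=> a y a0 yy; apply: nsqF; exists a; split=> //; exists (ev (in_alg K) kap y).
  by rewrite expr2 -(ev_mul hr) yy evZ -dE mulrC.
- have J0 : (0 < #|J|)%N by rewrite J4.
  rewrite -[tensor B E]base_id.
  have hr' := hr; rewrite -[E]base_id in hr'.
  exact: (nzd_tensor_of_field hB fE.1.1 J0 hr' hi (fun a => erefl : in_alg K a = in_alg K (idfun a)) nB).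
have I0 : (0 < #|I|)%N by rewrite I4.
have [hrq _ _ hiq] := hq; rewrite -[tensor A _]base_id.
rewrite -[quadsalg E dv]base_id in hrq.
have := nzd_tensor_of_field hA fM.1.1 I0 hrq hiq (hs := (tau \o in_alg K)%FUN) (fun a => erefl) nA.
by rewrite base_id.
Qed.
End Conditions.

(** * Maximal subfields over the final field *)

Section OverL.
Variables (F : fieldType) (I J : finType) (A : salg F I) (B : salg F J) (eA : vec F I) (eB : vec F J).
Hypotheses (two : 2%:R != 0 :> F) (hA : is_algebra A) (hB : is_algebra B).
Hypotheses (uA : is_unit_of A eA) (uB : is_unit_of B eB) (I4 : #|I| = 4%N) (J4 : #|J| = 4%N).
Variables (L : fieldType) (s : {rmorphism F -> L}).
Hypothesis hinv : inv (DD A B) (abc A B) (@XX F) s.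

Lemma field_alg_base (T : finType) (E : salg F T) : is_field_alg E -> is_field_alg (base s E).
Proof. by move=> /(field_realization hinv) [EE [iota [kap hf]]]; exact: freal_field_alg hf. Qed.

Section Compare.
Variables (n : nat) (K : fieldExtType F) (E : salg F 'I_(\dim {: K})) (kap : 'I_(\dim {: K}) -> K).
Hypotheses (dimK : \dim {: K} = n) (hf : freal (in_alg K) E kap).
Variables (eE dv : vec F 'I_(\dim {: K})) (zz : vec F (J * 'I_(\dim {: K}))%type).
Hypotheses (uE : is_unit_of E eE) (habc : abc A B E dv).
Hypothesis hzz : amul (tensor B E) zz zz = vtensor eB dv.
Variables (TZ : finType) (Z : salg F TZ) (eZ : vec F TZ) (psi : 'I_(\dim {: K}) -> vec F TZ).
Hypotheses (uZ : is_unit_of Z eZ) (hpsi : sub Z eZ E eE psi).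
Variable w : TZ -> 'M[K]_n.
Hypothesis hs : splitrep (base (in_alg K) Z) (bmap (in_alg K) eZ) w.
Variables (T1 T2 : finType) (Y1 : salg L T1) (Y2 : salg L T2) (e1 : vec L T1) (e2 : vec L T2).
Hypotheses (hY1 : is_algebra Y1) (hY2 : is_algebra Y2) (u1 : is_unit_of Y1 e1) (u2 : is_unit_of Y2 e2).
Hypotheses (c1 : #|T1| = (4 * (n * n))%N) (c2 : #|T2| = (4 * (n * n))%N).
Variables (al : I -> vec L T1) (ze1 : TZ -> vec L T1) (be : J -> vec L T2) (ze2 : TZ -> vec L T2).
Hypotheses (hal : sub Y1 e1 (base s A) (bmap s eA) al) (hze1 : sub Y1 e1 (base s Z) (bmap s eZ) ze1).
Hypotheses (hbe : sub Y2 e2 (base s B) (bmap s eB) be) (hze2 : sub Y2 e2 (base s Z) (bmap s eZ) ze2).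
Hypotheses (com1 : forall i j, amul Y1 (al i) (ze1 j) = amul Y1 (ze1 j) (al i))
  (com2 : forall i j, amul Y2 (be i) (ze2 j) = amul Y2 (ze2 j) (be i)).

(** [Z] stands for the matrix algebra in (2) and for [C] in (3): it only has to contain K and to
    have degree n over K. The distinguishing subfield is K(sqrt d) extended to [L], of degree 2
    n. *)
Theorem compare_subfields : ~ same_max_subfields Y1 Y2.
Proof.
move=> [_ hsame]; have [fE fQ _ _] := habc; have fQL := field_alg_base fQ.
have [_ _ _ n0] := hs.
have [|_ h] := hsame _ _ fQL.
  by rewrite card_prod card_ord card_bool dimK c1; lia.
have Y20 : (0 < #|T2|)%N by rewrite c2; lia.
have emb : embeds (base s (quadsalg E dv)) Y2.
  exact: (quad_embeds uB uE uZ fE.2 hpsi hzz hY2 u2 Y20 hbe hze2 com2 fQL).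
have {h} := h emb.
have [EE [iota [kapE hfE]]] := field_realization hinv fE; have [hrE _ _ _] := hfE.
have [M [j [r [jr hQ]]]] := quad_realization hinv habc hfE.
have [h [hio _]] := freal_morph fE.1.1 hf (real_comp hrE).
have hs' := splitrep_map (t := (j \o (iota \o s))%FUN) (u := (j \o h)%FUN) (s := in_alg K)
  (fun a => esym (congr1 j (hio a))) hs.
have hs2 : splitrep (base (j \o iota)%FUN (base s Z)) (bmap (j \o iota)%FUN (bmap s eZ))
    (fun i => map_mx (j \o h)%FUN (w i)).
  suff -> : bmap (j \o iota)%FUN (bmap s eZ) = bmap (j \o (iota \o s))%FUN eZ by [].
  by apply/ffunP => t; rewrite !ffunE.
apply: (quad_not_embeds hY1 u1 (base_algebra s hA) (base_unit s uA) (base_unit s uZ) c1 n0 hal hze1 com1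
  fQL I4 _ _ hQ hs2).
  by rewrite card_prod card_ord card_bool dimK mulnC.
rewrite -base_tensor; have [h1 _ _] := hinv; exact: h1 (DDM habc).
Qed.
End Compare.
End OverL.

Lemma inv_initial (F : fieldType) (I J : finType) (A : salg F I) (B : salg F J) : nzd A -> nzd B ->
  inv (DD A B) (abc A B) (@XX F) (idfun : {rmorphism F -> F}).
Proof.
move=> nA nB; split.
- move=> T D; rewrite base_id; case=> {T D} // [T E fE|T K d|T K d].
  + exact: division_nzd fE.1.
  + by case=> _ _ _ [].
  by case=> _ _ _ [].
- by move=> T K d [_ _ _ [h _ _]] a y a0; rewrite base_id bmap_id; exact: h.
by move=> T X e n [_ _ h _] rho; rewrite base_id bmap_id; exact: h.
Qed.

Lemma same_max_subfields_trans (L : fieldType) (T I J : finType) (D : salg L T) (A : salg L I) (B : salg L J) :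
  same_max_subfields D A -> same_max_subfields A B -> same_max_subfields D B.
Proof.
move=> [c h] [c' h']; split; first by rewrite c.
by move=> T' E fE cE; rewrite h // h' // -c.
Qed.

Lemma same_max_subfields_genus (L : fieldType) (I J : finType) (A : salg L I) (B : salg L J) :
  same_max_subfields A B -> same_genus A B.
Proof.
move=> hAB; have hBA : same_max_subfields B A.
  by case: hAB => c h; split=> // T E fE cE; rewrite h // c.
move=> T X cX; split=> -[T' [D [cD [dD [hD bD]]]]]; exists T', D; split=> //; split=> //; split=> //.
  exact: same_max_subfields_trans hD hAB.
exact: same_max_subfields_trans hD hBA.
Qed.

Theorem theorem5 (F : fieldType) (I J : finType) (A : salg F I) (B : salg F J) :
  (2%:R : F) != 0 ->
  quaternion_division A -> quaternion_division B -> ~ iso A B ->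
  exists (L : fieldType) (sigma : {rmorphism F -> L}),
    regular_ext sigma /\
    (* (1) *)
    (is_division (base sigma A) /\ is_division (base sigma B) /\
     same_genus (base sigma A) (base sigma B)) /\
    (* (2) *)
    (forall (n : nat) (K : fieldExtType F),
       \dim {: K} = n -> separable 1%VS {: K} -> conditions_ABC K A B ->
       ~ same_max_subfields (tensor (matalg L n) (base sigma A))
                            (tensor (matalg L n) (base sigma B))) /\
    (* (3) *)
    (forall (n : nat) (K : fieldExtType F),
       \dim {: K} = n -> separable 1%VS {: K} -> conditions_ABC K A B ->
       forall (T : finType) (C : salg F T),
         is_csa C -> is_division C -> exponent_is C n -> splits (GRing.in_alg K) C ->
         is_division (base sigma C) /\ exponent_is (base sigma C) n /\
         ~ same_max_subfields (tensor (base sigma A) (base sigma C))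
                              (tensor (base sigma B) (base sigma C))).
Proof.
move=> two [[_ [cA _]] [dA I4]] [[_ [cB _]] [dB J4]] _.
have [eA [hA uA nA I0]] := division_algebra dA; have [eB [hB uB nB J0]] := division_algebra dB.
have gA := quaternion_gens two hA uA nA cA I4; have gB := quaternion_gens two hB uB nB cB J4.
have [L [s [hinv hsq]]] := closure_field two hA hB I4 J4 uA uB gA gB (@no_small_rep F I J A B)
  (inv_initial nA nB).
exists L, s; have twoL : 2%:R != 0 :> L by rewrite -(rmorph_nat s) fmorph_eq0.
have [h1 _ _] := hinv.
have hAL := base_algebra s hA; have hBL := base_algebra s hB.
have uAL := base_unit s uA; have uBL := base_unit s uB.
split; first by move=> T E; exact: field_alg_base hinv _ _.
split.
  split; first exact: nzd_division hAL I0 (h1 _ _ (DDA _ _)).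
  split; first exact: nzd_division hBL J0 (h1 _ _ (DDB _ _)).
  (* Maximal subfields of quaternion algebras are quadratic, and [hsq] gives both algebras the same
     square roots of scalars. *)
  apply: same_max_subfields_genus; split; first by rewrite I4 J4.
  move=> T E fE cE; have T2 : #|T| = 2%N.
    by apply/eqP; rewrite -(eqn_sqr _ 2) -mulnn cE I4.
  split.
    exact: (embeds_two twoL uAL hBL uBL J0 fE T2 (fun a => (hsq a).1)).
  exact: (embeds_two twoL uBL hAL uAL I0 fE T2 (fun a => (hsq a).2)).
split=> n K dimK sepK habc; subst n; have [E [kap hf]] := fieldExt_salg K;
  have fE := freal_field_alg hf; have [_ [eE uE]] := fE.1.1;
  have [dv [hdv [zz hzz]]] := abc_of_conditions two hA hB uA uB I4 J4 gA gB uE hf habc.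
  have n0 : (0 < \dim {: K})%N by have := field_alg_card fE.1; rewrite card_ord.
  (* For (2), [Z] is the matrix algebra, into which K embeds by its regular representation. *)
  have [w hw] := matalg_split K n0; have uZ := @matalg_unit F (\dim {: K}).
  have hw' : splitrep (base (in_alg K) (matalg F (\dim {: K}))) (bmap (in_alg K) (matv 1%:M)) w.
    by rewrite base_matalg bmap_matv1.
  rewrite -[matalg L _](base_matalg s).
  have hZL := base_algebra s (matalg_algebra F (\dim {: K})).
  have uZL' := base_unit s uZ.
  have cd (Q : finType) : #|Q| = 4%N -> #|{: ('I_(\dim {: K}) * 'I_(\dim {: K})) * Q}| = (4 * (\dim {: K} * \dim {: K}))%N.
    by move=> Q4; rewrite !card_prod !card_ord Q4 mulnC.
  apply: (compare_subfields two hA uA uB I4 J4 hinv erefl hf uE hdv hzz uZ (regular_sub fE.1.1 uE) hw'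
    (tensor_algebra hZL hAL) (tensor_algebra hZL hBL) (tensor_unit uZL' uAL) (tensor_unit uZL' uBL)
    (cd _ I4) (cd _ J4) (tensor_subr _ _ uZL') (tensor_subl _ _ uAL) (tensor_subr _ _ uZL') (tensor_subl _ _ uBL)).
  - by move=> i j; rewrite (tensor_comm uZL' uAL).
  by move=> i j; rewrite (tensor_comm uZL' uBL).
(* For (3), [Z] is [C], which has degree n by [degree_exponent] and contains K by [division_sub]. *)
move=> T C cC dC expC spC; have [eC [hC uC nC T0]] := division_algebra dC.
have [w hw] := degree_exponent erefl sepK two hC uC nC T0 expC spC.
have hCL := base_algebra s hC; have uCL := base_unit s uC.
split.
  exact: nzd_division hCL T0 (division_base erefl sepK two hC uC nC T0 expC spC hinv).
split; first exact: (exponent_base erefl sepK two hC uC nC T0 expC spC hinv).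
have [psi hpsi] := division_sub erefl hC uC nC hw uE hf.
have [_ cT _ _] := hw.
have cd (Q : finType) : #|Q| = 4%N -> #|{: Q * T}| = (4 * (\dim {: K} * \dim {: K}))%N.
  by move=> Q4; rewrite card_prod Q4 cT.
apply: (compare_subfields two hA uA uB I4 J4 hinv erefl hf uE hdv hzz uC hpsi hw
  (tensor_algebra hAL hCL) (tensor_algebra hBL hCL) (tensor_unit uAL uCL) (tensor_unit uBL uCL)
  (cd _ I4) (cd _ J4) (tensor_subl _ _ uCL) (tensor_subr _ _ uAL) (tensor_subl _ _ uCL) (tensor_subr _ _ uBL)).
- by move=> i j; rewrite (tensor_comm uAL uCL).
by move=> i j; rewrite (tensor_comm uBL uCL).
Qed.
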